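(* Let $m\in\mathbb{N}$. The operator $\Phi_m:\mathcal{T}_m\to\mathcal{T}_m$ is continuous at each continuity point of the topological entropy function $h|_{\mathcal{T}_m}:\mathcal{T}_m\to\mathbb{R}$. In particular, $\Phi_m$ is continuous (on all of $\mathcal{T}_m$) for $m\le 4$.
   Context: A continuous map $f:[0,1]\to[0,1]$ is piecewise monotone if $\mathrm{Crit}(f)=\{0,1\}\cup\{x : f \text{ is not monotone on any neighborhood of } x\}$ is finite; the modality of $f$ is the cardinality of $\mathrm{Crit}(f)\cap(0,1)$. $\mathcal{T}$ is the space of continuous, topologically transitive, piecewise monotone maps $[0,1]\to[0,1]$, and $\mathcal{T}_m\subset\mathcal{T}$ is the subspace of maps of modality $m$. All spaces of maps carry the metric $d(f,g)=\max_{x\in[0,1]}|f(x)-g(x)|$. $\mathcal{H}^+$ is the space of increasing homeomorphisms of $[0,1]$ onto itself. A map $f\in\mathcal{T}$ has constant slope $\lambda$ if $|f'(x)|=\lambda$ for all $x\notin\mathrm{Crit}(f)$. It is known that for each $f\in\mathcal{T}$ there are a unique map $\tilde f\in\mathcal{T}$ of some constant slope and a unique $\psi\in\mathcal{H}^+$ with $f=\psi\circ\tilde f\circ\psi^{-1}$, and that the slope of $\tilde f$ is $\exp h(f)$, where $h(f)$ is the topological entropy. Write $\Phi(f)=\tilde f$ (the constant slope model). Since conjugacy preserves modality, $\Phi$ restricts to an operator $\Phi_m:\mathcal{T}_m\to\mathcal{T}_m$. *)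

(* Defs.v *)
From HB Require Import structures.
From mathcomp Require Import all_boot all_order all_algebra.
From mathcomp Require Import all_classical all_reals all_analysis.
From mathcomp Require Import lra.

Set Implicit Arguments.
Unset Strict Implicit.
Unset Printing Implicit Defensive.

Import Order.TTheory GRing.Theory Num.Theory.
Import numFieldNormedType.Exports.

Local Open Scope classical_set_scope.
Local Open Scope card_scope.
Local Open Scope ring_scope.

(* A self-map of [0,1] is represented by a function R -> R, of which the
   definitions below only see the restriction to [0,1]. *)

Definition unit_itv (R : realType) : set R := `[0, 1]%classic.
Arguments unit_itv : clear implicits.

Definition monotone_on (R : realType) (A : set R) (f : R -> R) : Prop :=
  {in A &, {homo f : x y / x <= y}} \/ {in A &, {homo f : x y /~ x <= y}}.

Definition Crit (R : realType) (f : R -> R) : set R :=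
  [set 0; 1] `|`
  [set x | unit_itv R x /\
    ~ exists2 U : set R, nbhs x U & monotone_on (U `&` unit_itv R) f].

Definition transitive_map (R : realType) (f : R -> R) : Prop :=
  forall U V : set R, open U -> open V ->
    U `&` unit_itv R !=set0 -> V `&` unit_itv R !=set0 ->
    exists2 n : nat, (0 < n)%N &
      (iter n f @` (U `&` unit_itv R)) `&` V !=set0.

(* [tmap R] is the space T. The last field picks a canonical representative
   of each map of [0,1], so that equality in [tmap R] is equality of maps on
   [0,1] and the distance below is a genuine metric. *)
Record tmap (R : realType) : Type := TMap {
  tfun :> R -> R;
  tmap_cont : {within unit_itv R, continuous tfun};
  tmap_itv : set_fun (unit_itv R) (unit_itv R) tfun;
  tmap_transitive : transitive_map tfun;
  tmap_pwm : finite_set (Crit tfun);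
  tmap_out : forall x, ~ unit_itv R x -> tfun x = 0 }.

HB.instance Definition _ (R : realType) := gen_eqMixin (tmap R).
HB.instance Definition _ (R : realType) := gen_choiceMixin (tmap R).

Lemma tmap_ext (R : realType) (f g : tmap R) :
  (forall x, unit_itv R x -> f x = g x) -> f = g.
Proof.
case: f => f c1 i1 t1 p1 o1; case: g => g c2 i2 t2 p2 o2 /= fg.
have E : f = g.
  apply/funext => x; have [/fg//|nx] := pselect (unit_itv R x).
  by rewrite o1 // o2.
subst g; by congr TMap; exact: Prop_irrelevance.
Qed.

(* The supremum is attained, the maps being continuous. *)
Definition tdist (R : realType) (f g : tmap R) : R :=
  sup [set `|f x - g x| | x in unit_itv R].

Section tdist_metric.
Variable R : realType.
Implicit Types f g k : tmap R.

Let I0 : unit_itv R 0.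
Proof. by rewrite /unit_itv /= in_itv /= lexx ler01. Qed.

Lemma tdist_ub f g x : unit_itv R x -> `|f x - g x| <= tdist f g.
Proof.
move=> Ix; apply: ub_le_sup; last by exists x.
exists 1 => _ /= [y Iy <-].
have := tmap_itv f Iy; have := tmap_itv g Iy.
rewrite /unit_itv /= !in_itv /= => /andP[g0 g1] /andP[f0 f1].
by rewrite ler_norml; apply/andP; split; lra.
Qed.

Lemma tdist_le f g c :
  (forall x, unit_itv R x -> `|f x - g x| <= c) -> tdist f g <= c.
Proof.
move=> h; apply: ge_sup; first by exists `|f 0 - g 0|; exists 0.
by move=> _ /= [x /h ? <-].
Qed.

Lemma tdistxx f : tdist f f = 0.
Proof.
apply/eqP; rewrite eq_le; apply/andP; split.
  by apply: tdist_le => x _; rewrite subrr normr0.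
by apply: le_trans (tdist_ub f f I0).
Qed.

Lemma tdist_positivity f g : tdist f g = 0 -> f = g.
Proof.
move=> d0; apply: tmap_ext => x /(tdist_ub f g).
by rewrite d0 normr_le0 subr_eq0 => /eqP.
Qed.

Lemma tdist_sym f g : tdist f g = tdist g f.
Proof.
by apply/eqP; rewrite eq_le; apply/andP; split; apply: tdist_le => x Ix;
  rewrite distrC; exact: tdist_ub.
Qed.

Lemma tdist_triangle g f k : tdist f k <= tdist f g + tdist g k.
Proof.
apply: tdist_le => x Ix; rewrite (le_trans (ler_distD (g x) _ _))//.
by rewrite lerD// tdist_ub.
Qed.

End tdist_metric.

HB.instance Definition _ (R : realType) := @isMetric.Build R (tmap R)
  (@tdist R) (@tdistxx R) (@tdist_positivity R) (@tdist_sym R)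
  (@tdist_triangle R).

(* As a type, [T_ R m] carries the topology induced by that of [tmap R]. *)
Definition T_ (R : realType) (m : nat) : set (tmap R) :=
  [set f : tmap R | (Crit f `&` `]0, 1[%classic) #= `I_m].
Arguments T_ : clear implicits.

(* A point outside Crit f is in the open interval ]0, 1[, so the derivative
   does not depend on the values of f off [0,1]. *)
Definition constant_slope (R : realType) (lambda : R) (f : R -> R) : Prop :=
  forall x, unit_itv R x -> ~ Crit f x ->
    derivable f x 1 /\ `|derive1 f x| = lambda.

(* psi is an element of H^+ with inverse phi *)
Record increasing_homeo (R : realType) (psi phi : R -> R) : Prop := {
  ih_cont : {within unit_itv R, continuous psi};
  ih_contV : {within unit_itv R, continuous phi};
  ih_itv : set_fun (unit_itv R) (unit_itv R) psi;
  ih_itvV : set_fun (unit_itv R) (unit_itv R) phi;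
  ih_K : {in unit_itv R, cancel psi phi};
  ih_VK : {in unit_itv R, cancel phi psi};
  ih_lt : {in unit_itv R &, {homo psi : x y / x < y}} }.

Definition slope_model (R : realType) (f g : tmap R) : Prop :=
  (exists lambda : R, constant_slope lambda g) /\
  exists psi phi : R -> R, increasing_homeo psi phi /\
    forall x, unit_itv R x -> f x = psi (g (phi x)).

(* The constant slope model of f. It always exists and is unique, so the
   default value f of [xget] is never used. *)
Definition Phi (R : realType) (f : tmap R) : tmap R :=
  xget f [set g | slope_model f g].

(* Topological entropy by Bowen's (n,e)-separated sets; the limit as e tends
   to 0 is a supremum, by monotonicity in e. *)
Definition separated (R : realType) (f : R -> R) (n : nat) (e : R)
    (s : seq R) : Prop :=
  [/\ uniq s, (forall x, x \in s -> unit_itv R x) &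
    {in s &, forall x y, x != y ->
      exists2 k : nat, (k < n)%N & e < `|iter k f x - iter k f y|}].

Definition sep_number (R : realType) (f : R -> R) (n : nat) (e : R) : \bar R :=
  ereal_sup [set ((size s)%:R)%:E | s in separated f n e].

Definition entropy (R : realType) (f : R -> R) : \bar R :=
  ereal_sup [set limn_esup
      (fun n : nat => ((n%:R^-1)%:E * lne (sep_number f n e))%E)
    | e in [set e : R | 0 < e]].

(* The entropy of a piecewise monotone map is finite. *)
Definition h (R : realType) (f : tmap R) : R := fine (entropy f).

Section modality.
Variable R : realType.
Implicit Types (f g : R -> R) (psi phi : R -> R).

Lemma homeo_inv psi phi : increasing_homeo psi phi -> increasing_homeo phi psi.
Proof.
case=> c1 c2 i1 i2 k1 k2 lt1; split => // x y Ix Iy xy.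
have Ipx : unit_itv R (phi x) by apply: i2; rewrite inE in Ix.
have Ipy : unit_itv R (phi y) by apply: i2; rewrite inE in Iy.
rewrite ltNge le_eqVlt; apply/negP => /orP[/eqP e|l].
  by move: xy; rewrite -(k2 _ Ix) -(k2 _ Iy) e ltxx.
have := lt1 _ _ (mem_set Ipy) (mem_set Ipx) l.
by rewrite !k2// => /(lt_trans xy); rewrite ltxx.
Qed.

Lemma homeo_le psi phi : increasing_homeo psi phi ->
  {in unit_itv R &, {homo psi : x y / x <= y}}.
Proof.
move=> H x y Ix Iy; rewrite le_eqVlt => /orP[/eqP->//|xy].
by apply/ltW/(ih_lt H).
Qed.

Lemma homeo_oo psi phi x : increasing_homeo psi phi ->
  `]0, 1[%classic x -> `]0, 1[%classic (psi x).
Proof.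
move=> H; rewrite /= in_itv /= => /andP[x0 x1].
have I0 : unit_itv R 0 by rewrite /unit_itv /= in_itv /= lexx ler01.
have I1 : unit_itv R 1 by rewrite /unit_itv /= in_itv /= lexx ler01.
have Ix : unit_itv R x by rewrite /unit_itv /= in_itv /= !ltW.
have h0 := ih_lt H (mem_set I0) (mem_set Ix) x0.
have h1 := ih_lt H (mem_set Ix) (mem_set I1) x1.
have := ih_itv H I0; have := ih_itv H I1.
rewrite /unit_itv /= !in_itv /= => /andP[_ a] /andP[b _].
by rewrite (le_lt_trans b h0) (lt_le_trans h1 a).
Qed.

Lemma Crit_homeo f g psi phi x : increasing_homeo psi phi ->
  set_fun (unit_itv R) (unit_itv R) g ->
  (forall x, unit_itv R x -> f x = psi (g (phi x))) ->
  `]0, 1[%classic x -> Crit f (psi x) -> Crit g x.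
Proof.
move=> H gI fE x01; have y01 := homeo_oo H x01.
have sub : `]0, 1[%classic `<=` unit_itv R.
  by move=> z; rewrite /unit_itv /= !in_itv /= => /andP[? ?]; rewrite !ltW.
have Ix := sub _ x01.
case=> [[e|e]|[Iy nmon]].
- by move: y01; rewrite e /= in_itv /= ltxx.
- by move: y01; rewrite e /= in_itv /= ltxx andbF.
right; split=> // -[U Ux mU]; apply: nmon.
have [cphi _ _] := (continuous_within_itvP _ ltr01).1 (ih_contV H).
have /= cy := cphi _ y01.
have phiy : phi (psi x) = x by exact: (ih_K H (mem_set Ix)).
exists (phi @^-1` U); first by apply: cy; rewrite phiy.
have aux z : z \in phi @^-1` U `&` unit_itv R ->
    [/\ unit_itv R z, phi z \in U `&` unit_itv R & g (phi z) \in unit_itv R].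
  rewrite !inE => -[/= Uz Iz]; have Ip := ih_itvV H Iz.
  by split => //; apply: gI.
have phile := homeo_le (homeo_inv H); have psile := homeo_le H.
case: mU => m; [left|right] => a b /aux[Ia Ua ga] /aux[Ib Ub gb] ab;
  rewrite !fE//; apply: psile => //; apply: m => //;
  by apply: phile => //; exact: mem_set.
Qed.

Lemma T_Phi (m : nat) (f : tmap R) : T_ R m f -> T_ R m (Phi f).
Proof.
rewrite /Phi; case: xgetP => [g _ [_ [psi [phi [H fE]]]]|//] Tf.
have gE x : unit_itv R x -> g x = phi (f (psi x)).
  move=> Ix; rewrite fE; last exact: (ih_itv H).
  rewrite (ih_K H (mem_set Ix)) (ih_K H)//; apply/mem_set.
  exact: tmap_itv.
have H' := homeo_inv H.
rewrite /T_ /=; apply: card_eq_trans Tf.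
have -> : Crit g `&` `]0, 1[%classic = phi @` (Crit f `&` `]0, 1[%classic).
  have sub : `]0, 1[%classic `<=` unit_itv R.
    by move=> z; rewrite /unit_itv /= !in_itv /= => /andP[? ?]; rewrite !ltW.
  apply/seteqP; split => [x [Cx x01]|_ [y [Cy y01] <-]].
    exists (psi x); last by apply: (ih_K H); apply/mem_set/sub.
    split; last exact: homeo_oo H x01.
    apply: (Crit_homeo H' (@tmap_itv R f) gE); first exact: homeo_oo H x01.
    by rewrite (ih_K H)//; apply/mem_set/sub.
  split; last exact: homeo_oo H' y01.
  apply: (Crit_homeo H (@tmap_itv R g) fE); first exact: homeo_oo H' y01.
  by rewrite (ih_VK H)//; apply/mem_set/sub.
apply: inj_card_eq => a b /set_mem[_ a01] /set_mem[_ b01] e.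
have sub : `]0, 1[%classic `<=` unit_itv R.
  by move=> z; rewrite /unit_itv /= !in_itv /= => /andP[? ?]; rewrite !ltW.
have ka := ih_VK H (mem_set (sub _ a01)).
by rewrite -ka e (ih_VK H (mem_set (sub _ b01))).
Qed.

End modality.

Definition Phi_ (R : realType) (m : nat) (f : T_ R m) : T_ R m :=
  SigSub (mem_set (T_Phi (set_mem (valP f)))).

(* The restriction of h to T_m. *)
Definition h_ (R : realType) (m : nat) : T_ R m -> R := sigL (T_ R m) (@h R).

Arguments Phi_ R m f : clear implicits.
Arguments h_ R m _ : clear implicits.

(* Main.v *)
Require Import Defs.
From HB Require Import structures.
From mathcomp Require Import all_boot all_order all_algebra.
From mathcomp Require Import all_classical all_reals all_analysis.
From mathcomp Require Import zify ring lra.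
Import Order.TTheory GRing.Theory Num.Theory.
Import numFieldNormedType.Exports.
Local Open Scope classical_set_scope.
Local Open Scope ring_scope.

Set Implicit Arguments.
Unset Strict Implicit.
Unset Printing Implicit Defensive.

(** Since the slope of the model of [f] is [exp (h f)], only the conjugacy has to be controlled.
Along an ultrafilter of maps converging to [f], the lengths that the conjugacies give to intervals
converge to an additive length [l] with possible atoms [a x], which each lap of [f] multiplies at
most by the limit [lam] of the slopes. Without atoms the limit is a conjugacy from [f] to a map of
constant slope [lam], and uniqueness of the model gives continuity. Atoms satisfy
[lam * a x <= a (f x)] off the turning points and [lam * a c <= 2 * a (f c)] at a turning point [c];
as [lam > 1], an atom forces one at a turning point.

If [lam] is the slope of the model of [f], as it is at a continuity point of the entropy, compare [l]
with the length of the model. The ratio is minimal on some interval, which then carries no atom,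
while an image of this interval crosses the turning point and meets its atom: a contradiction.

In general an atom at a turning point has a periodic orbit, of period [p] with [q] turning points,
and [lam ^ p <= 2 ^ q]. A horseshoe gives [lam ^ 2 > 2], so [p < 2 * q]; at most four turning points
leave finitely many cyclic permutations. For most of them the number of closed walks in the
covering graph of the cycle contradicts [lam ^ p <= 2 ^ q]; in the remaining ones the turning points
outside the cycle produce an invariant interval or additional coverings. *)

(** The facts about models that the theorem quotes are proved here as well. Existence: itineraries
    are counted with weights [t ^ n], and the counts, normalised on [0,1], are followed as [t] tends
    to the inverse growth rate, where the total diverges and bounded errors disappear. The slope of
    a model is read off from the entropy, the conjugacy from minimal ratios of lengths. Fixed
    modality controls the limit of the conjugacies: every turning point of [f] attracts exactly one
    turning point of each nearby map, so that mass near it is folded at most twice onto its image;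
    hence the factor 2 for atoms. An atom is a jump of the limit. Lengths are measured between
    one-sided limits, without the atoms at the ends; they stay superadditive and lower
    semicontinuous, which is all that the argument of minimal ratios uses. A positive atom at a
    turning point makes all lengths positive, because some image of any interval crosses that point.
    Every covering relation along a cycle then becomes an inequality for [lam], whatever the map
    does between the points of the cycle. *)

(** * Tactics for order goals *)

Local Ltac same a b :=
  first [constr_eq a b
    | lazymatch a with @Algebra.zero _ => idtac end; lazymatch b with @Algebra.zero _ => idtac end
    | lazymatch a with GRing.one _ => idtac end; lazymatch b with GRing.one _ => idtac end].

(** Most order goals are short chains of hypotheses. A search for at most [n] links is tried before
    [lra], whose cost grows with the large contexts of the later proofs. *)
Local Ltac chain n :=
  lazymatch n with
  | O => fail
  | S ?k =>
    lazymatch goal with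
    | |- is_true (?a < ?b) =>
      first
      [ match goal with
        | H : is_true (?a' < ?b') |- _ => same a a'; same b b'; exact H
        | H : is_true ((?a' < ?b') && _) |- _ => same a a'; same b b'; exact (proj1 (andP H))
        | H : is_true (_ && (?a' < ?b')) |- _ => same a a'; same b b'; exact (proj2 (andP H))
        end
      | match goal with
        | H : is_true (?a' < ?c) |- _ => same a a'; refine (lt_le_trans H _); chain k
        | H : is_true (?a' <= ?c) |- _ => same a a'; refine (le_lt_trans H _); chain k
        | H : is_true ((?a' < ?c) && _) |- _ => same a a'; refine (lt_le_trans (proj1 (andP H)) _); chain k
        | H : is_true ((?a' <= ?c) && _) |- _ => same a a'; refine (le_lt_trans (proj1 (andP H)) _); chain k
        | H : is_true (_ && (?a' < ?c)) |- _ => same a a'; refine (lt_le_trans (proj2 (andP H)) _); chain k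
        | H : is_true (_ && (?a' <= ?c)) |- _ => same a a'; refine (le_lt_trans (proj2 (andP H)) _); chain k
        end ]
    | |- is_true (?a <= ?b) =>
      first
      [ same a b; exact (lexx _)
      | match goal with
        | H : is_true (?a' <= ?b') |- _ => same a a'; same b b'; exact H
        | H : is_true (?a' < ?b') |- _ => same a a'; same b b'; exact (ltW H)
        | H : is_true ((?a' <= ?b') && _) |- _ => same a a'; same b b'; exact (proj1 (andP H))
        | H : is_true (_ && (?a' <= ?b')) |- _ => same a a'; same b b'; exact (proj2 (andP H))
        | H : is_true ((?a' < ?b') && _) |- _ => same a a'; same b b'; exact (ltW (proj1 (andP H)))
        | H : is_true (_ && (?a' < ?b')) |- _ => same a a'; same b b'; exact (ltW (proj2 (andP H)))
        end
      | match goal with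
        | H : is_true (?a' < ?c) |- _ => same a a'; refine (le_trans (ltW H) _); chain k
        | H : is_true (?a' <= ?c) |- _ => same a a'; refine (le_trans H _); chain k
        | H : is_true ((?a' < ?c) && _) |- _ => same a a'; refine (le_trans (ltW (proj1 (andP H))) _); chain k
        | H : is_true ((?a' <= ?c) && _) |- _ => same a a'; refine (le_trans (proj1 (andP H)) _); chain k
        | H : is_true (_ && (?a' < ?c)) |- _ => same a a'; refine (le_trans (ltW (proj2 (andP H))) _); chain k
        | H : is_true (_ && (?a' <= ?c)) |- _ => same a a'; refine (le_trans (proj2 (andP H)) _); chain k
        end ]
    end
  end.

Local Ltac chains := first [chain (1)%N | chain (2)%N | chain (3)%N | chain (4)%N].

Local Ltac easy_ord :=
  lazymatch goal with
  | |- is_true (_ && _) => apply/andP; split; easy_ord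
  | |- is_true (0 < _ / _) => apply: divr_gt0; [easy_ord | exact: ltr0Sn]
  | |- is_true (0 < _ - _) => rewrite subr_gt0; easy_ord
  | |- is_true (0 <= _ - _) => rewrite subr_ge0; easy_ord
  | |- is_true (1 - _ < 1 - _) => rewrite ltrD2l ltrN2; easy_ord
  | |- is_true (1 - _ <= 1 - _) => rewrite lerD2l lerN2; easy_ord
  | |- is_true (1 - _ < 1) => rewrite gtrBl; easy_ord
  | |- is_true (1 - _ <= 1) => rewrite gerBl; easy_ord
  | |- is_true (?a < ?a + _) => rewrite ltrDl; easy_ord
  | |- is_true (?a <= ?a + _) => rewrite lerDl; easy_ord
  | |- is_true (?a - _ < ?a) => rewrite gtrBl; easy_ord
  | |- _ \/ _ => first [left; easy_ord | right; easy_ord]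
  | |- is_true (_ < _) => first [chains | exact: ltr01]
  | |- is_true (_ <= _) => first [chains | exact: ler01]
  end.

Local Ltac clash H :=
  lazymatch type of H with
  | is_true (?a < ?b) => exfalso; assert (H' : b <= a) by first [chain (1)%N | chain (2)%N]; rewrite (lt_geF H) in H'; discriminate H'
  | is_true (?a <= ?b) => exfalso; assert (H' : b < a) by first [chain (1)%N | chain (2)%N]; rewrite (le_gtF H) in H'; discriminate H'
  | is_true (_ && _) => let H1 := fresh in let H2 := fresh in
      case/andP: (H) => H1 H2; first [clash H1 | clash H2]
  end.

Local Ltac ord :=
  lazymatch goal with
  | |- is_true (_ && _) => apply/andP; split; ord
  | |- is_true true => exact isT
  | |- is_true (_ < _) => first [easy_ord | lra]
  | |- is_true (_ <= _) => first [easy_ord | lra]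
  | |- is_true _ -> _ => let H := fresh in intro H; first [clash H | ord]
  | |- _ -> _ => let H := fresh in intro H; ord
  | |- ?x = ?y \/ ?y < ?x => first [easy_ord
      | let H := fresh in assert (H : y <= x) by chains; move: H; rewrite le_eqVlt eq_sym => /orP[/eqP|]; [left|right]; assumption | lra]
  | |- ?x = ?y \/ ?x < ?y => first [easy_ord
      | let H := fresh in assert (H : x <= y) by chains; move: H; rewrite le_eqVlt => /orP[/eqP|]; [left|right]; assumption | lra]
  | |- _ \/ _ => first [easy_ord | lra]
  | |- False => first [match goal with
      | H : is_true (_ < _) |- _ => clash H
      end | lra]
  | |- ex _ => fail
  | |- ex2 _ _ => fail
  | |- forall x, _ => fail
  | |- _ => lra
  end.

(** * Piecewise monotone transitive maps *)

Local Notation lr := (ltac:(ord)) (only parsing).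

Section interval_maps.
Variable R : realType.
Implicit Types (f g h : R -> R) (x y z a b c d e p v lo hi : R) (C : seq R).

Definition ctsI f := forall x, 0 <= x <= 1 -> forall e, 0 < e ->
  exists2 d : R, 0 < d & forall y, 0 <= y <= 1 -> `|y - x| < d -> `|f y - f x| < e.

Definition selfI f := forall x, 0 <= x <= 1 -> 0 <= f x <= 1.

Definition inc f a b := forall x y, a <= x -> x < y -> y <= b -> f x < f y.
Definition dec f a b := forall x y, a <= x -> x < y -> y <= b -> f y < f x.
Definition smono f a b := inc f a b \/ dec f a b.

Definition fold f c := exists2 d : R, 0 < d & [/\ 0 <= c - d, c + d <= 1 &
  (inc f (c - d) c /\ dec f c (c + d)) \/ (dec f (c - d) c /\ inc f c (c + d))].

(** The working form of the space of maps: [C] lists the turning points, all of them inside (0,1).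
    Laps are strictly monotone, which transitivity forces. An explicit list makes it possible to
    count turning points and to reflect them. *)
Record pmt f C : Prop := Pmt {
  pm_self : selfI f;
  pm_cts : ctsI f;
  pm_uniq : uniq C;
  pm_fold : forall c, c \in C -> fold f c;
  pm_mono : forall x y, 0 <= x -> x < y -> y <= 1 ->
    (forall c, c \in C -> ~~ (x < c < y)) -> smono f x y;
  pm_tr : forall a b c d, 0 <= a -> a < b -> b <= 1 ->
    0 <= c -> c < d -> d <= 1 ->
    exists2 n, (0 < n)%N & exists2 x : R, a < x < b & c < iter n f x < d }.

Lemma inc_sub f a b a' b' : inc f a b -> a <= a' -> b' <= b -> inc f a' b'.
Proof. by move=> h aa bb x y ax xy yb; apply: h => //; ord. Qed.

Lemma dec_sub f a b a' b' : dec f a b -> a <= a' -> b' <= b -> dec f a' b'.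
Proof. by move=> h aa bb x y ax xy yb; apply: h => //; ord. Qed.

Lemma smono_sub f a b a' b' : smono f a b -> a <= a' -> b' <= b -> smono f a' b'.
Proof.
by case=> h *; [left; apply: inc_sub h _ _|right; apply: dec_sub h _ _].
Qed.

Lemma ctsI_within f a b : ctsI f -> 0 <= a -> b <= 1 ->
  {within `[a, b], continuous f}.
Proof.
move=> fc a0 b1; apply/subspace_continuousP => x /=; rewrite in_itv /= => xab.
apply/cvgrPdist_lt => e e0.
have [|d d0 hd] := fc x _ e e0; first ord.
rewrite near_withinE; exists d => //= t tx; rewrite in_itv /= => tab.
rewrite distrC; apply: hd; [ord|by rewrite distrC].
Qed.

Lemma ctsI_IVT f a b v : ctsI f -> 0 <= a -> a <= b -> b <= 1 ->
  (f a <= v <= f b) \/ (f b <= v <= f a) -> exists2 c : R, a <= c <= b & f c = v.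
Proof.
move=> fc a0 ab b1 hv.
have [|c] := @IVT R f a b v ab (ctsI_within fc a0 b1).
  by rewrite ge_min le_max; case: hv => /andP[-> ->]; rewrite ?orbT.
by rewrite in_itv /=; exists c.
Qed.

Lemma ctsI_max f a b : ctsI f -> 0 <= a -> a <= b -> b <= 1 ->
  exists2 c : R, a <= c <= b & forall x, a <= x <= b -> f x <= f c.
Proof.
move=> fc a0 ab b1; have [c] := EVT_max ab (ctsI_within fc a0 b1).
by rewrite in_itv /= => cab h; exists c => // x xab; apply: h.
Qed.

Lemma ctsI_min f a b : ctsI f -> 0 <= a -> a <= b -> b <= 1 ->
  exists2 c : R, a <= c <= b & forall x, a <= x <= b -> f c <= f x.
Proof.
move=> fc a0 ab b1; have [c] := EVT_min ab (ctsI_within fc a0 b1).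
by rewrite in_itv /= => cab h; exists c => // x xab; apply: h.
Qed.

Lemma selfI_iter f n : selfI f -> selfI (iter n f).
Proof. by move=> fI; elim: n => //= n IH x xI; apply/fI/IH. Qed.

Lemma ctsI_comp f g : selfI g -> ctsI f -> ctsI g -> ctsI (fun x => f (g x)).
Proof.
move=> gI fc gc x xI e e0; have [d d0 hd] := fc _ (gI _ xI) e e0.
have [d' d'0 hd'] := gc x xI d d0; exists d' => // y yI yx.
by apply: hd; [apply: gI|apply: hd'].
Qed.

Lemma ctsI_iter f n : selfI f -> ctsI f -> ctsI (iter n f).
Proof.
move=> fI fc; elim: n => [|n IH] /=; last first.
  by apply: ctsI_comp => //; apply: selfI_iter.
by move=> x _ e e0; exists e.
Qed.

Lemma ctsI_lt f x v : ctsI f -> 0 <= x <= 1 -> f x < v ->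
  exists2 d : R, 0 < d & forall y, 0 <= y <= 1 -> `|y - x| < d -> f y < v.
Proof.
move=> fc xI fv; have [|d d0 hd] := fc x xI (v - f x); first ord.
by exists d => // y yI yx; have := hd y yI yx; rewrite ltr_norml; ord.
Qed.

Lemma ctsI_gt f x v : ctsI f -> 0 <= x <= 1 -> v < f x ->
  exists2 d : R, 0 < d & forall y, 0 <= y <= 1 -> `|y - x| < d -> v < f y.
Proof.
move=> fc xI fv; have [|d d0 hd] := fc x xI (f x - v); first ord.
by exists d => // y yI yx; have := hd y yI yx; rewrite ltr_norml; ord.
Qed.

Lemma gap_seq C x : exists2 d : R, 0 < d & forall c, c \in C -> c != x -> d <= `|c - x|.
Proof.
elim: C => [|c C [d d0 hd]]; first by exists 1.
have [->|cx] := eqVneq c x.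
  by exists d => // c'; rewrite inE => /orP[/eqP->|/hd//]; rewrite eqxx.
exists (Num.min d `|c - x|); first by rewrite lt_min d0 normr_gt0 subr_eq0.
move=> c'; rewrite inE => /orP[/eqP->|c'C] h; first by rewrite ge_min lexx orbT.
by rewrite ge_min hd.
Qed.

(* Last preimage: [f] omits the value [v] just left of [p]. *)
Lemma last_preim f v a p d : ctsI f -> 0 <= a -> a < p -> p <= 1 -> f a = v ->
  0 < d -> (forall x, p - d < x -> x < p -> f x <> v) ->
  exists2 z : R, a <= z < p & f z = v /\ forall x, z < x < p -> f x <> v.
Proof.
move=> fc a0 ap p1 fa d0 hd.
pose S := [set x | a <= x < p /\ f x = v].
have Sa : S a by split => //; ord.
have Sub : has_ubound S by exists p => x [? _]; ord.
have hs : has_sup S by split => //; exists a.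
pose z := sup S.
have za : a <= z by apply: ub_le_sup.
have zp : z <= p - d \/ z <= a.
  have [h|h] := leP (p - d) a; [right|left]; apply: ge_sup; try by exists a.
    move=> x [xa fx]; have [//|ax] := leP x a.
    by case: (hd x) => //; ord.
  move=> x [xa fx]; have [//|ax] := leP x (p - d).
  by case: (hd x) => //; ord.
have zI : 0 <= z <= 1 by case: zp; ord.
have fz : f z = v.
  apply/eqP; apply/negPn/negP => nz.
  have e0 : 0 < `|f z - v| by rewrite normr_gt0 subr_eq0.
  have [e e1 he] := fc z zI _ e0.
  have [x [xa fx] zx] := sup_adherent e1 hs.
  have xz : x <= z by apply: ub_le_sup.
  have : `|f x - f z| < `|f z - v|.
    by apply: he; [ord|rewrite ltr_norml -/z in zx *; ord].
  by rewrite fx distrC ltxx.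
exists z; first by case: zp; ord.
split=> // x xz fx.
have : x <= z by apply: ub_le_sup => //; split => //; ord.
by ord.
Qed.

Section with_pmt.
Variables (f : R -> R) (C : seq R).
Hypothesis P : pmt f C.
Let fI := pm_self P.
Let fc := pm_cts P.

Lemma fold_in c : c \in C -> 0 < c < 1.
Proof. by move=> /(pm_fold P)[d d0 []]; ord. Qed.

Lemma iterI n x : 0 <= x <= 1 -> 0 <= iter n f x <= 1.
Proof. exact: selfI_iter. Qed.

Lemma smono_right x : 0 <= x < 1 -> exists2 d : R, 0 < d & x + d <= 1 /\ smono f x (x + d).
Proof.
move=> xI; have [d d0 hd] := gap_seq C x.
exists (Num.min d (1 - x)); first by rewrite lt_min; ord.
set e := Num.min _ _; have ed : e <= d by rewrite ge_min lexx.
have e1 : e <= 1 - x by rewrite ge_min lexx orbT.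
have e0 : 0 < e by rewrite lt_min; ord.
split; first ord.
apply: (pm_mono P); [ord|ord|ord|].
move=> c cC; apply/negP => xc.
have := hd c cC; have -> : c != x by apply/eqP; ord.
by move=> /(_ isT); rewrite ger0_norm; ord.
Qed.

Lemma smono_left x : 0 < x <= 1 -> exists2 d : R, 0 < d & 0 <= x - d /\ smono f (x - d) x.
Proof.
move=> xI; have [d d0 hd] := gap_seq C x.
exists (Num.min d x); first by rewrite lt_min; ord.
set e := Num.min _ _; have ed : e <= d by rewrite ge_min lexx.
have e1 : e <= x by rewrite ge_min lexx orbT.
have e0 : 0 < e by rewrite lt_min; ord.
split; first ord.
apply: (pm_mono P); [ord|ord|ord|].
move=> c cC; apply/negP => xc.
have := hd c cC; have -> : c != x by apply/eqP; ord.
by move=> /(_ isT); rewrite ler0_norm; ord.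
Qed.

(** Induction on the number of turning points inside the interval, for estimates that add up over
    adjacent intervals. *)
Lemma lap_ind (Q : R -> R -> Prop) :
  (forall x y, 0 <= x -> x < y -> y <= 1 -> smono f x y -> Q x y) ->
  (forall x y z, 0 <= x -> x < y -> y < z -> z <= 1 -> Q x y -> Q y z -> Q x z) ->
  forall x y, 0 <= x -> x < y -> y <= 1 -> Q x y.
Proof.
move=> Q0 Q1 x y; have [n] := ubnP (size [seq c <- C | x < c < y]).
elim: n x y => // n IH x y sz x0 xy y1.
have [|/hasPn no] := boolP (has (fun c => x < c < y) C); last first.
  by apply: Q0 => //; apply: (pm_mono P).
move=> /hasP[c cC xcy].
have hs (p q : pred R) : (forall z, p z -> q z) -> q c -> ~~ p c ->
    (size [seq c <- C | p c] < size [seq c <- C | q c])%N.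
  move=> pq qc pc; rewrite !size_filter.
  elim: (C) cC => // c' C' IHC; rewrite inE => /orP[/eqP <-|cC] /=.
    by rewrite qc (negbTE pc) add0n add1n ltnS; apply: sub_count.
  have := IHC cC; case: (boolP (p c')) => [/pq ->|_] /=; first by rewrite !add1n.
  by move=> h; apply: leq_trans h _; rewrite leq_addl.
have c01 : x < c < y by [].
apply: (Q1 x c y) => //; try ord.
- apply: IH; try ord; rewrite -ltnS; apply: leq_trans sz; rewrite ltnS.
  by apply: hs => /= [d||]; ord.
- apply: IH; try ord; rewrite -ltnS; apply: leq_trans sz; rewrite ltnS.
  by apply: hs => /= [d||]; ord.
Qed.

(** The basic use of transitivity: the orbit of an interval visits every interval and carries a
    forward invariant property with it. All later exclusions of invariant intervals rest on this. *)
Lemma inv_all (S : R -> Prop) :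
  (forall x, 0 <= x <= 1 -> S x -> S (f x)) ->
  (exists a b : R, [/\ 0 <= a, a < b, b <= 1 & forall x, a < x < b -> S x]) ->
  forall c d, 0 <= c -> c < d -> d <= 1 -> exists2 x : R, c < x < d & S x.
Proof.
move=> Sf [a [b [a0 ab b1 Sab]]] c d c0 cd d1.
have [n _ [x xab h]] := pm_tr P a0 ab b1 c0 cd d1.
exists (iter n f x) => //; elim: n {h} => [|n IH]; first exact: Sab.
by rewrite iterS; apply: Sf => //; apply: iterI; ord.
Qed.

Lemma inv_itv a b : 0 <= a -> a < b -> b <= 1 ->
  (forall x, a <= x <= b -> a <= f x <= b) -> a = 0 /\ b = 1.
Proof.
move=> a0 ab b1 h.
have k c d : 0 <= c -> c < d -> d <= 1 -> exists2 x : R, c < x < d & a <= x <= b.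
  apply: inv_all; first by move=> x _; apply: h.
  by exists a, b; split => // x; ord.
split.
  have [//|a1] : a = 0 \/ 0 < a by ord.
  by have [x] := k 0 a (lexx _) a1 lr; ord.
have [//|a1] : b = 1 \/ b < 1 by ord.
by have [x] := k b 1 lr a1 (lexx _); ord.
Qed.

Lemma inv_two a b c d : 0 <= a -> a <= b -> b < c -> c <= d -> d <= 1 ->
  a < b \/ c < d ->
  ~ (forall x, (a <= x <= b) \/ (c <= x <= d) ->
       (a <= f x <= b) \/ (c <= f x <= d)).
Proof.
move=> a0 ab bc cd d1 nd h.
have [|||||x xbc] := @inv_all (fun x => (a <= x <= b) \/ (c <= x <= d)) _ _ b c; try ord.
- by move=> x _; apply: h.
- case: nd => ?; [exists a, b|exists c, d]; split; try ord; move=> x; ord.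
Qed.

(** The image of [0,1] is an invariant interval, nondegenerate because [f] is strictly monotone near
    0; so it is all of [0,1]. *)
Lemma pm_onto v : 0 <= v <= 1 -> exists2 x : R, 0 <= x <= 1 & f x = v.
Proof.
move=> v01.
have [a aI ha] := ctsI_min fc (lexx 0) ler01 (lexx 1).
have [b bI hb] := ctsI_max fc (lexx 0) ler01 (lexx 1).
have fa := fI aI; have fb := fI bI.
have ab : f a < f b.
  have [//|ba] := ltP (f a) (f b).
  have [|d d0 [d1 [] h]] := @smono_right 0; first ord.
    have := h 0 (0 + d) (lexx _) _ (lexx _).
    have := ha 0; have := hb 0; have := ha (0 + d); have := hb (0 + d); ord.
  have := h 0 (0 + d) (lexx _) _ (lexx _).
  have := ha 0; have := hb 0; have := ha (0 + d); have := hb (0 + d); ord.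
have [||||fa0 fb1] := @inv_itv (f a) (f b); try ord.
  by move=> x xI; rewrite ha ?hb //; ord.
have [ab'|ba'] := leP a b.
  have [||||x xab fx] := @ctsI_IVT f a b v fc; try ord.
  by exists x => //; ord.
have [||||x xab fx] := @ctsI_IVT f b a v fc; try ord.
by exists x => //; ord.
Qed.

Lemma smono_comp g h a b lo hi : smono g a b ->
  (forall x, a <= x <= b -> lo <= g x <= hi) -> smono h lo hi ->
  smono (fun x => h (g x)) a b.
Proof.
move=> sg gb sh.
have gx x y : a <= x -> x < y -> y <= b -> lo <= g x <= hi /\ lo <= g y <= hi.
  by move=> ax xy yb; split; apply: gb; ord.
case: sg => sg; case: sh => sh; [left|right|right|left] => x y ax xy yb;
  have [gxx gyy] := gx x y ax xy yb; have := sg x y ax xy yb => ?;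
  by apply: sh; ord.
Qed.

(** A short interval right of [x] is sent by [iter n f] to one side of the image point, and on that
    side [f] is monotone even when the image point is a turning point. *)
Lemma smono_iter_right n x : 0 <= x < 1 ->
  exists2 d : R, 0 < d & x + d <= 1 /\ smono (iter n f) x (x + d).
Proof.
move=> x01; elim: n => [|n [d d0 [d1 h]]].
  by exists (1 - x); [ord|split; [ord|left => a b /=]].
have Fc := ctsI_iter n fI fc.
have FI := @iterI n.
have Fx : 0 <= iter n f x <= 1 by apply: FI; ord.
have Fy : 0 <= iter n f (x + d) <= 1 by apply: FI; ord.
case: h => h; have hxy := h x (x + d) (lexx _) lr (lexx _).
- have [d' d'0 [d'1 sd]] := @smono_right (iter n f x) lr.
  have [e e0 he] := @ctsI_lt _ x (iter n f x + d') Fc lr lr.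
  pose y2 := Num.min d (e / 2).
  have y2y : y2 <= d by rewrite ge_min lexx.
  have y2e : y2 <= e / 2 by rewrite ge_min lexx orbT.
  have y2x : 0 < y2 by rewrite lt_min; ord.
  exists y2 => //; split; first ord.
  apply: (smono_comp (g := iter n f) (lo := iter n f x) (hi := iter n f x + d')) => //.
    by left; apply: inc_sub h _ _; ord.
  move=> z xz; have [->|zx] : z = x \/ x < z by ord.
    by ord.
  have := h x z (lexx _) zx lr; have := he z lr; rewrite ltr_norml; ord.
- have [d' d'0 [d'1 sd]] := @smono_left (iter n f x) lr.
  have [e e0 he] := @ctsI_gt _ x (iter n f x - d') Fc lr lr.
  pose y2 := Num.min d (e / 2).
  have y2y : y2 <= d by rewrite ge_min lexx.
  have y2e : y2 <= e / 2 by rewrite ge_min lexx orbT.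
  have y2x : 0 < y2 by rewrite lt_min; ord.
  exists y2 => //; split; first ord.
  apply: (smono_comp (g := iter n f) (lo := iter n f x - d') (hi := iter n f x)) => //.
    by right; apply: dec_sub h _ _; ord.
  move=> z xz; have [->|zx] : z = x \/ x < z by ord.
    by ord.
  have := h x z (lexx _) zx lr; have := he z lr; rewrite ltr_norml; ord.
Qed.

Lemma pm_plateau n x y v : 0 <= x -> x < y -> y <= 1 ->
  exists2 z : R, x < z < y & iter n f z <> v.
Proof.
move=> x0 xy y1; have [d d0 [d1 h]] := @smono_iter_right n x lr.
pose x' := x; pose y' := Num.min y (x + d).
have y'y : y' <= y by rewrite ge_min lexx.
have y'd : y' <= x + d by rewrite ge_min lexx orbT.
have xy' : x' < y' by rewrite lt_min; apply/andP; split; rewrite /x'; ord.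
pose a := (2 * x' + y') / 3; pose b := (x' + 2 * y') / 3.
have ab : iter n f a <> iter n f b.
  by case: h => h; have := h a b; rewrite /a /b /x' in xy' *; ord.
have [e|nv] := pselect (iter n f a = v).
  by exists b; [rewrite /b /x' in xy' *; ord|rewrite -e => e'; apply: ab].
by exists a => //; rewrite /a /x' in xy' *; ord.
Qed.

End with_pmt.

(** Conjugation by the reflection of [0,1]. It exchanges left and right, maxima and minima, so that
    one of each pair of symmetric cases suffices. *)
Definition mir f x := 1 - f (1 - x).

Lemma mirK f : mir (mir f) = f.
Proof. by apply/funext => x; rewrite /mir !subKr. Qed.

Lemma mir_iter f n x : iter n (mir f) x = 1 - iter n f (1 - x).
Proof. by elim: n => [|n /= ->]; rewrite /= ?subKr // /mir subKr. Qed.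

Lemma mir_inc f a b : inc f a b -> inc (mir f) (1 - b) (1 - a).
Proof.
by move=> h x y ax xy yb; rewrite /mir; have := h (1 - y) (1 - x); ord.
Qed.

Lemma mir_dec f a b : dec f a b -> dec (mir f) (1 - b) (1 - a).
Proof.
by move=> h x y ax xy yb; rewrite /mir; have := h (1 - y) (1 - x); ord.
Qed.

Lemma mir_pmt f C : pmt f C -> pmt (mir f) [seq 1 - c | c <- C].
Proof.
move=> P; split.
- by move=> x xI; rewrite /mir; have := pm_self P (x := 1 - x); ord.
- move=> x xI e e0; have [d d0 hd] := pm_cts P (x := 1 - x) lr e0.
  exists d => // y yI yx; rewrite /mir.
  have -> : 1 - f (1 - y) - (1 - f (1 - x)) = - (f (1 - y) - f (1 - x)) by ring.
  rewrite normrN; apply: hd; first ord.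
  by rewrite opprB addrC addrA subrK -normrN opprB.
- by rewrite map_inj_uniq ?(pm_uniq P) // => x y; ord.
- move=> _ /mapP[c cC ->]; have [d d0 [c0 c1 h]] := pm_fold P cC.
  exists d => //; split; [ord|ord|].
  have e1 : 1 - c - d = 1 - (c + d) by ring.
  have e2 : 1 - c + d = 1 - (c - d) by ring.
  by rewrite e1 e2; case: h => -[h1 h2]; [right|left]; split;
    (apply: mir_inc || apply: mir_dec).
- move=> x y x0 xy y1 h.
  have [||||k|k] := @pm_mono f C P (1 - y) (1 - x); try ord.
  + move=> c cC; have := h (1 - c) (map_f _ cC); ord.
  + by left; have := mir_inc k; rewrite !subKr.
  + by right; have := mir_dec k; rewrite !subKr.
- move=> a b c d a0 ab b1 c0 cd d1.
  have [n n0 [x xab h]] := @pm_tr f C P (1 - b) (1 - a) (1 - d) (1 - c) lr lr lr lr lr lr.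
  exists n => //; exists (1 - x); first ord.
  by rewrite mir_iter subKr; ord.
Qed.

End interval_maps.

(** * Horseshoes *)

Section horseshoes.
Variable R : realType.
Implicit Types (f g h : R -> R) (x y z w a b c d e p v lo hi : R) (C : seq R).

(** A strict horseshoe: [z,w] and [w,p] are both mapped over [f w,p], which is strictly longer than
    [z,p]. In [hs2] the same happens for the second iterate. *)
Definition hs1 f := exists z w p, [/\ 0 <= z, z < w, w < p, p < 1 &
  [/\ f z = p, f p = p & f w < z]].
Definition hs2 f := exists z w p, [/\ 0 <= z, z < w, w < p, p < 1 &
  [/\ f (f z) = p, f (f p) = p & f (f w) < z]].
(** The borderline case: [f] exchanges the two sides of [p], and its second iterate folds [0,p] onto
    itself without overshoot, so that only [2 <= lam ^ 2] follows. The sign conditions serve to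
    exclude equality when there is an atom on a cycle. *)
Definition hs3 f := exists w p, [/\ 0 < w, w < p, p < 1 &
  [/\ f 0 = p, f p = p, f (f w) = 0, (forall x, 0 < x < p -> p < f x) &
      forall x, p < x <= 1 -> f x < p]].
Definition hs f := [\/ hs1 f, hs2 f | hs3 f].

Lemma sign_const f a b v : ctsI f -> 0 <= a -> a < b -> b <= 1 ->
  (forall x, a < x < b -> f x <> v) ->
  (forall x, a < x < b -> f x < v) \/ (forall x, a < x < b -> v < f x).
Proof.
move=> fc a0 ab b1 nv; pose m := (a + b) / 2.
have mab : a < m < b by rewrite /m; ord.
have [fm|fm] := ltP (f m) v; [left|right] => x xab;
  rewrite ltNge; apply/negP => fx; have [xm|mx] := leP x m.
- have [||||t tx ft] := @ctsI_IVT R f x m v fc; try ord.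
  by apply: (nv t) => //; ord.
- have [||||t tx ft] := @ctsI_IVT R f m x v fc; try ord.
  by apply: (nv t) => //; ord.
- have [||||t tx ft] := @ctsI_IVT R f x m v fc; try ord.
  by apply: (nv t) => //; ord.
- have [||||t tx ft] := @ctsI_IVT R f m x v fc; try ord.
  by apply: (nv t) => //; ord.
Qed.

Section one_map.
Variables (f : R -> R) (C : seq R).
Hypothesis P : pmt f C.
Let fI := pm_self P.
Let fc := pm_cts P.

Lemma smono_iter_left n x : 0 < x <= 1 ->
  exists2 d : R, 0 < d & 0 <= x - d /\ smono (iter n f) (x - d) x.
Proof.
move=> xI; have [d d0 [d1 h]] := @smono_iter_right R _ _ (mir_pmt P) n (1 - x) lr.
exists d => //; split; first ord.
have E y : iter n f y = 1 - iter n (mir f) (1 - y) by rewrite mir_iter !subKr.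
by case: h => h; [left|right] => a b ax xb bx; rewrite !E;
  have := h (1 - b) (1 - a); ord.
Qed.

(** Otherwise [f x - x] has a constant sign on (0,1), and [0,1/2] or [1/2,1] is invariant. *)
Lemma fixed_point : exists2 p : R, 0 < p < 1 & f p = p.
Proof.
apply: contrapT => no.
pose g x := f x - x.
have gc : ctsI g.
  move=> x xI e e0; have [d d0 hd] := fc xI (e := e / 2) lr.
  exists (Num.min d (e / 2)); first by rewrite lt_min; ord.
  move=> y yI; rewrite lt_min => /andP[yd ye].
  by have := hd y yI yd; move: ye; rewrite /g !ltr_norml; ord.
have [||||h|h] := @sign_const g 0 1 0 gc; try ord.
- by move=> x x01 gx; apply: no; exists x => //; rewrite /g in gx; ord.
- have [||||] := @inv_itv R f C P 0 (1 / 2); try ord.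
  move=> x xI; have fx := fI (x := x) lr.
  have [x0|x0] : x = 0 \/ 0 < x by ord.
    have [f0|] := ltP (1 / 2) (f x); last ord.
    have [d d0 hd] := ctsI_gt fc (x := x) lr f0.
    pose y := Num.min (d / 2) (1 / 4).
    have yd : y <= d / 2 by rewrite ge_min lexx.
    have y4 : y <= 1 / 4 by rewrite ge_min lexx orbT.
    have y0 : 0 < y by rewrite lt_min; ord.
    have := hd y lr; rewrite ltr_norml; have := h y; rewrite /g; ord.
  by have := h x; rewrite /g; ord.
- have [||||] := @inv_itv R f C P (1 / 2) 1; try ord.
  move=> x xI; have fx := fI (x := x) lr.
  have [x0|x0] : x = 1 \/ x < 1 by ord.
    have [f0|] := ltP (f x) (1 / 2); last ord.
    have [d d0 hd] := ctsI_lt fc (x := x) lr f0.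
    pose y := Num.min (d / 2) (1 / 4).
    have yd : y <= d / 2 by rewrite ge_min lexx.
    have y4 : y <= 1 / 4 by rewrite ge_min lexx orbT.
    have y0 : 0 < y by rewrite lt_min; ord.
    have := hd (1 - y) lr; rewrite ltr_norml; have := h (1 - y); rewrite /g; ord.
  by have := h x; rewrite /g; ord.
Qed.

(** If no point of [z,p] were mapped below [z], this interval would be invariant. *)
Lemma hs1_intro z p : 0 <= z -> z < p -> p < 1 -> f z = p -> f p = p ->
  (forall x, z < x < p -> f x < p) -> hs1 f.
Proof.
move=> z0 zp p1 fz fp h.
have [[w [zw wp fw]]|no] := pselect (exists w, [/\ z < w, w < p & f w < z]).
  by exists z, w, p.
have [||||] := @inv_itv R f C P z p; try ord.
move=> x xI; have [->|[->|xz]] : x = z \/ (x = p \/ z < x < p) by ord.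
- ord.
- ord.
have := h x xz; have [fx|] := ltP (f x) z; last ord.
by case: no; exists x; split; ord.
Qed.
End one_map.

Lemma hs1_mir f C z p : pmt f C -> z <= 1 -> p < z -> 0 < p -> f z = p -> f p = p ->
  (forall x, p < x < z -> p < f x) -> hs1 (mir f).
Proof.
move=> P z1 pz p0 fz fp h.
apply: (@hs1_intro _ _ (mir_pmt P) (1 - z) (1 - p)); rewrite /mir ?subKr; try ord.
by move=> x xz; have := h (1 - x); ord.
Qed.

Section one_map2.
Variables (f : R -> R) (C : seq R).
Hypothesis P : pmt f C.
Let fI := pm_self P.
Let fc := pm_cts P.
Let f2c : ctsI (fun x => f (f x)) := ctsI_comp fI fc fc.

(** Points just right of [p] stay right of [p]. As [p,1] is not invariant, [p] has a further
    preimage on the right; the first of these, found as a last preimage of the reflected map, bounds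
    the horseshoe. *)
Lemma hs_fixmin p e : 0 < p < 1 -> f p = p -> 0 < e -> p + e <= 1 ->
  (forall u, p < u <= p + e -> p < f u) -> hs1 (mir f).
Proof.
move=> pI fp e0 e1 near.
have [[x xI fx]|no] := pselect (exists2 x : R, p < x <= 1 & f x <= p); last first.
  have [||||] := @inv_itv R f C P p 1; try ord.
  move=> x xI; have := fI (x := x) lr; have [->|px] : x = p \/ p < x by ord.
    ord.
  by have [k|] := leP (f x) p; [case: no; exists x => //; ord|ord].
have xs : p + e < x.
  by have [k|//] := leP x (p + e); have := near x lr; ord.
have near_e := near (p + e) lr.
have [||||Z0 Z0I fZ0] := @ctsI_IVT R f (p + e) x p fc; try ord.
have P' := mir_pmt P.
have [|t tp1 tp2|t tI [ft nt]] := @last_preim R (mir f) (1 - p) (1 - Z0) (1 - p) e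
  (pm_cts P') lr lr lr _ e0.
- by rewrite /mir subKr fZ0.
- by rewrite /mir; have := near (1 - t); ord.
apply: (@hs1_mir f C (1 - t) p P); try ord.
- by move: ft; rewrite /mir; ord.
move=> y yI; have nfp : f y <> p.
  by move=> e'; apply: (nt (1 - y)); rewrite /mir ?subKr; ord.
have [yp'|] := leP (f y) p; last ord.
have [ys|sy] := leP y (p + e); first by have := near y lr; ord.
have [||||s sI fs] := @ctsI_IVT R f (p + e) y p fc; try ord.
by exfalso; apply: (nt (1 - s)); rewrite /mir ?subKr; ord.
Qed.

(** Without overshoot [z',p] is invariant under the second iterate, so its union with its image
    [p,f M] is an invariant interval and equals [0,1]. Hence [z' = z = 0]; the point mapped to 0
    lies right of [p], and its preimage in [0,p] is the [w] of [hs3]. *)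
Lemma hs3_intro z z' p : 0 <= z -> z <= z' -> z' < p -> p < 1 ->
  f p = p -> f z = p -> f (f z') = p ->
  (forall x, z < x < p -> p < f x) -> (forall x, z' < x < p -> f (f x) < p) ->
  ~ (exists w, [/\ z' < w, w < p & f (f w) < z']) -> hs3 f.
Proof.
move=> z0 zz' zp' p1 fp fz fz' h h2 no.
have n2 x : z' <= x <= p -> z' <= f (f x) <= p.
  move=> xI; have [->|[->|xz]] : x = z' \/ (x = p \/ z' < x < p) by ord.
  - ord.
  - rewrite !fp; ord.
  - have := h2 x xz; have [k|] := ltP (f (f x)) z'; last ord.
    by case: no; exists x; split; ord.
have n1 x : z' <= x <= p -> p <= f x.
  move=> xI; have [->|[->|xz]] : x = z \/ (x = p \/ z < x < p) by ord.
  - ord.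
  - ord.
  - have := h x xz; ord.
have [M Mz hM] := @ctsI_max R f z' p fc lr lr lr.
have onM x : p <= x <= f M -> exists2 s : R, z' <= s <= p & f s = x.
  move=> xM; have [||||s sM fs] := @ctsI_IVT R f M p x fc; try ord.
  by exists s => //; ord.
have pM : p <= f M by apply: n1.
have fM1 := fI (x := M) lr.
have [||||z0' M1] := @inv_itv R f C P z' (f M); try ord.
  move=> x xI; have [xp|px] := leP x p.
    have := hM x lr; have := n1 x lr; ord.
  have [s sI <-] := onM x lr; have := n2 s sI; ord.
have ze : z = 0 by move: z0'; ord.
have right x : p < x <= 1 -> f x < p.
  move=> xI; have [s sI fs] := onM x lr; rewrite -fs.
  have [e|[e|e]] : s = z \/ (s = p \/ z' < s < p) by ord.
  + by move: fs; rewrite e; ord.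
  + by move: fs; rewrite e; ord.
  + exact: h2.
have [u uI fu] := @pm_onto R f C P 0 lr.
have pu : p < u.
  by rewrite ltNge; apply/negP => up; move: (n1 u lr); clear -fu zp' zz' z0; ord.
have [s sI fs] := onM u lr.
have s0 : s <> 0 by move=> e; move: fs; rewrite e -ze; ord.
have sp : s <> p by move=> e; move: fs; rewrite e; ord.
exists s, p; split; try ord.
split; rewrite -?ze ?fs //; try ord.
Qed.

(** Between the last preimage of [p] and [p] itself [f] stays on one side of [p]. Below [p] this is
    a horseshoe; above [p] the same dichotomy is repeated for the second iterate. *)
Lemma hs_left p y : p < 1 -> f p = p -> 0 <= y -> y < p -> f y = p ->
  hs f \/ hs (mir f).
Proof.
move=> p1 fp y0 yp fy.
have [d d0 [d1 sm]] := @smono_left R f C P p lr.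
have [x xp px fx|z zy [fz nz]] := @last_preim R f p y p d fc y0 yp lr fy d0.
  by case: sm => h; have := h x p; ord.
have zI : 0 <= z < p by ord.
have [||||h|h] := @sign_const f z p p fc; try ord.
- by move=> x xz; apply: nz; ord.
- by left; apply: Or31; apply: (@hs1_intro f C P z p) => //; ord.
have [d2 d20 [d21 sm2]] := @smono_iter_left f C P 2 p lr.
have [|x xp px fx|z' zz' [fz' nz']] :=
    @last_preim R (fun x => f (f x)) p z p d2 f2c lr lr lr _ d20.
- by rewrite fz fp.
- by case: sm2 => h'; have := h' x p; rewrite /= fp fp; ord.
have [||||h2|h2] := @sign_const (fun x => f (f x)) z' p p f2c; try ord.
- by move=> x xz; apply: nz'; ord.
- left.
  have [[w [zw wp fw]]|no] := pselect (exists w, [/\ z' < w, w < p & f (f w) < z']).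
    by apply: Or32; exists z', w, p; rewrite fp fp; split; try ord; split.
  by apply: Or33; apply: (@hs3_intro z z' p) => //; ord.
(* Both iterates send (z',p) above [p]. The images of (s0,p) fill the interval right of [p] up to
   [f s0], so [f] is above [p] there. *)
right; apply: Or31.
pose s0 := (z' + p) / 2.
have s0I : z' < s0 < p by rewrite /s0; ord.
have fs0 := h s0 lr.
have fs0I := fI (x := s0) lr.
apply: (@hs_fixmin p (f s0 - p)); try ord.
move=> u uI; have [||||s sI fs] := @ctsI_IVT R f s0 p u fc; try ord.
have sp : s <> p by move=> e; move: fs; rewrite e; ord.
by rewrite -fs; apply: h2; ord.
Qed.
End one_map2.

Lemma unique_left f C p : pmt f C -> 0 < p < 1 -> f p = p ->
  (forall x, 0 <= x <= 1 -> f x = p -> x = p) -> forall x, 0 <= x < p -> p < f x.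
Proof.
move=> P pI fp uq x xI; rewrite ltNge; apply/negP => fx.
have fc := pm_cts P.
have fx' : f x < p.
  have [e|//] : f x = p \/ f x < p by ord.
  by have := uq x lr e; ord.
have [||||] := @inv_itv R f C P 0 p; try ord.
move=> y yI; have := pm_self P (x := y) lr.
have [yp|fy] := ltP p (f y); last ord.
have [xy|yx] := leP x y.
  have [||||t tI ft] := @ctsI_IVT R f x y p fc; try ord.
  have te := uq t lr ft; have ye : y = p by ord.
  by move: yp; rewrite ye fp; ord.
have [||||t tI ft] := @ctsI_IVT R f y x p fc; try ord.
have te := uq t lr ft; ord.
Qed.

(** If [p] were its only preimage, [f] would exchange the sides of [p] and its second iterate would
    preserve [0,p). Near [p] that iterate either has a point that it does not move towards [p], or
    moves all points towards [p]; in both cases an interval and its image form an invariant set that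
    is not dense. *)
Lemma no_unique f C p : pmt f C -> 0 < p < 1 -> f p = p ->
  ~ (forall x, 0 <= x <= 1 -> f x = p -> x = p).
Proof.
move=> P pI fp uq.
have L := unique_left P pI fp uq.
have Rt x : p < x <= 1 -> f x < p.
  move=> xI; have := @unique_left (mir f) _ (1 - p) (mir_pmt P) lr.
  rewrite {1}/mir subKr fp => /(_ erefl) H.
  have /H /(_ (1 - x) lr) : forall x, 0 <= x <= 1 -> mir f x = 1 - p -> x = 1 - p.
    by move=> y yI; rewrite /mir => fy; have := uq (1 - y); ord.
  by rewrite /mir subKr; ord.
have fI := pm_self P; have fc := pm_cts P.
have f2c : ctsI (fun x => f (f x)) := ctsI_comp fI fc fc.
have F x : 0 <= x < p -> 0 <= f (f x) < p.
  move=> xI; have := L x xI; have := fI x lr => ? ?.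
  by have := Rt (f x); have := fI (f x); ord.
have [d d0 [d1 sm]] := @smono_iter_left f C P 2 p lr.
have {}sm : inc (fun x => f (f x)) (p - d) p.
  case: sm => // sm; have := sm (p - d) p (lexx _) lr (lexx _).
  by rewrite /= fp fp; have := F (p - d) lr; ord.
have [M MI hM] := @ctsI_max R _ 0 (p - d) f2c lr lr lr.
have FM := F M lr.
(* All values of the second iterate on [0,p-d] are at most [b], so that beyond [b] only the
   increasing germ at [p] matters. *)
pose b := Num.max (f (f M)) (p - d).
have bM : f (f M) <= b by rewrite le_max lexx.
have bd : p - d <= b by rewrite le_max lexx orbT.
have bp : b < p by rewrite gt_max; ord.
have f2p : f (f p) = p by rewrite fp.
have [[x xI Fx]|no] := pselect (exists2 x : R, b < x < p & f (f x) <= x).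
  have Q s : 0 <= s <= x -> 0 <= f (f s) <= x.
    move=> sI; have := F s lr; have [sd|ds] := leP s (p - d).
      by have := hM s lr; ord.
    have [->|sx] : s = x \/ s < x by ord.
      by ord.
    by have := sm s x lr sx lr; ord.
  have [|||||y yI [yx|[s [sI ye]]]] := @inv_all R f C P
     (fun y => 0 <= y <= x \/ exists s, 0 <= s <= x /\ f s = y) _ _ x p; try ord.
  - by move=> y _ [yx|[s [sI <-]]]; [right; exists y|left; exact: Q].
  - by exists 0, x; split; try ord; move=> y yI; left; ord.
  - by have := L s lr; ord.
have {}no x : b < x < p -> x < f (f x).
  by move=> xI; rewrite ltNge; apply/negP => h; apply: no; exists x.
pose x := (b + p) / 2.
have xI : b < x < p by rewrite /x; ord.
have Q s : x <= s <= p -> x <= f (f s) <= p.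
  move=> sI; have [->|sp] : s = p \/ s < p by ord.
    ord.
  by have := no s lr; have := F s lr; ord.
have [|||||y yI [yx|[s [sI ye]]]] := @inv_all R f C P
   (fun y => x <= y <= p \/ exists s, x <= s <= p /\ f s = y) _ _ 0 x; try ord.
- by move=> y _ [yx|[s [sI <-]]]; [right; exists y|left; exact: Q].
- by exists x, p; split; try ord; move=> y yI; left; ord.
- have [e|sp] : s = p \/ s < p by ord.
    by move: ye; rewrite e fp; ord.
  by have := L s lr; ord.
Qed.

Theorem horseshoe f C : pmt f C -> hs f \/ hs (mir f).
Proof.
move=> P; have [p pI fp] := fixed_point P.
have [[y [yI fy yp]]|no] := pselect (exists y : R, [/\ 0 <= y <= 1, f y = p & y <> p]).
  have [l|l] : y < p \/ p < y by ord.
    by apply: (@hs_left f C P p y); ord.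
  have := @hs_left (mir f) _ (mir_pmt P) (1 - p) (1 - y).
  rewrite mirK /mir !subKr fp fy or_comm => h.
  by apply: h; ord.
case: (no_unique P pI fp) => x xI fx; apply: contrapT => xp.
by apply: no; exists x.
Qed.

End horseshoes.

(** * Gauges and constant slope models *)

Section models.
Variable R : realType.
Implicit Types (f g h phi : R -> R) (x y z w a b c d e p v s t lam : R) (C : seq R).

Definition conf f lam phi := forall x y, 0 <= x -> x < y -> y <= 1 ->
  smono f x y -> `|phi (f y) - phi (f x)| = lam * (phi y - phi x).

(** [phi] conjugates [f] to a map of constant slope [lam]. That map is not mentioned: all is
    expressed as lengths on the domain of [f], where different models can be compared. *)
Record model f lam phi : Prop := Model {
  md_lam : 0 <= lam;
  md_0 : phi 0 = 0;
  md_1 : phi 1 = 1;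
  md_inc : inc phi 0 1;
  md_cts : ctsI phi;
  md_conf : conf f lam phi }.

Lemma md_nd f lam phi x y : model f lam phi -> 0 <= x -> x <= y -> y <= 1 -> phi x <= phi y.
Proof. by move=> M x0; rewrite le_eqVlt => /orP[/eqP->//|xy] y1; apply/ltW/(md_inc M). Qed.

Lemma md_I f lam phi x : model f lam phi -> 0 <= x <= 1 -> 0 <= phi x <= 1.
Proof. by move=> M /andP[x0 x1]; rewrite -{1}(md_0 M) -(md_1 M) !(md_nd M). Qed.

(* [l x y] is the length of the gap between x and y: atoms at x and y are
   not counted, hence superadditivity only. *)
Record gauge f lam (l : R -> R -> R) : Prop := Gauge {
  ga_lam : 0 <= lam;
  ga_ge0 : forall x y, 0 <= x -> x < y -> y <= 1 -> 0 <= l x y;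
  ga_add : forall x y z, 0 <= x -> x < y -> y < z -> z <= 1 ->
    l x y + l y z <= l x z;
  ga_up : forall x y, 0 <= x -> x < y -> y <= 1 -> f x < f y ->
    l (f x) (f y) <= lam * l x y;
  ga_dn : forall x y, 0 <= x -> x < y -> y <= 1 -> f y < f x ->
    l (f y) (f x) <= lam * l x y }.

Definition gpos (l : R -> R -> R) :=
  forall x y, 0 <= x -> x < y -> y <= 1 -> 0 < l x y.

Lemma mir_gauge f lam l : gauge f lam l ->
  gauge (mir f) lam (fun x y => l (1 - y) (1 - x)).
Proof.
move=> G; split; first exact: ga_lam G.
- by move=> x y *; apply: (ga_ge0 G); ord.
- by move=> x y z *; rewrite addrC; apply: (ga_add G); ord.
- by move=> x y x0 xy y1; rewrite /mir => fxy; rewrite !subKr; apply: (ga_up G); ord.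
- by move=> x y x0 xy y1; rewrite /mir => fxy; rewrite !subKr; apply: (ga_dn G); ord.
Qed.

Lemma mir_gpos l : gpos l -> gpos (fun x y => l (1 - y) (1 - x)).
Proof. by move=> h x y x0 xy y1; apply: h; ord. Qed.

Section gauges.
Variables (f : R -> R) (C : seq R) (lam : R) (l : R -> R -> R).
Hypotheses (P : pmt f C) (G : gauge f lam l) (L : gpos l).

Lemma ga_mono x x' y' y : 0 <= x -> x <= x' -> x' < y' -> y' <= y -> y <= 1 ->
  l x' y' <= l x y.
Proof.
move=> x0 xx xy yy y1.
have h1 : l x' y' <= l x' y.
  have [->//|ly] : y' = y \/ y' < y by ord.
  have := @ga_add _ _ _ G x' y' y; have := @ga_ge0 _ _ _ G y' y; ord.
apply: le_trans h1 _.
have [->//|lx] : x = x' \/ x < x' by ord.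
have := @ga_add _ _ _ G x x' y; have := @ga_ge0 _ _ _ G x x'; ord.
Qed.

Lemma ga_up_sub x y a b : 0 <= x -> x < y -> y <= 1 -> f x <= a -> a < b ->
  b <= f y -> l a b <= lam * l x y.
Proof.
move=> x0 xy y1 fa ab fb; apply: le_trans (ga_up G x0 xy y1 lr).
have := pm_self P (x := x); have := pm_self P (x := y) => h1 h2.
by apply: ga_mono; ord.
Qed.

Lemma ga_dn_sub x y a b : 0 <= x -> x < y -> y <= 1 -> f y <= a -> a < b ->
  b <= f x -> l a b <= lam * l x y.
Proof.
move=> x0 xy y1 fa ab fb; apply: le_trans (ga_dn G x0 xy y1 lr).
have := pm_self P (x := x); have := pm_self P (x := y) => h1 h2.
by apply: ga_mono; ord.
Qed.

(** The two halves of [z,p] have together at most the length of [z,p], and each covers [f w,p],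
    which exceeds [z,p] by the positive length of [f w,z]. *)
Lemma hs1_gauge : hs1 f -> 2 < lam.
Proof.
move=> [z [w [p [z0 zw wp p1 [fz fp fw]]]]].
have fwI := pm_self P (x := w) lr.
have h1 := @ga_dn_sub z w (f w) p lr lr lr lr lr lr.
have h2 := @ga_up_sub w p (f w) p lr lr lr lr lr lr.
have h3 := @ga_add _ _ _ G z w p lr lr lr lr.
have h4 := @ga_add _ _ _ G (f w) z p lr lr lr lr.
have h5 := @L (f w) z lr lr lr.
have h6 := @L z p lr lr lr.
have h7 : lam * (l z w + l w p) <= lam * l z p by rewrite ler_wpM2l ?(ga_lam G).
rewrite mulrDr in h7.
have h8 : 2 * l z p < lam * l z p by ord.
by move: h8; rewrite ltr_pM2r.
Qed.

Lemma ga_iter2 x y a b : 0 <= x -> x < y -> y <= 1 -> a < b ->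
  (f (f x) <= a /\ b <= f (f y)) \/ (f (f y) <= a /\ b <= f (f x)) ->
  l a b <= lam ^+ 2 * l x y.
Proof.
move=> x0 xy y1 ab h.
have fx := pm_self P (x := x) lr; have fy := pm_self P (x := y) lr.
have l0 := ga_lam G.
rewrite expr2 -mulrA.
have [e|[u|u]] : f x = f y \/ (f x < f y \/ f y < f x) by ord.
- by rewrite e in h; ord.
- apply: le_trans (_ : lam * l (f x) (f y) <= _).
    by case: h => h; [apply: ga_up_sub|apply: ga_dn_sub]; ord.
  by rewrite ler_wpM2l //; apply: (ga_up G).
- apply: le_trans (_ : lam * l (f y) (f x) <= _).
    by case: h => h; [apply: ga_dn_sub|apply: ga_up_sub]; ord.
  by rewrite ler_wpM2l //; apply: (ga_dn G).
Qed.

Lemma hs2_gauge : hs2 f -> 2 < lam ^+ 2.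
Proof.
move=> [z [w [p [z0 zw wp p1 [fz fp fw]]]]].
have fwI := pm_self P (x := f w) (pm_self P (x := w) lr).
have h1 := @ga_iter2 z w (f (f w)) p lr lr lr lr lr.
have h2 := @ga_iter2 w p (f (f w)) p lr lr lr lr lr.
have h3 := @ga_add _ _ _ G z w p lr lr lr lr.
have h4 := @ga_add _ _ _ G (f (f w)) z p lr lr lr lr.
have h5 := @L (f (f w)) z lr lr lr.
have h6 := @L z p lr lr lr.
have h7 : lam ^+ 2 * (l z w + l w p) <= lam ^+ 2 * l z p.
  by rewrite ler_wpM2l ?exprn_ge0 ?(ga_lam G).
rewrite mulrDr in h7.
have h8 : 2 * l z p < lam ^+ 2 * l z p by ord.
by move: h8; rewrite ltr_pM2r.
Qed.

Lemma hs3_gauge : hs3 f -> 2 <= lam ^+ 2.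
Proof.
move=> [w [p [w0 wp p1 [f0 fp fw h k]]]].
have h1 := @ga_iter2 0 w 0 p lr lr lr lr ltac:(rewrite f0 fp fw; ord).
have h2 := @ga_iter2 w p 0 p lr lr lr lr ltac:(rewrite fp fw fp; ord).
have h3 := @ga_add _ _ _ G 0 w p lr lr lr lr.
have h6 := @L 0 p lr lr lr.
have h7 : lam ^+ 2 * (l 0 w + l w p) <= lam ^+ 2 * l 0 p.
  by rewrite ler_wpM2l ?exprn_ge0 ?(ga_lam G).
rewrite mulrDr in h7.
have h8 : 2 * l 0 p <= lam ^+ 2 * l 0 p by ord.
by move: h8; rewrite ler_pM2r.
Qed.

Lemma gauge_hs : hs f -> 2 <= lam ^+ 2.
Proof.
have l0 := ga_lam G.
case=> [/hs1_gauge h|/hs2_gauge/ltW//|/hs3_gauge//].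
by rewrite expr2; apply: (@le_trans _ _ (2 * 2)); [ord|apply: ler_pM; ord].
Qed.
End gauges.

Lemma gauge_sqrt2 f C lam l : pmt f C -> gauge f lam l -> gpos l -> 2 <= lam ^+ 2.
Proof.
move=> P G L; case: (horseshoe P) => h; first exact: gauge_hs P G L h.
exact: gauge_hs (mir_pmt P) (mir_gauge G) (mir_gpos L) h.
Qed.

Section conformal.
Variables (f : R -> R) (C : seq R) (lam : R) (phi : R -> R).
Hypotheses (P : pmt f C) (lam0 : 0 <= lam) (K : conf f lam phi).
Hypothesis nd : forall x y, 0 <= x -> x <= y -> y <= 1 -> phi x <= phi y.

Lemma conf_lip x y : 0 <= x <= 1 -> 0 <= y <= 1 ->
  `|phi (f y) - phi (f x)| <= lam * `|phi y - phi x|.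
Proof.
wlog xy : x y / x < y.
  move=> H xI yI; have [e|[l|l]] : x = y \/ (x < y \/ y < x) by ord.
  - by rewrite e !subrr normr0 mulr0.
  - exact: H.
  - by rewrite distrC [`|phi y - _|]distrC; apply: H.
move=> xI yI; rewrite [`|phi y - phi x|]ger0_norm ?subr_ge0 ?nd //; try ord.
have := @lap_ind R f C P (fun x y => `|phi (f y) - phi (f x)| <= lam * (phi y - phi x)).
apply; try ord.
- by move=> a b a0 ab b1 m; rewrite K.
- move=> a b c a0 ab bc c1 h1 h2; have := ler_distD (phi (f b)) (phi (f c)) (phi (f a)).
  by move: h1 h2; rewrite !mulrBr; ord.
Qed.

Lemma conf_lip_iter n x y : 0 <= x <= 1 -> 0 <= y <= 1 ->
  `|phi (iter n f y) - phi (iter n f x)| <= lam ^+ n * `|phi y - phi x|.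
Proof.
move=> xI yI; elim: n => [|n IH]; first by rewrite expr0 mul1r.
rewrite !iterS exprS -mulrA.
apply: le_trans (conf_lip _ _) _; try exact: (iterI P).
by rewrite ler_wpM2l.
Qed.

Hypotheses (phi0 : phi 0 = 0) (phi1 : phi 1 = 1) (phic : ctsI phi).

(** An interval on which [phi] is constant meets itself again under some iterate, so [phi] takes
    finitely many values along its orbit. The points with these values are dense, but by continuity
    [phi] takes small positive values on a whole interval. *)
Lemma conf_strict : inc phi 0 1.
Proof.
move=> a b a0 ab b1; have := nd a0 (ltW ab) b1; rewrite le_eqVlt => /orP[/eqP eab|//].
have ka x : a < x < b -> phi x = phi a.
  by move=> xab; have := @nd a x a0 lr lr; have := @nd x b lr lr b1; ord.
have [n n0 [x xab fxab]] := pm_tr P a0 ab b1 a0 ab b1.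
have lev y z m : 0 <= y <= 1 -> 0 <= z <= 1 -> phi y = phi z ->
    phi (iter m f y) = phi (iter m f z).
  move=> yI zI e; have := conf_lip_iter m zI yI.
  by rewrite e subrr normr0 mulr0 normr_le0 subr_eq0 => /eqP.
have fna : phi (iter n f a) = phi a.
  by rewrite (lev a x) ?ka //; ord.
pose vals := [seq phi (iter i f a) | i <- iota 0 n].
have vals_inv y : 0 <= y <= 1 -> phi y \in vals -> phi (f y) \in vals.
  move=> yI /mapP[i]; rewrite mem_iota add0n => /andP[_ iln] e.
  have -> : phi (f y) = phi (iter i.+1 f a).
    by apply: (lev y (iter i f a) 1%N) => //; apply: (iterI P); ord.
  have [->|] := eqVneq i.+1 n.
    by rewrite fna; apply/mapP; exists 0%N => //; rewrite mem_iota.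
  by move=> ne; apply: map_f; rewrite mem_iota add0n /= ltn_neqAle ne iln.
have dense := @inv_all R f C P (fun y => phi y \in vals) vals_inv.
(* [d] bounds the nonzero values from below; with [t <= d / 2] all values of [phi] near a point
   where it equals [t] lie strictly between 0 and [d]. *)
have [d d0 hd] := gap_seq vals 0.
pose t := Num.min d 1 / 2.
have t0 : 0 < t by rewrite /t divr_gt0 // lt_min d0 ltr01.
have td : t <= d / 2 by rewrite /t ler_pM2r ?ge_min ?lexx // invr_gt0.
have t1 : t <= 1 / 2 by rewrite /t ler_pM2r ?ge_min ?lexx ?orbT // invr_gt0.
have [||||x0 x0I fx0] := @ctsI_IVT R phi 0 1 t phic; [ord|ord|ord|rewrite phi0 phi1; ord|].
have [e e0 he] := phic x0I (e := t / 2) lr.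
have x0lt : x0 < 1.
  have [//|e1] : x0 < 1 \/ x0 = 1 by ord.
  by move: fx0; rewrite e1 phi1; ord.
pose u := Num.min (x0 + e) 1.
have ue : u <= x0 + e by rewrite ge_min lexx.
have u1 : u <= 1 by rewrite ge_min lexx orbT.
have x0u : x0 < u by rewrite lt_min; ord.
have [|y yu yv] := dense _ x0 u lr lr lr.
  exists a, b; split => // y yab; rewrite ka //; apply/mapP; exists 0%N => //.
  by rewrite mem_iota.
have := he y lr; rewrite !ltr_norml fx0 => hy.
have := hd _ yv; rewrite subr0 => hv.
have y0 : 0 < phi y by ord.
by move: hv; rewrite gt_eqF // gtr0_norm //; ord.
Qed.
End conformal.

Lemma expn_unbounded lam M : 1 < lam -> exists n, M < lam ^+ n.
Proof.
move=> l1; have B n : 1 + n%:R * (lam - 1) <= lam ^+ n.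
  elim: n => [|n IH]; first by rewrite mul0r addr0 expr0.
  rewrite exprSr -natr1; apply: (@le_trans _ _ ((1 + n%:R * (lam - 1)) * lam)).
    have : 0 <= n%:R * (lam - 1) * (lam - 1) by rewrite !mulr_ge0 ?ler0n //; ord.
    set k := n%:R; nra.
  by rewrite ler_wpM2r //; ord.
have h0 : 0 <= `|M| / (lam - 1) by rewrite divr_ge0 ?normr_ge0 //; ord.
exists (Num.bound (`|M| / (lam - 1))).
apply: lt_le_trans (B _); have := archi_boundP h0.
by rewrite ltr_pdivrMr; [have := ler_norm M; ord|ord].
Qed.

(** A one-sided neighbourhood of [x] lies in one lap, so the oscillation of [phi] at [x] is at most
    that at [f x] divided by [lam]; after [n] steps it is at most [1 / lam ^ n]. *)
Lemma conf_cts f C lam phi : pmt f C -> 1 < lam -> conf f lam phi ->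
  (forall x y, 0 <= x -> x <= y -> y <= 1 -> phi x <= phi y) ->
  phi 0 = 0 -> phi 1 = 1 -> ctsI phi.
Proof.
move=> P lam1 K nd phi0 phi1.
have bd x : 0 <= x <= 1 -> 0 <= phi x <= 1.
  by move=> xI; rewrite -{1}phi0 -phi1 !nd //; ord.
have Q n : forall x, 0 <= x <= 1 -> exists2 d : R, 0 < d &
    forall y, 0 <= y <= 1 -> `|y - x| < d -> `|phi y - phi x| * lam ^+ n <= 1.
  elim: n => [|n IH] x xI.
    exists 1 => // y yI _; rewrite expr0 mulr1 ler_norml.
    by have := bd x xI; have := bd y yI; ord.
  have [d2 d20 h2] := IH (f x) (pm_self P xI).
  have [d3 d30 h3] := pm_cts P xI d20.
  have step y : 0 <= y <= 1 -> `|y - x| < d3 ->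
      `|phi (f y) - phi (f x)| = lam * `|phi y - phi x| ->
      `|phi y - phi x| * lam ^+ n.+1 <= 1.
    move=> yI yx e; rewrite exprSr mulrC -mulrA -e mulrC.
    by apply: h2; [exact: (pm_self P)|exact: h3].
  have [d4 d40 h4] : exists2 d4 : R, 0 < d4 & forall y, x < y -> y <= 1 ->
      y < x + d4 -> `|phi (f y) - phi (f x)| = lam * `|phi y - phi x|.
    have [x1|x1] : x = 1 \/ x < 1 by ord.
      by exists 1 => // y; ord.
    have [d4 d40 [d41 sm]] := @smono_right R f C P x lr.
    exists d4 => // y xy y1 yd; rewrite K //; try ord.
      by rewrite ger0_norm // subr_ge0 nd //; ord.
    by apply: smono_sub sm _ _; ord.
  have [d5 d50 h5] : exists2 d5 : R, 0 < d5 & forall y, y < x -> 0 <= y ->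
      x - d5 < y -> `|phi (f y) - phi (f x)| = lam * `|phi y - phi x|.
    have [x1|x1] : x = 0 \/ 0 < x by ord.
      by exists 1 => // y; ord.
    have [d5 d50 [d51 sm]] := @smono_left R f C P x lr.
    exists d5 => // y xy y1 yd; rewrite distrC K //; try ord.
      by rewrite ler0_norm ?opprB // subr_le0 nd //; ord.
    by apply: smono_sub sm _ _; ord.
  exists (Num.min d3 (Num.min d4 d5)); first by rewrite !lt_min d30 d40.
  move=> y yI; rewrite !lt_min => /and3P[y3 y4 y5]; apply: step => //.
  have [e|[yx|yx]] : y = x \/ (x < y \/ y < x) by ord.
  - by rewrite e !subrr normr0 mulr0.
  - by apply: h4 => //; [ord|move: y4; rewrite ltr_norml; ord].
  - by apply: h5 => //; [ord|move: y5; rewrite ltr_norml; ord].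
move=> x xI e e0.
have [n hn] := expn_unbounded e^-1 lam1.
have [d d0 hd] := Q n x xI; exists d => // y yI yx.
have := hd y yI yx; have l0 : 0 < lam ^+ n by rewrite exprn_gt0 //; ord.
move=> h; rewrite -(ltr_pM2r l0); apply: le_lt_trans h _.
by rewrite -(ltr_pM2l (_ : 0 < e^-1)) ?invr_gt0 // mulr1 mulrA mulVf ?gt_eqF // mul1r.
Qed.

Lemma model_gauge f C lam phi : pmt f C -> model f lam phi ->
  gauge f lam (fun x y => phi y - phi x).
Proof.
move=> P M.
have nd x y : 0 <= x -> x <= y -> y <= 1 -> phi x <= phi y.
  move=> x0 xy y1; have [->//|l] : x = y \/ x < y by ord.
  by apply/ltW/(md_inc M); ord.
have Lip := conf_lip P (md_conf M) nd.
split; first exact: md_lam M.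
- by move=> x y *; rewrite subr_ge0 nd //; ord.
- by move=> x y z *; ord.
- move=> x y x0 xy y1 _; apply: le_trans (ler_norm _) _.
  apply: le_trans (Lip x y lr lr) _; rewrite ger0_norm // subr_ge0 nd //; ord.
- move=> x y x0 xy y1 _; apply: le_trans (ler_norm _) _; rewrite distrC.
  apply: le_trans (Lip x y lr lr) _; rewrite ger0_norm // subr_ge0 nd //; ord.
Qed.

Lemma model_sqrt2 f C lam phi : pmt f C -> model f lam phi -> 2 <= lam ^+ 2.
Proof.
move=> P M; apply: (gauge_sqrt2 P (model_gauge P M)).
by move=> x y x0 xy y1; rewrite subr_gt0; apply: (md_inc M).
Qed.

Lemma sqrt2_gt1 lam : 0 <= lam -> 2 <= lam ^+ 2 -> 1 < lam.
Proof.
move=> l0 l2; rewrite ltNge; apply/negP => l1.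
have : lam ^+ 2 <= 1 by rewrite exprn_ile1.
ord.
Qed.

End models.

(** * Existence of the model *)

Section ultralimits.
Variables (R : realType) (T : Type) (F : set_system T).
Hypothesis UF : UltraFilter F.
Implicit Types (u : T -> R).

(** Limits along one ultrafilter replace the successive extraction of subsequences: every bounded
    function has such a limit. *)
Definition ulim u : R := lim (u @ F).

Lemma ulim_cvg u (B : R) : (forall t, `|u t| <= B) -> u @ F --> ulim u.
Proof.
move=> uB; have PF := @ultra_proper _ _ UF.
have U : UltraFilter (u @ F).
  split; first exact: fmap_proper_filter.
  move=> G PG FG; rewrite eqEsubset; split => // B' GB.
  have [//|FB] := in_ultra_setVsetC (u @^-1` B') UF.
  exfalso; have /(filterI GB) : G (~` B') by exact: FG.
  by rewrite setICr; exact: filter_not_empty.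
have := @segment_compact R (- B) B; rewrite compact_ultra /= => /(_ _ U)[|p [_ up]].
  change (F (u @^-1` `[- B, B]%classic)); apply: filterE => t.
  by rewrite /= in_itv /= -ler_norml; exact: uB.
exact: cvgP up.
Qed.

Lemma ulimE u (l : R) : u @ F --> l -> ulim u = l.
Proof. by have PF := @ultra_proper _ _ UF; move=> ul; apply: cvg_lim. Qed.

End ultralimits.

Section finite_cardinals.
Variables (T U : choiceType).
Implicit Types (A B : set T).

Definition cN (T : choiceType) (A : set T) : nat := size (finmap.enum_fset (fset_set A)).

Lemma cN_le A B : finite_set B -> A `<=` B -> (cN A <= cN B)%N.
Proof.
move=> fB AB; apply: finmap.fsubset_leq_card.
by rewrite -fset_set_sub //; apply: sub_finite_set fB.
Qed.

Lemma cN_image (g : T -> U) A : finite_set A -> (cN (g @` A) <= cN A)%N.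
Proof.
move=> fA; rewrite /cN fset_set_image //.
exact: finmap.leq_imfset_card.
Qed.

Lemma cN_UI A B : finite_set A -> finite_set B ->
  (cN (A `|` B) + cN (A `&` B) = cN A + cN B)%N.
Proof.
by move=> fA fB; rewrite /cN fset_setU // fset_setI // finmap.cardfsUI.
Qed.

Lemma cN_1 (x : T) : cN [set x] = 1%N.
Proof. by rewrite /cN fset_set1 finmap.cardfs1. Qed.

Lemma cN_le1 A : (forall x y, A x -> A y -> x = y) -> (cN A <= 1)%N.
Proof.
move=> h; have [[x Ax]|no] := pselect (exists x, A x).
  by rewrite -(cN_1 x); apply: cN_le => // y Ay; apply: h.
have -> : A = set0 by apply/seteqP; split => // x Ax; apply: no; exists x.
by rewrite /cN fset_set0.
Qed.

Lemma cN_gt0 A x : finite_set A -> A x -> (0 < cN A)%N.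
Proof. by move=> fA Ax; rewrite -(cN_1 x); apply: cN_le => // y ->. Qed.

Lemma cN_X A (B : set U) : finite_set A -> finite_set B ->
  (cN (A `*` B) <= cN A * cN B)%N.
Proof.
move=> fA fB; rewrite /cN -(size_allpairs pair).
apply: uniq_leq_size; first exact: finmap.fset_uniq.
move=> [x y]; rewrite in_fset_set; last exact: finite_setX.
rewrite inE => -[/= Ax By]; apply/allpairsP; exists (x, y) => /=.
by rewrite !in_fset_set // !inE.
Qed.

End finite_cardinals.

(** * Counting itineraries *)

Section words.
Variable R : realType.
Implicit Types (x y z a b c d e p v s t lam : R) (J : set R).
Variables (f : R -> R) (C : seq R).
Hypothesis P : pmt f C.

(* The cell of x in the partition by turning points. *)
Definition cell x : nat := count (fun c => c <= x) C.

Fixpoint word n x : seq nat := if n is n'.+1 then cell x :: word n' (f x) else [::].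

Lemma cell_le x y : x <= y -> (cell x <= cell y)%N.
Proof. by move=> xy; apply: sub_count => c /= cx; apply: le_trans xy. Qed.

Lemma cell_eqP x y : x <= y -> cell x = cell y <-> (forall c, c \in C -> ~~ (x < c <= y)).
Proof.
move=> xy; rewrite /cell; elim: C => [|c D IH]; first by split.
have le : (count (fun c => (c <= x)%R) D <= count (fun c => (c <= y)%R) D)%N.
  by apply: sub_count => e /= cx; apply: le_trans xy.
have key : (c <= x) = (c <= y) <-> ~~ (x < c <= y).
  have [cx|xc] := leP c x; have [cy|yc] := leP c y; split => //=.
  by move: (lt_le_trans yc cx); rewrite ltNge xy.
split=> /= [e|h].
  have [ec ed] : (c <= x) = (c <= y) /\
      count (fun c => c <= x) D = count (fun c => c <= y) D.
    move: e; have [cx|xc] := leP c x; have [cy|yc] := leP c y; rewrite /= ?add1n ?add0n.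
    - by move=> [].
    - by move: (lt_le_trans yc cx); rewrite ltNge xy.
    - by move=> e; move: le; rewrite e ltnn.
    - by [].
  by move=> d; rewrite inE => /orP[/eqP ->|dD]; [apply/key|apply: (IH.1 ed)].
have -> : (c <= x) = (c <= y) by apply/key/h/mem_head.
by congr addn; apply/IH => d dD; apply: h; rewrite inE dD orbT.
Qed.

Lemma cell_smono x y : 0 <= x -> x < y -> y <= 1 -> cell x = cell y -> smono f x y.
Proof.
move=> x0 xy y1 /(cell_eqP (ltW xy)) h; apply: (pm_mono P) => // c cC.
by have := h c cC; ord.
Qed.

(** On a cell [f] is monotone and preserves betweenness. Points with equal itineraries thus form
    intervals, and two adjacent intervals share at most one word, which makes the counts additive up
    to 1. *)
Lemma word_convex n x y z : 0 <= x -> x <= y -> y <= z -> z <= 1 ->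
  word n x = word n z -> word n y = word n x.
Proof.
elim: n x y z => // n IH x y z x0 xy yz z1 /= [cxz wxz].
have cy : cell y = cell x.
  by apply/eqP; rewrite eqn_leq {1}cxz !cell_le.
congr cons => //.
have [e|xz] : x = z \/ x < z by ord.
  by congr word; congr f; ord.
have sm := cell_smono x0 xz z1 cxz.
have xI := pm_self P (x := x) lr; have zI := pm_self P (x := z) lr.
have [->//|xy'] : x = y \/ x < y by ord.
have [->//|yz'] : y = z \/ y < z by ord.
case: sm => sm.
  by apply: (IH _ _ (f z)) => //; try ord; apply/ltW/sm; ord.
rewrite wxz; apply: (IH _ _ (f x)) => //; try ord; apply/ltW/sm; ord.
Qed.

Lemma word_fin n J : finite_set (word n @` J).
Proof.
suff H : finite_set (word n @` setT) by apply: sub_finite_set H => _ [x Jx <-]; exists x.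
elim: n => [|n IH].
  by apply: sub_finite_set (finite_set1 [::]) => _ [x _ <-].
apply: (@sub_finite_set _ _ ((fun p : nat * seq nat => p.1 :: p.2) @` (`I_(size C).+1 `*` (word n @` setT)))).
  move=> _ [x _ <-] /=; exists (cell x, word n (f x)) => //; split; last by exists (f x).
  by rewrite /= ltnS count_size.
by apply: finite_image; apply: finite_setX => //; exact: finite_II.
Qed.

(** It plays the part of the number of laps of the [n]-th iterate on [J]. *)
Definition N n J := cN (word n @` J).

Lemma N_le n J J' : J `<=` J' -> (N n J <= N n J')%N.
Proof. by move=> h; apply: cN_le; [exact: word_fin|exact: image_subset]. Qed.

Lemma N_U n J J' : (N n (J `|` J') <= N n J + N n J')%N.
Proof.
rewrite /N image_setU -(cN_UI (word_fin _ _) (word_fin _ _)); exact: leq_addr.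
Qed.

Lemma N_gt0 n J x : J x -> (0 < N n J)%N.
Proof. by move=> Jx; apply: (@cN_gt0 _ _ (word n x)); [exact: word_fin|exists x]. Qed.

Lemma N_1 n x : N n [set x] = 1%N.
Proof. by rewrite /N image_set1 cN_1. Qed.

Lemma N_overlap n J J' : J `<=` `[0, 1] -> J' `<=` `[0, 1] ->
  (forall x y, J x -> J' y -> x <= y) -> (N n J + N n J' <= N n (J `|` J') + 1)%N.
Proof.
move=> JI J'I h; rewrite /N image_setU -(cN_UI (word_fin _ _) (word_fin _ _)).
rewrite leq_add2l; apply: cN_le1 => w1 w2 [[x1 Jx1 <-] [y1 Jy1 e1]] [[x2 Jx2 <-] [y2 Jy2 e2]].
have := JI _ Jx1; have := JI _ Jx2; have := J'I _ Jy1; have := J'I _ Jy2.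
rewrite /= !in_itv /= => ? ? ? ?.
have h1 := h _ _ Jx1 Jy1; have h2 := h _ _ Jx1 Jy2.
have h3 := h _ _ Jx2 Jy1; have h4 := h _ _ Jx2 Jy2.
have [l|l] := leP x1 x2.
  by apply/esym/(@word_convex n x1 x2 y1) => //; ord.
by apply: (@word_convex n x2 x1 y2) => //; ord.
Qed.

Lemma N_tail n J : (N n (f @` J) <= N n.+1 J)%N.
Proof.
apply: leq_trans (cN_image behead (word_fin n.+1 J)); apply: cN_le.
  by apply: finite_image; exact: word_fin.
by move=> _ [_ [x Jx <-] <-]; exists (word n.+1 x) => //; exists x.
Qed.

Lemma N_cell n J : (forall x y, J x -> J y -> cell x = cell y) ->
  (N n.+1 J <= N n (f @` J))%N.
Proof.
move=> h; have [[x Jx]|no] := pselect (exists x, J x); last first.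
  have -> : J = set0 by apply/seteqP; split => // x Jx; apply: no; exists x.
  by rewrite /N image_set0 /cN fset_set0.
apply: leq_trans (cN_image (cons (cell x)) (word_fin n (f @` J))); apply: cN_le.
  by apply: finite_image; exact: word_fin.
move=> _ [y Jy <-]; exists (word n (f y)); first by exists (f y) => //; exists y.
by rewrite /= (h _ _ Jx Jy).
Qed.

Lemma word_cat n k x : word (n + k) x = word n x ++ word k (iter n f x).
Proof. by elim: n x => // n IH x; rewrite addSn /= IH -iterS iterSr. Qed.

Definition NI n := N n `[0, 1].

Lemma NI_submul n k : (NI (n + k) <= NI n * NI k)%N.
Proof.
rewrite /NI /N; apply: leq_trans (cN_X _ _); try exact: word_fin.
have fX : finite_set ((word n @` `[0, 1]) `*` (word k @` `[0, 1])).
  by apply: finite_setX; exact: word_fin.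
apply: leq_trans (cN_image (fun p : seq nat * seq nat => p.1 ++ p.2) fX).
apply: cN_le; first exact: finite_image.
move=> _ [x xI <-]; exists (word n x, word k (iter n f x)); last by rewrite word_cat.
split; [by exists x|exists (iter n f x) => //].
move: xI; rewrite /= !in_itv /=; exact: (iterI P).
Qed.

Lemma N_iter_tail k n J : (N n (iter k f @` J) <= N (k + n) J)%N.
Proof.
elim: k J => [|k IH] J; first by rewrite image_id.
have -> : iter k.+1 f @` J = iter k f @` (f @` J).
  apply/seteqP; split=> [_ [x Jx <-]|_ [_ [x Jx <-] <-]].
    by exists (f x); [exists x|rewrite -iterSr].
  by exists x => //; rewrite -iterSr.
by apply: leq_trans (IH _) _; rewrite addSn; apply: N_tail.
Qed.

Lemma word_smono n x y : 0 <= x -> x < y -> y <= 1 -> word n x = word n y ->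
  smono (iter n f) x y.
Proof.
elim: n x y => [|n IH] x y x0 xy y1; first by move=> _; left => a b.
move=> [cxy wxy]; have sm := cell_smono x0 xy y1 cxy.
have xI := pm_self P (x := x) lr; have yI := pm_self P (x := y) lr.
have E a b : smono (fun x => iter n f (f x)) a b -> smono (iter n.+1 f) a b.
  by case=> h; [left|right] => c d *; rewrite !iterSr; apply: h.
apply: E; case: sm => sm; have fxy := sm x y (lexx _) xy (lexx _).
  apply: (smono_comp (g := f) (lo := f x) (hi := f y)); first by left.
    move=> z xzy; have [->|xz] : x = z \/ x < z by ord.
      have [->|zy] : z = y \/ z < y by ord.
        ord.
      by have := sm z y; ord.
    have [->|zy] : z = y \/ z < y by ord.
      ord.
    by have := sm x z; have := sm z y; ord.
  by apply: IH => //; ord.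
apply: (smono_comp (g := f) (lo := f y) (hi := f x)); first by right.
  move=> z xzy; have [->|xz] : x = z \/ x < z by ord.
    have [->|zy] : z = y \/ z < y by ord.
      ord.
    by have := sm z y; ord.
  have [->|zy] : z = y \/ z < y by ord.
    ord.
  by have := sm x z; have := sm z y; ord.
by apply: IH => //; ord.
Qed.

Definition shoe := exists k a w b, [/\ (0 < k <= 2)%N, 0 <= a, a < w, w < b & b <= 1] /\
  ([/\ iter k f w <= a, b <= iter k f a & b <= iter k f b] \/
   [/\ b <= iter k f w, iter k f a <= a & iter k f b <= a]).

Lemma hs_shoe : shoe.
Proof.
have S1 z w p (k : nat) g : (0 < k <= 2)%N -> (forall x, iter k f x = g x) ->
   0 <= z -> z < w -> w < p -> p < 1 -> g z = p -> g p = p -> g w <= z -> shoe.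
  move=> k2 e z0 zw wp p1 gz gp gw; exists k, z, w, p; split; first by split => //; ord.
  by left; rewrite !e; split; ord.
have S2 z w p (k : nat) g : (0 < k <= 2)%N -> (forall x, 1 - iter k f (1 - x) = g x) ->
   0 <= z -> z < w -> w < p -> p < 1 -> g z = p -> g p = p -> g w <= z -> shoe.
  move=> k2 e z0 zw wp p1 gz gp gw; exists k, (1 - p), (1 - w), (1 - z).
  split; first by split => //; ord.
  by right; have := e w; have := e z; have := e p; split; ord.
case: (horseshoe P) => [] [].
- by move=> [z [w [p [? ? ? ? [? ? ?]]]]]; apply: (S1 z w p 1%N f) => //; ord.
- by move=> [z [w [p [? ? ? ? [? ? ?]]]]]; apply: (S1 z w p 2%N (fun x => f (f x))) => //; ord.
- move=> [w [p [? ? ? [e1 e2 e3 _ _]]]].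
  by apply: (S1 0 w p 2%N (fun x => f (f x))) => //; rewrite ?e1 ?e2 ?e3 //; ord.
- by move=> [z [w [p [? ? ? ? [? ? ?]]]]]; apply: (S2 z w p 1%N (mir f)) => //; ord.
- move=> [z [w [p [? ? ? ? [? ? ?]]]]].
  by apply: (S2 z w p 2%N (fun x => mir f (mir f x))) => //; [move=> x; rewrite -(mir_iter f 2)|ord].
- move=> [w [p [? ? ? [e1 e2 e3 _ _]]]].
  apply: (S2 0 w p 2%N (fun x => mir f (mir f x))) => //; rewrite ?e1 ?e2 ?e3 //; try ord.
  by move=> x; rewrite -(mir_iter f 2).
Qed.

Lemma iter_cover k a b c d : 0 <= a -> a < b -> b <= 1 ->
  (iter k f a <= c /\ d <= iter k f b) \/ (iter k f b <= c /\ d <= iter k f a) ->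
  `[c, d] `<=` iter k f @` `[a, b].
Proof.
move=> a0 ab b1 h y; rewrite /= in_itv /= => yI.
have kc := ctsI_iter k (pm_self P) (pm_cts P).
have [||||x xab fx] := @ctsI_IVT R (iter k f) a b y kc; try ord.
by exists x => //; rewrite /= in_itv.
Qed.

(** Each half of the horseshoe covers the whole after [k] steps and the halves share at most one
    word, so the count at least doubles, up to 1; the strict inequality absorbs this 1. *)
Lemma N_growth : exists2 k, (0 < k <= 2)%N & forall j, (2 ^ j < NI (k * j.+1))%N.
Proof.
have [k [a [w [b [[k2 a0 aw wb b1] h]]]]] := hs_shoe; exists k => //.
suff H j : (2 ^ j < N (k * j.+1) `[a, b])%N.
  move=> j; apply: leq_trans (H j) _; apply: N_le => x /=.
  by rewrite !in_itv /=; ord.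
have {}h : (iter k f w <= a /\ b <= iter k f a /\ b <= iter k f b) \/
   (b <= iter k f w /\ iter k f a <= a /\ iter k f b <= a) by case: h => -[]; ord.
have aI : 0 <= a <= 1 by ord.
have U : `[a, b]%classic = `[a, w] `|` `[w, b].
  by apply/seteqP; split => x /=; rewrite !in_itv /=; [have [] := leP x w; [left|right]; ord|ord].
elim: j => [|j IH].
  (* With a single word the [k]-th iterate would be monotone on [a,b], against its values at [a],
     [w] and [b]. *)
  rewrite muln1 expn0 ltnNge; apply/negP => N1.
  have e x y : a <= x <= b -> a <= y <= b -> word k x = word k y.
    move=> xI yI; have [//|ne] := eqVneq (word k x) (word k y).
    have : (1 < N k `[a, b])%N; last by rewrite ltnNge N1.
    have -> : 2%N = cN [set word k x; word k y].
      rewrite /cN fset_setU1 //= fset_set1 finmap.cardfs2 ne //.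
    apply: cN_le; first exact: word_fin.
    by move=> _ [->|->]; [exists x|exists y] => //=; rewrite in_itv.
  have [sm|sm] := word_smono a0 (lt_trans aw wb) b1 (e a b lr lr).
    have := sm a w (lexx _) aw (ltW wb); have := sm w b (ltW aw) wb (lexx _); ord.
  have := sm a w (lexx _) aw (ltW wb); have := sm w b (ltW aw) wb (lexx _); ord.
have h1 : (N (k * j.+1) `[a, b] <= N (k * j.+2) `[a, w])%N.
  rewrite (mulnS k j.+1); apply: leq_trans (N_iter_tail _ _ _); apply: N_le.
  by apply: iter_cover; ord.
have h2 : (N (k * j.+1) `[a, b] <= N (k * j.+2) `[w, b])%N.
  rewrite (mulnS k j.+1); apply: leq_trans (N_iter_tail _ _ _); apply: N_le.
  by apply: iter_cover; ord.
have h3 : (N (k * j.+2) `[a, w] + N (k * j.+2) `[w, b] <= N (k * j.+2) `[a, b] + 1)%N.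
  rewrite U; apply: N_overlap => x; rewrite /= !in_itv /=; try ord.
  by move=> y; rewrite !in_itv /=; ord.
rewrite expnS; clear -IH h1 h2 h3; lia.
Qed.

Let q n : R := (NI n)%:R.

Lemma q_ge1 n : 1 <= q n.
Proof. by rewrite ler1n; apply: (@N_gt0 _ _ 0); rewrite /= in_itv /= lexx ler01. Qed.

Lemma q_submul n k : q (n + k) <= q n * q k.
Proof. by rewrite -natrM ler_nat; exact: NI_submul. Qed.

Lemma q_submul_exp n j t : 0 <= t -> t ^+ n * q n < 1 -> (0 < j)%N ->
  t ^+ (n * j) * q (n * j) < 1.
Proof.
move=> t0 h; elim: j => // -[_ _|j IH _]; first by rewrite muln1.
rewrite mulnS exprD; apply: le_lt_trans (_ : (t ^+ n * q n) * (t ^+ (n * j.+1) * q (n * j.+1)) < 1).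
  rewrite mulrACA ler_wpM2l ?mulr_ge0 ?exprn_ge0 //; exact: q_submul.
have h0 m : 0 <= t ^+ m * q m by rewrite mulr_ge0 ?exprn_ge0 // ler0n.
have := IH isT; have := h0 n; have := h0 (n * j.+1)%N; nra.
Qed.

(** The count doubles at least every two steps, and [2 * (3 / 4) ^ 2 = 9 / 8 > 1]. One value below 1
    would stay below 1 along all multiples of [n] by submultiplicativity, against this growth. *)
Lemma q_34 n : (0 < n)%N -> 1 <= (3 / 4) ^+ n * q n.
Proof.
move=> n0; rewrite leNgt; apply/negP => h.
have [k k2 hk] := N_growth.
have [j hj] := @expn_unbounded R (9 / 8) 2 lr.
have t0 : (0 : R) <= 3 / 4 by ord.
have := @q_submul_exp n (k * j.+1) _ t0 h; rewrite muln_gt0 => /(_ _)/wrap[|].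
  by case/andP: k2 => ->.
have -> : (n * (k * j.+1) = k * (n * j.+1))%N by rewrite mulnCA.
case: n n0 h => // n _ h.
have -> : (n.+1 * j.+1 = (n.+1 * j + n).+1)%N by lia.
set i := (n.+1 * j + n)%N; rewrite ltNge => /negP; apply.
have q2 : 2 ^+ i <= q (k * i.+1).
  by rewrite -natrX ler_nat ltnW.
apply: le_trans (_ : (3 / 4) ^+ (k * i.+1) * 2 ^+ i <= _); last first.
  by rewrite ler_wpM2l // exprn_ge0.
have le2 : (3 / 4 : R) ^+ (2 * i.+1) <= (3 / 4) ^+ (k * i.+1).
  apply: ler_wiXn2l; [ord|ord|].
  by rewrite leq_mul2r; case/andP: k2 => _ ->; rewrite orbT.
apply: le_trans (_ : (3 / 4) ^+ (2 * i.+1) * 2 ^+ i <= _); last first.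
  by rewrite ler_wpM2r // exprn_ge0.
have -> : (3 / 4 : R) ^+ (2 * i.+1) * 2 ^+ i = (9 / 8) ^+ i.+1 / 2.
  rewrite exprM (_ : (3 / 4 : R) ^+ 2 = 9 / 8 * 2^-1); last by field.
  by rewrite exprMn exprVn (exprS 2); field; rewrite expf_neq0.
rewrite ler_pdivlMr // mul1r ltW // (lt_le_trans hj) //.
apply: ler_weXn2l; [ord|]; rewrite /i; nia.
Qed.

Lemma bernoulli_le d n : 0 <= d <= 1 -> 1 - n%:R * d <= (1 - d) ^+ n.
Proof.
move=> dI; elim: n => [|n IH]; first by rewrite mul0r subr0 expr0.
rewrite exprSr -natr1; apply: (@le_trans _ _ ((1 - n%:R * d) * (1 - d))).
  have : 0 <= n%:R * d * d by rewrite !mulr_ge0 ?ler0n //; ord.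
  set k := n%:R; nra.
by rewrite ler_wpM2r //; ord.
Qed.

Definition small t := 0 <= t /\ exists2 n, (0 < n)%N & t ^+ n * q n < 1.
(** The inverse growth rate of [q], that is the radius of convergence of the series of
    [q n * t ^ n]. Its inverse will be the slope, and the bound 3/4 makes that slope greater than
    1. *)
Definition tst : R := sup [set t | small t].

Lemma small_lt t : small t -> t <= 3 / 4.
Proof.
move=> [t0 [n n0 h]]; rewrite leNgt; apply/negP => tt.
have := q_34 n0; rewrite leNgt => /negP; apply; apply: le_lt_trans h.
rewrite ler_wpM2r ?ler0n //; apply: lerXn2r; rewrite ?nnegrE; ord.
Qed.

Lemma small_has_sup : has_sup [set t | small t].
Proof.
split; last by exists (3 / 4) => t /= /small_lt.
exists 0; split=> //; exists 1%N => //; rewrite expr1 mul0r; ord.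
Qed.

Lemma tst_lt1 : tst <= 3 / 4.
Proof. by apply: ge_sup; [case: small_has_sup|move=> t /= /small_lt]. Qed.

Lemma tst_gt0 : 0 < tst.
Proof.
have q1 := q_ge1 1; have h : 0 < (q 1 + 1)^-1 by rewrite invr_gt0; ord.
apply: lt_le_trans h _; apply: ub_le_sup; first by case: small_has_sup.
split; first by rewrite invr_ge0; ord.
by exists 1%N => //; rewrite expr1 mulrC ltr_pdivrMr; ord.
Qed.

(** A strict inequality would persist for slightly larger [t]. In consequence the series diverges at
    [tst]. *)
Lemma tst_ge1 n : (0 < n)%N -> 1 <= tst ^+ n * q n.
Proof.
move=> n0; rewrite leNgt; apply/negP => h; set u := tst ^+ n * q n in h.
have t0 := tst_gt0; have nR : (0 : R) < n%:R by rewrite ltr0n.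
have n1 : (1 : R) <= n%:R by rewrite ler1n.
have u0 : 0 <= u by rewrite mulr_ge0 ?exprn_ge0 ?ler0n // ltW.
pose d := (1 - u) / (2 * n%:R).
have dn : n%:R * d = (1 - u) / 2 by rewrite /d; field; rewrite gt_eqF.
have d0 : 0 < d by rewrite divr_gt0 //; ord.
have d1 : d <= 1 / 2 by rewrite ler_pdivrMr; nra.
have : small (tst / (1 - d)).
  split; first by rewrite divr_ge0 ?ltW //; ord.
  exists n => //; rewrite exprMn exprVn mulrAC -/u ltr_pdivrMr ?exprn_gt0 //; last ord.
  by have := @bernoulli_le d n lr; ord.
move=> sm; have : tst / (1 - d) <= tst by apply: ub_le_sup => //; case: small_has_sup.
by rewrite ler_pdivrMr; [nra|ord].
Qed.

(** A truncated weighted count of the laps in [J]. Its additivity and its scaling under [f] hold up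
    to bounded errors, which vanish after division by a total that tends to infinity. *)
Definition Lsum t M J : R := \sum_(n < M) t ^+ n * (N n J)%:R.

Lemma Lsum_choice (K : nat) : exists t M,
  [/\ tst / 2 <= t, tst - K.+1%:R^-1 <= t, t < tst,
      K%:R <= Lsum t M `[0, 1] & t ^+ M * q M <= 1].
Proof.
have t0 := tst_gt0; have t1 := tst_lt1.
(* The first [M0] terms are at least 1/2, because [(1 - d) ^ i >= 1 - i * d >= 1/2], and add up to
   at least [K + 1]. Truncation at a multiple of an [n] with [t ^ n * q n < 1] bounds the first
   omitted term by 1. *)
pose M0 := (2 * K.+1)%N.
have K0 : (1 : R) <= K.+1%:R by rewrite ler1n.
have KR : (K.+1%:R : R) = K%:R + 1 by rewrite -natr1.
have M0E : (M0%:R : R) = 2 * K.+1%:R by rewrite natrM.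
pose d := (2 * M0%:R)^-1 : R.
have dM : M0%:R * d = 1 / 2 by rewrite /d M0E; field; rewrite gt_eqF //; ord.
have d0 : 0 < d by rewrite invr_gt0 M0E; ord.
have dK : d <= K.+1%:R^-1 by rewrite lef_pV2 ?posrE ?M0E; ord.
have d1 : d <= 1 / 2 by rewrite M0E in dM; nra.
pose t := tst * (1 - d).
have tp : 0 < t by rewrite mulr_gt0 //; ord.
have tt : t < tst by rewrite /t; nra.
have [t' [_ [n n0 hn]] tt'] : exists2 t', small t' & t < t'.
  have [|t' st' tt'] := @sup_adherent _ [set t | small t] (tst - t) _ small_has_sup.
    by rewrite subr_gt0.
  by exists t' => //; move: tt'; rewrite -/tst; ord.
have hn' : t ^+ n * q n < 1.
  apply: le_lt_trans hn; rewrite ler_wpM2r ?ler0n //.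
  by apply: lerXn2r; rewrite ?nnegrE; ord.
exists t, (n * M0)%N; split => //.
- by rewrite /t; nra.
- have : tst * d <= d by rewrite ler_piMl; ord.
  by rewrite /t mulrBr mulr1; move: (K.+1%:R^-1) dK => Ki; clear; ord.
- have le : (M0 <= n * M0)%N by rewrite leq_pmull.
  apply: (@le_trans _ _ (\sum_(i < M0) (1 / 2 : R))).
    by rewrite sumr_const card_ord -[_ *+ M0]mulr_natr M0E KR; ord.
  apply: (@le_trans _ _ (Lsum t M0 `[0, 1])); last first.
    rewrite /Lsum (big_ord_widen _ (fun i => t ^+ i * (N i `[0, 1])%:R) le).
    rewrite big_mkcond /=; apply: ler_sum => i _; case: ifP => // _.
    by rewrite mulr_ge0 ?exprn_ge0 ?ler0n // ltW.
  apply: ler_sum => i _; rewrite -[N i _]/(NI i) -/(q i).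
  have [->|i0] := eqVneq (i : nat) 0%N.
    by rewrite expr0 mul1r; have := q_ge1 0; ord.
  rewrite /t exprMn mulrAC; have h1 := @tst_ge1 i ltac:(by rewrite lt0n).
  have h2 := @bernoulli_le d i lr.
  have h3 : i%:R * d <= 1 / 2.
    by rewrite -dM ler_wpM2r ?(ltW d0) // ler_nat ltnW.
  have h4 : 1 / 2 <= (1 - d) ^+ i by ord.
  apply: le_trans h4 _; rewrite ler_peMl //.
  by rewrite exprn_ge0 //; ord.
- by apply/ltW/q_submul_exp => //; rewrite ?ltW //.
Qed.

(** Each count is additive up to 1, and the weights sum to at most 4 because [t <= 3/4]. *)
Lemma Lsum_add t M x y : 0 <= t -> t <= 3 / 4 -> 0 <= x -> x <= y -> y <= 1 ->
  `|Lsum t M `[0, y] - Lsum t M `[0, x] - Lsum t M `[x, y]| <= 4.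
Proof.
move=> t0 t1 x0 xy y1.
have geo m : \sum_(n < m) t ^+ n <= 4.
  suff : (1 - t) * \sum_(n < m) t ^+ n <= 1.
    set s := \sum_(n < m) _; have : 0 <= s by apply: sumr_ge0 => i _; exact: exprn_ge0.
    by nra.
  rewrite -opprB mulNr -subrX1 opprB; have : 0 <= t ^+ m by exact: exprn_ge0.
  by ord.
rewrite /Lsum -!sumrB; apply: le_trans (geo M); apply: le_trans (ler_norm_sum _ _ _) _.
apply: ler_sum => n _; rewrite -!mulrBr normrM ger0_norm ?exprn_ge0 //.
rewrite -[leRHS]mulr1 ler_wpM2l ?exprn_ge0 //.
have U : `[0, y]%classic = `[0, x] `|` `[x, y].
  by apply/seteqP; split => z /=; rewrite !in_itv /=; [have [] := leP z x; [left|right]; ord|ord].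
have h1 : (N n `[0%R, y] <= N n `[0%R, x] + N n `[x, y])%N by rewrite U N_U.
have h2 : (N n `[0%R, x] + N n `[x, y] <= N n `[0%R, y] + 1)%N.
  rewrite U; apply: N_overlap => z; rewrite /= !in_itv /=; try ord.
  by move=> w; rewrite !in_itv /=; ord.
move: h1 h2; rewrite -!(ler_nat R) !natrD ler_norml; ord.
Qed.

(** The additional 1 is due to the right end point: if it is a turning point, it belongs to the next
    cell. *)
Lemma N_smono n x y : 0 <= x -> x < y -> y <= 1 -> smono f x y ->
  (N n.+1 `[x, y] <= N n (f @` `[x, y]) + 1)%N /\
  (N n (f @` `[x, y]) <= N n.+1 `[x, y])%N.
Proof.
move=> x0 xy y1 sm; split; last exact: N_tail.
have U : `[x, y]%classic = `[x, y[ `|` [set y].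
  apply/seteqP; split => z /=; rewrite !in_itv /=.
    by move=> zI; have [->|zy] := eqVneq z y; [right|left; move/eqP: zy; ord].
  by case=> [|->]; ord.
rewrite {1}U; apply: leq_trans (N_U _ _ _) _; rewrite N_1 leq_add2r.
apply: leq_trans (N_cell _ _) _; last first.
  by apply: N_le; apply: image_subset => z /=; rewrite !in_itv /=; ord.
have H a b : x <= a -> a <= b -> b < y -> cell a = cell b.
  move=> xa ab by'; apply/(cell_eqP ab) => c cC; apply/negP => cab.
  have [d d0 [c0 c1 fo]] := pm_fold P cC.
  pose e := Num.min d (Num.min (c - x) (y - c)) / 2.
  have m0 : 0 < Num.min d (Num.min (c - x) (y - c)) by rewrite !lt_min d0; ord.
  have e0 : 0 < e by rewrite divr_gt0.
  have me : Num.min d (Num.min (c - x) (y - c)) = e * 2 by rewrite /e; field.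
  have ed : e * 2 <= d by rewrite -me ge_min lexx.
  have ex : e * 2 <= c - x by rewrite -me !ge_min lexx orbT.
  have ey : e * 2 <= y - c by rewrite -me !ge_min lexx !orbT.
  have h1 := (lr : c - e < c); have h2 := (lr : c < c + e).
  have A : (f (c - e) < f c /\ f (c + e) < f c) \/ (f c < f (c - e) /\ f c < f (c + e)).
    by case: fo => -[i1 i2]; [left|right];
      (split; [apply: i1|apply: i2]); clear -h1 h2 ed; ord.
  have B : (f (c - e) < f c /\ f c < f (c + e)) \/ (f c < f (c - e) /\ f (c + e) < f c).
    by case: sm => s; [left|right]; split; apply: s; clear -h1 h2 ex ey cab xa ab by'; ord.
  by clear -A B; ord.
move=> a b /=; rewrite !in_itv /= => aI bI; have [ab|ba] := leP a b.
  by apply: H; ord.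
by apply/esym/H; ord.
Qed.

(** Deleting the first letter of the words shifts the series by one factor [t]. The error leaves
    room for the constant term, the term at the truncation and the defect of the counts. *)
Lemma Lsum_smono t M x y : 0 <= t -> t <= 3 / 4 -> 0 <= x -> x < y -> y <= 1 ->
  smono f x y -> t ^+ M * q M <= 1 ->
  `|t * Lsum t M (f @` `[x, y]) - Lsum t M `[x, y]| <= 6.
Proof.
move=> t0 t1 x0 xy y1 sm tM.
have geo m : 0 <= \sum_(n < m) t ^+ n <= 4.
  have s0 : 0 <= \sum_(n < m) t ^+ n by apply: sumr_ge0 => i _; exact: exprn_ge0.
  rewrite s0; suff : (1 - t) * \sum_(n < m) t ^+ n <= 1 by nra.
  rewrite -opprB mulNr -subrX1 opprB; have : 0 <= t ^+ m by exact: exprn_ge0.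
  by ord.
have NM : t ^+ M * (N M `[x, y])%:R <= 1.
  apply: le_trans tM; rewrite ler_wpM2l ?exprn_ge0 // ler_nat; apply: N_le => z /=.
  by rewrite !in_itv /=; ord.
have NM0 : 0 <= t ^+ M * (N M `[x, y])%:R by rewrite mulr_ge0 ?exprn_ge0 ?ler0n.
have N0 : (N 0 `[x, y])%:R = 1 :> R.
  have -> // : N 0 `[x, y] = 1%N.
  apply/eqP; rewrite eqn_leq (@N_gt0 0 _ x) ?andbT; last by rewrite /= in_itv /=; ord.
  by apply: cN_le1 => w1 w2 [a _ <-] [b _ <-].
have E : Lsum t M `[x, y] + t ^+ M * (N M `[x, y])%:R =
    1 + t * \sum_(n < M) t ^+ n * (N n.+1 `[x, y])%:R.
  rewrite /Lsum -(big_ord_recr M (fun n => t ^+ n * (N n `[x, y])%:R)) /=.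
  rewrite big_ord_recl expr0 mul1r N0 mulr_sumr; congr (_ + _).
  by apply: eq_bigr => i _; rewrite /= /bump /= add1n exprS mulrA.
have D : `|\sum_(n < M) t ^+ n * (N n.+1 `[x, y])%:R - Lsum t M (f @` `[x, y])| <= 4.
  rewrite /Lsum -sumrB; apply: le_trans (ler_norm_sum _ _ _) _.
  have /andP[_ g4] := geo M; apply: le_trans g4.
  apply: ler_sum => n _; rewrite -mulrBr normrM ger0_norm ?exprn_ge0 //.
  rewrite -[leRHS]mulr1 ler_wpM2l ?exprn_ge0 //.
  have [h1 h2] := N_smono n x0 xy y1 sm.
  by move: h1 h2; rewrite -!(ler_nat R) !natrD ler_norml; ord.
move: E D; set A := Lsum t M `[x, y]; set B := Lsum t M (f @` _).
set S := \sum_(n < M) _ => E; rewrite !ler_norml => /andP[D1 D2].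
have : t * B - A = t * (B - S) - 1 + t ^+ M * (N M `[x, y])%:R by ord.
by move=> ->; apply/andP; split; nra.
Qed.
Lemma smono_image (phi : R -> R) x y :
  (forall x y, 0 <= x -> x <= y -> y <= 1 -> phi x <= phi y) ->
  0 <= x -> x < y -> y <= 1 -> smono f x y ->
  exists a b, [/\ 0 <= a, a <= b & b <= 1] /\
    f @` `[x, y]%classic = `[a, b]%classic /\ `|phi (f y) - phi (f x)| = phi b - phi a.
Proof.
move=> nd x0 xy y1 sm.
have fx := pm_self P (x := x) lr; have fy := pm_self P (x := y) lr.
have E z : x <= z <= y -> z = x \/ (z = y \/ (x < z /\ z < y)) by ord.
case: sm => sm; have fxy := sm x y (lexx _) xy (lexx _).
  exists (f x), (f y); split; first by split; ord.
  split; last by rewrite ger0_norm // subr_ge0 nd //; ord.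
  apply/seteqP; split=> [_ [z /= zI <-]|]; last first.
    by apply: (@iter_cover 1) => //; left; rewrite /= !lexx.
  move: zI; rewrite !in_itv /= => /E[->|[->|[xz zy]]].
  - by rewrite lexx ltW.
  - by rewrite lexx ltW.
  - by rewrite !ltW // sm // ltW.
exists (f y), (f x); split; first by split; ord.
split; last by rewrite distrC ger0_norm // subr_ge0 nd //; ord.
apply/seteqP; split=> [_ [z /= zI <-]|]; last first.
  by apply: (@iter_cover 1) => //; right; rewrite /= !lexx.
move: zI; rewrite !in_itv /= => /E[->|[->|[xz zy]]].
- by rewrite lexx ltW.
- by rewrite lexx ltW.
- by rewrite !ltW // sm // ltW.
Qed.

(** The normalised counts converge along an ultrafilter that refines the filter at infinity; the
    denominators tend to infinity, so additivity and the scaling by [tst] on laps become exact. *)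
Theorem model_exists : exists lam phi, model f lam phi.
Proof.
have [T hT] := choice Lsum_choice.
have [M hM] := choice hT.
have PE : ProperFilter (\oo : set_system nat) by exact: eventually_filter.
have [F [UF FE]] := @ultraFilterLemma _ (\oo : set_system nat) PE.
have PF := @ultra_proper _ _ UF.
have ts0 := tst_gt0; have ts1 := tst_lt1.
have K0 k : (0 : R) < k.+1%:R by rewrite ltr0n.
pose D k := Lsum (T k) (M k) `[0, 1].
have Tt k : 0 < T k <= 3 / 4 by have [? _ ? _ _] := hM k; ord.
pose r J k := Lsum (T k) (M k) J / D k.
have L0 k J : 0 <= Lsum (T k) (M k) J.
  apply: sumr_ge0 => i _; rewrite mulr_ge0 ?exprn_ge0 ?ler0n //.
  by have := Tt k; ord.
have L_le k J J' : J `<=` J' -> Lsum (T k) (M k) J <= Lsum (T k) (M k) J'.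
  move=> JJ; apply: ler_sum => i _; rewrite ler_wpM2l ?exprn_ge0 //.
    by have := Tt k; ord.
  by rewrite ler_nat N_le.
have D0 k : 0 <= D k by apply: L0.
have Dk k : k%:R <= D k by have [_ _ _ ? _] := hM k.
have Dgt k : (0 < k)%N -> 0 < D k.
  by move=> k0; apply: lt_le_trans (Dk k); rewrite ltr0n.
have rb J : J `<=` `[0, 1] -> forall k, `|r J k| <= 1.
  move=> JI k; rewrite ger0_norm ?divr_ge0 //.
  have [k0|] := ltP 0 (D k); first by rewrite ler_pdivrMr // mul1r L_le.
  (* The lower bound on [D k] says nothing for [k = 0]; a vanishing denominator would give the
     quotient 0. *)
  by move=> h; have -> : r J k = 0 by rewrite /r (le_anti (_ : D k <= 0 <= D k)) ?invr0 ?mulr0 // h D0.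
have lim0 (u : nat -> R) B : (forall k, (0 < k)%N -> `|u k| <= B / D k) -> u @ F --> (0 : R).
  move=> hu; apply/cvgrPdist_lt => e e0; apply: FE.
  have B0 : 0 <= `|B| / e by rewrite divr_ge0 // ltW.
  exists (Num.bound (`|B| / e)).+1 => // k /= hk; rewrite sub0r normrN.
  have k0 : (0 < k)%N by apply: leq_trans hk.
  apply: le_lt_trans (hu k k0) _; rewrite ltr_pdivrMr ?Dgt //.
  apply: le_lt_trans (ler_norm B) _; rewrite mulrC -ltr_pdivrMr //.
  apply: lt_le_trans (archi_boundP B0) _; apply: le_trans (Dk k).
  by rewrite ler_nat ltnW.
pose phi x := ulim F (r `[0, x]%classic).
have sub x : x <= 1 -> `[0, x] `<=` (`[0, 1] : set R).
  by move=> x1 z /=; rewrite !in_itv /=; ord.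
have phic x : x <= 1 -> r `[0, x]%classic @ F --> phi x.
  by move=> x1; apply: (@ulim_cvg _ _ _ UF _ 1); exact/rb/sub.
have diff x y : 0 <= x -> x <= y -> y <= 1 -> r `[x, y]%classic @ F --> phi y - phi x.
  move=> x0 xy y1.
  have -> : r `[x, y]%classic = (fun k => r `[0, y]%classic k - r `[0, x]%classic k - (r `[0, y]%classic k - r `[0, x]%classic k - r `[x, y]%classic k)).
    by apply/funext => k; ring.
  rewrite -[phi y - phi x]subr0; apply: cvgB; first by apply: cvgB; apply: phic; ord.
  apply: (lim0 _ 4) => k k0; rewrite /r -!mulrBl normrM [`|(D k)^-1|]ger0_norm ?invr_ge0 //.
  by rewrite ler_wpM2r ?invr_ge0 //; apply: Lsum_add => //; have := Tt k; ord.
have Tc : T @ F --> tst.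
  apply/cvgrPdist_lt => e e0; apply: FE.
  have B0 : 0 <= e^-1 by rewrite invr_ge0 ltW.
  exists (Num.bound e^-1) => // k /= hk; have [h1 h2 h3 _ _] := hM k.
  have : k.+1%:R^-1 < e.
    rewrite invf_plt ?posrE //; apply: lt_le_trans (archi_boundP B0) _.
    by rewrite ler_nat leqW.
  by move: h2; move: (k.+1%:R^-1) => Ki h2 hKi; rewrite ger0_norm; ord.
have nd x y : 0 <= x -> x <= y -> y <= 1 -> phi x <= phi y.
  move=> x0 xy y1; rewrite -subr_ge0.
  apply: (@cvgr_to_ge _ _ _ _ _ _ 0 (diff x y x0 xy y1)).
  by apply: filterE => k; rewrite divr_ge0.
have phi1 : phi 1 = 1.
  apply: (@ulimE R _ F UF); apply/cvgrPdist_lt => e e0; apply: FE; exists 1%N => // k /= k0.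
  by rewrite /r divff ?gt_eqF ?Dgt // subrr normr0.
have phi0 : phi 0 = 0.
  apply: (@ulimE R _ F UF); apply: (lim0 _ 4) => k k0.
  rewrite /r normrM [`|(D k)^-1|]ger0_norm ?invr_ge0 // ler_wpM2r ?invr_ge0 //.
  have := @Lsum_add (T k) (M k) 0 0 ltac:(have := Tt k; ord) ltac:(have := Tt k; ord) lr lr lr.
  by rewrite subrr sub0r normrN.
have K : conf f (tst^-1) phi.
  move=> x y x0 xy y1 sm.
  have [a [b [[a0 ab b1] e]]] := smono_image nd x0 xy y1 sm.
  case: e => fJE ->.
  have c1 := diff x y x0 (ltW xy) y1; have c2 := diff a b a0 ab b1.
  have c3 : (fun k => T k * r `[a, b]%classic k - r `[x, y]%classic k) @ F --> tst * (phi b - phi a) - (phi y - phi x).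
    exact: cvgB (cvgM Tc c2) c1.
  have c4 : (fun k => T k * r `[a, b]%classic k - r `[x, y]%classic k) @ F --> (0 : R).
    apply: (lim0 _ 6) => k k0; rewrite /r mulrA -mulrBl normrM.
    rewrite [`|(D k)^-1|]ger0_norm ?invr_ge0 // ler_wpM2r ?invr_ge0 // -fJE.
    have [_ _ _ _ hq] := hM k.
    by apply: Lsum_smono => //; have := Tt k; ord.
  have : tst * (phi b - phi a) - (phi y - phi x) = 0 by apply: cvg_unique c3 c4.
  by move/eqP; rewrite subr_eq0 => /eqP <-; rewrite mulKf ?gt_eqF.
have lam1 : 1 < tst^-1 by rewrite invf_gt1 //; ord.
have cts := conf_cts P lam1 K nd phi0 phi1.
exists tst^-1, phi; split => //; first by rewrite invr_ge0 ltW.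
by apply: (conf_strict P _ K nd phi0 phi1 cts); rewrite invr_ge0 ltW.
Qed.

End words.

(** * Minimal ratios and uniqueness of the model *)

Section compactness.
Variable R : realType.
Implicit Types (x y z w a b c d e p v s t lam : R).

Lemma inv_lt_eps e : 0 < e -> exists n0, forall n, (n0 <= n)%N -> n.+1%:R^-1 < e.
Proof.
move=> e0; have h : 0 <= e^-1 by rewrite invr_ge0 ltW.
exists (Num.bound e^-1) => n hn; rewrite invf_plt ?posrE ?ltr0n //.
by apply: lt_le_trans (archi_boundP h) _; rewrite ler_nat leqW.
Qed.

Lemma seq_cluster2 (u v : nat -> R) :
  (forall n, 0 <= u n <= 1) -> (forall n, 0 <= v n <= 1) ->
  exists x y, [/\ 0 <= x <= 1, 0 <= y <= 1 & forall d, 0 < d -> forall n0,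
    exists n, [/\ (n0 <= n)%N, `|u n - x| < d & `|v n - y| < d]].
Proof.
move=> uI vI.
have PE : ProperFilter (\oo : set_system nat) by exact: eventually_filter.
have [F [UF FE]] := @ultraFilterLemma _ (\oo : set_system nat) PE.
have PF := @ultra_proper _ _ UF.
have ub (w : nat -> R) : (forall n : nat, 0 <= w n <= 1) -> forall n, `|w n| <= 1.
  by move=> wI n; have := wI n; rewrite ler_norml; ord.
have cu := ulim_cvg UF (ub u uI); have cv := ulim_cvg UF (ub v vI).
have lim01 (w : nat -> R) : (forall n : nat, 0 <= w n <= 1) -> w @ F --> ulim F w -> 0 <= ulim F w <= 1.
  move=> wI cw; apply/andP; split.
    by apply: (cvgr_to_ge cw); apply: filterE => n; have := wI n; ord.
  by apply: (cvgr_to_le cw); apply: filterE => n; have := wI n; ord.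
exists (ulim F u), (ulim F v); split; [exact: lim01|exact: lim01|].
move=> d d0 n0.
have h1 : F [set n | `|ulim F u - u n| < d] by move/cvgrPdist_lt : cu; apply.
have h2 : F [set n | `|ulim F v - v n| < d] by move/cvgrPdist_lt : cv; apply.
have h3 : F [set n | (n0 <= n)%N] by apply: FE; exists n0.
have [n [[/= h4 h5] h6]] := filter_ex (filterI (filterI h1 h2) h3).
by exists n; split => //; rewrite distrC.
Qed.

(** Existence of a Lebesgue number, by compactness of [0,1]. *)
Lemma small_itv (Q : R -> R -> Prop) :
  (forall x, 0 <= x <= 1 -> exists2 d : R, 0 < d & forall a b, 0 <= a -> a < b -> b <= 1 ->
     `|a - x| < d -> `|b - x| < d -> Q a b) ->
  exists2 d : R, 0 < d & forall a b, 0 <= a -> a < b -> b <= 1 -> b - a < d -> Q a b.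
Proof.
move=> H; apply: contrapT => no.
have bad (n : nat) : exists ab : R * R, [/\ 0 <= ab.1, ab.1 < ab.2, ab.2 <= 1,
    ab.2 - ab.1 < n.+1%:R^-1 & ~ Q ab.1 ab.2].
  apply: contrapT => h; apply: no; exists n.+1%:R^-1; first by rewrite invr_gt0 ltr0n.
  by move=> a b a0 ab b1 abn; apply: contrapT => q; apply: h; exists (a, b).
have [u hu] := choice bad.
have uI n : 0 <= (u n).1 <= 1 by have [? ? ? _ _] := hu n; ord.
have [x [y [xI _ cl]]] := seq_cluster2 uI uI.
have [d d0 hd] := H x xI.
have [n0 hn0] := @inv_lt_eps (d / 2) lr.
have [n [n0n h1 _]] := cl (d / 2) lr n0.
have [a0 ab b1 abn nq] := hu n; have hn := hn0 n n0n.
apply: nq; apply: hd => //; first by apply: lt_trans h1 _; ord.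
by move: abn hn h1; move: (n.+1%:R^-1) => i; rewrite !ltr_norml; ord.
Qed.

Lemma ctsI_unif (g : R -> R) e : ctsI g -> 0 < e ->
  exists2 d : R, 0 < d & forall x y, 0 <= x <= 1 -> 0 <= y <= 1 -> `|y - x| < d ->
    `|g y - g x| < e.
Proof.
move=> gc e0; have [|d d0 hd] := @small_itv (fun a b => `|g b - g a| < e).
  move=> x xI; have [d d0 hd] := gc x xI (e / 2) lr; exists d => // a b a0 ab b1 ax bx.
  have := hd a lr ax; have := hd b lr bx; rewrite !ltr_norml; ord.
exists d => // x y xI yI; have [h|h|->] := ltgtP x y.
- by move=> h3; apply: hd; move: h3; rewrite ?ltr_norml; ord.
- by rewrite distrC => h3; rewrite distrC; apply: hd; move: h3; rewrite ?ltr_norml; ord.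
- by rewrite !subrr normr0.
Qed.

Lemma inc_small (g : R -> R) d : inc g 0 1 -> 0 < d ->
  exists2 e : R, 0 < e & forall a b, 0 <= a -> a < b -> b <= 1 -> g b - g a < e -> b - a < d.
Proof.
move=> gi d0; apply: contrapT => no.
have bad (n : nat) : exists ab : R * R, [/\ 0 <= ab.1, ab.1 < ab.2, ab.2 <= 1,
    g ab.2 - g ab.1 < n.+1%:R^-1 & d <= ab.2 - ab.1].
  apply: contrapT => h; apply: no; exists n.+1%:R^-1; first by rewrite invr_gt0 ltr0n.
  by move=> a b a0 ab b1 abn; rewrite ltNge; apply/negP => q; apply: h; exists (a, b).
have [u hu] := choice bad.
have uI n : 0 <= (u n).1 <= 1 by have [? ? ? _ _] := hu n; ord.
have [x [y [xI _ cl]]] := seq_cluster2 uI uI.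
have [n1 [_ h1 _]] := cl (d / 3) lr 0%N.
have xd : x + 2 * d / 3 <= 1.
  by have [? ? ? _ ?] := hu n1; move: h1; rewrite ltr_norml; ord.
have e0 : 0 < g (x + 2 * d / 3) - g (x + d / 3) by rewrite subr_gt0; apply: gi; ord.
have [n0 hn0] := inv_lt_eps e0.
have [n [n0n h2 _]] := cl (d / 3) lr n0.
have [a0 ab b1 abn dab] := hu n; have hn := hn0 n n0n.
have g1 : g (u n).1 < g (x + d / 3) by apply: gi; move: h2; rewrite ltr_norml; ord.
have g2 : g (x + 2 * d / 3) < g (u n).2 by apply: gi; move: h2; rewrite ltr_norml; ord.
by move: abn hn g1 g2; move: (n.+1%:R^-1) => i; clear; ord.
Qed.

End compactness.

Section ratio.
Variable R : realType.
Implicit Types (x y z w a b c d e p u v s t lam : R) (phi : R -> R) (C : seq R).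
Variables (f : R -> R) (C : seq R).
Hypothesis P : pmt f C.

(** The first [n] images of [u,v], starting with [u,v] itself, each stay in one lap; the [n]-th
    iterate then scales the model length of [u,v] by exactly [lam ^ n]. *)
Definition chain n u v := forall j, (j < n)%N -> exists lo hi,
  [/\ 0 <= lo, hi <= 1, smono f lo hi & forall t, u <= t <= v -> lo <= iter j f t <= hi].

Lemma chain_sub n u v u' v' : chain n u v -> u <= u' -> v' <= v -> chain n u' v'.
Proof.
move=> h uu vv j jn; have [lo [hi [l0 h1 sm hh]]] := h j jn.
by exists lo, hi; split => // t tI; apply: hh; ord.
Qed.

Lemma chain_right n x : 0 <= x < 1 -> exists2 d : R, 0 < d & x + d <= 1 /\ chain n x (x + d).
Proof.
move=> xI; elim: n => [|n [d d0 [d1 hd]]].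
  by exists (1 - x); [ord|split; [ord|]].
have pI := iterI P n (x := x) lr.
have nc := ctsI_iter n (pm_self P) (pm_cts P).
have [d2 d20 [d21 sm]] := @smono_iter_right R f C P n x xI.
suff [d3 d30 [lo [hi [l0 h1 smf hh]]]] : exists2 d3 : R, 0 < d3 & exists lo hi,
    [/\ 0 <= lo, hi <= 1, smono f lo hi &
        forall t, x <= t <= x + d3 -> t <= x + d2 -> lo <= iter n f t <= hi].
  exists (Num.min d (Num.min d2 d3)); first by rewrite !lt_min d0 d20.
  set m := Num.min _ _; have m1 : m <= d by rewrite ge_min lexx.
  have m2 : m <= d2 by rewrite !ge_min lexx orbT.
  have m3 : m <= d3 by rewrite !ge_min lexx !orbT.
  split; first ord.
  move=> j; rewrite ltnS leq_eqVlt => /orP[/eqP ->|jn].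
    by exists lo, hi; split => // t tI; apply: hh; ord.
  by have [lo' [hi' [? ? ? h]]] := hd j jn; exists lo', hi'; split => // t tI; apply: h; ord.
case: sm => sm; have hx := sm x (x + d2) (lexx _) lr (lexx _);
  have yI := iterI P n (x := x + d2) lr.
  have [e e0 [e1 sf]] := @smono_right R f C P (iter n f x) lr.
  have [d3 d30 h3] := @ctsI_lt R _ x (iter n f x + e) nc lr lr.
  exists (d3 / 2); first ord.
  exists (iter n f x), (iter n f x + e); split => //; first ord.
  move=> t tI td; have := h3 t lr; rewrite ltr_norml.
  have [->|xt] : t = x \/ x < t by ord.
    ord.
  by have := sm x t (lexx _) xt td; ord.
have [e e0 [e1 sf]] := @smono_left R f C P (iter n f x) lr.
have [d3 d30 h3] := @ctsI_gt R _ x (iter n f x - e) nc lr lr.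
exists (d3 / 2); first ord.
exists (iter n f x - e), (iter n f x); split => //; first ord.
move=> t tI td; have := h3 t lr; rewrite ltr_norml.
have [->|xt] : t = x \/ x < t by ord.
  ord.
by have := sm x t (lexx _) xt td; ord.
Qed.

End ratio.

Lemma chain_mir (R : realType) (f : R -> R) n u v : chain (mir f) n u v -> chain f n (1 - v) (1 - u).
Proof.
move=> h j jn; have [lo [hi [l0 h1 sm hh]]] := h j jn.
exists (1 - hi), (1 - lo); split; try ord.
  by case: sm => sm; [left; have := mir_inc sm|right; have := mir_dec sm]; rewrite mirK.
move=> t tI; have := hh (1 - t) ltac:(ord); rewrite mir_iter subKr; ord.
Qed.

Section ratio2.
Variable R : realType.
Implicit Types (x y z w a b c d e p u v s t lam : R) (phi : R -> R) (C : seq R).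
Variables (f : R -> R) (C : seq R).
Hypothesis P : pmt f C.

Lemma chain_left n x : 0 < x <= 1 -> exists2 d : R, 0 < d & 0 <= x - d /\ chain f n (x - d) x.
Proof.
move=> xI; have [d d0 [d1 h]] := chain_right (mir_pmt P) n (x := 1 - x) lr.
exists d => //; split; first ord.
by have := chain_mir h; rewrite subKr opprD addrA subKr.
Qed.

(** On either side of every point, turning or not, short intervals are chains; by compactness one
    cut suffices for all short intervals. *)
Lemma two_chains n : exists2 d : R, 0 < d & forall a b, 0 <= a -> a < b -> b <= 1 -> b - a < d ->
  exists2 z : R, a <= z <= b & chain f n a z /\ chain f n z b.
Proof.
apply: small_itv => x xI.
have [d1 d10 h1] : exists2 d : R, 0 < d & forall b, x <= b -> b <= 1 -> b < x + d -> chain f n x b.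
  have [e|x1] : x = 1 \/ x < 1 by ord.
    exists 1 => // b xb b1 _; have -> : b = 1 by ord.
    rewrite e => j jn; exists (iter j f 1), (iter j f 1).
    have [h _] := (iterI P j (x := 1) lr, tt); split; try ord.
      by left => a' b'; ord.
    by move=> t tI; rewrite (_ : t = 1) ?lexx //; ord.
  have [d d0 [dx h]] := chain_right P n (x := x) lr; exists d => // b xb b1 bd.
  by apply: chain_sub h _ _; ord.
have [d2 d20 h2] : exists2 d : R, 0 < d & forall a, a <= x -> 0 <= a -> x - d < a -> chain f n a x.
  have [e|x1] : x = 0 \/ 0 < x by ord.
    exists 1 => // b xb b1 _; have -> : b = 0 by ord.
    rewrite e => j jn; exists (iter j f 0), (iter j f 0).
    have [h _] := (iterI P j (x := 0) lr, tt); split; try ord.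
      by left => a' b'; ord.
    by move=> t tI; rewrite (_ : t = 0) ?lexx //; ord.
  have [d d0 [dx h]] := chain_left n (x := x) lr; exists d => // b xb b1 bd.
  by apply: chain_sub h _ _; ord.
exists (Num.min d1 d2); first by rewrite lt_min d10.
have one u : 0 <= u <= 1 -> chain f n u u.
  move=> uI j jn; exists (iter j f u), (iter j f u).
  have h := iterI P j uI; split; try ord.
    by left => a' b'; ord.
  by move=> t tI; rewrite (_ : t = u) ?lexx //; ord.
move=> a b a0 ab b1; rewrite !lt_min => /andP[a1 a2] /andP[bb1 bb2].
have [bx|xb] := leP b x.
  exists b; first ord; split; last by apply: one; ord.
  by apply: (@chain_sub _ _ _ a x); [apply: h2; move: a2; rewrite ?ltr_norml; ord|ord|ord].
have [xa|ax] := leP x a.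
  exists a; first ord; split; first by apply: one; ord.
  by apply: (@chain_sub _ _ _ x b); [apply: h1; move: bb1; rewrite ?ltr_norml; ord|ord|ord].
exists x; first ord; split.
  by apply: h2; move: a2; rewrite ?ltr_norml; ord.
by apply: h1; move: bb1; rewrite ?ltr_norml; ord.
Qed.

Lemma conf_chain lam phi n u v : 0 < lam -> conf f lam phi -> inc phi 0 1 ->
  0 <= u -> u < v -> v <= 1 -> chain f n u v ->
  `|phi (iter n f v) - phi (iter n f u)| = lam ^+ n * (phi v - phi u).
Proof.
move=> l0 K ph u0 uv v1; elim: n => [|n IH] ch.
  by rewrite expr0 mul1r /= gtr0_norm // subr_gt0; apply: ph.
have {}IH : `|phi (iter n f v) - phi (iter n f u)| = lam ^+ n * (phi v - phi u).
  by apply: IH => j jn; apply: ch; apply: leqW.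
have [lo [hi [lo0 hi1 sm h]]] := ch n (leqnn _).
have hu := h u lr; have hv := h v lr.
have pos : 0 < lam ^+ n * (phi v - phi u).
  by rewrite mulr_gt0 ?exprn_gt0 // subr_gt0; apply: ph.
rewrite exprS -mulrA -IH !iterS.
have [l|l|e] := ltgtP (iter n f u) (iter n f v).
- rewrite K //; try ord; last by apply: smono_sub sm _ _; ord.
  by rewrite ger0_norm // subr_ge0 ltW //; apply: ph; ord.
- rewrite distrC K //; try ord; last by apply: smono_sub sm _ _; ord.
  by rewrite distrC ger0_norm // subr_ge0 ltW //; apply: ph; ord.
- by move: pos; rewrite -IH e subrr normr0 ltxx.
Qed.

Lemma ga_iter lam l n u v : gauge f lam l -> 0 <= u -> u < v -> v <= 1 ->
  (iter n f u < iter n f v -> l (iter n f u) (iter n f v) <= lam ^+ n * l u v) /\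
  (iter n f v < iter n f u -> l (iter n f v) (iter n f u) <= lam ^+ n * l u v).
Proof.
move=> G u0 uv v1; elim: n => [|n [IH1 IH2]].
  by rewrite expr0 mul1r /=; split => // h; ord.
have uI := iterI P n (x := u) lr; have vI := iterI P n (x := v) lr.
have l0 := ga_lam G.
rewrite exprS -mulrA !iterS.
have [h|h|e] := ltgtP (iter n f u) (iter n f v).
- split=> h'; (apply: le_trans (_ : lam * l (iter n f u) (iter n f v) <= _);
    last by rewrite ler_wpM2l //; apply: IH1).
    by apply: (ga_up G); ord.
  by apply: (ga_dn G); ord.
- split=> h'; (apply: le_trans (_ : lam * l (iter n f v) (iter n f u) <= _);
    last by rewrite ler_wpM2l //; apply: IH2).
    by apply: (ga_dn G); ord.
  by apply: (ga_up G); ord.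
- by rewrite e; split; ord.
Qed.
End ratio2.

Section ratio3.
Variable R : realType.
Implicit Types (x y z w a b c d e p q u v s t lam : R) (phi : R -> R).
Variables (f : R -> R) (C : seq R) (lam : R) (phi : R -> R) (l : R -> R -> R).
Hypotheses (P : pmt f C) (M : model f lam phi) (G : gauge f lam l).

(* Short intervals are expanded by f^k faster than they are cut. *)
Lemma stretch_bound k q r u v : 0 <= u -> u < v -> v <= 1 -> chain f k u v ->
  (forall a b, 0 <= a -> a < b -> b <= 1 -> q * (phi b - phi a - r) <= l a b) ->
  q * (phi v - phi u - r / lam ^+ k) <= l u v.
Proof.
have lam1 := sqrt2_gt1 (md_lam M) (model_sqrt2 P M); have ph := md_inc M.
have lam0 : 0 < lam := lt_trans ltr01 lam1.
have L0 : 0 < lam ^+ k by rewrite exprn_gt0.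
move=> u0 uv v1 ch IH.
have uI := iterI P k (x := u) lr; have vI := iterI P k (x := v) lr.
have cc := conf_chain lam0 (md_conf M) ph u0 uv v1 ch.
have [g1 g2] := ga_iter P k G u0 uv v1.
have E : lam ^+ k * (q * (phi v - phi u - r / lam ^+ k)) = q * (lam ^+ k * (phi v - phi u) - r).
  by field; rewrite gt_eqF.
rewrite -(ler_pM2l L0) E -cc.
have [h|h|e] := ltgtP (iter k f u) (iter k f v).
- apply: le_trans (g1 h); rewrite gtr0_norm ?subr_gt0 ?ph //; try ord.
  by apply: IH; ord.
- apply: le_trans (g2 h); rewrite distrC gtr0_norm ?subr_gt0 ?ph //; try ord.
  by apply: IH; ord.
- have : 0 < lam ^+ k * (phi v - phi u) by rewrite mulr_gt0 // subr_gt0 ph.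
  by rewrite -cc e subrr normr0 ltxx.
Qed.

(** A bound with error [r] is improved on a short interval by cutting it into two chains and
    stretching them by more than 4: each piece has error at most [r / 4], so the total error is
    halved at every round. *)
Lemma long_suffices : exists2 D : R, 0 < D <= 1 & forall q, 0 <= q ->
  (forall a b, 0 <= a -> a < b -> b <= 1 -> D <= phi b - phi a ->
     q * (phi b - phi a) <= l a b) ->
  forall a b, 0 <= a -> a < b -> b <= 1 -> q * (phi b - phi a) <= l a b.
Proof.
have lam1 := sqrt2_gt1 (md_lam M) (model_sqrt2 P M).
have lam0 : 0 < lam by ord.
have ph := md_inc M.
have [k hk] := expn_unbounded 4 lam1.
set L := lam ^+ k in hk; have L0 : 0 < L by ord.
have [d d0 hd] := two_chains P k.
have [D1 D10 hD] := inc_small ph d0.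
exists (Num.min D1 1); first by rewrite lt_min D10 ltr01 ge_min lexx orbT.
move=> q q0 hq.
have Q n : forall a b, 0 <= a -> a < b -> b <= 1 -> q * (phi b - phi a - (1 / 2) ^+ n) <= l a b.
  elim: n => [|n IH] a b a0 ab b1.
    apply: (@le_trans _ _ 0); last exact: (ga_ge0 G).
    rewrite mulr_ge0_le0 // expr0; have := md_I M (x := a) lr; have := md_I M (x := b) lr; ord.
  have e0 : (0 : R) <= (1 / 2) ^+ n by apply: exprn_ge0; ord.
  have qe : 0 <= q * (1 / 2) ^+ n by rewrite mulr_ge0.
  have eL : (1 / 2) ^+ n / L <= (1 / 2) ^+ n / 4.
    by rewrite ler_wpM2l // lef_pV2 ?posrE; ord.
  have qeL : q * ((1 / 2) ^+ n / L) <= q * ((1 / 2) ^+ n / 4) by rewrite ler_wpM2l.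
  rewrite exprSr.
  have [hl|hs] := leP (Num.min D1 1) (phi b - phi a).
    by apply: le_trans (hq a b a0 ab b1 hl); rewrite ler_wpM2l //; ord.
  have hD1 : phi b - phi a < D1 by move: hs; rewrite lt_min => /andP[].
  have [z zI [c1 c2]] := hd a b a0 ab b1 (hD a b a0 ab b1 hD1).
  have [e|az] : a = z \/ a < z by ord.
    by have := stretch_bound a0 ab b1 ltac:(rewrite e; exact: c2) IH; rewrite -/L; ord.
  have [e|zb] : z = b \/ z < b by ord.
    by have := stretch_bound a0 ab b1 ltac:(rewrite -e; exact: c1) IH; rewrite -/L; ord.
  have p1 := stretch_bound a0 az (le_trans (ltW zb) b1) c1 IH.
  have p2 := stretch_bound (le_trans a0 (ltW az)) zb b1 c2 IH; rewrite -/L in p1 p2.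
  have := ga_add G a0 az zb b1; ord.
move=> a b a0 ab b1; rewrite leNgt; apply/negP => h.
have q1 : 0 < q.
  have [//|] := ltP 0 q; move=> qn; have qe : q = 0 by ord.
  by move: h; rewrite qe mul0r ltNge (ga_ge0 G).
pose e := (q * (phi b - phi a) - l a b) / q.
have e0 : 0 < e by rewrite divr_gt0 // subr_gt0.
have [n hn] := @expn_unbounded R 2 e^-1 lr.
have he : (1 / 2) ^+ n < e.
  by rewrite mul1r exprVn invf_plt ?posrE // exprn_gt0.
have := Q n a b a0 ab b1.
have : q * (1 / 2) ^+ n < q * e by rewrite ltr_pM2l.
have -> : q * e = q * (phi b - phi a) - l a b by rewrite /e mulrC divfK // gt_eqF.
ord.
Qed.

(** Lower semicontinuity is what lengths with atoms satisfy: a length loses an atom when an end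
    point reaches it. *)
Hypothesis lsc : forall x y e, 0 <= x -> x < y -> y <= 1 -> 0 < e ->
  exists2 d : R, 0 < d & forall x' y', 0 <= x' -> x' < y' -> y' <= 1 ->
    `|x' - x| < d -> `|y' - y| < d -> l x y - e < l x' y'.

Lemma ratio_gap (q lxy lu s t pa pb e e' i D : R) : 0 <= q -> 0 < e' -> q * e' <= e -> 0 < e -> 0 < D ->
  0 <= pa -> pb <= 1 -> D <= pb - pa -> `|pa - s| < e' -> `|pb - t| < e' -> i < e ->
  lu < (q + i) * (pb - pa) -> lxy - e < lu -> lxy - q * (t - s) < 4 * e.
Proof.
move=> q0 e'0 qe e0 D0 pa0 pb1 hD; rewrite !ltr_norml => /andP[h1 h2] /andP[h3 h4] ie hl hx.
have t1 : q * (pb - pa) <= q * (t - s + 2 * e') by rewrite ler_wpM2l //; lra.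
have t2 : i * (pb - pa) <= e.
  have [i0|i0] := leP i 0; last first.
    by apply: (@le_trans _ _ (i * 1)); [rewrite ler_pM2l //; lra|rewrite mulr1 ltW].
  by apply: (@le_trans _ _ 0); [rewrite mulr_le0_ge0 //; lra|exact: ltW].
by move: hl t1; rewrite mulrDl [q * (_ + 2 * _)]mulrDr; lra.
Qed.

(** Taking the infimum over intervals of model length at least [D] prevents a minimising sequence
    from shrinking to a point. Lower semicontinuity makes the limit interval a minimiser, and
    [long_suffices] extends the bound to all intervals. *)
Theorem min_ratio : exists q x y, [/\ 0 <= q, 0 <= x, x < y & y <= 1] /\
  l x y = q * (phi y - phi x) /\
  forall a b, 0 <= a -> a < b -> b <= 1 -> q * (phi b - phi a) <= l a b.
Proof.
have [D /andP[D0 D1] hD] := long_suffices.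
have ph := md_inc M; have phc := md_cts M.
pose S := [set r | exists a b, [/\ 0 <= a, a < b & b <= 1] /\
   D <= phi b - phi a /\ r = l a b / (phi b - phi a)].
have S0 : S !=set0.
  exists (l 0 1 / (phi 1 - phi 0)), 0, 1; split; first by split; ord.
  by rewrite (md_0 M) (md_1 M) subr0.
have Slb : lbound S 0.
  move=> _ [a [b [[a0 ab b1] [_ ->]]]]; rewrite divr_ge0 ?(ga_ge0 G) //.
  by rewrite subr_ge0 ltW // ph.
have hS : has_inf S by split => //; exists 0.
pose q := inf S.
have q0 : 0 <= q by apply: lb_le_inf.
have hq : forall a b, 0 <= a -> a < b -> b <= 1 -> q * (phi b - phi a) <= l a b.
  apply: hD => // a b a0 ab b1 hl; rewrite -ler_pdivlMr; last ord.
  by apply: ge_inf; [exists 0|exists a, b; split].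
have near (n : nat) : exists ab : R * R, [/\ 0 <= ab.1, ab.1 < ab.2,
    ab.2 <= 1, D <= phi ab.2 - phi ab.1 &
    l ab.1 ab.2 < (q + n.+1%:R^-1) * (phi ab.2 - phi ab.1)].
  have e0 : (0 : R) < n.+1%:R^-1 by rewrite invr_gt0 ltr0n.
  have [r [a [b [[a0 ab b1] [hl ->]]]] hr] := inf_adherent e0 hS.
  exists (a, b); split => //=; rewrite -ltr_pdivrMr //; ord.
have [u hu] := choice near.
have uI n : 0 <= (u n).1 <= 1 by have [? ? ? _ _] := hu n; ord.
have vI n : 0 <= (u n).2 <= 1 by have [? ? ? _ _] := hu n; ord.
have [x [y [xI yI cl]]] := seq_cluster2 uI vI.
have lng : D <= phi y - phi x.
  rewrite leNgt; apply/negP => h; pose e := (D - (phi y - phi x)) / 2.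
  have e0 : 0 < e by rewrite /e; ord.
  have [d1 d10 h1] := phc x xI e e0; have [d2 d20 h2] := phc y yI e e0.
  have [|n [_ c1 c2]] := cl (Num.min d1 d2) _ 0%N; first by rewrite lt_min d10.
  have := h1 _ (uI n) (lt_le_trans c1 _); rewrite ge_min lexx => /(_ isT).
  have := h2 _ (vI n) (lt_le_trans c2 _); rewrite ge_min lexx orbT => /(_ isT).
  have [_ _ _ hl _] := hu n; move: hl; rewrite !ltr_norml /e; ord.
have xy : x < y.
  rewrite ltNge; apply/negP => yx; have [e|l'] : x = y \/ y < x by ord.
    by move: lng; rewrite e subrr; ord.
  by have := ph y x; ord.
exists q, x, y; split; first by split; ord.
split=> //; apply/eqP; rewrite eq_le hq ?andbT; try ord.
rewrite leNgt; apply/negP => h; pose e := (l x y - q * (phi y - phi x)) / 4.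
have e0 : 0 < e by rewrite /e; ord.
have [d1 d10 h1] := lsc (x := x) (y := y) lr xy lr e0.
pose e' := e / (q + 1); have e'0 : 0 < e' by rewrite divr_gt0 //; ord.
have eE : e' * (q + 1) = e by rewrite /e' divfK // gt_eqF // ltr_wpDl.
have qe : q * e' <= e by clear -eE e'0; ord.
have [d2 d20 h2] := phc x xI e' e'0; have [d3 d30 h3] := phc y yI e' e'0.
have [n0 hn0] := inv_lt_eps e0.
have [|n [n0n c1 c2]] := cl (Num.min d1 (Num.min d2 d3)) _ n0.
  by rewrite !lt_min d10 d20.
move: c1 c2; rewrite !lt_min => /and3P[c1 c2 c3] /and3P[c4 c5 c6].
have [a0 ab b1 hl hr] := hu n.
have /andP[ua _] := uI n; have /andP[_ vb] := vI n.
have /andP[pa _] := md_I M (uI n); have /andP[_ pb] := md_I M (vI n).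
have := ratio_gap q0 e'0 qe e0 D0 pa pb hl (h2 _ (uI n) c2) (h3 _ (vI n) c6) (hn0 n n0n) hr (h1 _ _ a0 ab b1 c1 c4).
by rewrite /e [4 * _]mulrC divfK ?ltxx.
Qed.

End ratio3.

(** * Uniqueness of the model *)

Section uniqueness.
Variable R : realType.
Implicit Types (x y z w a b c d e p q u v s t lam : R) (f phi psi : R -> R) (C : seq R).

Lemma model_lsc f lam phi : model f lam phi ->
  forall x y e, 0 <= x -> x < y -> y <= 1 -> 0 < e ->
  exists2 d : R, 0 < d & forall x' y', 0 <= x' -> x' < y' -> y' <= 1 ->
    `|x' - x| < d -> `|y' - y| < d -> phi y - phi x - e < phi y' - phi x'.
Proof.
move=> M x y e x0 xy y1 e0.
have [d1 d10 h1] := md_cts M (x := x) lr (e := e / 2) lr.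
have [d2 d20 h2] := md_cts M (x := y) lr (e := e / 2) lr.
exists (Num.min d1 d2); first by rewrite lt_min d10.
move=> x' y' x'0 xy' y'1; rewrite !lt_min => /andP[a1 a2] /andP[b1 b2].
have := h1 x' lr a1; have := h2 y' lr b2; rewrite !ltr_norml; ord.
Qed.

(** If the minimal ratio is attained on an interval, a larger ratio on one piece could not be
    compensated on the others, so it is attained on every subinterval. *)
Lemma affine_sub (g h : R -> R) q a b u v :
  (forall x y, 0 <= x -> x < y -> y <= 1 -> q * (g y - g x) <= h y - h x) ->
  h b - h a = q * (g b - g a) -> 0 <= a -> b <= 1 ->
  a <= u -> u < v -> v <= b -> h v - h u = q * (g v - g u).
Proof.
move=> H e a0 b1 au uv vb.
have H' x y : 0 <= x -> x <= y -> y <= 1 -> q * (g y - g x) <= h y - h x.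
  by move=> x0; rewrite le_eqVlt => /orP[/eqP ->|xy] y1; [rewrite !subrr mulr0|exact: H].
have h1 := H' a u a0 au lr; have h2 := H' v b lr vb b1; have h3 := H' u v lr (ltW uv) lr.
move: h1 h2 h3 e; rewrite !mulrBr; clear; ord.
Qed.

Lemma chain_into f C n x b c d : pmt f C -> 0 <= x -> x < b -> b <= 1 ->
  c < iter n f x < d ->
  exists y, [/\ x < y, y < b, chain f n x y & c < iter n f y < d].
Proof.
move=> P x0 xb b1 fx.
have [e e0 [xe ch]] := chain_right P n (x := x) lr.
have nc := ctsI_iter n (pm_self P) (pm_cts P).
have [e1 e10 he1] := ctsI_lt (x := x) (v := d) nc lr lr.
have [e2 e20 he2] := ctsI_gt (x := x) (v := c) nc lr lr.
pose m := Num.min (Num.min e (b - x)) (Num.min e1 e2) / 2.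
have m0 : 0 < Num.min (Num.min e (b - x)) (Num.min e1 e2) by rewrite !lt_min e0 e10 e20; ord.
have mE : Num.min (Num.min e (b - x)) (Num.min e1 e2) = m * 2 by rewrite /m; field.
have me : m * 2 <= e by rewrite -mE !ge_min lexx.
have mb : m * 2 <= b - x by rewrite -mE !ge_min lexx !orbT.
have m1 : m * 2 <= e1 by rewrite -mE !ge_min lexx !orbT.
have m2 : m * 2 <= e2 by rewrite -mE !ge_min lexx !orbT.
have yI : 0 <= x + m <= 1 by clear -m0 mE mb x0 b1; ord.
have ye : `|x + m - x| < e1 by rewrite addrAC subrr add0r gtr0_norm; clear -m0 mE m1; ord.
have ye2 : `|x + m - x| < e2 by rewrite addrAC subrr add0r gtr0_norm; clear -m0 mE m2; ord.
exists (x + m); split.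
- by clear -m0 mE; ord.
- by clear -m0 mE mb xb; ord.
- by apply: chain_sub ch _ _; rewrite ?lexx ?lerD2l //; clear -m0 mE me; ord.
- by rewrite he1 // he2.
Qed.

(** [q] and [r] are the minimal ratios in the two directions, each exact on some interval.
    Transitivity carries a short chain from the first interval into the second, and both lengths are
    multiplied by [lam ^ n]; hence [q * r = 1]. As both total lengths are 1, neither ratio exceeds
    1, so [q = 1]. *)
Lemma model_le f C lam phi psi x y : pmt f C -> model f lam phi -> model f lam psi ->
  0 <= x -> x < y -> y <= 1 -> phi y - phi x <= psi y - psi x.
Proof.
move=> P M M'.
have [q [a [b [[q0 a0 ab b1] [eq1 h1]]]]] :=
  min_ratio P M (model_gauge P M') (model_lsc M').
have [r [c [d [[r0 c0 cd d1] [eq2 h2]]]]] :=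
  min_ratio P M' (model_gauge P M) (model_lsc M).
have lam0 : 0 < lam := lt_trans ltr01 (sqrt2_gt1 (md_lam M) (model_sqrt2 P M)).
suff qr : q * r = 1.
  have q1 : q <= 1.
    by have := h1 0 1 (lexx _) ltr01 (lexx _); rewrite (md_0 M) (md_1 M) (md_0 M') (md_1 M'); clear; ord.
  have r1 : r <= 1.
    by have := h2 0 1 (lexx _) ltr01 (lexx _); rewrite (md_0 M) (md_1 M) (md_0 M') (md_1 M'); clear; ord.
  have qe : q = 1 by clear -qr q0 r0 q1 r1; nra.
  by move=> x0 xy y1; have := h1 x y x0 xy y1; rewrite qe mul1r.
have sub1 u v := @affine_sub phi psi q a b u v h1 eq1 a0 b1.
have sub2 u v := @affine_sub psi phi r c d u v h2 eq2 c0 d1.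
clear x y h1 h2 eq1 eq2; have [n _ [x xab fx]] := pm_tr P a0 ab b1 c0 cd d1.
have x0 : 0 <= x by clear -xab a0; ord.
have xb : x < b by clear -xab; ord.
have [y [xy yb ch fy]] := chain_into P x0 xb b1 fx.
have y1 : y <= 1 by clear -yb b1; ord.
have c1 := conf_chain lam0 (md_conf M) (md_inc M) x0 xy y1 ch.
have c2 := conf_chain lam0 (md_conf M') (md_inc M') x0 xy y1 ch.
have s1 : psi y - psi x = q * (phi y - phi x) by apply: sub1; clear -xab yb xy; ord.
have p1 : 0 < phi y - phi x by rewrite subr_gt0; apply: (md_inc M).
have L0 : 0 < lam ^+ n by rewrite exprn_gt0.
have s2 : `|phi (iter n f y) - phi (iter n f x)| = r * `|psi (iter n f y) - psi (iter n f x)|.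
  have [h|h|e'] := ltgtP (iter n f x) (iter n f y).
  - by rewrite sub2 ?normrM ?(ger0_norm r0) //; clear -fx fy; ord.
  - by rewrite distrC [in RHS]distrC sub2 ?normrM ?(ger0_norm r0) //; clear -fx fy; ord.
  - by rewrite e' !subrr normr0 mulr0.
move: s2; rewrite c1 c2 s1 => /eqP; rewrite !(mulrCA r) -subr_eq0 -mulrBr.
rewrite mulf_eq0 gt_eqF //= => /eqP h.
have : (phi y - phi x) * (1 - q * r) = 0 by move: h; rewrite mulrBr; clear; ord.
by move/eqP; rewrite mulf_eq0 gt_eqF //= subr_eq0 => /eqP.
Qed.
End uniqueness.

Lemma model_unique (R : realType) (f : R -> R) C (lam : R) phi psi : pmt f C ->
  model f lam phi -> model f lam psi -> forall x, 0 <= x <= 1 -> phi x = psi x.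
Proof.
move=> P M M' x xI; have [->|x0] : x = 0 \/ 0 < x by ord.
  by rewrite (md_0 M) (md_0 M').
have := model_le P M M' (lexx 0) x0 lr; have := model_le P M' M (lexx 0) x0 lr.
by rewrite (md_0 M) (md_0 M'); ord.
Qed.

(** * Entropy of the model *)

Section esup.
Variable R : realType.
Implicit Types (u : nat -> \bar R) (L : \bar R).

Lemma limn_esup_ub u L : (exists N, forall n, (N <= n)%N -> (u n <= L)%E) -> (limn_esup u <= L)%E.
Proof.
move=> [N h]; rewrite /limn_esup limf_esupE.
apply: (@le_trans _ _ (ereal_sup (u @` [set n | (N <= n)%N]))).
  by apply: ereal_inf_lbound; exists [set n | (N <= n)%N] => //; exists N.
by apply: ge_ereal_sup => _ [n /= hn <-]; apply: h.
Qed.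

Lemma limn_esup_lb u L : (forall N, exists2 n, (N <= n)%N & (L <= u n)%E) -> (L <= limn_esup u)%E.
Proof.
move=> h; rewrite /limn_esup limf_esupE; apply: le_ereal_inf_tmp => _ [V [N _ hV] <-].
have [n hn Ln] := h N; apply: le_trans Ln _; apply: ereal_sup_ubound.
by exists n => //; apply: hV.
Qed.

End esup.

Lemma quarter (R : realType) (a b : R) : a / 4 < b + 1 -> 8 <= a -> a / 8 <= b.
Proof. ord. Qed.

Section entropy.
Variable R : realType.
Implicit Types (x y z w a b c d e p q u v t lam : R) (f phi psi : R -> R) (C : seq R) (s : seq R).

(** Points that far apart have different integer parts of [phi x / g]. *)
Lemma spaced_size phi s g : 0 < g -> uniq s ->
  (forall x, x \in s -> 0 <= phi x <= 1) ->
  {in s &, forall x y, x != y -> g <= `|phi x - phi y|} ->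
  (size s)%:R <= g^-1 + 1.
Proof.
move=> g0 us sI sep; pose fl x := Num.truncn (phi x / g).
have flP x : x \in s -> (fl x)%:R <= phi x / g < (fl x).+1%:R.
  by move=> xs; apply: truncn_itv; rewrite divr_ge0 ?(ltW g0) //; have := sI x xs; ord.
have inj : {in s &, injective fl}.
  move=> x y xs ys e; apply: contrapT => /eqP xy.
  have := sep x y xs ys xy; rewrite leNgt => /negP; apply.
  have := flP x xs; have := flP y ys; rewrite -e -!natr1.
  rewrite !ler_pdivlMr // !ltr_pdivrMr // mulrDl mul1r ltr_norml.
  move: ((fl x)%:R * g) => k; ord.
have le : (size s <= (Num.truncn g^-1).+1)%N.
  rewrite -(size_map fl) -(size_iota 0 (Num.truncn g^-1).+1).
  apply: uniq_leq_size; first by rewrite map_inj_in_uniq.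
  move=> _ /mapP[x xs ->]; rewrite mem_iota add0n ltnS; apply: le_truncn.
  by rewrite ler_pdivrMr // mulVf ?gt_eqF //; have := sI x xs; ord.
have g1 : 0 <= g^-1 by rewrite invr_ge0 ltW.
have /andP[h _] := truncn_itv g1.
apply: (@le_trans _ _ (Num.truncn g^-1).+1%:R); first by rewrite ler_nat.
by rewrite -natr1 lerD2r.
Qed.

Variables (f : R -> R) (C : seq R) (lam : R) (phi : R -> R).
Hypotheses (P : pmt f C) (M : model f lam phi).

Let lam1 : 1 < lam := sqrt2_gt1 (md_lam M) (model_sqrt2 P M).
Let lam0 : 0 < lam := lt_trans ltr01 lam1.

Let nd x y := @md_nd R f lam phi x y M.
Let phI x := @md_I R f lam phi x M.

(** One step of [f] expands model distances at most by [lam], so points that separate before time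
    [n] have model distance at least [e' / lam ^ n] at the start. *)
Lemma sep_number_le e : 0 < e ->
  exists2 K : R, 1 <= K & forall n, (sep_number f n e <= (K * lam ^+ n)%:E)%E.
Proof.
move=> e0; have [e' e'0 he'] := inc_small (md_inc M) e0.
have sep_phi x y : 0 <= x <= 1 -> 0 <= y <= 1 -> e < `|x - y| -> e' <= `|phi x - phi y|.
  wlog xy : x y / x < y.
    move=> H xI yI; have [l|l|->] := ltgtP x y; first exact: H.
      by rewrite distrC [`|phi x - _|]distrC; apply: H.
    by rewrite subrr normr0; ord.
  move=> xI yI; rewrite distrC gtr0_norm ?subr_gt0 // => exy.
  rewrite distrC ger0_norm ?subr_ge0 ?nd //; try ord.
  rewrite leNgt; apply/negP => h; have := he' x y lr xy lr h; ord.
have e'' : 0 <= e'^-1 by rewrite invr_ge0 ltW.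
exists (e'^-1 + 1); first ord.
move=> n; apply: ge_ereal_sup => _ [s [us sI sep] <-]; rewrite lee_fin.
have L1 : 1 <= lam ^+ n by rewrite exprn_ege1 // ltW.
have L0 : 0 < lam ^+ n by rewrite exprn_gt0.
have sI' x : x \in s -> 0 <= x <= 1 by move=> /sI; rewrite /unit_itv /= in_itv.
apply: (@le_trans _ _ ((e' / lam ^+ n)^-1 + 1)); last first.
  by rewrite invf_div mulrDl mul1r lerD // mulrC.
apply: (@spaced_size phi); [by rewrite divr_gt0|by []|by move=> x /sI'/phI|].
move=> x y xs ys xy; have [k kn hk] := sep x y xs ys xy.
have xI := sI' x xs; have yI := sI' y ys.
rewrite ler_pdivrMr //.
have h1 := sep_phi _ _ (iterI P k xI) (iterI P k yI) hk.
apply: le_trans h1 _; rewrite mulrC.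
apply: le_trans (conf_lip_iter P (md_lam M) (md_conf M) nd k yI xI) _.
by rewrite ler_wpM2r // ler_weXn2l ?(ltW lam1) // ltnW.
Qed.

Lemma sep_number_ge0 n e : (0 <= sep_number f n e)%E.
Proof. by apply: ereal_sup_ubound; exists [::]. Qed.

Lemma entropy_le : (entropy f <= (ln lam)%:E)%E.
Proof.
apply: ge_ereal_sup => _ [e /= e0 <-]; apply/lee_addgt0Pr => /= r r0.
have [K K1 hK] := sep_number_le e0.
apply: limn_esup_ub.
have h0 : 0 <= ln K / r by rewrite divr_ge0 ?ln_ge0 // ltW.
exists (Num.bound (ln K / r)).+1 => n hn.
have n0 : (0 : R) < n%:R by rewrite ltr0n; apply: leq_trans hn.
have L0 : 0 < K * lam ^+ n by rewrite mulr_gt0 ?exprn_gt0 //; ord.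
apply: (@le_trans _ _ (n%:R^-1%:E * (ln (K * lam ^+ n))%:E)%E).
  rewrite lee_wpmul2l ?lee_fin ?invr_ge0 ?(ltW n0) // -lne_EFin //.
  rewrite lee_lne ?hK // in_itv /= ?leey ?andbT ?sep_number_ge0 //.
  by rewrite lee_fin ltW.
rewrite -EFinM -EFinD lee_fin lnM ?posrE ?exprn_gt0 //; last ord.
rewrite lnXn // -[ln lam *+ n]mulr_natr mulrDr mulrC [X in _ + X]mulrC mulfK ?gt_eqF //.
rewrite addrC lerD2l ler_pdivrMr // mulrC -ler_pdivrMr //.
apply: (le_trans (ltW (archi_boundP h0))); rewrite ler_nat; exact: ltnW.
Qed.

(* [k] iterates stretch an interval of phi-length D to length 2 N D, whose
   even-numbered subintervals of length D are pairwise separated. *)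
Definition sepd m e s :=
  {in s &, forall x y, x != y -> exists2 j, (j < m)%N & e < `|iter j f x - iter j f y|}.

Lemma phi_IVT t : 0 <= t <= 1 -> exists2 x : R, 0 <= x <= 1 & phi x = t.
Proof.
move=> tI; have [||||x xI fx] := @ctsI_IVT R phi 0 1 t (md_cts M); [ord|ord|ord| |by exists x].
by left; rewrite (md_0 M) (md_1 M).
Qed.

Lemma phi_le_inv x y : 0 <= x <= 1 -> 0 <= y <= 1 -> phi x <= phi y -> x <= y.
Proof.
move=> xI yI h; rewrite leNgt; apply/negP => l.
by have := md_inc M (x := y) (y := x) lr l lr; ord.
Qed.

(** Pieces of length [D] alternate with gaps of length [D], so points of different pieces are
    separated already at time 0. *)
Lemma merge_pieces N D e m B c : 0 < D -> 0 < e -> (0 < m)%N -> 0 <= c <= 1 ->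
  (forall x y, 0 <= x <= 1 -> 0 <= y <= 1 -> D <= phi y - phi x -> e < `|x - y|) ->
  (forall a b, 0 <= a -> a < b -> b <= 1 -> phi b - phi a = D ->
     exists s, [/\ uniq s, (forall x, x \in s -> a <= x <= b), sepd m e s & (B <= size s)%N]) ->
  phi c + 2 * N%:R * D <= 1 ->
  exists s, [/\ uniq s, (forall x, x \in s -> c <= x <= 1 /\ phi x <= phi c + 2 * N%:R * D - D),
     sepd m e s & (N * B <= size s)%N].
Proof.
move=> D0 e0 m0 cI he H; elim: N => [|N IH] hN; first by exists [::].
have N0 : (0 : R) <= N%:R by exact: ler0n.
have ND : 0 <= N%:R * D by rewrite mulr_ge0 // ltW.
have pc := phI cI.
rewrite -natr1 in hN *.
have [s [us sI ss szs]] := IH ltac:(ord).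
have [a aI pa] := @phi_IVT (phi c + 2 * N%:R * D) ltac:(ord).
have [b bI pb] := @phi_IVT (phi c + 2 * N%:R * D + D) ltac:(ord).
have ab : a < b.
  by rewrite ltNge; apply/negP => l; have := nd (x := b) (y := a) lr l lr; ord.
have [s' [us' sI' ss' szs']] := H a b lr ab lr ltac:(ord).
have far x y : x \in s -> y \in s' -> e < `|x - y|.
  move=> xs ys; have [xc xp] := sI x xs; have yab := sI' y ys.
  have := @nd a y ltac:(ord) ltac:(ord) ltac:(ord) => ay.
  by apply: he; ord.
exists (s ++ s'); split.
- rewrite cat_uniq us us' andbT; apply/hasPn => y ys'; apply/negP => ys.
  by have := far y y ys ys'; rewrite subrr normr0; ord.
- move=> x; rewrite mem_cat => /orP[/sI|/sI' xab]; first ord.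
  have := @nd x b ltac:(ord) ltac:(ord) ltac:(ord).
  have := @phi_le_inv c a cI aI ltac:(ord); ord.
- move=> x y; rewrite !mem_cat => /orP[xs|xs] /orP[ys|ys] xy.
  + exact: ss.
  + by exists 0%N => //; apply: far.
  + by exists 0%N => //; rewrite distrC; apply: far.
  + exact: ss'.
- by rewrite size_cat mulSn addnC leq_add.
Qed.

Lemma pull_back k u v m e s : 0 <= u -> u <= v -> v <= 1 -> uniq s -> sepd m e s ->
  (forall y, y \in s -> iter k f u <= y <= iter k f v \/ iter k f v <= y <= iter k f u) ->
  exists s', [/\ uniq s', (forall x, x \in s' -> u <= x <= v), sepd (k + m) e s' &
    size s' = size s].
Proof.
move=> u0 uv v1 us ss H.
have kc := ctsI_iter k (pm_self P) (pm_cts P).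
have g' y : exists x : R, y \in s -> u <= x <= v /\ iter k f x = y.
  case ys: (y \in s); last by exists 0.
  have [x xI fx] := ctsI_IVT kc u0 uv v1 (H y ys).
  by exists x => _.
have [g gP] := choice g'.
exists (map g s); split.
- rewrite map_inj_in_uniq // => x y xs ys e1.
  by rewrite -(gP x xs).2 -(gP y ys).2 e1.
- by move=> _ /mapP[y ys ->]; have [] := gP y ys.
- move=> _ _ /mapP[x xs ->] /mapP[y ys ->] xy.
  have nxy : x != y by apply: contra_neq xy => ->.
  have [j jm hj] := ss x y xs ys nxy.
  exists (j + k)%N; first by rewrite addnC ltn_add2l.
  by rewrite !iterD (gP x xs).2 (gP y ys).2.
- by rewrite size_map.
Qed.

Lemma stretched k N D a b z : 4 * N%:R <= lam ^+ k -> 0 < D -> 0 <= a -> a < b -> b <= 1 ->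
  phi b - phi a = D -> a <= z <= b -> chain f k a z -> chain f k z b ->
  exists u v c c', [/\ [/\ 0 <= u, u < v, v <= 1, a <= u & v <= b], 0 <= c <= 1, 0 <= c' <= 1,
    phi c + 2 * N%:R * D <= phi c' &
    forall y, c <= y <= c' -> iter k f u <= y <= iter k f v \/ iter k f v <= y <= iter k f u].
Proof.
move=> hN D0 a0 ab b1 pab zI c1 c2.
have [u [v [uv au vb cuv puv]]] : exists u v, [/\ u < v, a <= u, v <= b, chain f k u v & D / 2 <= phi v - phi u].
  (* One of the two chains carries at least half of the length [D]; stretched by [4 * N] it has
     length [2 * N * D]. *)
  have [h|h] := leP (D / 2) (phi z - phi a).
    exists a, z; split => //; try ord.
    have [e|//] : a = z \/ a < z by ord.
    by move: h; rewrite e; ord.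
  exists z, b; split => //; try ord.
  have [e|//] : b = z \/ z < b by ord.
  by move: h; rewrite -e; ord.
have u0 : 0 <= u by ord.
have v1 : v <= 1 by ord.
have cc := conf_chain lam0 (md_conf M) (md_inc M) u0 uv v1 cuv.
have uI := iterI P k (x := u) lr; have vI := iterI P k (x := v) lr.
have N1 : (0 : R) <= N%:R by exact: ler0n.
have ND : 2 * N%:R * D <= `|phi (iter k f v) - phi (iter k f u)|.
  rewrite cc; apply: (@le_trans _ _ (4 * N%:R * (D / 2))); first ord.
  by apply: ler_pM => //; ord.
have [c [c' [cI cI' pc hc]]] : exists c c', [/\ 0 <= c <= 1, 0 <= c' <= 1, phi c + 2 * N%:R * D <= phi c' &
    forall y, c <= y <= c' -> iter k f u <= y <= iter k f v \/ iter k f v <= y <= iter k f u].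
  move: ND; have [h|h] := leP (iter k f u) (iter k f v).
    exists (iter k f u), (iter k f v); split => //; last by left.
    have := nd (x := iter k f u) (y := iter k f v) lr h lr => h'.
    by move: ND; rewrite ger0_norm; ord.
  exists (iter k f v), (iter k f u); split => //; last by right.
  have := nd (x := iter k f v) (y := iter k f u) lr (ltW h) lr => h'.
  by move: ND; rewrite ler0_norm; ord.
by exists u, v, c, c'.
Qed.

(** Every block of [k] iterates multiplies the number of separated points by [N]; the additional
    step is the one in which the last images are compared. *)
Lemma many_separated k N : (0 < N)%N -> 4 * N%:R <= lam ^+ k ->
  exists2 e, 0 < e & forall n, exists s,
    [/\ uniq s, (forall x, x \in s -> 0 <= x <= 1), sepd (k * n + 1) e s & (N ^ n <= size s)%N].
Proof.
move=> N0 hN.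
have [d d0 hd] := two_chains P k.
have [D1 D10 hD] := inc_small (md_inc M) d0.
pose D := Num.min (D1 / 2) 1.
have D0 : 0 < D by rewrite lt_min ltr01 andbT divr_gt0.
have DD1 : D <= D1 / 2 by rewrite ge_min lexx.
have D11 : D <= 1 by rewrite ge_min lexx orbT.
have [e2 e20 he2] := ctsI_unif (md_cts M) D0.
have he x y : 0 <= x <= 1 -> 0 <= y <= 1 -> D <= phi y - phi x -> e2 / 2 < `|x - y|.
  move=> xI yI h; rewrite ltNge; apply/negP => h'.
  have := he2 x y xI yI; rewrite distrC => /(_ ltac:(ord)).
  by have := ler_norm (phi y - phi x); ord.
exists (e2 / 2); first ord.
suff Q n : forall a b, 0 <= a -> a < b -> b <= 1 -> phi b - phi a = D -> exists s,
    [/\ uniq s, (forall x, x \in s -> a <= x <= b), sepd (k * n + 1) (e2 / 2) s & (N ^ n <= size s)%N].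
  move=> n; have [b bI pb] := @phi_IVT D ltac:(ord).
  have b0 : 0 < b.
    have [e|//] : b = 0 \/ 0 < b by ord.
    by move: pb; rewrite e (md_0 M); ord.
  have [s [us sI ss hs]] := Q n 0 b lr b0 lr ltac:(rewrite (md_0 M); ord).
  by exists s; split => // x /sI; ord.
elim: n => [|n IH] a b a0 ab b1 pab.
  exists [:: a]; split => //; first by move=> x; rewrite inE => /eqP->; ord.
  by move=> x y; rewrite !inE => /eqP-> /eqP->; rewrite eqxx.
have [z zI [c1 c2]] := hd a b a0 ab b1 (hD a b a0 ab b1 ltac:(ord)).
have [u [v [c [c' [[u0 uv v1 au vb] cI cI' pc hc]]]]] := stretched hN D0 a0 ab b1 pab zI c1 c2.
have pc1 := phI cI'.
have [s [us sI ss hs]] := @merge_pieces N D (e2 / 2) (k * n + 1) (N ^ n) c D0 ltac:(ord)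
  ltac:(by rewrite addn1) cI he IH ltac:(ord).
have [s' [us' sI' ss' hs']] := @pull_back k u v _ _ s ltac:(ord) ltac:(ord) ltac:(ord) us ss
  ltac:(move=> y /sI [yI py]; apply: hc; have := @phi_le_inv y c' ltac:(ord) cI' ltac:(ord); ord).
exists s'; split => //.
- by move=> x /sI'; ord.
- by rewrite mulnS -addnA.
- by rewrite hs' expnS.
Qed.

Lemma entropy_ge_k k N : (0 < k)%N -> (0 < N)%N -> 4 * N%:R <= lam ^+ k ->
  ((ln N%:R / k%:R)%:E <= entropy f)%E.
Proof.
move=> k0 N0 hN; have [e e0 he] := many_separated N0 hN.
apply: (@le_trans _ _ (limn_esup
      (fun n : nat => ((n%:R^-1)%:E * lne (sep_number f n e))%E))); last first.
  by apply: ereal_sup_ubound; exists e.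
have NR : (1 : R) <= N%:R by rewrite ler1n.
have lN : 0 <= ln (N%:R : R) by apply: ln_ge0.
apply/lee_subgt0Pr => /= r r0.
apply: limn_esup_lb => B.
pose n := (Num.bound (ln (N%:R : R) / (r * k%:R)) + B)%N.
have kR : (1 : R) <= k%:R by rewrite ler1n.
have nB : ln (N%:R : R) / (r * k%:R) <= n%:R.
  have h0 : 0 <= ln (N%:R : R) / (r * k%:R) by rewrite divr_ge0 // mulr_ge0 //; ord.
  by apply: (le_trans (ltW (archi_boundP h0))); rewrite ler_nat leq_addr.
exists (k * n + 1)%N.
  apply: (@leq_trans n); first exact: leq_addl.
  by rewrite addn1 leqW // leq_pmull.
have [s [us sI ss hs]] := he n.
have Nn : (0 : R) < N%:R ^+ n by rewrite exprn_gt0 //; ord.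
have hsep : ((N%:R ^+ n)%:E <= sep_number f (k * n + 1) e)%E.
  apply: (@le_trans _ _ (size s)%:R%:E); first by rewrite lee_fin -natrX ler_nat.
  apply: ereal_sup_ubound; exists s => //; split => // x /sI.
have kn : (0 : R) < (k * n + 1)%:R by rewrite ltr0n addn1.
apply: (@le_trans _ _ ((k * n + 1)%:R^-1%:E * (ln (N%:R ^+ n : R))%:E)%E); last first.
  rewrite lee_wpmul2l ?lee_fin ?invr_ge0 ?(ltW kn) // -lne_EFin //.
  rewrite lee_lne // in_itv /= ?leey ?andbT ?sep_number_ge0 //.
rewrite -EFinM -EFinB lee_fin lnXn; last exact: lt_le_trans ltr01 NR.
rewrite [X in _ <= X]mulrC ler_pdivlMr // natrD natrM mulrBl -[ln _ *+ n]mulr_natr.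
have -> : ln N%:R / k%:R * (k%:R * n%:R + 1) = ln N%:R * n%:R + ln (N%:R : R) / k%:R.
  by field; rewrite gt_eqF // (lt_le_trans ltr01 kR).
have h1 : ln (N%:R : R) / k%:R <= r * n%:R.
  have -> : ln (N%:R : R) / k%:R = r * (ln (N%:R : R) / (r * k%:R)).
    by field; rewrite !gt_eqF // (lt_le_trans ltr01 kR).
  by rewrite ler_pM2l.
have h2 : r * n%:R <= r * (k%:R * n%:R + 1).
  rewrite ler_pM2l // (le_trans (ler_peMl (ler0n _ n) kR)) // lerDl //.
by rewrite -addrA gerDl subr_le0 (le_trans h1).
Qed.

(** With [N] the integer part of [lam ^ k / 4] the lower bound falls short of [ln lam] by at most
    [ln 8 / k]; the passage from 4 to 8 absorbs the rounding. *)
Lemma entropy_ge : ((ln lam)%:E <= entropy f)%E.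
Proof.
apply/lee_subgt0Pr => /= r r0; rewrite -EFinB.
have l8 : 0 <= ln (8 : R) by apply: ln_ge0; ord.
have [k1 hk1] := expn_unbounded 8 lam1.
pose k := ((Num.bound (ln (8 : R) / r)).+1 + k1)%N.
have kR : (1 : R) <= k%:R by rewrite ler1n.
have hk : 8 <= lam ^+ k.
  by apply: (le_trans (ltW hk1)); rewrite ler_weXn2l ?(ltW lam1) // leq_addl.
have kb : ln (8 : R) / r <= k%:R.
  have h0 : 0 <= ln (8 : R) / r by rewrite divr_ge0 // ltW.
  apply: (le_trans (ltW (archi_boundP h0))); rewrite ler_nat /k; lia.
pose N := Num.truncn (lam ^+ k / 4).
have /andP[hN1 hN2] : N%:R <= lam ^+ k / 4 < N.+1%:R.
  by apply: truncn_itv; rewrite divr_ge0 // exprn_ge0 // ltW.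
have N8 : lam ^+ k / 8 <= N%:R.
  by move: hN2; rewrite -[N.+1%:R]natr1; move/quarter => -> //.
have N0 : (0 < N)%N.
  by rewrite -(@ltr_nat R); apply: lt_le_trans N8; rewrite divr_gt0 // exprn_gt0.
have N4 : 4 * N%:R <= lam ^+ k by rewrite mulrC -ler_pdivlMr.
have := @entropy_ge_k k N isT N0 N4; apply: le_trans; rewrite lee_fin.
have L0 : 0 < lam ^+ k by exact: exprn_gt0.
rewrite ler_pdivlMr; last exact: lt_le_trans ltr01 kR.
apply: (@le_trans _ _ (ln (lam ^+ k / 8))); last first.
  by rewrite ler_ln // ?posrE ?divr_gt0 // ltr0n.
rewrite ln_div ?posrE // lnXn // -[ln lam *+ k]mulr_natr mulrBl lerD2l lerN2.
by rewrite mulrC -ler_pdivrMr.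
Qed.

Theorem entropy_model : entropy f = (ln lam)%:E.
Proof. by apply/eqP; rewrite eq_le entropy_le entropy_ge. Qed.

End entropy.

(** Minimal ratios compare models of equal slope only; the entropy, defined without reference to
    models, identifies the slopes. *)
Lemma model_lam_unique (R : realType) (f : R -> R) C (lam lam' : R) phi psi : pmt f C ->
  model f lam phi -> model f lam' psi -> lam = lam'.
Proof.
move=> P M M'; apply: ln_inj; rewrite ?posrE.
- by apply: lt_trans ltr01 _; apply: sqrt2_gt1 (md_lam M) (model_sqrt2 P M).
- by apply: lt_trans ltr01 _; apply: sqrt2_gt1 (md_lam M') (model_sqrt2 P M').
- by apply: EFin_inj; rewrite -(entropy_model P M) (entropy_model P M').
Qed.

(** * The operator in terms of models *)

Section local_monotonicity.
Variable R : realType.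
Implicit Types (x y z w a b c d e p q u v s t lam : R) (g : R -> R) (C : seq R).
Variable f : R -> R.
Hypotheses (fI : selfI f) (fc : ctsI f).
Hypothesis tr : forall a b c d, 0 <= a -> a < b -> b <= 1 ->
    0 <= c -> c < d -> d <= 1 ->
    exists2 n, (0 < n)%N & exists2 x : R, a < x < b & c < iter n f x < d.

(** A plateau is sent to one point. As it returns to itself, that point is periodic, and the finite
    orbit misses an interval next to 0 that transitivity requires it to visit. *)
Lemma tr_plateau x y v : 0 <= x -> x < y -> y <= 1 -> exists2 z : R, x < z < y & f z <> v.
Proof.
move=> x0 xy y1; apply: contrapT => H.
have fv z : x < z < y -> f z = v by move=> zI; apply: contrapT => h; apply: H; exists z.
have [[//|n] _ [z zI hz]] := tr x0 xy y1 x0 xy y1.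
rewrite iterSr (fv z zI) in hz.
have per j : iter (n.+1 + j) f v = iter j f v.
  by rewrite addnC iterD iterS (fv _ hz).
pose O := [seq iter j f v | j <- iota 0 n.+1].
have inO j : iter j f v \in O.
  rewrite (divn_eq j n.+1); elim: (j %/ n.+1)%N => [|q IH].
    by rewrite mul0n add0n; apply/mapP; exists (j %% n.+1)%N; rewrite // mem_iota add0n ltn_mod.
  by rewrite mulSn -addnA per.
have [d d0 hd] := gap_seq O 0.
have [[//|j] _ [t tI ht]] := tr x0 xy y1 (lexx 0) (d := Num.min d 1) ltac:(rewrite lt_min d0 ltr01 //)
  ltac:(by rewrite ge_min lexx orbT).
rewrite iterSr (fv t tI) lt_min in ht; have /andP[h1 /andP[h2 h3]] := ht.
have := hd _ (inO j) ltac:(by rewrite gt_eqF); rewrite subr0 gtr0_norm //; ord.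
Qed.

Definition locmono x := exists2 d : R, 0 < d &
  (forall a b, 0 <= a -> b <= 1 -> x - d < a -> a <= b -> b < x + d -> f a <= f b) \/
  (forall a b, 0 <= a -> b <= 1 -> x - d < a -> a <= b -> b < x + d -> f b <= f a).

(** Two equal values give an extremum in between, and local monotonicity at an extremum makes [f]
    constant on one side of it. *)
Lemma locmono_inj x y : 0 <= x -> y <= 1 ->
  (forall z, x < z < y -> locmono z) -> forall a b, x <= a -> a < b -> b <= y -> f a <> f b.
Proof.
move=> x0 y1 H a b xa ab yb e.
have noext c v : a < c < b -> f c = v ->
    (forall t, a <= t <= b -> f t <= v) \/ (forall t, a <= t <= b -> v <= f t) -> False.
  move=> cI <- hm; have [d d0 h] := H c lr.
  pose r := Num.min d (Num.min (c - a) (b - c)).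
  have r0 : 0 < r by rewrite !lt_min d0 !subr_gt0.
  have [rd ra rb] : [/\ r <= d, r <= c - a & r <= b - c].
    by split; rewrite /r !ge_min lexx ?orbT.
  clearbody r.
  have [h1|h1] : (forall t, c < t < c + r -> f t = f c) \/ (forall t, c - r < t < c -> f t = f c).
    case: hm => hm; case: h => h.
    - left => t tI; apply/eqP; rewrite eq_le hm ?h //; ord.
    - right => t tI; apply/eqP; rewrite eq_le hm ?h //; ord.
    - right => t tI; apply/eqP; rewrite eq_le hm ?h //; ord.
    - left => t tI; apply/eqP; rewrite eq_le hm ?h //; ord.
  + by have [z zI] := @tr_plateau c (c + r) (f c) lr lr lr; apply; apply: h1.
  + by have [z zI] := @tr_plateau (c - r) c (f c) lr lr lr; apply; apply: h1.
have [z zI fz] := @tr_plateau a b (f a) lr lr lr.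
have [h|h|//] := ltgtP (f z) (f a).
- have [c cI cm] := @ctsI_min R f a b fc lr lr lr.
  have cz := cm z lr.
  have [ca|[cb|cc]] : c = a \/ (c = b \/ a < c < b) by ord.
  + by move: cz; rewrite ca; ord.
  + by move: cz; rewrite cb -e; ord.
  + by apply: (noext c (f c)) => //; right.
- have [c cI cm] := @ctsI_max R f a b fc lr lr lr.
  have cz := cm z lr.
  have [ca|[cb|cc]] : c = a \/ (c = b \/ a < c < b) by ord.
  + by move: cz; rewrite ca; ord.
  + by move: cz; rewrite cb -e; ord.
  + by apply: (noext c (f c)) => //; left.
Qed.

Lemma locmono_smono x y : 0 <= x -> x < y -> y <= 1 ->
  (forall z, x < z < y -> locmono z) -> smono f x y.
Proof.
move=> x0 xy y1 H; have inj := locmono_inj x0 y1 H.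
have fw := ctsI_within fc x0 y1.
have ij : {in `[x, y] &, injective f}.
  move=> a b; rewrite !in_itv /= => aI bI e.
  by have [l|l|//] := ltgtP a b; exfalso; [apply: (inj a b)|apply: (inj b a)] => //; ord.
have [h|h] := itv_continuous_inj_mono fw ij.
  left => a b xa ab yb; apply: (h a b) => //; rewrite in_itv /=; ord.
right => a b xa ab yb; apply: (h b a) => //; rewrite in_itv /=; ord.
Qed.

End local_monotonicity.

Section dictionary.
Variable R : realType.
Implicit Types (x y z w a b c d e p q u v s t lam : R) (f g : tmap R) (C : seq R).

Lemma within_ctsI (f : R -> R) : {within unit_itv R, continuous f} -> ctsI f.
Proof.
move=> /subspace_continuousP fc x xI e e0.
have Ix : unit_itv R x by rewrite /unit_itv /= in_itv.
have := fc x Ix => /cvgrPdist_lt /(_ e e0); rewrite near_withinE => -[d /= d0 hd].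
exists d => // y yI yx; rewrite distrC; apply: hd; first by rewrite /= distrC.
by rewrite /unit_itv /= in_itv.
Qed.

Lemma tmap_selfI f : selfI f.
Proof. by move=> x xI; have := @tmap_itv R f x; rewrite /unit_itv /= !in_itv => /(_ xI). Qed.

Lemma open_itv (U : set R) x : nbhs x U -> 0 <= x <= 1 ->
  exists a b, [/\ 0 <= a, a < b, b <= 1 & forall t, a < t < b -> U t].
Proof.
move=> [d /= d0 hd] xI.
pose a := Num.max 0 (x - d); pose b := Num.min 1 (x + d).
have [h1 h2] : 0 <= a /\ x - d <= a by rewrite /a !le_max !lexx orbT.
have [h3 h4] : b <= 1 /\ b <= x + d by rewrite /b !ge_min !lexx orbT.
exists a, b; split => //.
  by rewrite /a /b gt_max !lt_min ltr01; ord.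
move=> t tI; apply: hd; rewrite /= ltr_norml; ord.
Qed.

Lemma tr_of (f : R -> R) : transitive_map f -> forall a b c d, 0 <= a -> a < b -> b <= 1 ->
    0 <= c -> c < d -> d <= 1 ->
    exists2 n, (0 < n)%N & exists2 x : R, a < x < b & c < iter n f x < d.
Proof.
move=> tr a b c d a0 ab b1 c0 cd d1.
have ne u v : 0 <= u -> u < v -> v <= 1 -> `]u, v[ `&` unit_itv R !=set0.
  move=> u0 uv v1; exists ((u + v) / 2); rewrite /unit_itv /= !in_itv /=; ord.
have [n n0 [_ [[x [xab _] <-]]]] := tr `]a, b[%classic `]c, d[%classic (itv_open _ _) (itv_open _ _) (ne a b a0 ab b1) (ne c d c0 cd d1).
by move: xab; rewrite /= !in_itv => xab h; exists n => //; exists x.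
Qed.

Lemma nCrit_locmono (f : R -> R) x : 0 <= x <= 1 -> ~ Crit f x -> locmono f x.
Proof.
move=> xI nC.
have [U [d /= d0 hd] mU] : exists2 U : set R, nbhs x U & monotone_on (U `&` unit_itv R) f.
  by apply: contrapT => h; apply: nC; right.
exists d => //; have mem a : 0 <= a <= 1 -> x - d < a < x + d -> a \in U `&` unit_itv R.
  move=> aI ad; rewrite inE; split; last by rewrite /unit_itv /= in_itv.
  by apply: hd; rewrite /= ltr_norml; ord.
case: mU => h; [left|right] => a b a0 b1 xa ab bx; apply: h => //; apply: mem; ord.
Qed.

Lemma locmono_nCrit (f : R -> R) x : 0 < x < 1 -> locmono f x -> ~ Crit f x.
Proof.
move=> xI [d d0 h] [[e|e]|[_ nm]]; try (move: xI; rewrite e; ord).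
apply: nm; exists (ball x d); first exact: nbhsx_ballx.
have aux a : a \in ball x d `&` unit_itv R -> x - d < a < x + d /\ 0 <= a <= 1.
  by rewrite inE /unit_itv /= in_itv /= => -[]; rewrite /ball /= ltr_norml; ord.
case: h => h; [left|right] => a b /aux[aI aI'] /aux[bI bI'] ab; apply: h => //; ord.
Qed.

Lemma smono_locmono (f : R -> R) x a b : a < x < b -> smono f a b -> locmono f x.
Proof.
move=> xI H; exists (Num.min (x - a) (b - x)); first by rewrite lt_min !subr_gt0.
have m1 : Num.min (x - a) (b - x) <= x - a by rewrite ge_min lexx.
have m2 : Num.min (x - a) (b - x) <= b - x by rewrite ge_min lexx orbT.
case: H => h; [left|right] => u v u0 v1 xu; rewrite le_eqVlt => /orP[/eqP->//|uv] vx;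
  apply/ltW/h => //; ord.
Qed.

Definition turning f := finmap.enum_fset (fset_set (Crit f `&` `]0, 1[%classic)).

Lemma turningP f c : reflect (0 < c < 1 /\ Crit f c) (c \in turning f).
Proof.
have fin : finite_set (Crit f `&` `]0, 1[%classic).
  exact: (sub_finite_set (@subIsetl _ _ _) (tmap_pwm f)).
have e : (c \in turning f) = (c \in Crit f `&` `]0, 1[%classic) by exact: in_fset_set.
rewrite e; apply: (iffP idP); first by rewrite inE => -[hc]; rewrite /= in_itv.
by move=> [cI hc]; rewrite inE; split => //; rewrite /= in_itv.
Qed.

(** Both germs at a turning point are strictly monotone; if they had the same direction, the point
    would not be in [Crit f]. *)
Lemma tmap_pmt f : pmt f (turning f).
Proof.
have fI := @tmap_selfI f; have fc := within_ctsI (@tmap_cont R f).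
have tr := tr_of (@tmap_transitive R f).
have mono x y : 0 <= x -> x < y -> y <= 1 ->
    (forall c, c \in turning f -> ~~ (x < c < y)) -> smono f x y.
  move=> x0 xy y1 H; apply: locmono_smono => // z zI.
  apply: nCrit_locmono; first ord.
  move=> hz; have zC : z \in turning f by apply/turningP; split => //; ord.
  by have := H z zC; rewrite zI.
split => //; first exact: finmap.fset_uniq.
move=> c /turningP[cI cC].
(* Adding 0 and 1 to the list keeps the neighbourhood of [c] inside [0,1]. *)
have [d d0 hd] := gap_seq [:: 0, 1 & turning f] c.
have near z : z \in turning f -> z != c -> d <= `|z - c|.
  by move=> h; apply: hd; rewrite !inE h !orbT.
have dc : d <= c.
  have h0 : (0 : R) \in [:: 0, 1 & turning f] by rewrite !inE eqxx.
  by have := hd 0 h0 ltac:(by rewrite lt_eqF; ord); rewrite sub0r normrN gtr0_norm; ord.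
have dc' : d <= 1 - c.
  have h1 : (1 : R) \in [:: 0, 1 & turning f] by rewrite !inE eqxx orbT.
  by have := hd 1 h1 ltac:(by rewrite gt_eqF; ord); rewrite gtr0_norm; ord.
have hl : smono f (c - d) c.
  apply: mono; try ord.
  move=> z zC; apply/negP => zI; have := near z zC ltac:(by rewrite lt_eqF; ord).
  by rewrite ltr0_norm; ord.
have hr : smono f c (c + d).
  apply: mono; try ord.
  move=> z zC; apply/negP => zI; have := near z zC ltac:(by rewrite gt_eqF; ord).
  by rewrite gtr0_norm; ord.
exists d => //; split; try ord.
case: hl => hl; case: hr => hr; [|by left|by right|].
- exfalso; apply: (@locmono_nCrit f c cI) => //; apply: (@smono_locmono f c (c - d) (c + d)); first ord.
  left => x y xd xy yd; have [h|h] := leP y c; first by apply: hl; ord.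
  have [h'|h'] := leP c x; first by apply: hr; ord.
  by apply: (@lt_trans _ _ (f c)); [apply: hl; ord|apply: hr; ord].
- exfalso; apply: (@locmono_nCrit f c cI) => //; apply: (@smono_locmono f c (c - d) (c + d)); first ord.
  right => x y xd xy yd; have [h|h] := leP y c; first by apply: hl; ord.
  have [h'|h'] := leP c x; first by apply: hr; ord.
  by apply: (@lt_trans _ _ (f c)); [apply: hr; ord|apply: hl; ord].
Qed.

Lemma size_turning m f : T_ R m f -> size (turning f) = m.
Proof. exact: card_fset_set. Qed.

Lemma homeo01 (psi phi : R -> R) : increasing_homeo psi phi -> psi 0 = 0 /\ psi 1 = 1.
Proof.
move=> H; have I0 : unit_itv R 0 by rewrite /unit_itv /= in_itv /=; ord.
have I1 : unit_itv R 1 by rewrite /unit_itv /= in_itv /=; ord.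
have p0 := ih_itvV H I0; have p1 := ih_itvV H I1.
have q0 := ih_itv H I0; have q1 := ih_itv H I1.
have := homeo_le H (mem_set I0) (mem_set p0); rewrite (ih_VK H) ?inE //.
have := homeo_le H (mem_set p1) (mem_set I1); rewrite (ih_VK H) ?inE //.
by move: p0 p1 q0 q1; rewrite /unit_itv /= !in_itv /=; ord.
Qed.

Lemma slope_smono (g : R -> R) lam u v : constant_slope lam g -> ctsI g -> 0 <= u -> u < v -> v <= 1 ->
  smono g u v -> `|g v - g u| = lam * (v - u).
Proof.
move=> cs gc u0 uv v1 hm.
have loc x : x \in `]u, v[ -> derivable g x 1 /\ `|derive1 g x| = lam.
  rewrite in_itv /= => xI; apply: cs; first by rewrite /unit_itv /= in_itv /=; ord.
  by apply: locmono_nCrit; [ord|apply: smono_locmono hm].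
have [|c cI ->] := @MVT R g (derive1 g) u v uv _ (ctsI_within gc u0 v1).
  by move=> x xI; rewrite derive1E; apply: derivableP; have [] := loc x xI.
by rewrite normrM (loc c cI).2 gtr0_norm // subr_gt0.
Qed.

Lemma slope_model_model f g : slope_model f g -> exists lam phi, model f lam phi /\
  forall x, 0 <= x <= 1 -> g (phi x) = phi (f x).
Proof.
move=> [[lam cs] [psi [phi [H fE]]]].
have II x : 0 <= x <= 1 -> unit_itv R x by rewrite /unit_itv /= in_itv.
have gI := @tmap_selfI g; have gc := within_ctsI (@tmap_cont R g).
have phI x : 0 <= x <= 1 -> 0 <= phi x <= 1.
  by move=> /II/(ih_itvV H); rewrite /unit_itv /= in_itv.
have H' := homeo_inv H; have [p0 p1] := homeo01 H'.
have pinc : inc phi 0 1.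
  by move=> x y x0 xy y1; apply: (ih_lt H') => //; rewrite inE; apply: II; ord.
have gphi x : 0 <= x <= 1 -> phi (f x) = g (phi x).
  by move=> xI; rewrite fE ?(ih_K H) ?inE //; apply: II => //; apply/gI/phI.
have K : conf f lam phi.
  move=> x y x0 xy y1 hm; rewrite !gphi; try ord.
  have [hx hy] := (phI x lr, phI y lr); have pxy := pinc x y x0 xy y1.
  apply: slope_smono => //; try ord.
  have pis t : phi x <= t <= phi y -> [/\ x <= psi t, psi t <= y, phi (psi t) = t & f (psi t) = psi (g t)].
    move=> tI; have It : unit_itv R t by apply: II; ord.
    have Ix : unit_itv R x by apply: II; ord.
    have Iy : unit_itv R y by apply: II; ord.
    have Ipx := ih_itvV H Ix; have Ipy := ih_itvV H Iy.
    have pt : phi (psi t) = t by rewrite (ih_K H) // inE.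
    split => //.
    - by rewrite -(ih_VK H (mem_set Ix)); apply: (homeo_le H); rewrite ?inE //; ord.
    - by rewrite -(ih_VK H (mem_set Iy)); apply: (homeo_le H); rewrite ?inE //; ord.
    - by rewrite fE ?pt //; apply: (ih_itv H).
  have gt t : phi x <= t <= phi y -> g t = phi (f (psi t)).
    by move=> tI; have [_ _ e1 ->] := pis t tI; rewrite (ih_K H) // inE; apply/II/gI; ord.
  case: hm => hm; [left|right] => s t hs st ht; rewrite !gt; try ord;
    have [a1 a2 a3 a4] := pis s lr; have [b1 b2 b3 b4] := pis t lr.
  - have fs := @tmap_selfI f (psi s) lr; have ft := @tmap_selfI f (psi t) lr.
    apply: pinc; try ord; apply: hm => //.
    by apply: (ih_lt H) => //; rewrite inE; apply: II; ord.
  - have fs := @tmap_selfI f (psi s) lr; have ft := @tmap_selfI f (psi t) lr.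
    apply: pinc; try ord; apply: hm => //.
    by apply: (ih_lt H) => //; rewrite inE; apply: II; ord.
exists lam, phi; split => [|x xI]; last by rewrite gphi.
split => //; last exact: within_ctsI (ih_contV H).
(* The sign of [lam] is read off from the scaling of a short lap starting at 0. *)
have [d d0 [d1 hd]] := smono_right (tmap_pmt f) (x := 0) lr; rewrite add0r in d1 hd.
have := K 0 d lr d0 d1 hd; have := pinc 0 d lr d0 d1.
rewrite p0 subr0 => pd e; have := normr_ge0 (phi (f d) - phi (f 0)).
by rewrite e pmulr_lge0.
Qed.

Section build_model.
Variables (f : tmap R) (lam : R) (phi : R -> R).
Hypothesis M : model f lam phi.

Let phi_lt x y : 0 <= x -> x < y -> y <= 1 -> phi x < phi y.
Proof. by move=> ? ? ?; apply: (md_inc M). Qed.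

Let phi_I x := @md_I R f lam phi x M.

Let psi_ex t : exists x : R, 0 <= t <= 1 -> 0 <= x <= 1 /\ phi x = t.
Proof.
have [tI|tI] := boolP (0 <= t <= 1); last by exists 0.
have [||||x xI fx] := @ctsI_IVT R phi 0 1 t (md_cts M); [ord|ord|ord| |by exists x].
by left; rewrite (md_0 M) (md_1 M).
Qed.

Definition minv := projT1 (choice psi_ex).

Lemma minvI t : 0 <= t <= 1 -> 0 <= minv t <= 1.
Proof. by move=> tI; have [] := projT2 (choice psi_ex) t tI. Qed.

Lemma minvK t : 0 <= t <= 1 -> phi (minv t) = t.
Proof. by move=> tI; have [] := projT2 (choice psi_ex) t tI. Qed.

Lemma minvVK x : 0 <= x <= 1 -> minv (phi x) = x.
Proof.
move=> xI; have pI := phi_I xI; have mI := minvI pI; have e := minvK pI.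
have [l|l|//] := ltgtP (minv (phi x)) x.
  by have := phi_lt _ l; rewrite e ltxx => h; exfalso; apply: notF; apply: h; ord.
by have := phi_lt _ l; rewrite e ltxx => h; exfalso; apply: notF; apply: h; ord.
Qed.

Lemma minv_lt s t : 0 <= s -> s < t -> t <= 1 -> minv s < minv t.
Proof.
move=> s0 st t1; have sI := minvI (t := s) lr; have tI := minvI (t := t) lr.
rewrite ltNge; apply/negP; rewrite le_eqVlt => /orP[/eqP e|l].
  by have := minvK (t := s) lr; rewrite -e minvK; ord.
by have := phi_lt _ l; rewrite !minvK; try ord; move=> h; have := h lr lr; ord.
Qed.

Lemma minv_cts : ctsI minv.
Proof.
move=> t tI e e0; have [d d0 hd] := inc_small (md_inc M) e0.
exists d => // s sI st.
have tI' := minvI tI; have sI' := minvI sI.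
have [l|l|->] := ltgtP s t; last by rewrite subrr normr0.
  have h := minv_lt (s := s) (t := t) lr l lr.
  rewrite ltr0_norm ?subr_lt0 // opprB; apply: hd; rewrite ?minvK //; try ord.
  by move: st; rewrite ltr0_norm ?subr_lt0 // opprB.
have h := minv_lt (s := t) (t := s) lr l lr.
rewrite gtr0_norm ?subr_gt0 //; apply: hd; rewrite ?minvK //; try ord.
by move: st; rewrite gtr0_norm ?subr_gt0.
Qed.

Lemma model_homeo : increasing_homeo minv phi.
Proof.
have II x : unit_itv R x -> 0 <= x <= 1 by rewrite /unit_itv /= in_itv.
split.
- exact: ctsI_within minv_cts _ _.
- exact: ctsI_within (md_cts M) _ _.
- by move=> x /II/minvI; rewrite /unit_itv /= in_itv.
- by move=> x /II/phi_I; rewrite /unit_itv /= in_itv.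
- by move=> x; rewrite inE => /II/minvK.
- by move=> x; rewrite inE => /II/minvVK.
- by move=> x y; rewrite !inE => /II xI /II yI xy; apply: minv_lt => //; ord.
Qed.

(** Outside [0,1] the value is the one prescribed by [tmap_out]. *)
Definition gfun x := if 0 <= x <= 1 then phi (f (minv x)) else 0.

Lemma gfunE x : 0 <= x <= 1 -> gfun x = phi (f (minv x)).
Proof. by rewrite /gfun => ->. Qed.

Lemma gfun_selfI : selfI gfun.
Proof. by move=> x xI; rewrite gfunE //; apply/phi_I/tmap_selfI/minvI. Qed.

Lemma gfun_cts : ctsI gfun.
Proof.
move=> x xI e e0.
have cf : ctsI (fun x => f (minv x)).
  apply: ctsI_comp; [exact: minvI|exact: within_ctsI (@tmap_cont R f)|exact: minv_cts].
have [|d d0 hd] := (ctsI_comp _ (md_cts M) cf) x xI e e0.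
  by move=> y yI; apply/tmap_selfI/minvI.
by exists d => // y yI yx; rewrite !gfunE // hd.
Qed.

Lemma gfun_iter n x : 0 <= x <= 1 -> iter n gfun (phi x) = phi (iter n f x).
Proof.
move=> xI; elim: n => //= n ->.
have h := iterI (tmap_pmt f) n xI.
by rewrite gfunE ?minvVK //; apply: phi_I.
Qed.

Lemma gfun_transitive : transitive_map gfun.
Proof.
move=> U V oU oV [x [Ux Ix]] [y [Vy Iy]].
have xI : 0 <= x <= 1 by move: Ix; rewrite /unit_itv /= in_itv.
have yI : 0 <= y <= 1 by move: Iy; rewrite /unit_itv /= in_itv.
have [a [b [a0 ab b1 hU]]] := open_itv (open_nbhs_nbhs (conj oU Ux)) xI.
have [c [d [c0 cd d1 hV]]] := open_itv (open_nbhs_nbhs (conj oV Vy)) yI.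
have aI := minvI (t := a) lr; have bI := minvI (t := b) lr.
have cI := minvI (t := c) lr; have dI := minvI (t := d) lr.
have [||||||n n0 [z zI hz]] := pm_tr (tmap_pmt f) (a := minv a) (b := minv b) (c := minv c) (d := minv d);
  try ord; [by apply: minv_lt|by apply: minv_lt|].
exists n => //; exists (iter n gfun (phi z)); split.
  exists (phi z) => //; split.
    apply: hU; rewrite -(minvK (t := a) lr) -(minvK (t := b) lr).
    by rewrite !phi_lt //; ord.
  by have := phi_I (x := z) lr; rewrite /unit_itv /= in_itv.
rewrite gfun_iter; last ord.
have hzI := iterI (tmap_pmt f) n (x := z) lr.
apply: hV; rewrite -(minvK (t := c) lr) -(minvK (t := d) lr).
by rewrite !phi_lt //; ord.
Qed.

Lemma gfun_pwm : finite_set (Crit gfun).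
Proof.
have H := homeo_inv model_homeo.
have IE x : unit_itv R x <-> 0 <= x <= 1 by rewrite /unit_itv /= in_itv.
have gE x : unit_itv R x -> gfun x = phi (f (minv x)) by move=> /IE/gfunE.
apply: (@sub_finite_set _ _ ([set 0; 1] `|` phi @` Crit f)); last first.
  rewrite finite_setU; split; first exact: finite_set2.
  exact/finite_image/(tmap_pwm f).
move=> x Cx; have [->|[->|xI]] : x = 0 \/ (x = 1 \/ 0 < x < 1).
  case: (Cx) => [[->|->]|[/IE xI _]]; [by left|by right; left|].
  have [l|l] := ltP 0 x; last by left; apply/eqP; rewrite eq_le l; case/andP: xI.
  have [l'|l'] := ltP x 1; first by right; right.
  by right; left; apply/eqP; rewrite eq_le l'; case/andP: xI => _ ->.
- by left; left.
- by left; right.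
- right; have xI' : 0 <= x <= 1 by ord.
  exists (minv x); last exact: minvK.
  apply: (Crit_homeo (x := minv x) H (@tmap_itv R f) gE); last by rewrite minvK.
  by apply: (homeo_oo model_homeo); rewrite /= in_itv.
Qed.

Definition gmap : tmap R.
Proof.
refine (@TMap R gfun _ _ gfun_transitive gfun_pwm _).
- exact: ctsI_within gfun_cts _ _.
- by move=> x; have := @gfun_selfI x; rewrite /unit_itv /= !in_itv.
- by move=> x; rewrite /unit_itv /= in_itv /gfun => /negP/negbTE->.
Defined.

Lemma gmap_slope_model : slope_model f gmap.
Proof.
have IE x : unit_itv R x <-> 0 <= x <= 1 by rewrite /unit_itv /= in_itv.
split; last first.
  exists minv, phi; split; first exact: model_homeo.
  move=> x /IE xI; rewrite /= gfunE ?minvVK //; last exact: phi_I.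
  exact: tmap_selfI.
exists lam => x /IE xI nC.
have xI' : 0 < x < 1.
  have [e|[e|//]] : x = 0 \/ (x = 1 \/ 0 < x < 1) by ord.
    by exfalso; apply: nC; left; left.
  by exfalso; apply: nC; left; right.
have [d d0 hd] := gap_seq [:: 0, 1 & turning gmap] x.
have near z : z \in turning gmap -> d <= `|z - x|.
  move=> h; apply: hd; first by rewrite !inE h !orbT.
  by apply/eqP => e; apply: nC; rewrite -e; have /turningP[] := h.
have dc : d <= x.
  have h0 : (0 : R) \in [:: 0, 1 & turning gmap] by rewrite !inE eqxx.
  by have := hd 0 h0 ltac:(by rewrite lt_eqF; ord); rewrite sub0r normrN gtr0_norm; ord.
have dc' : d <= 1 - x.
  have h1 : (1 : R) \in [:: 0, 1 & turning gmap] by rewrite !inE eqxx orbT.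
  by have := hd 1 h1 ltac:(by rewrite gt_eqF; ord); rewrite gtr0_norm; ord.
have hm : smono gmap (x - d) (x + d).
  apply: (pm_mono (tmap_pmt gmap)); try ord.
  move=> z zC; apply/negP => zI; have := near z zC.
  by rewrite leNgt ltr_norml; ord.
have dist u v : x - d <= u -> u < v -> v <= x + d -> `|gfun v - gfun u| = lam * (v - u).
  move=> hu uv hv.
  have uI : 0 <= u <= 1 by ord. have vI : 0 <= v <= 1 by ord.
  rewrite !gfunE //.
  have muv := minv_lt (s := u) (t := v) lr uv lr.
  have muI := minvI uI; have mvI := minvI vI.
  have phiK w : 0 <= w <= 1 -> minv (gfun (phi w)) = f w.
    move=> wI; rewrite gfunE ?minvVK //; first exact: tmap_selfI.
    exact: phi_I.
  rewrite (md_conf M) ?minvK //; try ord.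
  case: hm => hm; [left|right] => s t hs st ht.
  - have ps := phi_lt (x := s) (y := t) lr st lr.
    rewrite -(phiK s lr) -(phiK t lr).
    have h1 : u <= phi s.
      rewrite -(minvK uI); have [->//|l] : minv u = s \/ minv u < s by ord.
      by apply/ltW/phi_lt => //; ord.
    have h2 : phi t <= v.
      rewrite -(minvK vI); have [->//|l] : t = minv v \/ t < minv v by ord.
      by apply/ltW/phi_lt => //; ord.
    have g1 := @gfun_selfI (phi s) (phi_I (x := s) lr).
    have g2 := @gfun_selfI (phi t) (phi_I (x := t) lr).
    by apply: minv_lt; [ord|apply: hm; ord|ord].
  - have ps := phi_lt (x := s) (y := t) lr st lr.
    rewrite -(phiK s lr) -(phiK t lr).
    have h1 : u <= phi s.
      rewrite -(minvK uI); have [->//|l] : minv u = s \/ minv u < s by ord.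
      by apply/ltW/phi_lt => //; ord.
    have h2 : phi t <= v.
      rewrite -(minvK vI); have [->//|l] : t = minv v \/ t < minv v by ord.
      by apply/ltW/phi_lt => //; ord.
    have g1 := @gfun_selfI (phi s) (phi_I (x := s) lr).
    have g2 := @gfun_selfI (phi t) (phi_I (x := t) lr).
    by apply: minv_lt; [ord|apply: hm; ord|ord].
(* Away from its turning points the conjugate map is affine with slope [lam] or [- lam], hence
   differentiable. *)
have [s [s1 hs]] : exists s : R, `|s| = lam /\ forall t, x - d < t < x + d -> s * (t - x) + gfun x = gfun t.
  case: hm => hm.
    exists lam; split; first by rewrite ger0_norm ?(md_lam M).
    move=> t tI; have [l|l|->] := ltgtP t x; last by rewrite subrr mulr0 add0r.
      have := dist t x lr l lr; have := hm t x lr l lr; rewrite /= => h.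
      by rewrite gtr0_norm ?subr_gt0 // => e; rewrite -opprB mulrN -e opprB subrK.
    have := dist x t lr l lr; have := hm x t lr l lr; rewrite /= => h.
    by rewrite gtr0_norm ?subr_gt0 // => <-; rewrite subrK.
  exists (- lam); split; first by rewrite normrN ger0_norm ?(md_lam M).
  move=> t tI; have [l|l|->] := ltgtP t x; last by rewrite subrr mulr0 add0r.
    have := dist t x lr l lr; have := hm t x lr l lr; rewrite /= => h.
    by rewrite ltr0_norm ?subr_lt0 // => e; rewrite mulNr -mulrN opprB -e opprB subrK.
  have := dist x t lr l lr; have := hm x t lr l lr; rewrite /= => h.
  by rewrite ltr0_norm ?subr_lt0 // mulNr => <-; rewrite opprK subrK.
have nr : \forall t \near x, s * (t - x) + gfun x = gfun t.
  exists d => //= t; rewrite /= ltr_norml => h; apply: hs; ord.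
have D : is_derive x 1 gfun s.
  apply: (near_eq_is_derive nr).
  apply: is_derive_eq.
  by rewrite !(scaler0, addr0, subr0) /= ?scaler1.
split; first exact: ex_derive.
by rewrite derive1E derive_val.
Qed.

End build_model.

(** [Phi f] is picked among all slope models and brings its own conjugacy and slope; the uniqueness
    of both identifies them with [phi] and [lam]. *)
Theorem Phi_spec f lam phi : model f lam phi ->
  forall x, 0 <= x <= 1 -> Phi f (phi x) = phi (f x).
Proof.
move=> M; have P := tmap_pmt f.
rewrite /Phi; case: xgetP => [g _ Hg|/(_ (gmap M))[]]; last exact: gmap_slope_model.
have [lam' [phi' [M' hg]]] := slope_model_model Hg.
have e := model_lam_unique P M' M; rewrite e in M'.
have e' := model_unique P M' M.
move=> x xI; rewrite -e' // hg // e' //; exact: tmap_selfI.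
Qed.

Theorem h_spec f lam phi : model f lam phi -> h f = ln lam.
Proof. by move=> M; rewrite /h (entropy_model (tmap_pmt f) M). Qed.

Lemma tmap_model f : exists lam phi, model f lam phi.
Proof. exact: model_exists (tmap_pmt f). Qed.

End dictionary.

(** * Lengths with atoms *)

Section covering.
Variable R : realType.
Implicit Types (x y z w c d e u v s t lam : R) (f g : R -> R) (C : seq R).

(** The images of the two sides of a turning point overlap in an interval with end point [f c]. *)
Lemma fold_overlap f c d : ctsI f -> fold f c -> 0 < d -> exists e1 e2 : R, e1 < e2 /\
  forall w, e1 < w < e2 -> exists u v : R, [/\ c - d < u < c, c < v < c + d, f u = w & f v = w].
Proof.
move=> fc [d1 d10 [cd1 cd2 H]] d0.
pose r := Num.min d1 d / 2.
have r0 : 0 < r by rewrite divr_gt0 // lt_min d10.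
have [rd1 rd] : r < d1 /\ r < d.
  have m1 : Num.min d1 d <= d1 by rewrite ge_min lexx.
  have m2 : Num.min d1 d <= d by rewrite ge_min lexx orbT.
  by move: m1 m2 r0; rewrite /r; move: (Num.min d1 d) => k; clear; ord.
clearbody r.
case: H => [[h1 h2]|[h1 h2]].
- have l1 := h1 (c - r) c lr lr lr; have l2 := h2 c (c + r) lr lr lr.
  exists (Num.max (f (c - r)) (f (c + r))), (f c); split; first by rewrite gt_max l1.
  move=> w; rewrite gt_max => /andP[/andP[w1 w2] w3].
  have [||||u uI fu] := @ctsI_IVT R f (c - r) c w fc; [ord|ord|ord|left; ord|].
  have [||||v vI fv] := @ctsI_IVT R f c (c + r) w fc; [ord|ord|ord|right; ord|].
  have uc : u <> c by move=> e; move: fu; rewrite e; ord.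
  have vc : v <> c by move=> e; move: fv; rewrite e; ord.
  by exists u, v; split => //; clear -uI vI uc vc rd r0; ord.
- have l1 := h1 (c - r) c lr lr lr; have l2 := h2 c (c + r) lr lr lr.
  exists (f c), (Num.min (f (c - r)) (f (c + r))); split; first by rewrite lt_min l1.
  move=> w; rewrite lt_min => /andP[w3 /andP[w1 w2]].
  have [||||u uI fu] := @ctsI_IVT R f (c - r) c w fc; [ord|ord|ord|right; ord|].
  have [||||v vI fv] := @ctsI_IVT R f c (c + r) w fc; [ord|ord|ord|left; ord|].
  have uc : u <> c by move=> e; move: fu; rewrite e; ord.
  have vc : v <> c by move=> e; move: fv; rewrite e; ord.
  by exists u, v; split => //; clear -uI vI uc vc rd r0; ord.
Qed.

Lemma iter_two f C n x y : pmt f C -> 0 <= x -> x < y -> y <= 1 ->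
  exists s t : R, [/\ x < s < y, x < t < y & iter n f s < iter n f t].
Proof.
move=> P x0 xy y1; have [z zI hz] := pm_plateau P n (iter n f ((x + y) / 2)) x0 xy y1.
have mI : x < (x + y) / 2 < y by ord.
have [l|l|//] := ltgtP (iter n f z) (iter n f ((x + y) / 2)).
  by exists z, ((x + y) / 2).
by exists ((x + y) / 2), z.
Qed.

Lemma iter_between f C n x y s t v : pmt f C -> 0 <= x -> y <= 1 -> x < s < y -> x < t < y ->
  iter n f s <= v <= iter n f t -> exists2 r : R, x < r < y & iter n f r = v.
Proof.
move=> P x0 y1 sI tI vI.
have fc := ctsI_iter n (pm_self P) (pm_cts P).
have [st|ts] := leP s t.
  have [||||r rI fr] := @ctsI_IVT R (iter n f) s t v fc; [ord|ord|ord|by left|].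
  by exists r => //; ord.
have [||||r rI fr] := @ctsI_IVT R (iter n f) t s v fc; [ord|ord|ord|by right|].
by exists r => //; ord.
Qed.

(* If no image [f^b V] of [V = (x, y)] crosses [c], each lies on one side of
   [c]; the sides are eventually periodic, and the two families of images
   accumulating at [c] from the left and from the right are glued by the fold. *)
Lemma cover_turning f C c x y : pmt f C -> c \in C -> 0 <= x -> x < y -> y <= 1 ->
  exists j, exists s t : R, [/\ x < s < y, x < t < y & iter j f s < c < iter j f t].
Proof.
move=> P cC x0 xy y1; apply: contrapT => bad.
have cI := fold_in P cC; have fo := pm_fold P cC.
pose V s := x < s < y.
pose L b := forall s, V s -> iter b f s <= c.
pose Rt b := forall s, V s -> c <= iter b f s.
have side b : L b \/ Rt b.
  apply: contrapT => /not_orP[/existsNP[t /not_implyP[Vt /negP ht]] /existsNP[s /not_implyP[Vs /negP hs]]].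
  by apply: bad; exists b, s, t; split => //; rewrite !ltNge ht hs.
have two b := iter_two b P x0 xy y1.
have VI s : V s -> 0 <= s <= 1 by rewrite /V; ord.
have imI b s : V s -> 0 <= iter b f s <= 1 by move=> /VI; exact: (iterI P).
have excl b : L b -> ~ Rt b.
  move=> hl hr; have [s [t [Vs Vt st]]] := two b.
  by have := hl t Vt; have := hr s Vs; ord.
(* an open interval of common values forces equal sides from then on *)
have over a b e1 e2 : e1 < e2 -> (forall w, e1 < w < e2 -> exists s t : R, [/\ V s, V t, iter a f s = w & iter b f t = w]) ->
    forall k, L (k + a)%N -> Rt (k + b)%N -> False.
  move=> e12 H k hl hr.
  have [e1I e2I] : 0 <= e1 /\ e2 <= 1.
    split; rewrite leNgt; apply/negP => l.
      have [w wI] : exists w : R, e1 < w < Num.min e2 0.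
        by exists ((e1 + Num.min e2 0) / 2); have : e1 < Num.min e2 0; [by rewrite lt_min e12|clear; ord].
      rewrite lt_min in wI; have [s [t [Vs Vt e _]]] := H w ltac:(by move: wI; clear; ord).
      by have := imI a s Vs; move: wI; rewrite e; clear; ord.
    have [w wI] : exists w : R, Num.max e1 1 < w < e2.
      by exists ((Num.max e1 1 + e2) / 2); have : Num.max e1 1 < e2; [by rewrite gt_max e12|clear; ord].
    rewrite gt_max in wI; have [s [t [Vs Vt e _]]] := H w ltac:(by move: wI; clear; ord).
    by have := imI a s Vs; move: wI; rewrite e; clear; ord.
  have [z zI hz] := pm_plateau P k c e1I e12 e2I.
  have [s [t [Vs Vt es et]]] := H z zI; apply: hz.
  by apply/eqP; rewrite eq_le -{1}es -et -!iterD hl ?hr.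
have [n n0 [p Vp Vfp]] := pm_tr P x0 xy y1 x0 xy y1.
have consec b : exists s t : R, [/\ V s, V t & iter b f s = iter (n + b) f t].
  by exists (iter n f p), p; split => //; rewrite addnC iterD.
have near_left b s : V s -> L b -> iter b f s = c -> exists2 d : R, 0 < d & forall u, c - d < u < c ->
    exists2 s' : R, V s' & iter b f s' = u.
  move=> Vs hl e; have [s1 [t1 [Vs1 Vt1 st]]] := two b.
  have lt : iter b f s1 < c by apply: lt_le_trans (hl t1 Vt1).
  exists (c - iter b f s1); first by rewrite subr_gt0.
  move=> u uI; apply: (iter_between P x0 y1 Vs1 Vs); rewrite e; move: uI; clear; ord.
have near_right b s : V s -> Rt b -> iter b f s = c -> exists2 d : R, 0 < d & forall u, c < u < c + d ->
    exists2 s' : R, V s' & iter b f s' = u.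
  move=> Vs hl e; have [s1 [t1 [Vs1 Vt1 st]]] := two b.
  have lt : c < iter b f t1 by apply: le_lt_trans (hl s1 Vs1) _.
  exists (iter b f t1 - c); first by rewrite subr_gt0.
  move=> u uI; apply: (iter_between P x0 y1 Vs Vt1); rewrite e; move: uI; clear; ord.
have glue a b d : 0 < d -> (forall u, c - d < u < c -> exists2 s' : R, V s' & iter a f s' = u) ->
    (forall u, c < u < c + d -> exists2 s' : R, V s' & iter b f s' = u) ->
    exists e1 e2 : R, e1 < e2 /\ forall w, e1 < w < e2 ->
      exists s t : R, [/\ V s, V t, iter a.+1 f s = w & iter b.+1 f t = w].
  move=> d0 hl hr; have [e1 [e2 [e12 H]]] := fold_overlap (pm_cts P) fo d0.
  exists e1, e2; split => // w wI; have [u [v [uI vI <- fv]]] := H w wI.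
  have [s Vs es] := hl u uI; have [t Vt et] := hr v vI.
  by exists s, t; split => //; rewrite iterS ?es // et fv.
(* Images [n] steps apart meet. If they lie on different sides of [c], they meet at [c] and contain
   both sides of it; the fold gives their successors an interval of common values, and from then on
   their sides agree. So the sides are eventually periodic with period [n]. *)
have [N0 per] : exists N0, forall b, (N0 <= b)%N -> (L b -> L (n + b)%N) /\ (Rt b -> Rt (n + b)%N).
  have [sw|nsw] := pselect (exists a, (L a /\ Rt (n + a)%N) \/ (Rt a /\ L (n + a)%N)); last first.
    exists 0%N => b _; split => h.
      by have [//|h'] := side (n + b)%N; exfalso; apply: nsw; exists b; left.
    by have [h'|//] := side (n + b)%N; exfalso; apply: nsw; exists b; right.
  have [a ha] := sw; exists a.+1 => b hb.
  have [s [t [Vs Vt est]]] := consec a.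
  have [a1 [a2 [e1 [e2 [e12 H hab]]]]] : exists a1 a2, exists e1 e2 : R, [/\ e1 < e2,
      (forall w, e1 < w < e2 -> exists s t : R, [/\ V s, V t, iter a1.+1 f s = w & iter a2.+1 f t = w]) &
      (a1 = a /\ a2 = n + a)%N \/ (a1 = n + a /\ a2 = a)%N].
    case: ha => -[h1 h2].
      have e : iter a f s = c.
        by apply/eqP; rewrite eq_le h1 //= est h2.
      have [d1 d10 g1] := near_left a s Vs h1 e.
      have [d2 d20 g2] := near_right (n + a)%N t Vt h2 ltac:(by rewrite -est).
      have d0 : 0 < Num.min d1 d2 by rewrite lt_min d10.
      have [m1 m2] : Num.min d1 d2 <= d1 /\ Num.min d1 d2 <= d2 by rewrite !ge_min !lexx orbT.
      have [||e1 [e2 [e12 H]]] := glue a (n + a)%N _ d0.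
      - by move=> u uI; apply: g1; move: uI m1; clear; ord.
      - by move=> u uI; apply: g2; move: uI m2; clear; ord.
      by exists a, (n + a)%N, e1, e2; split => //; left.
    have e : iter a f s = c.
      by apply/eqP; rewrite eq_le h1 // andbT est h2.
    have [d1 d10 g1] := near_left (n + a)%N t Vt h2 ltac:(by rewrite -est).
    have [d2 d20 g2] := near_right a s Vs h1 e.
    have d0 : 0 < Num.min d1 d2 by rewrite lt_min d10.
    have [m1 m2] : Num.min d1 d2 <= d1 /\ Num.min d1 d2 <= d2 by rewrite !ge_min !lexx orbT.
    have [||e1 [e2 [e12 H]]] := glue (n + a)%N a _ d0.
    - by move=> u uI; apply: g1; move: uI m1; clear; ord.
    - by move=> u uI; apply: g2; move: uI m2; clear; ord.
    by exists (n + a)%N, a, e1, e2; split => //; right.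
  have no k : ~ (L (k + a1.+1)%N /\ Rt (k + a2.+1)%N) by case=> ? ?; apply: (over a1.+1 a2.+1 e1 e2 e12 H k).
  have no' k : ~ (L (k + a2.+1)%N /\ Rt (k + a1.+1)%N).
    case=> ? ?; apply: (over a2.+1 a1.+1 e1 e2 e12 _ k) => // w wI.
    by have [s' [t' [? ? ? ?]]] := H w wI; exists t', s'.
  have eb : b = (b - a.+1 + a.+1)%N by rewrite subnK.
  have enb : (n + b = b - a.+1 + (n + a).+1)%N by move: hb; clear; lia.
  split => h.
    have [//|h'] := side (n + b)%N; exfalso.
    by case: hab => -[e1' e2']; [apply: (no (b - a.+1)%N)|apply: (no' (b - a.+1)%N)]; rewrite e1' e2' -eb -enb.
  have [h'|//] := side (n + b)%N; exfalso.
  by case: hab => -[e1' e2']; [apply: (no' (b - a.+1)%N)|apply: (no (b - a.+1)%N)]; rewrite e1' e2' -eb -enb.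
(* The images at times [N0 + i] modulo [n] meet successively, so their union is an interval; it lies
   on one side of [c]. *)
pose D i u := exists k, exists2 s : R, V s & iter (k * n + (N0 + i)) f s = u.
have Dside i : L (N0 + i)%N -> forall k, L (k * n + (N0 + i))%N.
  by move=> h; elim=> [|k IH]; rewrite ?mul0n ?add0n // mulSn -addnA; apply: (per _ _).1 => //; rewrite addnCA leq_addr.
have Dside' i : Rt (N0 + i)%N -> forall k, Rt (k * n + (N0 + i))%N.
  by move=> h; elim=> [|k IH]; rewrite ?mul0n ?add0n // mulSn -addnA; apply: (per _ _).2 => //; rewrite addnCA leq_addr.
have Dconv i u v w : D i u -> D i v -> u <= w <= v -> D i w.
  have st k s : V s -> forall k' s', V s' -> (k <= k')%N ->
     (iter (k * n + (N0 + i)) f s <= w <= iter (k' * n + (N0 + i)) f s') \/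
     (iter (k' * n + (N0 + i)) f s' <= w <= iter (k * n + (N0 + i)) f s) -> D i w.
    move=> Vs; elim=> [|k' IH] s' Vs'.
      rewrite leqn0 => /eqP-> [h|h].
        by have [r Vr er] := iter_between P x0 y1 Vs Vs' h; exists 0%N, r.
      by have [r Vr er] := iter_between P x0 y1 Vs' Vs h; exists 0%N, r.
    rewrite leq_eqVlt => /orP[/eqP->|]; last first.
      rewrite ltnS => kk h; have [s1 [t1 [Vs1 Vt1 e1]]] := consec (k' * n + (N0 + i))%N.
      rewrite [(n + _)%N]addnA -mulSn in e1; have hIH := IH s1 Vs1 kk; rewrite e1 in hIH.
      move: h; set A := iter (k * n + (N0 + i)) f s in hIH *.
      set B := iter (k'.+1 * n + (N0 + i)) f t1 in hIH *.
      set E := iter (k'.+1 * n + (N0 + i)) f s' => h.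
      have [h1|[h1|h1]] : (A <= w <= B \/ B <= w <= A) \/ (B <= w <= E \/ E <= w <= B).
        by clear hIH; move: h; move: A B E => A B E; clear; have [|] := leP w B; ord.
      - exact: hIH.
      - by have [r Vr er] := iter_between P x0 y1 Vt1 Vs' h1; exists k'.+1, r.
      - by have [r Vr er] := iter_between P x0 y1 Vs' Vt1 h1; exists k'.+1, r.
    case=> [h|h].
      by have [r Vr er] := iter_between P x0 y1 Vs Vs' h; exists k'.+1, r.
    by have [r Vr er] := iter_between P x0 y1 Vs' Vs h; exists k'.+1, r.
  move=> [k [s Vs <-]] [k' [s' Vs' <-]] h.
  have [kk|kk] := leqP k k'; first by apply: (st k s Vs k' s' Vs' kk); left.
  by apply: (st k' s' Vs' k s Vs (ltnW kk)); right.
pose S u := exists2 i, (i < n)%N & D i u.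
have SV b s : (N0 <= b)%N -> V s -> S (iter b f s).
  move=> hb Vs; exists ((b - N0) %% n)%N; first by rewrite ltn_mod.
  exists ((b - N0) %/ n)%N, s => //; congr (iter _ f s).
  by rewrite addnCA -divn_eq subnKC.
have Sdense u v : 0 <= u -> u < v -> v <= 1 -> exists2 r : R, u < r < v & S r.
  apply: (inv_all P).
    move=> r _ [i _ [k [s Vs <-]]].
    by rewrite -iterS; apply: SV; rewrite // leqW // addnCA leq_addr.
  have [s [t [Vs Vt st]]] := two N0; have sI := imI N0 s Vs; have tI := imI N0 t Vt.
  exists (iter N0 f s), (iter N0 f t); split; [by case/andP: sI|by []|by case/andP: tI|].
  move=> r rI; have [r' Vr' <-] := iter_between P x0 y1 Vs Vt (v := r) ltac:(move: rI; clear; ord).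
  exact: SV.
(* Pigeonhole over the [n] classes: their union is dense, so some class accumulates at [c] from the
   left and some class from the right. *)
have acc (Q : R -> R -> Prop) : (forall d d' r, 0 < d -> d <= d' -> Q d r -> Q d' r) ->
    (forall d, 0 < d -> exists2 r, Q d r & S r) ->
    exists2 i, (i < n)%N & forall d, 0 < d -> exists2 r, Q d r & D i r.
  move=> mon H; apply: contrapT => no.
  have fin k : (k <= n)%N -> exists2 d : R, 0 < d & forall i, (i < k)%N -> forall r, Q d r -> ~ D i r.
    elim: k => [|k IH] hk; first by exists 1.
    have [d d0 hd] := IH (ltnW hk).
    have [d1 d10 hd1] : exists2 d1 : R, 0 < d1 & forall r, Q d1 r -> ~ D k r.
      apply: contrapT => h; apply: no; exists k => // d1 d10; apply: contrapT => h'.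
      by apply: h; exists d1 => // r Qr Dr; apply: h'; exists r.
    exists (Num.min d d1); first by rewrite lt_min d0.
    have m0 : 0 < Num.min d d1 by rewrite lt_min d0.
    move=> i; rewrite ltnS leq_eqVlt => /orP[/eqP->|ik] r Qr.
      by apply: hd1; apply: mon Qr; rewrite // ge_min lexx orbT.
    by apply: (hd i ik); apply: mon Qr; rewrite // ge_min lexx.
  have [d d0 hd] := fin n (leqnn n).
  by have [r Qr [i ik Dr]] := H d d0; apply: (hd i ik r).
have [i _ hi] := acc (fun d r => c - d < r < c) ltac:(move=> ? ? ? /=; clear; ord)
  ltac:(move=> d d0; have [|||r rI Sr] := @Sdense (Num.max 0 (c - d)) c;
    [by rewrite le_max lexx|by rewrite gt_max; move: cI d0; clear; ord|by case/andP: cI => _ /ltW|];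
    by exists r => //; move: rI; rewrite gt_max => /andP[/andP[_ ->] ->]).
have [j _ hj] := acc (fun d r => c < r < c + d) ltac:(move=> ? ? ? /=; clear; ord)
  ltac:(move=> d d0; have [|||r rI Sr] := @Sdense c (Num.min 1 (c + d));
    [by case/andP: cI => /ltW|by rewrite lt_min; move: cI d0; clear; ord|by rewrite ge_min lexx|];
    by exists r => //; move: rI; rewrite lt_min => /andP[-> /andP[_ ->]]).
have iL : forall k, L (k * n + (N0 + i))%N.
  apply: Dside; have [//|h] := side (N0 + i)%N; exfalso.
  have [r rI [k [s Vs e]]] := hi 1 ltr01.
  by have := Dside' i h k s Vs; rewrite e; move: rI; clear; ord.
have jR : forall k, Rt (k * n + (N0 + j))%N.
  apply: Dside'; have [h|//] := side (N0 + j)%N; exfalso.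
  have [r rI [k [s Vs e]]] := hj 1 ltr01.
  by have := Dside j h k s Vs; rewrite e; move: rI; clear; ord.
have [r1 r1I D1] := hi 1 ltr01; have [r2 r2I D2] := hj 1 ltr01.
have Di u : r1 <= u < c -> D i u.
  move=> uI; have [r3 r3I D3] := hi (c - u) ltac:(move: uI; clear; ord).
  by apply: (Dconv i r1 r3) => //; move: uI r3I; clear; ord.
have Dj u : c < u <= r2 -> D j u.
  move=> uI; have [r3 r3I D3] := hj (u - c) ltac:(move: uI; clear; ord).
  by apply: (Dconv j r3 r2) => //; move: uI r3I; clear; ord.
have d0 : 0 < Num.min (c - r1) (r2 - c) by rewrite lt_min; move: r1I r2I; clear; ord.
have [m1 m2] : Num.min (c - r1) (r2 - c) <= c - r1 /\ Num.min (c - r1) (r2 - c) <= r2 - c.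
  by rewrite !ge_min !lexx orbT.
have [e1 [e2 [e12 H]]] := fold_overlap (pm_cts P) fo d0.
(* Such a [w] has preimages in the left and in the right class. One period after them the same image
   has to lie on both sides of [c], so an iterate is constant on (e1,e2). *)
have Hw w : e1 < w < e2 -> iter n.-1 f w = c /\ 0 <= w <= 1.
  move=> wI; have [u [v [uI vI fu fv]]] := H w wI.
  have [k [s Vs es]] := Di u ltac:(move: uI m1; clear; ord).
  have [k' [t Vt et]] := Dj v ltac:(move: vI m2; clear; ord).
  split; last by rewrite -fu -es -iterS; apply: imI.
  have h1 : iter n.-1 f w <= c.
    have := iL k.+1 s Vs; rewrite mulSn -addnA iterD es.
    by rewrite -(prednK n0) iterSr fu.
  have h2 : c <= iter n.-1 f w.
    have := jR k'.+1 t Vt; rewrite mulSn -addnA iterD et.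
    by rewrite -(prednK n0) iterSr fv.
  by apply/eqP; rewrite eq_le h1.
have Hm := (Hw ((e1 + (e1 + e2) / 2) / 2) ltac:(move: e12; clear; ord)).2.
have Hm' := (Hw (((e1 + e2) / 2 + e2) / 2) ltac:(move: e12; clear; ord)).2.
have [|||z zI] := @pm_plateau R f C P n.-1 ((e1 + (e1 + e2) / 2) / 2) (((e1 + e2) / 2 + e2) / 2) c.
- by case/andP: Hm.
- by move: e12; clear; ord.
- by case/andP: Hm'.
by apply; apply: (Hw z _).1; move: zI e12; clear; ord.
Qed.

End covering.

(** * Atoms at turning points *)

Section atomic_gauges.
Variable R : realType.
Implicit Types (x y z w c d e q u v s t lam : R) (f g phi a : R -> R) (C : seq R) (l : R -> R -> R).

(** What survives of a sequence of models in the limit. Lengths are exactly additive once the atom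
    in the middle is counted; the 2 in [at_fold] accounts for the two sides of a turning point,
    whose masses land on the same atom. *)
Record atoms f C lam l a : Prop := Atoms {
  at_gauge : gauge f lam l;
  at_lam : 2 <= lam ^+ 2;
  at_ge0 : forall x, 0 <= x <= 1 -> 0 <= a x;
  at_le1 : forall x, 0 <= x <= 1 -> a x <= 1;
  at_add : forall x y z, 0 <= x -> x < y -> y < z -> z <= 1 -> l x y + a y + l y z = l x z;
  at_reg : forall x, 0 <= x <= 1 -> x \notin C -> lam * a x <= a (f x);
  at_fold : forall c, c \in C -> lam * a c <= 2 * a (f c) }.

Lemma at_lam1 f C lam l a : atoms f C lam l a -> 1 < lam.
Proof. by move=> A; apply: sqrt2_gt1 (ga_lam (at_gauge A)) (at_lam A). Qed.

Lemma at_le f C lam l a c x z : atoms f C lam l a -> 0 <= x -> x < c -> c < z -> z <= 1 -> a c <= l x z.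
Proof.
move=> A x0 xc cz z1; have h := at_add A x0 xc cz z1.
have h1 := ga_ge0 (at_gauge A) x0 xc (ltW (lt_le_trans cz z1)).
have h2 := ga_ge0 (at_gauge A) (le_trans x0 (ltW xc)) cz z1.
by move: h h1 h2; clear; ord.
Qed.

(** Off the turning points an atom grows by [lam > 1] at each step, but atoms are at most 1. *)
Lemma atom_turning f C lam l a x : pmt f C -> atoms f C lam l a -> 0 <= x <= 1 -> 0 < a x ->
  exists k, iter k f x \in C /\ lam ^+ k * a x <= a (iter k f x).
Proof.
move=> P A xI ax; have lam1 := at_lam1 A; apply: contrapT => no.
have lam0 : 0 < lam by apply: lt_trans lam1.
have gr k : lam ^+ k * a x <= a (iter k f x).
  elim: k => [|k IH]; first by rewrite expr0 mul1r.
  rewrite exprS -mulrA; apply: le_trans (at_reg A (iterI P k xI) _); first by rewrite ler_pM2l.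
  by apply/negP => h; apply: no; exists k.
have [k hk] := expn_unbounded (a x)^-1 lam1.
have := le_trans (gr k) (at_le1 A (iterI P k xI)).
by rewrite -ler_pdivlMr // mul1r leNgt hk.
Qed.

Lemma atom_cross f C lam l a c n s t : pmt f C -> atoms f C lam l a -> c \in C ->
  0 <= s <= 1 -> 0 <= t <= 1 -> iter n f s < c < iter n f t ->
  (s < t -> a c <= lam ^+ n * l s t) /\ (t < s -> a c <= lam ^+ n * l t s).
Proof.
move=> P A cC sI tI cI; have G := at_gauge A.
have fsI := iterI P n sI; have ftI := iterI P n tI.
have lt : iter n f s < iter n f t by move: cI; clear; ord.
have h : a c <= l (iter n f s) (iter n f t).
  by apply: (at_le A); move: cI fsI ftI; clear; ord.
split => st.
  have [g1 _] := ga_iter P n G (u := s) (v := t) ltac:(by case/andP: sI) st ltac:(by case/andP: tI).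
  exact: le_trans h (g1 lt).
have [_ g1] := ga_iter P n G (u := t) (v := s) ltac:(by case/andP: tI) st ltac:(by case/andP: sI).
exact: le_trans h (g1 lt).
Qed.

(** Some image of the interval crosses [c] and has length at least [a c]; the gauge pulls this bound
    back. *)
Lemma atoms_gpos f C lam l a c : pmt f C -> atoms f C lam l a -> c \in C -> 0 < a c -> gpos l.
Proof.
move=> P A cC ac x y x0 xy y1; have G := at_gauge A.
have [j [s [t [sI tI cI]]]] := cover_turning P cC x0 xy y1.
have sI' : 0 <= s <= 1 by move: sI x0 y1; clear; ord.
have tI' : 0 <= t <= 1 by move: tI x0 y1; clear; ord.
have [h1 h2] := atom_cross P A cC sI' tI' cI.
have lam0 : 0 < lam ^+ j by rewrite exprn_gt0 // (lt_trans ltr01 (at_lam1 A)).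
have [st|st|e] := ltgtP s t.
- have h := lt_le_trans ac (h1 st); rewrite pmulr_rgt0 // in h.
  by apply: lt_le_trans h _; apply: (ga_mono G); move: sI tI; clear -x0 y1 st; ord.
- have h := lt_le_trans ac (h2 st); rewrite pmulr_rgt0 // in h.
  by apply: lt_le_trans h _; apply: (ga_mono G); move: sI tI; clear -x0 y1 st; ord.
- by move: cI; rewrite e; clear; ord.
Qed.

(** The intermediate value theorem gives the value [c] only. Values below [c] accumulate at the
    supremum of the set where they occur, and the absence of plateaus gives values above [c] just
    after it. *)
Lemma crossing g x y c e : ctsI g -> 0 <= x -> y <= 1 -> x < y -> 0 < e ->
  (forall u v, x <= u -> u < v -> v <= y -> exists2 z : R, u < z < v & g z <> c) ->
  g x < c -> c < g y ->
  exists s t : R, [/\ x <= s <= y, x <= t <= y, `|s - t| < e & g s < c < g t].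
Proof.
move=> gc x0 y1 xy e0 np gx gy.
pose A := [set z | x <= z <= y /\ g z < c].
have Ax : A x by split => //; rewrite lexx ltW.
have hs : has_sup A by split; [exists x|exists y => z [/andP[]]].
have xs : x <= sup A by apply: ub_le_sup => //; case: hs.
have sy : sup A <= y by apply: ge_sup; [exists x|move=> z [/andP[]]].
have [s As hs1] := sup_adherent (divr_gt0 e0 (ltr0Sn R 1)) hs.
have ss : s <= sup A by apply: ub_le_sup => //; case: hs.
have [sI gs] := As.
have gsup : c <= g (sup A).
  rewrite leNgt; apply/negP => h.
  have [d d0 hd] := ctsI_lt gc (x := sup A) ltac:(move: xs sy; clear -x0 y1; ord) h.
  have sly : sup A < y.
    rewrite lt_neqAle sy andbT; apply/eqP => E; move: h; rewrite E; move: gy; clear; ord.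
  pose z := sup A + Num.min (d / 2) (y - sup A).
  have m0 : 0 < Num.min (d / 2) (y - sup A) by rewrite lt_min subr_gt0 sly divr_gt0.
  have [m1 m2] : Num.min (d / 2) (y - sup A) <= d / 2 /\ Num.min (d / 2) (y - sup A) <= y - sup A.
    by rewrite !ge_min !lexx orbT.
  have Az : A z.
    split; first by rewrite /z; move: m0 m2 xs; clear; ord.
    apply: hd; rewrite /z; first by move: m0 m2 xs x0 y1; clear; ord.
    by rewrite addrAC subrr add0r gtr0_norm //; move: m0 m1 d0; clear; ord.
  have : z <= sup A by apply: ub_le_sup => //; case: hs.
  by rewrite /z; move: m0; clear; ord.
have sup_y : sup A < y \/ sup A = y by move: sy; clear; ord.
have s_lt : s < sup A.
  by rewrite lt_neqAle ss andbT; apply/eqP => E; move: gs; rewrite E; move: gsup; clear; ord.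
case: sup_y => hy; last first.
  by exists s, y; split => //; [by rewrite lexx ltW|by move: hs1 s_lt; rewrite hy ltr_norml; clear -e0; ord|rewrite gs gy].
pose y' := Num.min y (sup A + e / 2).
have [m1 m2] : y' <= y /\ y' <= sup A + e / 2 by rewrite !ge_min !lexx orbT.
have m0 : sup A < y' by rewrite lt_min hy ltrDl divr_gt0.
have [z zI gz] := np (sup A) y' xs m0 m1.
have gz' : c < g z.
  rewrite lt_neqAle eq_sym; apply/andP; split; first exact/eqP.
  rewrite leNgt; apply/negP => h.
  have : z <= sup A.
    by apply: ub_le_sup; [case: hs|split => //; move: zI m1 xs; clear; ord].
  by move: zI; clear; ord.
exists s, z; split => //; first by move: zI m1 xs; clear; ord.
  by rewrite ltr_norml; move: zI m2 s_lt hs1; clear -e0; ord.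
by rewrite gs gz'.
Qed.

(* A minimal-ratio interval would carry no atoms, but its images cross [c]. *)
Lemma atoms_model_absurd f C lam l a c phi : pmt f C -> model f lam phi -> atoms f C lam l a ->
  (forall x y e, 0 <= x -> x < y -> y <= 1 -> 0 < e ->
    exists2 d : R, 0 < d & forall x' y', 0 <= x' -> x' < y' -> y' <= 1 ->
      `|x' - x| < d -> `|y' - y| < d -> l x y - e < l x' y') ->
  c \in C -> 0 < a c -> False.
Proof.
move=> P M A lsc cC ac; have G := at_gauge A.
have [q [x [y [[q0 x0 xy y1] [E Q]]]]] := min_ratio P M G lsc.
(* The pieces left and right of [u,v] have ratio at least [q], so [u,v] cannot exceed it. *)
have aff u v : x <= u -> u < v -> v <= y -> l u v <= q * (phi v - phi u).
  move=> xu uv vy; have u0 := le_trans x0 xu; have v1 := le_trans vy y1.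
  have [h1 h1'] : q * (phi u - phi x) <= 0 + (if x < u then l x u else 0) /\
      (if x < u then l x u else 0) + l u y <= l x y.
    have uy := lt_le_trans uv vy.
    case: ltP => h; first by split; [rewrite add0r; apply: Q => //; move: uv v1; clear; ord|exact: (ga_add G)].
    by have -> : u = x; [move: h xu; clear; ord|rewrite subrr mulr0 !add0r].
  have [h2 h2'] : q * (phi y - phi v) <= (if v < y then l v y else 0) /\
      l u v + (if v < y then l v y else 0) <= l u y.
    case: ltP => h; first by split; [apply: Q => //; move: u0 uv; clear; ord|exact: (ga_add G)].
    by have -> : v = y; [move: h vy; clear; ord|rewrite subrr mulr0 addr0].
  move: h1 h1' h2 h2' E; rewrite !mulrBr add0r.
  by move: (if x < u then _ else _) (if v < y then _ else _) => i j; clear; ord.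
have [j [s [t [sI tI cI]]]] := cover_turning P cC x0 xy y1.
have lam0 : 0 < lam ^+ j by rewrite exprn_gt0 // (lt_trans ltr01 (at_lam1 A)).
have fj := ctsI_iter j (pm_self P) (pm_cts P).
(* The images under [iter j f] of subintervals of model length below this bound are too short to
   contain the atom, but [crossing] finds such subintervals whose images cross [c]. *)
have e0 : 0 < a c / (lam ^+ j * (q + 1)) by rewrite divr_gt0 // mulr_gt0 //; move: q0; clear; ord.
have [d d0 hd] := ctsI_unif (md_cts M) e0.
have small s' t' : x <= s' -> s' < t' -> t' <= y -> `|s' - t'| < d -> lam ^+ j * l s' t' < a c.
  move=> xs st ty h; apply: le_lt_trans (ler_wpM2l (ltW lam0) (aff s' t' xs st ty)) _.
  rewrite mulrC -ltr_pdivlMr //.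
  have := hd t' s' ltac:(move: x0 y1 xs st ty; clear; ord) ltac:(move: x0 y1 xs st ty; clear; ord) h.
  rewrite distrC gtr0_norm ?subr_gt0 ?(md_inc M) //; [|exact: le_trans xs|exact: le_trans y1].
  move=> h'; have p0 : 0 <= phi t' - phi s'.
    by rewrite subr_ge0 ltW // (md_inc M) //; [exact: le_trans xs|exact: le_trans y1].
  apply: (@le_lt_trans _ _ ((q + 1) * (phi t' - phi s'))).
    by rewrite mulrDl mul1r lerDl.
  rewrite mulrC -ltr_pdivlMr; last by move: q0; clear; ord.
  by rewrite -mulrA -invfM.
have fin s' t' : x <= s' <= y -> x <= t' <= y -> `|s' - t'| < d -> iter j f s' < c < iter j f t' -> False.
  move=> sI' tI' dd cI'.
  have [h1 h2] := atom_cross P A cC (s := s') (t := t') (n := j)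
    ltac:(move: sI' x0 y1; clear; ord) ltac:(move: tI' x0 y1; clear; ord) cI'.
  have [st|st|e] := ltgtP s' t'.
  - by have := small s' t' ltac:(by case/andP: sI') st ltac:(by case/andP: tI') dd; rewrite ltNge h1.
  - by have := small t' s' ltac:(by case/andP: tI') st ltac:(by case/andP: sI') ltac:(by rewrite distrC);
      rewrite ltNge h2.
  - by move: cI'; rewrite e; clear; ord.
have [st|st|e] := ltgtP s t.
- have [|||||s' [t' [sI' tI' dd cI']]] := crossing (x := s) (y := t) (c := c) fj _ _ st d0.
  + by move: sI x0; clear; ord.
  + by move: tI y1; clear; ord.
  + move=> u v su uv vt; apply: (pm_plateau P j c) => //; first by move: sI x0 su; clear; ord.
    by move: tI y1 vt; clear; ord.
  + by case/andP: cI.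
  + by case/andP: cI.
  apply: (fin s' t') => //; first by move: sI' sI tI; clear; ord.
  by move: tI' sI tI; clear; ord.
- have gc : ctsI (fun u => - iter j f u).
    move=> u uI e1 e10; have [d1 d10 h1] := fj u uI e1 e10; exists d1 => // v vI vu.
    by rewrite -opprD normrN h1.
  have [|||||s' [t' [sI' tI' dd cI']]] := crossing (x := t) (y := s) (c := - c) gc _ _ st d0.
  + by move: tI x0; clear; ord.
  + by move: sI y1; clear; ord.
  + move=> u v su uv vt; have [||z zI hz] := pm_plateau P j c (x := u) (y := v) _ uv.
    * by move: tI x0 su; clear; ord.
    * by move: sI y1 vt; clear; ord.
    by exists z => // /oppr_inj.
  + by case/andP: cI; rewrite ltrN2.
  + by case/andP: cI; rewrite ltrN2.
  apply: (fin t' s') => //; first by move: tI' sI tI; clear; ord.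
  + by move: sI' sI tI; clear; ord.
  + by rewrite distrC.
  + by move: cI'; rewrite !ltrN2 andbC.
- by move: cI; rewrite e; clear; ord.
Qed.

End atomic_gauges.

(** * Limits of models *)

Section limits.
Variables (R : realType) (X : Type).
Implicit Types (x y z w c d e q u v s t lam : R) (f g phi : R -> R) (C : seq R) (U : set_system X)
  (F ph : X -> R -> R) (D : X -> seq R) (L : X -> R) (i : X).

Lemma lim_le U {PU : ProperFilter U} (p q : X -> R) x y : p @ U --> x -> q @ U --> y ->
  U [set i | p i <= q i] -> x <= y.
Proof.
move=> px qy h; rewrite leNgt; apply/negP => yx.
have e0 : 0 < (x - y) / 2 by rewrite divr_gt0 // subr_gt0.
have /cvgrPdist_lt /(_ _ e0) h1 := px; have /cvgrPdist_lt /(_ _ e0) h2 := qy.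
have [i [hi [i1 i2]]] := filter_ex (filterI h (filterI h1 h2)).
by move: hi i1 i2; rewrite /= !ltr_norml; clear -X; ord.
Qed.

Lemma seq_min C (Q : R -> R -> Prop) : (forall c d d', 0 < d' -> d' <= d -> Q c d -> Q c d') ->
  (forall c, c \in C -> exists2 d : R, 0 < d & Q c d) ->
  exists2 d : R, 0 < d & forall c, c \in C -> Q c d.
Proof.
move=> mon; elim: C => [|c C IH] H; first by exists 1.
have [d d0 hd] := IH ltac:(by move=> c' h; apply: H; rewrite inE h orbT).
have [d1 d10 hd1] := H c ltac:(by rewrite inE eqxx).
have m0 : 0 < Num.min d d1 by rewrite lt_min d0.
exists (Num.min d d1) => // c'; rewrite inE => /orP[/eqP->|h].
  by apply: mon hd1; rewrite // ge_min lexx orbT.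
by apply: mon (hd c' h); rewrite // ge_min lexx.
Qed.

(** Each lap has an image of length at most 1. The bound depends on the number of turning points
    only, so the slopes of an approximating family have a limit. *)
Lemma slope_le_laps f C lam phi : pmt f C -> model f lam phi -> lam <= (size C).+1%:R.
Proof.
move=> P M; pose n x y := count (fun c => x < c < y) C.
have H k : forall x y, 0 <= x -> x < y -> y <= 1 -> (n x y <= k)%N ->
    lam * (phi y - phi x) <= k.+1%:R.
  elim: k {-2}k (leqnn k) => [|N IH] k kN x y x0 xy y1 hk.
    have m : smono f x y.
      apply: (pm_mono P) => // c cC; apply/negP => cI.
      have : (0 < n x y)%N by rewrite -has_count; apply/hasP; exists c.
      by rewrite lt0n -leqn0 (leq_trans hk kN).
    rewrite -(md_conf M) //; apply: (@le_trans _ _ 1); last by rewrite ler1n.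
    have h1 := md_I M (pm_self P (x := x) lr); have h2 := md_I M (pm_self P (x := y) lr).
    by rewrite ler_norml; clear -h1 h2; ord.
  have [/hasP[c cC cI]|h] := boolP (has (fun c => x < c < y) C); last first.
    have m : smono f x y.
      apply: (pm_mono P) => // c cC; apply/negP => cI.
      by move/hasPn: h => /(_ c cC); rewrite cI.
    rewrite -(md_conf M) //; apply: (@le_trans _ _ 1); last by rewrite ler1n.
    have h1 := md_I M (pm_self P (x := x) lr); have h2 := md_I M (pm_self P (x := y) lr).
    by rewrite ler_norml; clear -h1 h2; ord.
  have split : (n x c + n c y + 1 <= n x y)%N.
    have one : (1 <= count (pred1 c) C)%N by rewrite -has_count has_pred1.
    apply: leq_trans (leq_add (leqnn _) one) _.
    rewrite /n; elim: (C) => //= b B IHB.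
    have : ((x < b < c)%R + (c < b < y)%R + (b == c) <= (x < b < y)%R)%N.
      have [l|l|->] := ltgtP b c; last by rewrite andbF cI.
        by rewrite andbT andFb !addn0; case: (ltP x b) => // xb; rewrite (lt_trans l); case/andP: cI.
      by rewrite andbF add0n addn0; case: (ltP b y) => // yb; rewrite (lt_trans _ l) //; case/andP: cI.
    by move: IHB; clear -X; lia.
  have n1 : (n x c < k)%N by move: split hk; clear -X; lia.
  have n2 : (n c y < k)%N by move: split hk; clear -X; lia.
  have [xc cy] := andP cI.
  have i1 := IH (n x c) ltac:(by rewrite -ltnS (leq_trans n1)) x c x0 xc ltac:(exact: ltW (lt_le_trans cy y1)) (leqnn _).
  have i2 := IH (n c y) ltac:(by rewrite -ltnS (leq_trans n2)) c y ltac:(exact: ltW (le_lt_trans x0 xc)) cy y1 (leqnn _).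
  have i3 : ((n x c).+1%:R + (n c y).+1%:R : R) <= k.+1%:R.
    by rewrite -natrD ler_nat; move: split hk; clear -X; lia.
  apply: le_trans i3.
  have -> : lam * (phi y - phi x) = lam * (phi c - phi x) + lam * (phi y - phi c) by ring.
  exact: lerD.
have := H (n 0 1) 0 1 lr ltr01 lr (leqnn _); rewrite (md_0 M) (md_1 M) subr0 mulr1.
by move=> h; apply: le_trans h _; rewrite ler_nat ltnS count_size.
Qed.

Record approx U F D L ph f C : Prop := Approx {
  ap_U : UltraFilter U;
  ap_f : pmt f C;
  ap_F : forall i, pmt (F i) (D i);
  ap_size : forall i, size (D i) = size C;
  ap_model : forall i, model (F i) (L i) (ph i);
  ap_cvg : forall e, 0 < e -> U [set i | forall x, 0 <= x <= 1 -> `|F i x - f x| < e] }.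

Definition Lim U L := ulim U L.
(** The extension by 0 and 1 gives sense to both one-sided limits at the end points of [0,1], where
    an atom is the jump from 0 or the jump to 1. *)
Definition PLim U ph x := if x < 0 then 0 else if 1 < x then 1 else ulim U (fun i => ph i x).
Definition limr U ph x := inf [set PLim U ph t | t in [set t | x < t]].
Definition liml U ph x := sup [set PLim U ph t | t in [set t | t < x]].
Definition lgap U ph x y := liml U ph y - limr U ph x.
Definition atom U ph x := limr U ph x - liml U ph x.

Section approximation.
Variables (U : set_system X) (F : X -> R -> R) (D : X -> seq R) (L : X -> R) (ph : X -> R -> R)
  (f : R -> R) (C : seq R).
Hypothesis A : approx U F D L ph f C.

Local Instance ap_proper : ProperFilter U := @ultra_proper _ _ (ap_U A).

Lemma ap_nd i x y : 0 <= x -> x <= y -> y <= 1 -> ph i x <= ph i y.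
Proof.
move=> x0; rewrite le_eqVlt => /orP[/eqP->//|xy] y1.
exact/ltW/(md_inc (ap_model A i)).
Qed.

Lemma ap_phI i x : 0 <= x <= 1 -> 0 <= ph i x <= 1.
Proof.
by move=> /andP[x0 x1]; rewrite -{1}(md_0 (ap_model A i)) -(md_1 (ap_model A i)) !ap_nd // lexx.
Qed.

Local Notation P := (PLim U ph).
Local Notation lamL := (Lim U L).
Local Notation pr := (limr U ph).
Local Notation pl := (liml U ph).
Local Notation l := (lgap U ph).
Local Notation a := (atom U ph).

Lemma P_cvg x : 0 <= x <= 1 -> (fun i => ph i x) @ U --> P x.
Proof.
move=> xI; rewrite /PLim !ltNge; case/andP: (xI) => -> -> /=.
apply: (@ulim_cvg _ _ _ (ap_U A) _ 1) => i.
by have := ap_phI i xI; rewrite ler_norml; clear -A; ord.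
Qed.

Lemma lam_cvg : L @ U --> lamL.
Proof.
apply: (@ulim_cvg _ _ _ (ap_U A) _ (size C).+1%:R) => i.
rewrite ger0_norm; last exact: md_lam (ap_model A i).
by rewrite -(ap_size A i); apply: slope_le_laps (ap_F A i) (ap_model A i).
Qed.

Lemma lam_sqr : 2 <= lamL ^+ 2.
Proof.
apply: (@lim_le U _ (fun=> 2) (fun i => L i ^+ 2)) => //; first exact: cvg_cst.
  by rewrite expr2; under eq_fun do rewrite expr2; apply: cvgM; exact: lam_cvg.
by apply: filterE => i; exact: model_sqrt2 (ap_F A i) (ap_model A i).
Qed.

Lemma lam_ge0 : 0 <= lamL.
Proof.
apply: (@lim_le U _ (fun=> 0) L) => //; [exact: cvg_cst|exact: lam_cvg|].
by apply: filterE => i; exact: md_lam (ap_model A i).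
Qed.

Lemma P_0 : P 0 = 0.
Proof.
rewrite /PLim ltxx ltr10; apply: (@ulimE _ _ _ (ap_U A)).
by under eq_fun do rewrite (md_0 (ap_model A _)); apply: cvg_cst.
Qed.

Lemma P_1 : P 1 = 1.
Proof.
rewrite /PLim ltxx ltr10; apply: (@ulimE _ _ _ (ap_U A)).
by under eq_fun do rewrite (md_1 (ap_model A _)); apply: cvg_cst.
Qed.

Lemma P_I x : 0 <= P x <= 1.
Proof.
have [h|h] := ltP x 0; first by rewrite /PLim h lexx ler01.
have [h'|h'] := ltP 1 x; first by rewrite /PLim ltNge h h' lexx ler01.
have xI : 0 <= x <= 1 by rewrite h.
apply/andP; split.
  apply: (@lim_le U _ (fun=> 0) (fun i => ph i x)) => //; [exact: cvg_cst|exact: P_cvg|].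
  by apply: filterE => i; case/andP: (ap_phI i xI).
apply: (@lim_le U _ (fun i => ph i x) (fun=> 1)) => //; [exact: P_cvg|exact: cvg_cst|].
by apply: filterE => i; case/andP: (ap_phI i xI).
Qed.

Lemma P_nd x y : x <= y -> P x <= P y.
Proof.
move=> xy; have [h|h] := ltP x 0; first by rewrite {1}/PLim h; case/andP: (P_I y).
have [h'|h'] := ltP 1 y; first by rewrite {2}/PLim ltNge (le_trans h xy) h'; case/andP: (P_I x).
apply: (@lim_le U _ (fun i => ph i x) (fun i => ph i y)) => //.
- by apply: P_cvg; rewrite h (le_trans xy).
- by apply: P_cvg; rewrite h' (le_trans h xy).
- by apply: filterE => i; apply: ap_nd.
Qed.

Lemma pr_le x t : x < t -> pr x <= P t.
Proof.
move=> xt; apply: ge_inf; last by exists t.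
by exists 0 => _ [z _ <-]; case/andP: (P_I z).
Qed.

Lemma le_pl x t : t < x -> P t <= pl x.
Proof.
move=> xt; apply: ub_le_sup; last by exists t.
by exists 1 => _ [z _ <-]; case/andP: (P_I z).
Qed.

Lemma pr_ap x y e : 0 < e -> x < y -> exists2 v : R, x < v < y & P v < pr x + e.
Proof.
move=> e0 xy.
have hi : has_inf [set P t | t in [set t | x < t]].
  split; first by exists (P y), y.
  by exists 0 => _ [z _ <-]; case/andP: (P_I z).
have [_ [z /= xz <-] hz] := inf_adherent e0 hi.
have m0 : x < Num.min z y by rewrite lt_min xz.
have [m1 m2] : Num.min z y <= z /\ Num.min z y <= y by rewrite !ge_min !lexx orbT.
exists ((x + Num.min z y) / 2); first by move: m0 m1 m2; clear -A; ord.
by apply: le_lt_trans hz; apply: P_nd; move: m0 m1; clear -A; ord.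
Qed.

Lemma pl_ap x y e : 0 < e -> x < y -> exists2 u : R, x < u < y & pl y - e < P u.
Proof.
move=> e0 xy.
have hi : has_sup [set P t | t in [set t | t < y]].
  split; first by exists (P x), x.
  by exists 1 => _ [z _ <-]; case/andP: (P_I z).
have [_ [z /= xz <-] hz] := sup_adherent e0 hi.
have m0 : Num.max z x < y by rewrite gt_max xz.
have [m1 m2] : z <= Num.max z x /\ x <= Num.max z x by rewrite !le_max !lexx orbT.
exists ((Num.max z x + y) / 2); first by move: m0 m1 m2; clear -A; ord.
by apply: lt_le_trans hz _; apply: P_nd; move: m0 m1; clear -A; ord.
Qed.

Lemma pl_0 : pl 0 = 0.
Proof.
apply/eqP; rewrite eq_le; apply/andP; split.
  apply: ge_sup; first by exists (P (-1)), (-1) => //=; rewrite oppr_lt0.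
  by move=> _ [z /= z0 <-]; rewrite /PLim z0.
have := le_pl (x := 0) (t := -1); rewrite {1}/PLim oppr_lt0 ltr01; exact.
Qed.

Lemma pr_1 : pr 1 = 1.
Proof.
apply/eqP; rewrite eq_le; apply/andP; split.
  apply: le_trans (pr_le (x := 1) (t := 2) _) _; first by rewrite ltr1n.
  by case/andP: (P_I 2).
apply: lb_le_inf; first by exists (P 2), 2 => //=; rewrite ltr1n.
by move=> _ [z /= z1 <-]; rewrite /PLim z1 ltNge (ltW (lt_trans ltr01 z1)).
Qed.

Lemma pl_le_P x : pl x <= P x.
Proof.
apply: ge_sup; first by exists (P (x - 1)), (x - 1) => //=; rewrite ltrBlDr ltrDl.
by move=> _ [z /= zx <-]; apply/P_nd/ltW.
Qed.

Lemma P_le_pr x : P x <= pr x.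
Proof.
apply: lb_le_inf; first by exists (P (x + 1)), (x + 1) => //=; rewrite ltrDl.
by move=> _ [z /= zx <-]; apply/P_nd/ltW.
Qed.

(* Near-infinitesimal bounds for values: an end point counts as beyond itself. *)
Definition below u z := u < z \/ u = 0.
Definition above v z := z < v \/ v = 1.

Lemma ap_below u x : 0 <= x <= 1 -> below u (f x) -> U [set i | u <= F i x].
Proof.
move=> xI [h|->]; last by apply: filterE => i; case/andP: (pm_self (ap_F A i) xI).
have e0 : 0 < f x - u by rewrite subr_gt0.
apply: filterS (ap_cvg A e0) => i /(_ x xI); rewrite /= ltr_norml; clear -A; ord.
Qed.

Lemma ap_above v x : 0 <= x <= 1 -> above v (f x) -> U [set i | F i x <= v].
Proof.
move=> xI [h|->]; last by apply: filterE => i; case/andP: (pm_self (ap_F A i) xI).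
have e0 : 0 < v - f x by rewrite subr_gt0.
apply: filterS (ap_cvg A e0) => i /(_ x xI); rewrite /= ltr_norml; clear -A; ord.
Qed.

Lemma ap_lip s t u v : 0 <= s <= 1 -> 0 <= t <= 1 -> 0 <= u <= 1 -> 0 <= v <= 1 ->
  above u (f s) -> below v (f t) -> P v - P u <= lamL * `|P t - P s|.
Proof.
move=> sI tI uI vI hu hv.
apply: (@lim_le U _ (fun i => ph i v - ph i u) (fun i => L i * `|ph i t - ph i s|)) => //.
- by apply: cvgB; apply: P_cvg.
- apply: cvgM; first exact: lam_cvg.
  have h : (fun i => ph i t - ph i s) @ U --> P t - P s by apply: cvgB; apply: P_cvg.
  exact: cvg_norm h.
apply: filterS (filterI (ap_above sI hu) (ap_below tI hv)) => i [h1 h2] /=.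
have M := ap_model A i.
apply: le_trans (conf_lip (ap_F A i) (md_conf M) (ap_nd i) sI tI).
apply: le_trans (ler_norm _).
have Fs := pm_self (ap_F A i) sI; have Ft := pm_self (ap_F A i) tI.
apply: lerB; apply: ap_nd => //; [by case/andP: vI|by case/andP: Ft|by case/andP: Fs|by case/andP: uI].
Qed.

(** Three values around a fold keep their order under a small perturbation, which forces a turning
    point of [F i] nearby. Both maps have equally many turning points, so there are no others; this
    is where fixed modality enters. *)
Lemma near_turning d : 0 < d -> U [set i | exists g : R -> R, (forall c, c \in C -> `|g c - c| < d) /\
  D i =i map g C].
Proof.
move=> d0; have Pf := ap_f A.
have [d1 d10 gap] : exists2 d1 : R, 0 < d1 & forall c, c \in C -> forall c', c' \in C -> c' != c -> d1 <= `|c' - c|.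
  apply: seq_min; first by move=> c e e' _ ee H c' h1 h2; apply: le_trans ee (H c' h1 h2).
  by move=> c cC; have [e e0 he] := gap_seq C c; exists e.
pose r0 := Num.min d (d1 / 2).
have r00 : 0 < r0 by rewrite lt_min d0 divr_gt0.
have [m1 m2] : r0 <= d /\ r0 <= d1 / 2 by rewrite !ge_min !lexx orbT.
have one c : c \in C -> U [set i | exists2 c', c' \in D i & `|c' - c| < r0].
  move=> cC; have [r r1 [a1 a2 H]] := pm_fold Pf cC.
  pose s := Num.min r (r0 / 2).
  have s0 : 0 < s by rewrite lt_min r1 divr_gt0.
  have [s1 s2] : s <= r /\ s <= r0 / 2 by rewrite !ge_min !lexx orbT.
  clearbody s r0.
  have s3 : s < r0 by move: s2 r00; clear -A; ord.
  have b1 : 0 <= c - s by move: a1 s1; clear -A; ord.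
  have b2 : c + s <= 1 by move: a2 s1; clear -A; ord.
  have e1 : c - r <= c - s by rewrite lerD2l lerN2.
  have e2 : c + s <= c + r by rewrite lerD2l.
  have e3 : c - s < c by rewrite ltrBlDr ltrDl.
  have e4 : c < c + s by rewrite ltrDl.
  have I1 : 0 <= c - s <= 1 by move: b1 b2 s0; clear -A; ord.
  have I2 : 0 <= c <= 1 by move: b1 b2 s0; clear -A; ord.
  have I3 : 0 <= c + s <= 1 by move: b1 b2 s0; clear -A; ord.
  have red : U [set i | ~ smono (F i) (c - s) (c + s)] -> U [set i | exists2 c', c' \in D i & `|c' - c| < r0].
    move=> h; apply: filterS h => i h; apply: contrapT => no; apply: h.
    apply: (pm_mono (ap_F A i)) => //; first by move: s0; clear -A; ord.
    move=> c' hc'; apply/negP => c'I; apply: no; exists c' => //.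
    by rewrite ltr_norml; move: c'I s3; clear -A; ord.
  apply: red; case: H => -[h1 h2].
  - have g1 := h1 (c - s) c e1 e3 (lexx _); have g2 := h2 c (c + s) (lexx _) e4 e2.
    have q0 : 0 < Num.min (f c - f (c - s)) (f c - f (c + s)) / 2 by rewrite divr_gt0 // lt_min !subr_gt0 g1.
    have [q1 q2] : Num.min (f c - f (c - s)) (f c - f (c + s)) <= f c - f (c - s) /\
      Num.min (f c - f (c - s)) (f c - f (c + s)) <= f c - f (c + s) by rewrite !ge_min !lexx orbT.
    apply: filterS (ap_cvg A q0) => i h /= hm.
    have k1 := h _ I1; have k2 := h _ I2; have k3 := h _ I3.
    move: k1 k2 k3 q0 q1 q2; move: (Num.min _ _) => q; rewrite !ltr_norml => k1 k2 k3 q0 q1 q2.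
    case: hm => hm.
      by have := hm c (c + s) (ltW e3) e4 (lexx _); move: k1 k2 k3 q0 q1 q2; clear -A; ord.
    by have := hm (c - s) c (lexx _) e3 (ltW e4); move: k1 k2 k3 q0 q1 q2; clear -A; ord.
  - have g1 := h1 (c - s) c e1 e3 (lexx _); have g2 := h2 c (c + s) (lexx _) e4 e2.
    have q0 : 0 < Num.min (f (c - s) - f c) (f (c + s) - f c) / 2 by rewrite divr_gt0 // lt_min !subr_gt0 g1.
    have [q1 q2] : Num.min (f (c - s) - f c) (f (c + s) - f c) <= f (c - s) - f c /\
      Num.min (f (c - s) - f c) (f (c + s) - f c) <= f (c + s) - f c by rewrite !ge_min !lexx orbT.
    apply: filterS (ap_cvg A q0) => i h /= hm.
    have k1 := h _ I1; have k2 := h _ I2; have k3 := h _ I3.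
    move: k1 k2 k3 q0 q1 q2; move: (Num.min _ _) => q; rewrite !ltr_norml => k1 k2 k3 q0 q1 q2.
    case: hm => hm.
      by have := hm (c - s) c (lexx _) e3 (ltW e4); move: k1 k2 k3 q0 q1 q2; clear -A; ord.
    by have := hm c (c + s) (ltW e3) e4 (lexx _); move: k1 k2 k3 q0 q1 q2; clear -A; ord.
have all : U [set i | forall c, c \in C -> exists2 c', c' \in D i & `|c' - c| < r0].
  elim: (C) one => [|c B IH] H; first by apply: filterE.
  have h1 := H c ltac:(by rewrite inE eqxx).
  have h2 := IH ltac:(by move=> c' h; apply: H; rewrite inE h orbT).
  apply: filterS (filterI h1 h2) => i [k1 k2] c'; rewrite inE => /orP[/eqP->//|]; exact: k2.
apply: filterS all => i H.
have [g hg] : {g : R -> R & forall c, c \in C -> g c \in D i /\ `|g c - c| < r0}.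
  apply: (@choice _ _ (fun c x => c \in C -> x \in D i /\ `|x - c| < r0)) => c.
  have [cC|nC] := boolP (c \in C); last by exists 0.
  by have [c' h1 h2] := H c cC; exists c'.
exists g; split; first by move=> c /hg[_ h]; apply: lt_le_trans h m1.
have ug : uniq (map g C).
  rewrite map_inj_in_uniq ?(pm_uniq Pf) // => c c' cC c'C e.
  apply/eqP; rewrite -[_ == _]negbK; apply/negP => ne.
  have := gap c' c'C c cC ne; have [_ h1] := hg c cC; have [_ h2] := hg c' c'C.
  move: h1 h2; rewrite e !ltr_norml leNgt ltr_norml => h1 h2 /negP; apply.
  by move: h1 h2 m2; clear -A; ord.
have sub : {subset map g C <= D i} by move=> _ /mapP[c cC ->]; have [] := hg c cC.
have [_ E] := uniq_min_size ug sub ltac:(by rewrite size_map (ap_size A)).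
by move=> x; rewrite E.
Qed.

Lemma ap_mono x y : 0 <= x -> x < y -> y <= 1 -> (forall c, c \in C -> ~~ (x <= c <= y)) ->
  U [set i | smono (F i) x y].
Proof.
move=> x0 xy y1 H.
have [d d0 hd] : exists2 d : R, 0 < d & forall c, c \in C -> c + d <= x \/ y <= c - d.
  apply: seq_min; first by move=> c e e' _; clear -A; ord.
  move=> c cC; have := H c cC; rewrite negb_and -!ltNge => /orP[h|h].
    by exists (x - c); [rewrite subr_gt0|left; rewrite addrC subrK].
  by exists (c - y); [rewrite subr_gt0|right; rewrite opprB addrC subrK].
apply: filterS (near_turning d0) => i [g [hg E]].
apply: (pm_mono (ap_F A i)) => // c'; rewrite E => /mapP[c cC ->].
apply/negP => cI; have := hg c cC; have := hd c cC; move: cI; rewrite ltr_norml; clear -A; ord.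
Qed.

Lemma ap_foldE x y c : c \in C -> 0 <= x -> x < c -> c < y -> y <= 1 ->
  (forall c', c' \in C -> c' != c -> ~~ (x <= c' <= y)) ->
  U [set i | exists2 c' : R, x < c' < y & smono (F i) x c' /\ smono (F i) c' y].
Proof.
move=> cC x0 xc cy y1 H.
have [d1 d10 hd1] : exists2 d : R, 0 < d & forall c', c' \in C -> c' != c -> c' + d <= x \/ y <= c' - d.
  apply: seq_min; first by move=> c' e e' _ ee h ne; have := h ne; move: ee; clear -A; ord.
  move=> c' c'C; have [->|ne] := eqVneq c' c; first by exists 1.
  have := H c' c'C ne; rewrite negb_and -!ltNge => /orP[h|h].
    by exists (x - c'); [rewrite subr_gt0|left; rewrite addrC subrK].
  by exists (c' - y); [rewrite subr_gt0|right; rewrite opprB addrC subrK].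
pose d := Num.min d1 (Num.min (c - x) (y - c)).
have d0 : 0 < d by rewrite !lt_min d10 !subr_gt0 xc.
have [h1 [h2 h3]] : d <= d1 /\ (d <= c - x /\ d <= y - c) by rewrite /d !ge_min !lexx !orbT.
clearbody d.
apply: filterS (near_turning d0) => i [g [hg E]].
have gc := hg c cC; rewrite ltr_norml in gc.
have gI : x < g c < y by move: gc h2 h3; clear -A; ord.
have [g1 g2] := andP gI.
exists (g c) => //; split; apply: (pm_mono (ap_F A i)) => //.
- exact: ltW (lt_le_trans g2 y1).
- move=> c'; rewrite E => /mapP[b bC ->]; apply/negP => bI.
  have [e|ne] := eqVneq b c; first by move: bI; rewrite e; clear -A; ord.
  have := hg b bC; have := hd1 b bC ne; move: bI h1 gI; rewrite ltr_norml; clear -A; ord.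
- exact: ltW (le_lt_trans x0 g1).
- move=> c'; rewrite E => /mapP[b bC ->]; apply/negP => bI.
  have [e|ne] := eqVneq b c; first by move: bI; rewrite e; clear -A; ord.
  have := hg b bC; have := hd1 b bC ne; move: bI h1 gI; rewrite ltr_norml; clear -A; ord.
Qed.

Lemma conf_within i x y u v : 0 <= x -> x < y -> y <= 1 -> smono (F i) x y -> 0 <= u -> v <= 1 ->
  u <= F i x <= v -> u <= F i y <= v -> L i * (ph i y - ph i x) <= ph i v - ph i u.
Proof.
move=> x0 xy y1 m u0 v1 xI yI; rewrite -(md_conf (ap_model A i)) //.
have h1 := ap_nd i (x := u) (y := F i x) u0 ltac:(by case/andP: xI) ltac:(by case/andP: xI => _ h; exact: le_trans h v1).
have h2 := ap_nd i (x := u) (y := F i y) u0 ltac:(by case/andP: yI) ltac:(by case/andP: yI => _ h; exact: le_trans h v1).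
have h3 := ap_nd i (x := F i x) (y := v) ltac:(by case/andP: xI => h _; exact: le_trans u0 h) ltac:(by case/andP: xI) v1.
have h4 := ap_nd i (x := F i y) (y := v) ltac:(by case/andP: yI => h _; exact: le_trans u0 h) ltac:(by case/andP: yI) v1.
by rewrite ler_norml; move: h1 h2 h3 h4; clear -A; ord.
Qed.

Lemma ap_expand x y u v : 0 <= x -> x < y -> y <= 1 -> (forall c, c \in C -> ~~ (x <= c <= y)) ->
  0 <= u <= 1 -> 0 <= v <= 1 -> below u (f x) -> below u (f y) -> above v (f x) -> above v (f y) ->
  lamL * (P y - P x) <= P v - P u.
Proof.
move=> x0 xy y1 H uI vI b1 b2 a1 a2.
have xI : 0 <= x <= 1 by rewrite x0 (le_trans (ltW xy)).
have yI : 0 <= y <= 1 by rewrite y1 (le_trans x0 (ltW xy)).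
apply: (@lim_le U _ (fun i => L i * (ph i y - ph i x)) (fun i => ph i v - ph i u)) => //.
- by apply: cvgM; [exact: lam_cvg|apply: cvgB; apply: P_cvg].
- by apply: cvgB; apply: P_cvg.
apply: filterS (filterI (ap_mono x0 xy y1 H) (filterI (filterI (ap_below xI b1) (ap_below yI b2))
  (filterI (ap_above xI a1) (ap_above yI a2)))) => i [m [[k1 k2] [k3 k4]]] /=.
apply: conf_within => //; [by case/andP: uI|by case/andP: vI|by rewrite k1 k3|by rewrite k2 k4].
Qed.

(** Here [F i] has two laps, and the image of each lies in [u,v]. *)
Lemma ap_fold_expand x y c u v : c \in C -> 0 <= x -> x < c -> c < y -> y <= 1 ->
  (forall c', c' \in C -> c' != c -> ~~ (x <= c' <= y)) ->
  0 <= u <= 1 -> 0 <= v <= 1 ->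
  (exists2 e : R, 0 < e & forall z, x <= z <= y -> (u = 0 \/ u + e <= f z) /\ (v = 1 \/ f z <= v - e)) ->
  lamL * (P y - P x) <= 2 * (P v - P u).
Proof.
move=> cC x0 xc cy y1 H uI vI [e e0 he].
have xy := lt_trans xc cy.
have xI : 0 <= x <= 1 by rewrite x0 (le_trans (ltW xy)).
have yI : 0 <= y <= 1 by rewrite y1 (le_trans x0 (ltW xy)).
apply: (@lim_le U _ (fun i => L i * (ph i y - ph i x)) (fun i => 2 * (ph i v - ph i u))) => //.
- by apply: cvgM; [exact: lam_cvg|apply: cvgB; apply: P_cvg].
- by apply: cvgM; [exact: cvg_cst|apply: cvgB; apply: P_cvg].
apply: filterS (filterI (ap_foldE cC x0 xc cy y1 H) (ap_cvg A e0)) => i [[c' cI [m1 m2]] hF] /=.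
have bnd z : x <= z <= y -> u <= F i z <= v.
  move=> zI; have zI' : 0 <= z <= 1 by move: zI x0 y1; clear -A; ord.
  have [k1 k2] := he z zI; have := hF z zI'; rewrite ltr_norml => k3.
  have k4 := pm_self (ap_F A i) zI'.
  by move: k1 k2 k3 k4; clear -A; ord.
have [c1 c2] := andP cI.
have := @conf_within i x c' u v x0 c1 ltac:(exact: ltW (lt_le_trans c2 y1)) m1 ltac:(by case/andP: uI)
  ltac:(by case/andP: vI) (bnd x ltac:(by rewrite lexx ltW)) (bnd c' ltac:(by rewrite !ltW)).
have := @conf_within i c' y u v ltac:(exact: ltW (le_lt_trans x0 c1)) c2 y1 m2 ltac:(by case/andP: uI)
  ltac:(by case/andP: vI) (bnd c' ltac:(by rewrite !ltW)) (bnd y ltac:(by rewrite lexx ltW)).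
by rewrite !mulrBr; move: (L i * ph i c') (L i * ph i x) (L i * ph i y) => q1 q2 q3; clear -A; ord.
Qed.

Lemma atom_le x s t : 0 <= x <= 1 -> s < x \/ s = 0 -> x < t \/ t = 1 -> s <= x <= t ->
  a x <= P t - P s.
Proof.
move=> xI hs ht sxt; apply: lerB.
  case: ht => [h|e]; first exact: pr_le.
  have [l|e'] : x < t \/ x = t by move: sxt; clear -A; ord.
    exact: pr_le.
  by rewrite e' e P_1 pr_1.
case: hs => [h|e]; first exact: le_pl.
have [l|e'] : s < x \/ x = s by move: sxt; clear -A; ord.
  exact: le_pl.
by rewrite e' e P_0 pl_0.
Qed.

Lemma atom_ap x e : 0 <= x <= 1 -> 0 < e -> exists u v : R, [/\ 0 <= u <= x, x <= v <= 1,
  u < x \/ u = 0, x < v \/ v = 1 & P v - P u < a x + e].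
Proof.
move=> xI e0; have e20 : 0 < e / 2 by rewrite divr_gt0.
have [u [uI hu ue]] : exists u : R, [/\ 0 <= u <= x, u < x \/ u = 0 & pl x - e / 2 < P u].
  have [h|h] : 0 < x \/ x = 0 by move: xI; clear -A; ord.
    have [u uI hu] := pl_ap e20 h; exists u; split => //; first by move: uI; clear -A; ord.
    by left; case/andP: uI.
  exists 0; rewrite h lexx pl_0 P_0; split => //; first by right.
  by rewrite sub0r oppr_lt0.
have [v [vI hv ve]] : exists v : R, [/\ x <= v <= 1, x < v \/ v = 1 & P v < pr x + e / 2].
  have [h|h] : x < 1 \/ x = 1 by move: xI; clear -A; ord.
    have [v vI hv] := pr_ap e20 h; exists v; split => //; first by move: vI; clear -A; ord.
    by left; case/andP: vI.
  exists 1; rewrite h lexx pr_1 P_1; split => //; first by right.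
  by rewrite ltrDl.
exists u, v; split => //; rewrite /atom; move: ue ve; clear -A; ord.
Qed.

Lemma atom_ge0 x : 0 <= a x.
Proof. by rewrite subr_ge0 (le_trans (pl_le_P x) (P_le_pr x)). Qed.

Lemma atom_le1 x : a x <= 1.
Proof.
have h1 : pr x <= 1.
  by apply: le_trans (pr_le (t := x + 1) _) _; [rewrite ltrDl|case/andP: (P_I (x + 1))].
have h2 : 0 <= pl x.
  by apply: le_trans (le_pl (t := x - 1) _); [case/andP: (P_I (x - 1))|rewrite ltrBlDr ltrDl].
by rewrite /atom; move: h1 h2; clear -A; ord.
Qed.

Lemma pr_le_pl x y : x < y -> pr x <= pl y.
Proof.
move=> xy; apply: le_trans (pr_le (t := (x + y) / 2) _) (le_pl _); move: xy; clear -A; ord.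
Qed.

Lemma itv_near x d : 0 <= x <= 1 -> 0 < d -> exists s t : R, [/\ 0 <= s <= x, x <= t <= 1, s < t,
  s < x \/ s = 0 & x < t \/ t = 1] /\ forall z, s <= z <= t -> `|z - x| < d.
Proof.
move=> xI d0; pose r := Num.min d 1 / 2.
have m0 : 0 < Num.min d 1 by rewrite lt_min d0 ltr01.
have [m1 m2] : Num.min d 1 <= d /\ Num.min d 1 <= 1 by rewrite !ge_min !lexx orbT.
have [r0 rd r1] : [/\ 0 < r, r < d & r <= 1 / 2] by rewrite /r; split; move: m0 m1 m2; clear -A; ord.
clearbody r.
have [s [sI s1 s2]] : exists s : R, [/\ 0 <= s <= x, x - r <= s & (s < x /\ s <= 1/2) \/ (s < x /\ s = x - r) \/ s = 0].
  have [h|h] := leP r x; [exists (x - r)|exists 0]; split.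
  - by move: h r0; clear -A; ord.
  - by [].
  - by right; left; split => //; rewrite ltrBlDr ltrDl.
  - by move: xI; clear -A; ord.
  - by move: h; clear -A; ord.
  - by right; right.
have [t [tI t1 t2]] : exists t : R, [/\ x <= t <= 1, t <= x + r & (x < t /\ t = x + r) \/ t = 1].
  have [h|h] := leP (x + r) 1; [exists (x + r)|exists 1]; split.
  - by move: h r0; clear -A; ord.
  - by [].
  - by left; split => //; rewrite ltrDl.
  - by move: xI; clear -A; ord.
  - by move: h; clear -A; ord.
  - by right.
exists s, t; split; last by move=> z zI; rewrite ltr_norml; move: zI s1 t1 rd; clear -A; ord.
split => //; move: s2 t2 sI tI r0 r1 xI; clear -A; ord.
Qed.

Lemma below_near u x : 0 <= x <= 1 -> below u (f x) -> exists2 d : R, 0 < d &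
  forall z, 0 <= z <= 1 -> `|z - x| < d -> below u (f z).
Proof.
move=> xI [h|h]; last by exists 1 => // z _ _; right.
have [d d0 hd] := ctsI_gt (pm_cts (ap_f A)) xI h.
by exists d => // z zI zx; left; apply: hd.
Qed.

Lemma above_near v x : 0 <= x <= 1 -> above v (f x) -> exists2 d : R, 0 < d &
  forall z, 0 <= z <= 1 -> `|z - x| < d -> above v (f z).
Proof.
move=> xI [h|h]; last by exists 1 => // z _ _; right.
have [d d0 hd] := ctsI_lt (pm_cts (ap_f A)) xI h.
by exists d => // z zI zx; left; apply: hd.
Qed.

(** A short interval around [x] is mapped monotonically by the approximating maps into an interval
    around [f x] whose length is close to the atom there. *)
Lemma atom_reg x : 0 <= x <= 1 -> x \notin C -> lamL * a x <= a (f x).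
Proof.
move=> xI xC; have fxI := pm_self (ap_f A) xI.
apply/ler_addgt0Pr => /= e e0.
have [u [v [uI vI hu hv ue]]] := atom_ap fxI e0.
have [d1 d10 h1] := @below_near u x xI ltac:(exact: hu).
have [d2 d20 h2] := @above_near v x xI ltac:(exact: hv).
have [d3 d30 h3] := gap_seq C x.
pose d := Num.min d1 (Num.min d2 d3).
have d0 : 0 < d by rewrite !lt_min d10 d20.
have [m1 [m2 m3]] : d <= d1 /\ (d <= d2 /\ d <= d3) by rewrite /d !ge_min !lexx !orbT.
have [s [t [[sI tI st hs ht] H]]] := itv_near xI d0.
have Hs := H s ltac:(by rewrite lexx ltW); have Ht := H t ltac:(by rewrite lexx ltW).
have sI' : 0 <= s <= 1 by move: sI xI; clear -A; ord.
have tI' : 0 <= t <= 1 by move: tI xI; clear -A; ord.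
have uI' : 0 <= u <= 1 by move: uI fxI; clear -A; ord.
have vI' : 0 <= v <= 1 by move: vI fxI; clear -A; ord.
apply: le_trans (ltW ue).
apply: (@le_trans _ _ (lamL * (P t - P s))).
  apply: ler_wpM2l; first exact: lam_ge0.
  by apply: atom_le => //; move: sI tI; clear -A; ord.
apply: ap_expand => //; [by case/andP: sI'|by case/andP: tI'| | | | |].
- move=> c cC; apply/negP => cI.
  have ne : c != x by apply/eqP => e'; move: xC; rewrite -e' cC.
  by have := h3 c cC ne; rewrite leNgt (lt_le_trans (H c cI) m3).
- exact: h1 (lt_le_trans Hs m1).
- exact: h1 (lt_le_trans Ht m1).
- exact: h2 (lt_le_trans Hs m2).
- exact: h2 (lt_le_trans Ht m2).
Qed.

Lemma atom_fold c : c \in C -> lamL * a c <= 2 * a (f c).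
Proof.
move=> cC; have cI := fold_in (ap_f A) cC.
have cI' : 0 <= c <= 1 by rewrite !ltW //; case/andP: cI.
have fcI := pm_self (ap_f A) cI'.
apply/ler_addgt0Pr => /= e e0; have e20 : 0 < e / 2 by rewrite divr_gt0.
have [u [v [uI vI hu hv ue]]] := atom_ap fcI e20.
have [r r0 hr] : exists2 r : R, 0 < r & (u = 0 \/ u + r + r <= f c) /\ (v = 1 \/ f c <= v - r - r).
  have [r1 r10 h1] : exists2 r : R, 0 < r & u = 0 \/ u + r + r <= f c.
    case: hu => h; last by exists 1 => //; left.
    by exists ((f c - u) / 2); [rewrite divr_gt0 // subr_gt0|right; clear -A; ord].
  have [r2 r20 h2] : exists2 r : R, 0 < r & v = 1 \/ f c <= v - r - r.
    case: hv => h; last by exists 1 => //; left.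
    by exists ((v - f c) / 2); [rewrite divr_gt0 // subr_gt0|right; clear -A; ord].
  have [m1 m2] : Num.min r1 r2 <= r1 /\ Num.min r1 r2 <= r2 by rewrite !ge_min !lexx orbT.
  exists (Num.min r1 r2); first by rewrite lt_min r10.
  by move: h1 h2 m1 m2; move: (Num.min r1 r2) => r; clear -A; ord.
have [d1 d10 h1] := pm_cts (ap_f A) cI' r0.
have [d3 d30 h3] := gap_seq C c.
pose d := Num.min d1 d3.
have d0 : 0 < d by rewrite !lt_min d10.
have [m1 m3] : d <= d1 /\ d <= d3 by rewrite /d !ge_min !lexx !orbT.
have [s [t [[sI tI st hs ht] H]]] := itv_near cI' d0.
have sI' : 0 <= s <= 1 by move: sI cI'; clear -A; ord.
have tI' : 0 <= t <= 1 by move: tI cI'; clear -A; ord.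
have uI' : 0 <= u <= 1 by move: uI fcI; clear -A; ord.
have vI' : 0 <= v <= 1 by move: vI fcI; clear -A; ord.
have sc : s < c by case: hs => // ->; case/andP: cI.
have ct : c < t by case: ht => // ->; case/andP: cI.
apply: (@le_trans _ _ (2 * (P v - P u))); last by move: ue; clear -A; ord.
apply: (@le_trans _ _ (lamL * (P t - P s))).
  apply: ler_wpM2l; first exact: lam_ge0.
  by apply: atom_le => //; move: sI tI; clear -A; ord.
apply: (@ap_fold_expand s t c) => //; [by case/andP: sI'|by case/andP: tI'| |].
- move=> c' c'C ne; apply/negP => c'I.
  by have := h3 c' c'C ne; rewrite leNgt (lt_le_trans (H c' c'I) m3).
- exists r => // z zI; have zI' : 0 <= z <= 1 by move: zI sI' tI'; clear -A; ord.
  have := h1 z zI' (lt_le_trans (H z zI) m1); rewrite ltr_norml; move: hr; clear -A; ord.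
Qed.

(** Points slightly inside the image interval are overtaken by images of points strictly inside
    [x,y], also for the approximating maps; so their Lipschitz bounds pass to the limit without the
    atoms at the ends. *)
Lemma lgap_gauge : gauge f lamL l.
Proof.
have lip x y xl yl : 0 <= x -> x < y -> y <= 1 -> xl < yl ->
    (forall u v, xl < u < yl -> xl < v < yl -> exists s t : R, [/\ x < s < y, x < t < y, f s < u & v < f t]) ->
    0 <= xl -> yl <= 1 -> l xl yl <= lamL * l x y.
  move=> x0 xy y1 xyl H xl0 yl1; apply/ler_addgt0Pr => /= e e0.
  have e20 : 0 < e / 2 by rewrite divr_gt0.
  have [u uI hu] := pr_ap e20 xyl; have [v vI hv] := pl_ap e20 xyl.
  have [s [t [sI tI fs ft]]] := H u v uI vI.
  have k := @ap_lip s t u v ltac:(move: sI x0 y1; clear -A; ord) ltac:(move: tI x0 y1; clear -A; ord)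
    ltac:(move: uI xl0 yl1; clear -A; ord) ltac:(move: vI xl0 yl1; clear -A; ord) (or_introl fs) (or_introl ft).
  have k' : `|P t - P s| <= l x y.
    have [s1 s2] := andP sI; have [t1 t2] := andP tI.
    have := le_pl s2; have := le_pl t2; have := pr_le s1; have := pr_le t1.
    by rewrite /lgap ler_norml; clear -A; ord.
  have k2 : lamL * `|P t - P s| <= lamL * l x y by rewrite ler_wpM2l // lam_ge0.
  by rewrite {1}/lgap; move: k k2 hu hv; clear -A; ord.
have Pf := ap_f A.
have nearR x y w : 0 <= x -> x < y -> y <= 1 -> f x < w -> exists2 s : R, x < s < y & f s < w.
  move=> x0 xy y1 h; have [d d0 hd] := ctsI_lt (pm_cts Pf) (x := x) ltac:(move: x0 xy y1; clear -A; ord) h.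
  have m0 : 0 < Num.min d (y - x) by rewrite lt_min d0 subr_gt0.
  have [m1 m2] : Num.min d (y - x) <= d /\ Num.min d (y - x) <= y - x by rewrite !ge_min !lexx orbT.
  exists (x + Num.min d (y - x) / 2); first by move: m0 m2; clear -A; ord.
  apply: hd; first by move: m0 m2 x0 y1; clear -A; ord.
  by rewrite addrAC subrr add0r gtr0_norm; move: m0 m1; clear -A; ord.
have nearR' x y w : 0 <= x -> x < y -> y <= 1 -> w < f x -> exists2 s : R, x < s < y & w < f s.
  move=> x0 xy y1 h; have [d d0 hd] := ctsI_gt (pm_cts Pf) (x := x) ltac:(move: x0 xy y1; clear -A; ord) h.
  have m0 : 0 < Num.min d (y - x) by rewrite lt_min d0 subr_gt0.
  have [m1 m2] : Num.min d (y - x) <= d /\ Num.min d (y - x) <= y - x by rewrite !ge_min !lexx orbT.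
  exists (x + Num.min d (y - x) / 2); first by move: m0 m2; clear -A; ord.
  apply: hd; first by move: m0 m2 x0 y1; clear -A; ord.
  by rewrite addrAC subrr add0r gtr0_norm; move: m0 m1; clear -A; ord.
have nearL x y w : 0 <= x -> x < y -> y <= 1 -> f y < w -> exists2 s : R, x < s < y & f s < w.
  move=> x0 xy y1 h; have [d d0 hd] := ctsI_lt (pm_cts Pf) (x := y) ltac:(move: x0 xy y1; clear -A; ord) h.
  have m0 : 0 < Num.min d (y - x) by rewrite lt_min d0 subr_gt0.
  have [m1 m2] : Num.min d (y - x) <= d /\ Num.min d (y - x) <= y - x by rewrite !ge_min !lexx orbT.
  exists (y - Num.min d (y - x) / 2); first by move: m0 m2; clear -A; ord.
  apply: hd; first by move: m0 m2 x0 y1; clear -A; ord.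
  by rewrite addrAC subrr add0r normrN gtr0_norm; move: m0 m1; clear -A; ord.
have nearL' x y w : 0 <= x -> x < y -> y <= 1 -> w < f y -> exists2 s : R, x < s < y & w < f s.
  move=> x0 xy y1 h; have [d d0 hd] := ctsI_gt (pm_cts Pf) (x := y) ltac:(move: x0 xy y1; clear -A; ord) h.
  have m0 : 0 < Num.min d (y - x) by rewrite lt_min d0 subr_gt0.
  have [m1 m2] : Num.min d (y - x) <= d /\ Num.min d (y - x) <= y - x by rewrite !ge_min !lexx orbT.
  exists (y - Num.min d (y - x) / 2); first by move: m0 m2; clear -A; ord.
  apply: hd; first by move: m0 m2 x0 y1; clear -A; ord.
  by rewrite addrAC subrr add0r normrN gtr0_norm; move: m0 m1; clear -A; ord.
have fI x y : 0 <= x -> x < y -> y <= 1 -> 0 <= f x <= 1 /\ 0 <= f y <= 1.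
  by move=> x0 xy y1; split; apply: (pm_self Pf); move: x0 xy y1; clear -A; ord.
split.
- exact: lam_ge0.
- by move=> x y _ xy _; rewrite subr_ge0; apply: pr_le_pl.
- move=> x y z _ xy yz _; have := le_trans (pl_le_P y) (P_le_pr y); rewrite /lgap; clear -A; ord.
- move=> x y x0 xy y1 lt; have [fx fy] := fI x y x0 xy y1.
  apply: lip => //; [|by case/andP: fx|by case/andP: fy].
  move=> u v /andP[u1 _] /andP[_ v1].
  have [s sI fs] := nearR x y u x0 xy y1 u1; have [t tI ft] := nearL' x y v x0 xy y1 v1.
  by exists s, t.
- move=> x y x0 xy y1 lt; have [fx fy] := fI x y x0 xy y1.
  apply: lip => //; [|by case/andP: fy|by case/andP: fx].
  move=> u v /andP[u1 _] /andP[_ v1].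
  have [s sI fs] := nearL x y u x0 xy y1 u1; have [t tI ft] := nearR' x y v x0 xy y1 v1.
  by exists s, t.
Qed.

Lemma lgap_lsc x y e : 0 <= x -> x < y -> y <= 1 -> 0 < e ->
  exists2 d : R, 0 < d & forall x' y', 0 <= x' -> x' < y' -> y' <= 1 ->
    `|x' - x| < d -> `|y' - y| < d -> l x y - e < l x' y'.
Proof.
move=> x0 xy y1 e0; have e20 : 0 < e / 2 by rewrite divr_gt0.
have [u uI hu] := pr_ap e20 xy; have [v vI hv] := pl_ap e20 xy.
exists (Num.min (u - x) (y - v)); first by rewrite lt_min !subr_gt0; case/andP: uI => ->; case/andP: vI.
move=> x' y' _ xy' _; rewrite !lt_min !ltr_norml => /andP[h1 _] /andP[_ h2].
have h3 : x' < u by move: h1; clear -A; ord.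
have h4 : v < y' by move: h2; clear -A; ord.
have := pr_le h3; have := le_pl h4; rewrite /lgap; move: hu hv; clear -A; ord.
Qed.

Lemma limit_atoms : atoms f C lamL l a.
Proof.
split.
- exact: lgap_gauge.
- exact: lam_sqr.
- by move=> x _; exact: atom_ge0.
- by move=> x _; exact: atom_le1.
- by move=> x y z _ _ _ _; rewrite /lgap /atom; clear -A; ord.
- exact: atom_reg.
- exact: atom_fold.
Qed.

Hypothesis no_atom : forall x, 0 <= x <= 1 -> a x = 0.

Lemma no_atom_cts : ctsI P.
Proof.
move=> x xI e e0; have [u [v [uI vI hu hv]]] := atom_ap xI e0.
rewrite (no_atom xI) add0r => ue.
have [d1 d10 h1] : exists2 d : R, 0 < d & forall z, 0 <= z <= 1 -> `|z - x| < d -> u <= z.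
  case: hu => [h|->]; last by exists 1 => // z /andP[].
  by exists (x - u); [rewrite subr_gt0|move=> z _; rewrite ltr_norml; clear -A; ord].
have [d2 d20 h2] : exists2 d : R, 0 < d & forall z, 0 <= z <= 1 -> `|z - x| < d -> z <= v.
  case: hv => [h|->]; last by exists 1 => // z /andP[].
  by exists (v - x); [rewrite subr_gt0|move=> z _; rewrite ltr_norml; clear -A; ord].
exists (Num.min d1 d2) => [|z zI]; first by rewrite lt_min d10.
rewrite lt_min => /andP[z1 z2].
have k1 := P_nd (h1 z zI z1); have k2 := P_nd (h2 z zI z2).
have k3 : P u <= P x by apply: P_nd; case/andP: uI.
have k4 : P x <= P v by apply: P_nd; case/andP: vI.
by rewrite ltr_norml; move: k1 k2 k3 k4 ue; clear -A; ord.
Qed.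

Lemma P_near x e : 0 <= x <= 1 -> 0 < e -> U [set i | `|ph i x - P x| < e].
Proof.
move=> xI e0; have /cvgrPdist_lt /(_ _ e0) := P_cvg xI.
by apply: filterS => i /=; rewrite distrC.
Qed.

(** [F i x] lies in a fixed interval around [f x] of small limit length, and [ph i] is monotone on
    it; no common modulus of continuity of the [ph i] is at hand. *)
Lemma no_atom_F x : 0 <= x <= 1 -> (fun i => ph i (F i x)) @ U --> P (f x).
Proof.
move=> xI; apply/cvgrPdist_lt => e e0; have e30 : 0 < e / 3 by rewrite divr_gt0.
have fxI := pm_self (ap_f A) xI.
have [u [v [uI vI hu hv]]] := atom_ap fxI e30.
rewrite (no_atom fxI) add0r => ue.
have uI' : 0 <= u <= 1 by move: uI fxI; clear -A; ord.
have vI' : 0 <= v <= 1 by move: vI fxI; clear -A; ord.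
have k3 : P u <= P (f x) by apply: P_nd; case/andP: uI.
have k4 : P (f x) <= P v by apply: P_nd; case/andP: vI.
apply: filterS (filterI (filterI (ap_below xI hu) (ap_above xI hv))
  (filterI (P_near uI' e30) (P_near vI' e30))) => i [[h1 h2] [h3 h4]] /=.
have FI := pm_self (ap_F A i) xI.
have k1 := ap_nd i (x := u) (y := F i x) ltac:(by case/andP: uI') h1 ltac:(by case/andP: FI).
have k2 := ap_nd i (x := F i x) (y := v) ltac:(by case/andP: FI) h2 ltac:(by case/andP: vI').
by move: h3 h4; rewrite /= !ltr_norml; move: k1 k2 k3 k4 ue; clear -A; ord.
Qed.

Lemma no_atom_conf_in x y : 0 <= x -> x < y -> y <= 1 -> (forall c, c \in C -> ~~ (x <= c <= y)) ->
  `|P (f y) - P (f x)| = lamL * (P y - P x).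
Proof.
move=> x0 xy y1 H.
have xI : 0 <= x <= 1 by rewrite x0 (le_trans (ltW xy)).
have yI : 0 <= y <= 1 by rewrite y1 (le_trans x0 (ltW xy)).
have c1 : (fun i => `|ph i (F i y) - ph i (F i x)|) @ U --> `|P (f y) - P (f x)|.
  have h : (fun i => ph i (F i y) - ph i (F i x)) @ U --> P (f y) - P (f x).
    by apply: cvgB; apply: no_atom_F.
  exact: cvg_norm h.
have c2 : (fun i => L i * (ph i y - ph i x)) @ U --> lamL * (P y - P x).
  by apply: cvgM; [exact: lam_cvg|apply: cvgB; apply: P_cvg].
have E : U [set i | `|ph i (F i y) - ph i (F i x)| = L i * (ph i y - ph i x)].
  by apply: filterS (ap_mono x0 xy y1 H) => i /= m; apply: (md_conf (ap_model A i)).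
apply/eqP; rewrite eq_le; apply/andP; split.
  by apply: (lim_le c1 c2); apply: filterS E => i /= ->.
by apply: (lim_le c2 c1); apply: filterS E => i /= ->.
Qed.

Lemma close_eq (p q k : R) : 0 <= k -> (forall e, 0 < e -> `|p - q| <= k * e) -> p = q.
Proof.
move=> k0 H; apply/eqP; rewrite -subr_eq0 -normr_eq0 eq_le normr_ge0 andbT leNgt; apply/negP => h.
have k1 : 0 < k + 1 by move: k0; clear -A; ord.
have := H (`|p - q| / (k + 1)) ltac:(by rewrite divr_gt0).
rewrite mulrA ler_pdivlMr // mulrDr mulr1 [k * _]mulrC gerDl leNgt; exact/negP/negPn.
Qed.

(** A lap that ends at turning points is first shrunk a little at both ends, where the nearby maps
    are monotone; the continuity of the limit recovers the full lap. *)
Lemma no_atom_conf : conf f lamL P.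
Proof.
move=> x y x0 xy y1 m; have Pf := ap_f A.
have noC c : c \in C -> ~~ (x < c < y).
  move=> cC; apply/negP => cI; have [r r0 [a1 a2 H]] := pm_fold Pf cC.
  pose s := Num.min r (Num.min (c - x) (y - c)).
  have s0 : 0 < s by rewrite !lt_min r0 !subr_gt0.
  have [s1 [s2 s3]] : s <= r /\ (s <= c - x /\ s <= y - c) by rewrite /s !ge_min !lexx !orbT.
  clearbody s.
  have e1 : x <= c - s by move: s2; clear -A; ord.
  have e2 : c + s <= y by move: s3; clear -A; ord.
  have e3 : c - s < c by rewrite ltrBlDr ltrDl.
  have e4 : c < c + s by rewrite ltrDl.
  have e5 : c - r <= c - s by rewrite lerD2l lerN2.
  have e6 : c + s <= c + r by rewrite lerD2l.
  have [xc cy] := andP cI.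
  case: H => -[h1 h2]; have g1 := h1 (c - s) c e5 e3 (lexx _); have g2 := h2 c (c + s) (lexx _) e4 e6;
    case: m => m; have g3 := m (c - s) c e1 e3 (ltW cy); have g4 := m c (c + s) (ltW xc) e4 e2;
    by move: g1 g2 g3 g4; clear -A; ord.
have xI : 0 <= x <= 1 by rewrite x0 (le_trans (ltW xy)).
have yI : 0 <= y <= 1 by rewrite y1 (le_trans x0 (ltW xy)).
have Pfc := ctsI_comp (pm_self Pf) no_atom_cts (pm_cts Pf).
have l0 := lam_ge0.
apply: (@close_eq _ _ (2 + lamL * 2)); first by move: l0; clear -A; ord.
move=> e e0.
have [d1 d10 h1] := no_atom_cts xI e0; have [d2 d20 h2] := no_atom_cts yI e0.
have [d3 d30 h3] := Pfc x xI e e0; have [d4 d40 h4] := Pfc y yI e e0.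
pose d := Num.min (Num.min d1 d2) (Num.min (Num.min d3 d4) (y - x)).
have d0 : 0 < d by rewrite !lt_min d10 d20 d30 d40 subr_gt0.
have [[m1 m2] [[m3 m4] m5]] : (d <= d1 /\ d <= d2) /\ (d <= d3 /\ d <= d4) /\ d <= y - x.
  by rewrite /d !ge_min !lexx !orbT.
clearbody d.
have sI : 0 <= x + d / 3 <= 1 by move: d0 m5 x0 y1; clear -A; ord.
have tI : 0 <= y - d / 3 <= 1 by move: d0 m5 x0 y1; clear -A; ord.
have st : x + d / 3 < y - d / 3 by move: d0 m5; clear -A; ord.
have E := @no_atom_conf_in (x + d / 3) (y - d / 3) ltac:(by case/andP: sI) st ltac:(by case/andP: tI)
  ltac:(move=> c cC; apply/negP => cI; move: (noC c cC) => /negP; apply; move: cI d0; clear -A; ord).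
have ds : `|x + d / 3 - x| < d by rewrite ltr_norml; move: d0; clear -A; ord.
have dt : `|y - d / 3 - y| < d by rewrite ltr_norml; move: d0; clear -A; ord.
have k1 := h1 _ sI (lt_le_trans ds m1); have k2 := h2 _ tI (lt_le_trans dt m2).
have k3 := h3 _ sI (lt_le_trans ds m3); have k4 := h4 _ tI (lt_le_trans dt m4).
move: E k1 k2 k3 k4 => /=; set p1 := P (f (y - d / 3)); set p2 := P (f (x + d / 3)).
set p3 := P (y - d / 3); set p4 := P (x + d / 3); set q1 := P (f y); set q2 := P (f x).
set q3 := P y; set q4 := P x => E k1 k2 k3 k4.
have j1 : `| `|q1 - q2| - `|p1 - p2| | <= e * 2.
  apply: le_trans (ler_dist_dist _ _) _.
  move: k3 k4; rewrite !ltr_norml ler_norml; clear -A; ord.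
have j2 : `|lamL * (p3 - p4) - lamL * (q3 - q4)| <= lamL * (2 * e).
  rewrite -mulrBr normrM ger0_norm // ler_wpM2l //.
  by move: k1 k2; rewrite !ltr_norml ler_norml; clear -A; ord.
rewrite mulrDl -mulrA; apply: le_trans (ler_distD `|p1 - p2| _ _) _.
by rewrite mulrC in j1; apply: lerD => //; rewrite E.
Qed.

Lemma no_atom_model : model f lamL P.
Proof.
split; [exact: lam_ge0|exact: P_0|exact: P_1| |exact: no_atom_cts|exact: no_atom_conf].
apply: (conf_strict (ap_f A) lam_ge0 no_atom_conf) => //; [|exact: P_0|exact: P_1|exact: no_atom_cts].
by move=> x y _ xy _; apply: P_nd.
Qed.

(** Pointwise convergence of monotone functions to a continuous limit is uniform: it suffices to
    control a finite grid. *)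
Lemma no_atom_unif e : 0 < e -> U [set i | forall x, 0 <= x <= 1 -> `|ph i x - P x| < e].
Proof.
move=> e0; have e30 : 0 < e / 3 by rewrite divr_gt0.
have [d d0 hd] := ctsI_unif no_atom_cts e30.
pose n := (Num.bound d^-1).+1.
have n0 : (0 : R) < n%:R by rewrite ltr0n.
have nd : n%:R^-1 < d.
  have h0 : 0 <= d^-1 by rewrite invr_ge0 ltW.
  rewrite -[d]invrK ltf_pV2 ?posrE ?invr_gt0 // (lt_le_trans (archi_boundP h0)) // ler_nat; exact: leqnSn.
have kI k : (k <= n)%N -> 0 <= (k%:R / n%:R : R) <= 1.
  by move=> kn; rewrite divr_ge0 //= ler_pdivrMr // mul1r ler_nat.
have all m : (m <= n)%N -> U [set i | forall k, (k <= m)%N -> `|ph i (k%:R / n%:R) - P (k%:R / n%:R)| < e / 3].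
  elim: m => [|m IH] mn.
    apply: filterS (P_near (kI 0%N isT) e30) => i h k; rewrite leqn0 => /eqP->; exact: h.
  apply: filterS (filterI (IH (ltnW mn)) (P_near (kI m.+1 mn) e30)) => i [h1 h2] k.
  rewrite leq_eqVlt => /orP[/eqP->|]; [exact: h2|rewrite ltnS; exact: h1].
apply: filterS (all n (leqnn n)) => i H x xI.
have [k [kn kx xk]] : exists k, [/\ (k < n)%N, k%:R / n%:R <= x & x <= k.+1%:R / n%:R].
  have [e1|xl] : x = 1 \/ x < 1 by move: xI; clear -A; ord.
    by exists n.-1; rewrite /n /= e1 ler_pdivrMr // ler_pdivlMr // !mul1r lexx ler_nat leqnSn; split.
  have xn : 0 <= x * n%:R by rewrite mulr_ge0 //; case/andP: xI.
  have /andP[t1 t2] := truncn_itv xn.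
  exists (Num.truncn (x * n%:R)); split.
  - by rewrite -(@ltr_nat R) (le_lt_trans t1) // gtr_pMl.
  - by rewrite ler_pdivrMr.
  - by rewrite ler_pdivlMr // ltW.
have h1 := H k (ltnW kn); have h2 := H k.+1 kn.
have I1 := kI k (ltnW kn); have I2 := kI k.+1 kn.
have m1 := ap_nd i (x := k%:R / n%:R) (y := x) ltac:(by case/andP: I1) kx ltac:(by case/andP: xI).
have m2 := ap_nd i (x := x) (y := k.+1%:R / n%:R) ltac:(by case/andP: xI) xk ltac:(by case/andP: I2).
have m3 := P_nd kx; have m4 := P_nd xk.
have st : `|k.+1%:R / n%:R - k%:R / n%:R| < d.
  by rewrite -mulrBl -natrB // subSnn mul1r gtr0_norm ?invr_gt0.
have h3 := hd _ _ I1 I2 st.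
move: h1 h2 h3 m1 m2 m3 m4; rewrite !ltr_norml.
move: (k.+1%:R / n%:R) (k%:R / n%:R) => p q; clear -A; ord.
Qed.

End approximation.

End limits.

Lemma approx_no_atom (R : realType) (X : Type) (U : set_system X) (F : X -> R -> R) (D : X -> seq R)
    (L : X -> R) (ph : X -> R -> R) (f : R -> R) (C : seq R) : approx U F D L ph f C ->
  (forall c, c \in C -> 0 < atom U ph c -> False) -> forall x : R, 0 <= x <= 1 -> atom U ph x = 0.
Proof.
move=> A H x xI; apply/eqP; rewrite eq_le (atom_ge0 A) andbT leNgt; apply/negP => ax.
have At := limit_atoms A; have [k [kC hk]] := atom_turning (ap_f A) At xI ax.
apply: (H _ kC); apply: lt_le_trans hk.
by rewrite mulr_gt0 // exprn_gt0 // (lt_trans ltr01 (at_lam1 At)).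
Qed.

(** * Convergence of the models without atoms *)

Section tmap_limits.
Variable R : realType.
Implicit Types (x y z e lam : R) (phi : R -> R) (f g : tmap R).

Definition slope f := projT1 (cid (tmap_model f)).
Definition mphi f := projT1 (cid (projT2 (cid (tmap_model f)))).

Lemma slope_model_of f : model f (slope f) (mphi f).
Proof. exact: projT2 (cid (projT2 (cid (tmap_model f)))). Qed.

Lemma model_onto f lam phi z : model f lam phi -> 0 <= z <= 1 -> exists2 x : R, 0 <= x <= 1 & phi x = z.
Proof.
move=> M zI; have [||||x xI fx] := @ctsI_IVT R phi 0 1 z (md_cts M); [by []|by []|by []| |by exists x].
by left; rewrite (md_0 M) (md_1 M).
Qed.

Lemma model_nd f lam phi x y : model f lam phi -> 0 <= x -> x <= y -> y <= 1 -> phi x <= phi y.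
Proof.
move=> M x0; rewrite le_eqVlt => /orP[/eqP->//|xy] y1; exact/ltW/(md_inc M).
Qed.

Lemma Phi_lip f lam phi u v : model f lam phi -> 0 <= u <= 1 -> 0 <= v <= 1 ->
  `|Phi f u - Phi f v| <= lam * `|u - v|.
Proof.
move=> M uI vI; have [x xI <-] := model_onto M uI; have [y yI <-] := model_onto M vI.
rewrite !(Phi_spec M) //; apply: (conf_lip (tmap_pmt f) (md_conf M)) => // p q p0 pq q1.
exact: model_nd M p0 pq q1.
Qed.

Variables (m : nat) (U : set_system (T_ R m)) (f : T_ R m).
Let X := set_type (T_ R m).
Hypothesis UF : UltraFilter U.
Hypothesis cvU : forall e, 0 < e -> U [set g : X | tdist (val f) (val g) < e].

Lemma tmap_approx : approx U (fun g : X => tfun (val g)) (fun g : X => turning (val g))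
  (fun g : X => slope (val g)) (fun g : X => mphi (val g)) (val f) (turning (val f)).
Proof.
split => //.
- exact: tmap_pmt.
- by move=> g; exact: tmap_pmt.
- by move=> g; rewrite !(@size_turning _ m) //; apply: set_mem; exact: valP.
- by move=> g; exact: slope_model_of.
- move=> e e0; have PU := @ultra_proper _ _ UF; apply: filterS (cvU e0) => g /= h x xI.
  rewrite distrC; apply: le_lt_trans h; apply: tdist_ub.
  by rewrite /unit_itv /= in_itv.
Qed.

(** Writing a point of [0,1] as [mphi (val g) y] turns the values of both models into conjugacies at
    [val f y] and [val g y]; the model of [f] is Lipschitz with the limit slope. *)
Lemma Phi_limit : (forall x, 0 <= x <= 1 -> atom U (fun g : X => mphi (val g)) x = 0) ->
  forall e, 0 < e -> U [set g : X | tdist (Phi (val f)) (Phi (val g)) < e].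
Proof.
move=> na e e0; have A := tmap_approx; have PU := @ultra_proper _ _ UF.
have M := no_atom_model A na; set P := PLim _ _ in M; set lam := Lim _ _ in M.
have l0 : 0 <= lam := md_lam M.
have e1 : 0 < e / 4 / (lam + 1) by rewrite !divr_gt0 // ltr_wpDl.
have e2 : 0 < e / 4 by rewrite divr_gt0.
have [d d0 hd] := ctsI_unif (md_cts M) e2.
apply: filterS (filterI (no_atom_unif A na e1) (filterI (no_atom_unif A na e2) (cvU d0))) => g [h1 [h2 h3]] /=.
apply: (@le_lt_trans _ _ (e / 4 + e / 4 + e / 4)); last by move: e0; clear -UF cvU; ord.
apply: tdist_le => z; rewrite /unit_itv /= in_itv /= => zI.
have Mg := slope_model_of (val g).
have [y yI <-] := model_onto Mg zI.
have fI := @tmap_selfI _ (val f) y yI; have gI := @tmap_selfI _ (val g) y yI.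
rewrite (Phi_spec Mg yI); have k0 := Phi_spec M yI.
have mI : 0 <= mphi (val g) y <= 1.
  have [k _] := (md_0 Mg, tt); rewrite -{1}(md_0 Mg) -(md_1 Mg); case/andP: yI => y0 y1.
  by rewrite !(model_nd Mg).
have k1 := Phi_lip M mI (P_I A y); rewrite k0 in k1.
have k2 := h1 y yI; have k3 := h2 _ gI; rewrite -/P in k2 k3.
have k4 : `|P (val g y) - P (val f y)| < e / 4.
  apply: hd => //; rewrite distrC; apply: le_lt_trans h3; apply: tdist_ub.
  by rewrite /unit_itv /= in_itv.
have k5 : `|Phi (val f) (mphi (val g) y) - P (val f y)| <= e / 4.
  apply: le_trans k1 _; apply: (@le_trans _ _ ((lam + 1) * (e / 4 / (lam + 1)))).
    apply: ler_pM => //; [by rewrite lerDl|exact: ltW].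
  by rewrite mulrC divfK // gt_eqF // ltr_wpDl.
move: k3 k4 k5; rewrite !ltr_norml !ler_norml; clear -UF cvU; ord.
Qed.

End tmap_limits.

(** * Continuity points of the entropy *)

Section continuity.
Variables (R : realType) (m : nat).
Implicit Types (f g : T_ R m) (e : R).

Lemma nbhs_tdist f e : 0 < e -> nbhs f [set g : T_ R m | tdist (val f) (val g) < e].
Proof.
by move=> e0; apply/nbhs_ballP; exists e => // g; rewrite -(initial_ballE (f := set_val)) /= ballEmdist.
Qed.

Lemma Phi_continuous_at f :
  (forall U : set_system (T_ R m), UltraFilter U -> U --> f ->
     approx U (fun g : T_ R m => tfun (val g)) (fun g => turning (val g))
       (fun g => slope (val g)) (fun g => mphi (val g)) (val f) (turning (val f)) ->
     forall c, c \in turning (val f) -> 0 < atom U (fun g : T_ R m => mphi (val g)) c -> False) ->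
  {for f, continuous (Phi_ R m)}.
Proof.
move=> H B nB.
have [e /= e0 eB] : exists2 e : R, 0 < e & forall g, tdist (Phi (val f)) (val g) < e -> B g.
  move/nbhs_ballP: nB => [e /= e0 eB]; exists e => // g hg; exact: eB.
rewrite nbhs_filterE.
pose S := [set g : T_ R m | tdist (Phi (val f)) (Phi (val g)) < e].
suff nS : nbhs f S by apply: filterS nS => g /= hg; apply: eB.
(* If [S] were not a neighbourhood, an ultrafilter finer than the neighbourhoods of [f] would
   contain its complement, but along that ultrafilter the models converge. *)
apply: contrapT => nS.
have PW : ProperFilter (within (~` S) (nbhs f)).
  apply: Build_ProperFilter_ex => A; rewrite /within /= => hA.
  apply: contrapT => nA; apply: nS; apply: filterS hA => g hg.
  by apply: contrapT => nSg; apply: nA; exists g; apply: hg.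
have [U [UF FU]] := ultraFilterLemma PW.
have PU := @ultra_proper _ _ UF.
have cvU : U --> f by move=> A nA; apply: FU; rewrite /within /=; apply: filterS nA => g ?.
have cvd d : 0 < d -> U [set g : T_ R m | tdist (val f) (val g) < d].
  by move=> d0; apply: cvU; apply: nbhs_tdist.
have A := tmap_approx UF cvd.
have := Phi_limit UF cvd (approx_no_atom A (H U UF cvU A)) e0.
have US : U (~` S) by apply: FU; rewrite /within /=; apply: filterE.
by move=> h; have [g [/= hg]] := filter_ex (filterI h US); apply.
Qed.

Lemma Phi_continuous_at_entropy f :
  {for f, continuous (h_ R m)} -> {for f, continuous (Phi_ R m)}.
Proof.
move=> ch; apply: Phi_continuous_at => U UF cvU A c cC ac.
have PU := @ultra_proper _ _ UF.
have At := limit_atoms A; have M := slope_model_of (val f).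
have hE (g : T_ R m) : h_ R m g = ln (slope (val g)) by exact: h_spec (slope_model_of (val g)).
have sl0 (g : T_ R m) : 0 < slope (val g).
  have Mg := slope_model_of (val g).
  by apply: lt_trans (sqrt2_gt1 (md_lam Mg) (model_sqrt2 (tmap_pmt _) Mg)).
have c1 : (fun g : T_ R m => ln (slope (val g))) @ U --> ln (slope (val f)).
  rewrite -hE; under eq_fun do rewrite -hE; exact: (cvg_trans (cvg_app _ cvU) ch).
have c2 : (fun g : T_ R m => slope (val g)) @ U --> slope (val f).
  rewrite -[slope (val f)]lnK ?posrE //; under eq_fun do rewrite -[slope _]lnK ?posrE //.
  exact: (continuous_cvg _ (@continuous_expR R _) c1).
have E : Lim U (fun g : T_ R m => slope (val g)) = slope (val f) by exact: ulimE.
rewrite E in At.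
exact: (atoms_model_absurd (tmap_pmt _) M At (lgap_lsc A) cC ac).
Qed.

End continuity.

(** * Periodic atoms *)

Section turning_cycles.
Variable R : realType.
Implicit Types (x y z w c d e u v s t lam : R) (f a : R -> R) (C : seq R) (l : R -> R -> R).

Lemma mir_atoms f C lam l a : atoms f C lam l a ->
  atoms (mir f) [seq 1 - c | c <- C] lam (fun x y => l (1 - y) (1 - x)) (fun x => a (1 - x)).
Proof.
move=> A; split.
- exact: mir_gauge (at_gauge A).
- exact: at_lam A.
- by move=> x xI; apply: (at_ge0 A); move: xI; clear; ord.
- by move=> x xI; apply: (at_le1 A); move: xI; clear; ord.
- move=> x y z x0 xy yz z1.
  have := @at_add _ _ _ _ _ _ A (1 - z) (1 - y) (1 - x) ltac:(move: z1; clear; ord)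
    ltac:(move: yz; clear; ord) ltac:(move: xy; clear; ord) ltac:(move: x0; clear; ord).
  by clear; ord.
- move=> x xI xC; rewrite /mir subKr; apply: (at_reg A).
    by move: xI; clear; ord.
  by apply/negP => h; move/negP: xC; apply; apply/mapP; exists (1 - x) => //; rewrite subKr.
- by move=> _ /mapP[c cC ->]; rewrite /mir !subKr; exact: (at_fold A).
Qed.

Lemma atom_step f C lam l a z : atoms f C lam l a -> 0 <= z <= 1 -> 0 <= a (f z) ->
  lam * a z <= 2 ^+ (z \in C) * a (f z).
Proof.
move=> A zI h; have [zC|zC] := boolP (z \in C); first exact: (at_fold A).
by rewrite expr0 mul1r; apply: (at_reg A).
Qed.

(** Each visit to a turning point costs a factor 2, each other step none. *)
Lemma atom_orbit f C lam l a c n : pmt f C -> atoms f C lam l a -> 0 <= c <= 1 ->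
  lam ^+ n * a c <= 2 ^+ (count (mem C) (traject f c n)) * a (iter n f c).
Proof.
move=> P A cI; elim: n => [|n IH]; first by rewrite !expr0.
have cn := iterI P n cI.
rewrite trajectSr -cats1 count_cat /= addn0 exprD exprS -!mulrA.
have l0 : 0 <= lam by apply: ltW; apply: lt_trans (at_lam1 A).
apply: le_trans (ler_wpM2l l0 IH) _; rewrite mulrCA ler_wpM2l ?exprn_ge0 //.
by apply: (atom_step A cn); apply: (at_ge0 A); exact: (iterI P n.+1 cI).
Qed.

Lemma atom_orbit_gt0 f C lam l a c n : pmt f C -> atoms f C lam l a -> 0 <= c <= 1 -> 0 < a c ->
  0 < a (iter n f c).
Proof.
move=> P A cI ac; have := atom_orbit n P A cI.
have l0 : 0 < lam ^+ n * a c by rewrite mulr_gt0 // exprn_gt0 // (lt_trans ltr01 (at_lam1 A)).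
by move=> /(lt_le_trans l0); rewrite pmulr_rgt0 // exprn_gt0.
Qed.

(** The orbit of an atom returns to the finite set [C] again and again, so two of its visits
    coincide. *)
Lemma periodic_atom f C lam l a c : pmt f C -> atoms f C lam l a -> c \in C -> 0 < a c ->
  exists c' p, [/\ c' \in C, 0 < a c', (0 < p)%N, iter p f c' = c' &
    forall j, (0 < j < p)%N -> iter j f c' <> c'].
Proof.
move=> P A cC ac.
have cI : 0 <= c <= 1 by have := fold_in P cC; clear; ord.
have visit n : exists k, (n <= k)%N /\ iter k f c \in C.
  have [k [kC _]] := atom_turning P A (iterI P n cI) (atom_orbit_gt0 n P A cI ac).
  by exists (k + n)%N; rewrite leq_addl iterD.
have lists n : exists ks, [/\ size ks = n, sorted ltn ks & all (fun k => iter k f c \in C) ks].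
  elim: n => [|n [ks [sz so al]]]; first by exists [::].
  have [k [hk kC]] := visit (last 0%N ks).+1.
  exists (rcons ks k); split; [by rewrite size_rcons sz| |by rewrite all_rcons kC].
  by case: ks so al hk {sz} => //= k0 ks so al hk; rewrite rcons_path so.
have [ks [sz so al]] := lists (size C).+1.
have nu : ~~ uniq [seq iter k f c | k <- ks].
  apply/negP => u; have := uniq_leq_size u (s2 := C).
  rewrite size_map sz => /(_ _) h; suff : (size C < size C)%N by rewrite ltnn.
  by apply: h => _ /mapP[k kk ->]; move/allP: al => /(_ k kk).
have /(uniqPn c)[i [j [ij jn e]]] := nu.
rewrite size_map in jn; rewrite !(nth_map 0%N) // in e; last exact: ltn_trans jn.
have lt : (nth 0%N ks i < nth 0%N ks j)%N.
  by apply: (sorted_ltn_nth ltn_trans 0%N so) => //; rewrite inE // (ltn_trans ij).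
set ki := nth 0%N ks i in e lt; set kj := nth 0%N ks j in e lt.
have kiC : iter ki f c \in C by move/allP: al; apply; apply: mem_nth; exact: ltn_trans jn.
have ex : exists p, (0 < p)%N && (iter p f (iter ki f c) == iter ki f c).
  by exists (kj - ki)%N; rewrite subn_gt0 lt -iterD subnK ?(ltnW lt) // e eqxx.
have [p /andP[p0 /eqP hp] pm] := ex_minnP ex.
exists (iter ki f c), p; split => //; first exact: atom_orbit_gt0 P A cI ac.
move=> k /andP[k0 kp] h; have := pm k; rewrite k0 h eqxx => /(_ isT).
by rewrite leqNgt kp.
Qed.

Lemma lam_period f C lam l a c p : pmt f C -> atoms f C lam l a -> 0 <= c <= 1 -> 0 < a c ->
  iter p f c = c -> lam ^+ p <= 2 ^+ (count (mem C) (traject f c p)).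
Proof.
by move=> P A cI ac hp; have := atom_orbit p P A cI; rewrite hp ler_pM2r.
Qed.

(* Equality [lam ^ 2 = 2] would make [f^2] monotone on [0, w] and on [w, p],
   leaving no room for a turning atom. *)
Lemma hs3_strict f C lam l a c p : pmt f C -> atoms f C lam l a -> gpos l -> c \in C -> 0 < a c ->
  (0 < p)%N -> iter p f c = c -> hs3 f -> lam ^+ 2 <> 2.
Proof.
move=> P A L cC ac p0 hp [w [e [w0 we e1 [f0 fe Fw H1 H2]]]] E; have G := at_gauge A.
have e0 := lt_trans w0 we.
have fI := pm_self P.
have cov x y u v : 0 <= x -> x < y -> y <= 1 -> u < v ->
    (f (f x) <= u /\ v <= f (f y)) \/ (f (f y) <= u /\ v <= f (f x)) -> l u v <= 2 * l x y.
  by rewrite -E; apply: (ga_iter2 P G).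
have w1 := lt_trans we e1.
have c1 : l 0 e <= 2 * l 0 w by apply: cov => //; [exact: ltW|right; rewrite Fw f0 fe].
have c2 : l 0 e <= 2 * l w e by apply: cov => //; [exact: ltW|exact: ltW|left; rewrite Fw !fe].
have ad := at_add A (lexx 0) w0 we (ltW e1).
have aw := at_ge0 A (x := w) ltac:(by rewrite !ltW).
have aw0 : a w = 0 by move: c1 c2 ad aw; clear; ord.
have g1 : l 0 e = 2 * l 0 w by move: c1 c2 ad aw; clear; ord.
have g2 : l 0 e = 2 * l w e by move: c1 c2 ad aw; clear; ord.
have FI x : 0 <= x <= e -> 0 <= f (f x) <= e.
  move=> xI; have xI' : 0 <= x <= 1 by move: xI e1; clear; ord.
  have /andP[h0 _] := fI _ (fI _ xI'); rewrite h0 /=.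
  have [->|[->|xe]] : x = 0 \/ x = e \/ 0 < x < e by move: xI; clear; ord.
  - by rewrite f0 fe.
  - by rewrite !fe.
  - by apply/ltW/H2; rewrite (H1 x xe); case/andP: (fI _ xI').
(* [0,v] and [u,e] fill [0,e] and overlap in [u,v]. A failure of monotonicity would make three
   disjoint pieces of a half cover these three intervals, which exceeds twice its length. *)
have room u v : 0 <= u -> u < v -> v <= e -> l 0 e < l u e + l u v + l 0 v.
  move=> u0 uv ve; have v1 := le_trans ve (ltW e1).
  have Luv := L u v u0 uv v1.
  have [eu|u0'] : u = 0 \/ 0 < u by move: u0; clear; ord.
    by move: Luv; rewrite eu; clear; ord.
  have ue := lt_le_trans uv ve.
  have h1 := at_add A (lexx 0) u0' uv v1; have h2 := at_add A (lexx 0) u0' ue (ltW e1).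
  by move: h1 h2 Luv; clear; ord.
have mono1 x y : 0 <= x -> x < y -> y <= w -> f (f y) <= f (f x).
  move=> x0 xy yw; rewrite leNgt; apply/negP => h.
  have xI : 0 <= x <= e by move: x0 xy yw we; clear; ord.
  have yI : 0 <= y <= e by move: x0 xy yw we; clear; ord.
  have Fx := FI x xI; have Fy := FI y yI.
  have x0' : 0 < x.
    rewrite lt_neqAle x0 andbT; apply/eqP => x00; move: h Fy; rewrite -x00 f0 fe; clear; ord.
  have yw' : y < w.
    rewrite lt_neqAle yw andbT; apply/eqP => yy; move: h Fx; rewrite yy Fw; clear; ord.
  have k1 : l (f (f x)) e <= 2 * l 0 x.
    apply: cov => //; [by move: xI e1; clear; ord|by move: h Fy; clear; ord|by right; rewrite f0 fe lexx].
  have k2 : l (f (f x)) (f (f y)) <= 2 * l x y.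
    by apply: cov => //; [by move: yI e1; clear; ord|left].
  have k3 : l 0 (f (f y)) <= 2 * l y w.
    apply: cov => //; [by case/andP: yI|exact: ltW|by move: h Fx; clear; ord|by right; rewrite Fw lexx].
  have k4 := room (f (f x)) (f (f y)) ltac:(by case/andP: Fx) h ltac:(by case/andP: Fy).
  have k5 := ga_add G (lexx 0) x0' xy (le_trans yw (ltW w1)).
  have k6 := ga_add G (lexx 0) (lt_trans x0' xy) yw' (ltW w1).
  by move: k1 k2 k3 k4 k5 k6 g1; clear; ord.
have mono2 x y : w <= x -> x < y -> y <= e -> f (f x) <= f (f y).
  move=> x0 xy yw; rewrite leNgt; apply/negP => h.
  have xI : 0 <= x <= e by move: x0 xy yw w0; clear; ord.
  have yI : 0 <= y <= e by move: x0 xy yw w0; clear; ord.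
  have Fx := FI x xI; have Fy := FI y yI.
  have x0' : w < x.
    rewrite lt_neqAle x0 andbT; apply/eqP => x00; move: h Fy; rewrite -x00 Fw; clear; ord.
  have yw' : y < e.
    rewrite lt_neqAle yw andbT; apply/eqP => yy; move: h Fx; rewrite yy !fe; clear; ord.
  have k1 : l 0 (f (f x)) <= 2 * l w x.
    apply: cov => //; [exact: ltW|by move: xI e1; clear; ord|by move: h Fy; clear; ord|by left; rewrite Fw lexx].
  have k2 : l (f (f y)) (f (f x)) <= 2 * l x y.
    by apply: cov => //; [by case/andP: xI|by move: yI e1; clear; ord|right].
  have k3 : l (f (f y)) e <= 2 * l y e.
    apply: cov => //; [by case/andP: yI|exact: ltW|by move: h Fx; clear; ord|by left; rewrite !fe lexx].
  have k4 := room (f (f y)) (f (f x)) ltac:(by case/andP: Fy) h ltac:(by case/andP: Fx).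
  have k5 := ga_add G (ltW w0) x0' xy (le_trans yw (ltW e1)).
  have k6 := ga_add G (ltW w0) (lt_trans x0' xy) yw' (ltW e1).
  by move: k1 k2 k3 k4 k5 k6 g2; clear; ord.
have inj x y : (0 <= x /\ y <= w) \/ (w <= x /\ y <= e) -> x < y -> f (f x) <> f (f y).
  move=> H xy eF.
  have [xI yI] : 0 <= x /\ y <= 1 by move: H xy w0 we e1; clear; ord.
  have [z zI] := pm_plateau P 2 (f (f x)) xI xy yI; apply; rewrite /=.
  have [xz zy] := andP zI.
  apply/eqP; rewrite eq_le; case: H => -[h1 h2].
    apply/andP; split; first by apply: mono1 => //; exact: le_trans (ltW zy) h2.
    by rewrite eF; apply: mono1 => //; exact: le_trans h1 (ltW xz).
  apply/andP; split; first by rewrite eF; apply: mono2 => //; exact: le_trans h1 (ltW xz).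
  by apply: mono2 => //; exact: le_trans (ltW zy) h2.
(* The second iterate is injective on either side of [w], whereas a fold at [b] or at [f b] produces
   two nearby points with the same second image. *)
have key b : 0 < b < e -> b \in C \/ f b \in C -> b = w.
  move=> bI hb; apply: contrapT => bw.
  have [d [d0 h1 h2 side]] : exists d : R, [/\ 0 < d, 0 <= b - d, b + d <= e & b + d <= w \/ w <= b - d].
    have [h|h|//] := ltgtP b w.
      pose d := Num.min b (w - b); have d0 : 0 < d by rewrite lt_min subr_gt0 h; case/andP: bI => ->.
      have [m1 m2] : d <= b /\ d <= w - b by rewrite !ge_min !lexx orbT.
      by exists d; split; move: d0 m1 m2 we; clear; ord.
    pose d := Num.min (b - w) (e - b); have d0 : 0 < d by rewrite lt_min !subr_gt0 h; case/andP: bI => _ ->.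
    have [m1 m2] : d <= b - w /\ d <= e - b by rewrite !ge_min !lexx orbT.
    by exists d; split; move: d0 m1 m2 w0; clear; ord.
  have twin u v : u <> v -> b - d < u < b + d -> b - d < v < b + d -> f (f u) = f (f v) -> False.
    move=> uv uI vI eF; have [h|h|//] := ltgtP u v.
      by apply: (inj u v) => //; move: side uI vI h1 h2; clear; ord.
    by apply: (inj v u) => //; move: side uI vI h1 h2; clear; ord.
  have [bC|bC] := boolP (b \in C).
    have [e1' [e2' [e12 H]]] := fold_overlap (pm_cts P) (pm_fold P bC) d0.
    have [u [v [uI vI fu fv]]] := H ((e1' + e2') / 2) ltac:(move: e12; clear; ord).
    apply: (twin u v); [by move: uI vI; clear; ord|by move: uI d0; clear; ord|by move: vI d0; clear; ord|by rewrite fu fv].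
  have fbC : f b \in C by case: hb => // h; rewrite h in bC.
  have [d1 d10 gap] := gap_seq C b.
  pose r := Num.min d d1 / 2.
  have m0 : 0 < Num.min d d1 by rewrite lt_min d0.
  have [m1 m2] : Num.min d d1 <= d /\ Num.min d d1 <= d1 by rewrite !ge_min !lexx orbT.
  have [r0 rd rd1] : [/\ 0 < r, r < d & r < d1] by rewrite /r; split; move: m0 m1 m2; clear; ord.
  clearbody r.
  have m : smono f (b - r) (b + r).
    apply: (pm_mono P); [by move: h1 rd; clear; ord|by move: r0; clear; ord|by move: h2 rd e1; clear; ord|].
    move=> c' c'C; apply/negP => c'I.
    have := gap c' c'C ltac:(by apply/eqP => eb; move: bC; rewrite -eb c'C).
    by rewrite leNgt => /negP; apply; rewrite ltr_norml; move: c'I rd1; clear; ord.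
  have [dd [dd0 pull]] : exists dd : R, 0 < dd /\ forall u', f b - dd < u' < f b + dd ->
      exists2 u : R, b - r <= u <= b + r & f u = u'.
    have b1 : b - r < b by rewrite ltrBlDr ltrDl.
    have b2 : b < b + r by rewrite ltrDl.
    have B1 : 0 <= b - r by move: h1 rd; clear; ord.
    have B2 : b + r <= 1 by move: h2 rd e1; clear; ord.
    have B3 : b - r <= b + r by exact: ltW (lt_trans b1 b2).
    case: m => m; have k1 := m (b - r) b (lexx _) b1 (ltW b2); have k2 := m b (b + r) (ltW b1) b2 (lexx _).
      exists (Num.min (f b - f (b - r)) (f (b + r) - f b)); split; first by rewrite lt_min !subr_gt0 k1.
      have [n1 n2] : Num.min (f b - f (b - r)) (f (b + r) - f b) <= f b - f (b - r) /\
        Num.min (f b - f (b - r)) (f (b + r) - f b) <= f (b + r) - f b by rewrite !ge_min !lexx orbT.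
      move=> u' u'I; apply: (ctsI_IVT (pm_cts P) B1 B3 B2); left; move: u'I n1 n2; clear; ord.
    exists (Num.min (f (b - r) - f b) (f b - f (b + r))); split; first by rewrite lt_min !subr_gt0 k1.
    have [n1 n2] : Num.min (f (b - r) - f b) (f b - f (b + r)) <= f (b - r) - f b /\
      Num.min (f (b - r) - f b) (f b - f (b + r)) <= f b - f (b + r) by rewrite !ge_min !lexx orbT.
    move=> u' u'I; apply: (ctsI_IVT (pm_cts P) B1 B3 B2); right; move: u'I n1 n2; clear; ord.
  have [e1' [e2' [e12 H]]] := fold_overlap (pm_cts P) (pm_fold P fbC) dd0.
  have [u' [v' [uI vI fu fv]]] := H ((e1' + e2') / 2) ltac:(move: e12; clear; ord).
  have [u uI' eu] := pull u' ltac:(move: uI dd0; clear; ord).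
  have [v vI' ev] := pull v' ltac:(move: vI dd0; clear; ord).
  apply: (twin u v); [|by move: uI' rd; clear; ord|by move: vI' rd; clear; ord|by rewrite eu ev fu fv].
  by move=> uv; move: uI vI; rewrite -eu -ev uv; clear; ord.
have cI := fold_in P cC; have cI' : 0 <= c <= 1 by move: cI; clear; ord.
(* Left of [e] the atom at [c] would be the vanishing one at [w]; right of [e] this applies to the
   predecessor of [c] in the cycle; at [e] itself [f] passes from above [e] to below, which is not a
   fold. *)
have [ce|ce|ce] := ltgtP c e.
- by move: ac; rewrite (key c _ (or_introl cC)) ?aw0 ?ltxx //; case/andP: cI => ->.
- have hb : f (iter p.-1 f c) = c by rewrite -iterS prednK.
  have bI := iterI P p.-1 cI'; have ab := atom_orbit_gt0 p.-1 P A cI' ac.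
  move: hb bI ab; set b := iter _ _ _ => hb bI ab.
  have bI' : 0 < b < e.
    have [b0|[be|[be|//]]] : b = 0 \/ b = e \/ e < b <= 1 \/ 0 < b < e by move: bI; clear; ord.
    - by move: hb ce; rewrite b0 f0 => ->; rewrite ltxx.
    - by move: hb ce; rewrite be fe => ->; rewrite ltxx.
    - by have := H2 b be; rewrite hb => /(lt_trans ce); rewrite ltxx.
  by move: ab; rewrite (key b bI') ?aw0 ?ltxx //; right; rewrite hb.
- have [r r0 [a1 a2 H]] := pm_fold P cC; rewrite ce in H a1 a2.
  have k1 := H1 (e - r / 2) ltac:(move: a1 r0; clear; ord).
  have k2 := H2 (e + r / 2) ltac:(move: a2 r0; clear; ord).
  case: H => -[h1 h2].
    have := h1 (e - r / 2) e ltac:(move: r0; clear; ord) ltac:(move: r0; clear; ord) (lexx _).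
    by rewrite fe; move: k1; clear; ord.
  have := h2 e (e + r / 2) (lexx _) ltac:(move: r0; clear; ord) ltac:(move: r0; clear; ord).
  by rewrite fe; move: k2; clear; ord.
Qed.

End turning_cycles.

(** * Cycles through turning points *)

Section branches.
Variable R : realType.
Implicit Types (x y z w c d e u v s t lam : R) (f a : R -> R) (C : seq R) (l : R -> R -> R).

(** A turning point at a maximum; [dn] is one at a minimum. *)
Definition up f c := exists2 d : R, 0 < d & [/\ 0 <= c - d, c + d <= 1, inc f (c - d) c & dec f c (c + d)].
Definition dn f c := exists2 d : R, 0 < d & [/\ 0 <= c - d, c + d <= 1, dec f (c - d) c & inc f c (c + d)].

Definition noC C u v := forall c, c \in C -> ~~ (u < c < v).

Lemma fold_updn f c : fold f c -> up f c \/ dn f c.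
Proof. by move=> [d d0 [h1 h2 [[h3 h4]|[h3 h4]]]]; [left|right]; exists d. Qed.

Lemma inc_dec f u v : u < v -> inc f u v -> dec f u v -> False.
Proof. by move=> uv h1 h2; have := h1 u v (lexx _) uv (lexx _); have := h2 u v (lexx _) uv (lexx _); clear; ord. Qed.

Lemma up_R f c v : up f c -> c < v -> smono f c v -> dec f c v.
Proof.
move=> [d d0 [_ _ _ h]] cv [m|//]; exfalso.
have m0 : 0 < Num.min d (v - c) by rewrite lt_min d0 subr_gt0.
have [m1 m2] : Num.min d (v - c) <= d /\ Num.min d (v - c) <= v - c by rewrite !ge_min !lexx orbT.
have h1 := h c (c + Num.min d (v - c)) (lexx _) ltac:(by rewrite ltrDl) ltac:(by rewrite lerD2l).
have := m c (c + Num.min d (v - c)) (lexx _) ltac:(by rewrite ltrDl) ltac:(move: m2; clear; ord).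
by move: h1; clear; ord.
Qed.

Lemma dn_R f c v : dn f c -> c < v -> smono f c v -> inc f c v.
Proof.
move=> [d d0 [_ _ _ h]] cv [//|m]; exfalso.
have m0 : 0 < Num.min d (v - c) by rewrite lt_min d0 subr_gt0.
have [m1 m2] : Num.min d (v - c) <= d /\ Num.min d (v - c) <= v - c by rewrite !ge_min !lexx orbT.
have h1 := h c (c + Num.min d (v - c)) (lexx _) ltac:(by rewrite ltrDl) ltac:(by rewrite lerD2l).
have := m c (c + Num.min d (v - c)) (lexx _) ltac:(by rewrite ltrDl) ltac:(move: m2; clear; ord).
by move: h1; clear; ord.
Qed.

Lemma up_L f c u : up f c -> u < c -> smono f u c -> inc f u c.
Proof.
move=> [d d0 [_ _ h _]] uc [//|m]; exfalso.
have m0 : 0 < Num.min d (c - u) by rewrite lt_min d0 subr_gt0.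
have [m1 m2] : Num.min d (c - u) <= d /\ Num.min d (c - u) <= c - u by rewrite !ge_min !lexx orbT.
have lt : c - Num.min d (c - u) < c by rewrite ltrBlDr ltrDl.
have h1 := h (c - Num.min d (c - u)) c ltac:(by rewrite lerD2l lerN2) lt (lexx _).
have := m (c - Num.min d (c - u)) c ltac:(move: m2; clear; ord) lt (lexx _).
by move: h1; clear; ord.
Qed.

Lemma dn_L f c u : dn f c -> u < c -> smono f u c -> dec f u c.
Proof.
move=> [d d0 [_ _ h _]] uc [m|//]; exfalso.
have m0 : 0 < Num.min d (c - u) by rewrite lt_min d0 subr_gt0.
have [m1 m2] : Num.min d (c - u) <= d /\ Num.min d (c - u) <= c - u by rewrite !ge_min !lexx orbT.
have lt : c - Num.min d (c - u) < c by rewrite ltrBlDr ltrDl.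
have h1 := h (c - Num.min d (c - u)) c ltac:(by rewrite lerD2l lerN2) lt (lexx _).
have := m (c - Num.min d (c - u)) c ltac:(move: m2; clear; ord) lt (lexx _).
by move: h1; clear; ord.
Qed.

Lemma inc_bnd f u v x : inc f u v -> u <= x <= v -> f u <= f x <= f v.
Proof.
move=> h /andP[ux xv]; apply/andP; split.
  by move: ux; rewrite le_eqVlt => /orP[/eqP->//|ux]; apply/ltW/h.
by move: xv; rewrite le_eqVlt => /orP[/eqP->//|xv]; apply/ltW/h.
Qed.

Lemma dec_bnd f u v x : dec f u v -> u <= x <= v -> f v <= f x <= f u.
Proof.
move=> h /andP[ux xv]; apply/andP; split.
  by move: xv; rewrite le_eqVlt => /orP[/eqP->//|xv]; apply/ltW/h.
by move: ux; rewrite le_eqVlt => /orP[/eqP->//|ux]; apply/ltW/h.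
Qed.

Lemma ne_inc f u v : inc f u v -> u < v -> f u < f v.
Proof. by move=> h uv; apply: h. Qed.

Lemma ne_dec f u v : dec f u v -> u < v -> f v < f u.
Proof. by move=> h uv; apply: h. Qed.

Section with_pmt.
Variables (f : R -> R) (C : seq R).
Hypothesis P : pmt f C.

Lemma seg u v : 0 <= u -> u < v -> v <= 1 -> noC C u v -> smono f u v.
Proof. exact: (pm_mono P). Qed.

Lemma seg_inc u v : 0 <= u -> u < v -> v <= 1 -> noC C u v -> f u < f v -> inc f u v.
Proof. by move=> u0 uv v1 n lt; case: (seg u0 uv v1 n) => // /ne_dec/(_ uv); move: lt; clear -P; ord. Qed.

Lemma seg_dec u v : 0 <= u -> u < v -> v <= 1 -> noC C u v -> f v < f u -> dec f u v.
Proof. by move=> u0 uv v1 n lt; case: (seg u0 uv v1 n) => // /ne_inc/(_ uv); move: lt; clear -P; ord. Qed.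

Lemma turn_updn c : c \in C -> up f c \/ dn f c.
Proof. by move=> cC; apply/fold_updn/(pm_fold P). Qed.

Lemma turn_incR c u v : c \in C -> u < c -> c < v -> inc f u c -> smono f c v -> dec f c v.
Proof.
move=> cC uc cv h m; have [k|k] := turn_updn cC; first exact: up_R k cv m.
by exfalso; apply: (inc_dec uc h); apply: dn_L k uc _; left.
Qed.

Lemma turn_decR c u v : c \in C -> u < c -> c < v -> dec f u c -> smono f c v -> inc f c v.
Proof.
move=> cC uc cv h m; have [k|k] := turn_updn cC; last exact: dn_R k cv m.
by exfalso; apply: (inc_dec uc _ h); apply: up_L k uc _; right.
Qed.

Lemma turn_decL c u v : c \in C -> u < c -> c < v -> dec f c v -> smono f u c -> inc f u c.
Proof.
move=> cC uc cv h m; have [k|k] := turn_updn cC; first exact: up_L k uc m.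
by exfalso; apply: (inc_dec cv _ h); apply: dn_R k cv _; right.
Qed.

Lemma not_turn c u v : u < c -> c < v -> (inc f u c /\ inc f c v) \/ (dec f u c /\ dec f c v) -> c \notin C.
Proof.
move=> uc cv H; apply/negP => cC; case: H => -[h1 h2].
  by apply: (inc_dec cv h2); apply: (turn_incR cC uc cv h1); left.
by apply: (inc_dec cv _ h2); apply: (turn_decR cC uc cv h1); right.
Qed.

Lemma only_turning (xs : seq R) : uniq xs -> (size C <= count (mem C) xs)%N -> {subset C <= xs}.
Proof.
move=> u h c cC.
have uf : uniq ([seq x <- xs | x \in C]) by exact: filter_uniq.
have sub : {subset [seq x <- xs | x \in C] <= C} by move=> x; rewrite mem_filter => /andP[].
have [_ E] := uniq_min_size uf sub ltac:(by rewrite size_filter).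
by move: cC; rewrite -E mem_filter => /andP[].
Qed.

Lemma extremum_turning m u v : 0 <= u -> v <= 1 -> u < m < v ->
  (forall x, u <= x <= v -> f x <= f m) \/ (forall x, u <= x <= v -> f m <= f x) -> m \in C.
Proof.
move=> u0 v1 mI H; apply: contraT => mC.
have [d d0 gap] := gap_seq C m.
pose r := Num.min d (Num.min (m - u) (v - m)).
have r0 : 0 < r by rewrite !lt_min d0 !subr_gt0.
have [r1 [r2 r3]] : r <= d /\ r <= m - u /\ r <= v - m by rewrite /r !ge_min !lexx !orbT.
clearbody r.
have s : smono f (m - r) (m + r).
  apply: (pm_mono P); [by move: r2 u0; clear -P; ord|by move: r0; clear -P; ord|by move: r3 v1; clear -P; ord|].
  move=> c cC; apply/negP => cI; have ne : c != m by apply/eqP => e; rewrite -e cC in mC.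
  by have := gap c cC ne; rewrite leNgt => /negP; apply; rewrite ltr_norml; move: cI r1; clear -P; ord.
have e1 : m - r < m by rewrite ltrBlDr ltrDl.
have e2 : m < m + r by rewrite ltrDl.
have h1 : u <= m - r <= v by move: r2 r0 mI; clear -P; ord.
have h2 : u <= m + r <= v by move: r3 r0 mI; clear -P; ord.
case: s => s; have k1 := s (m - r) m (lexx _) e1 (ltW e2); have k2 := s m (m + r) (ltW e1) e2 (lexx _);
  by case: H => H; have := H _ h1; have := H _ h2; move: k1 k2; clear -P; ord.
Qed.

(** The interval, later the hull of a cycle, is not invariant; the extremum that leaves it is
    attained in its interior and is therefore a turning point. *)
Lemma hull_exit u v : 0 <= u -> u < v -> v <= 1 -> u <= f u <= v -> u <= f v <= v -> u != 0 \/ v != 1 ->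
  exists e : R, [/\ e \in C, u < e < v & f e < u \/ v < f e].
Proof.
move=> u0 uv v1 fu fv ne.
have [M MI hM] := ctsI_max (pm_cts P) u0 (ltW uv) v1.
have [m mI hm] := ctsI_min (pm_cts P) u0 (ltW uv) v1.
have inner x : u <= x <= v -> f x < u \/ v < f x -> u < x < v.
  move=> xI h; have [e|[e|//]] : x = u \/ x = v \/ u < x < v by move: xI; clear -P; ord.
    by move: h fu; rewrite e; clear -P; ord.
  by move: h fv; rewrite e; clear -P; ord.
have [h|h] := ltP v (f M).
  exists M; have MI' := inner M MI (or_intror h); split => //; last by right.
  by apply: (extremum_turning u0 v1 MI'); left.
have [h'|h'] := ltP (f m) u.
  exists m; have mI' := inner m mI (or_introl h'); split => //; last by left.
  by apply: (extremum_turning u0 v1 mI'); right.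
have [e1 e2] : u = 0 /\ v = 1.
  apply: (inv_itv P u0 uv v1) => x xI; have := hM x xI; have := hm x xI; move: h h'; clear -P; ord.
by case: ne => /eqP.
Qed.

End with_pmt.

(** At a fixed turning point [f] keeps one side of the point to itself, so [hs_fixmin] applies
    directly or after reflection and yields a strict horseshoe of [f] itself. *)
Lemma no_cycle1 f C lam l c : pmt f C -> gauge f lam l -> gpos l -> c \in C -> f c = c -> 2 < lam.
Proof.
move=> P G L cC fc; have cI := fold_in P cC.
have [k|k] := turn_updn P cC; last first.
  have [d d0 [h1 h2 h3 h4]] := k.
  have H : hs1 (mir f).
    by apply: (hs_fixmin P cI fc d0 h2) => u /andP[u1 u2]; rewrite -{1}fc; apply: h4.
  exact: (hs1_gauge (mir_pmt P) (mir_gauge G) (mir_gpos L) H).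
have P' := mir_pmt P.
have [d d0 [h1 h2 h3 h4]] := k.
have H : hs1 (mir (mir f)).
  apply: (hs_fixmin P' (p := 1 - c) (e := d)) => //.
  - by move: cI; clear; ord.
  - by rewrite /mir subKr fc.
  - by move: h1; clear; ord.
  move=> u /andP[u1 u2]; rewrite /mir.
  have := h3 (1 - u) c ltac:(move: u2; clear; ord) ltac:(move: u1; clear; ord) (lexx _).
  by rewrite fc; move: u1; clear; ord.
rewrite mirK in H; exact: (hs1_gauge P G L H).
Qed.

Lemma only4 C c1 c2 c3 c4 : uniq [:: c1; c2; c3; c4] -> (size C <= 4)%N ->
  c1 \in C -> c2 \in C -> c3 \in C -> c4 \in C ->
  forall c, c \in C -> [\/ c = c1, c = c2, c = c3 | c = c4].
Proof.
move=> u sC h1 h2 h3 h4 c cC.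
have := only_turning u (C := C) _ cC; rewrite /= h1 h2 h3 h4 !inE => /(_ sC) /or4P[] /eqP; by constructor.
Qed.

Lemma uniq4 c1 c2 c3 c4 : c1 < c2 -> c2 < c3 -> c3 < c4 -> uniq [:: c1; c2; c3; c4].
Proof.
move=> h1 h2 h3; apply: (sorted_uniq (leT := <%R)); [exact: lt_trans|exact: ltxx|].
by rewrite /= h1 h2 h3.
Qed.

End branches.

(** Leaves to [lra] only the hypotheses in which a binary function variable, that is a length, is
    applied. *)
Local Ltac len :=
  repeat match goal with
  | H : ?T |- _ => assert_fails (match T with context [?g ?a ?b] => is_var g end); clear H
  end; lra.

(** * Cycles of period two and three *)

Section short_cycles.
Variable R : realType.
Implicit Types (x y z w c d e u v s t lam : R) (f a : R -> R) (C : seq R) (l : R -> R -> R).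

Definition rng f u v lo hi := forall x, u <= x <= v -> lo <= f x <= hi.

Lemma rng_cat f u v w lo hi : rng f u v lo hi -> rng f v w lo hi -> rng f u w lo hi.
Proof.
move=> h1 h2 x /andP[ux xw]; have [xv|vx] := leP x v; first by apply: h1; rewrite ux.
by apply: h2; rewrite xw andbT ltW.
Qed.

Lemma rng_inc f u v lo hi : inc f u v -> lo <= f u -> f v <= hi -> rng f u v lo hi.
Proof. by move=> h h1 h2 x /(inc_bnd h)/andP[h3 h4]; rewrite (le_trans h1 h3) (le_trans h4 h2). Qed.

Lemma rng_dec f u v lo hi : dec f u v -> lo <= f v -> f u <= hi -> rng f u v lo hi.
Proof. by move=> h h1 h2 x /(dec_bnd h)/andP[h3 h4]; rewrite (le_trans h1 h3) (le_trans h4 h2). Qed.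

Lemma rng_two f C u v : pmt f C -> 0 < u -> u < v -> v <= 1 -> rng f 0 u v 1 -> rng f v 1 0 u -> False.
Proof.
move=> P u0 uv v1 h1 h2.
apply: (@inv_two R f C P 0 u v 1 (lexx 0) (ltW u0) uv v1 (lexx 1) (or_introl u0)).
by move=> x [/h1|/h2]; [right|left].
Qed.

Lemma rng_itv f C u v : pmt f C -> 0 <= u -> u < v -> v <= 1 -> 0 < u \/ v < 1 -> rng f u v u v -> False.
Proof. by move=> P u0 uv v1 ne h; have [e1 e2] := inv_itv P u0 uv v1 h; move: ne; rewrite e1 e2 !ltxx => -[]. Qed.

Lemma f01 f C : pmt f C -> (0 <= f 0 <= 1) /\ (0 <= f 1 <= 1).
Proof. by move=> P; split; apply: (pm_self P); rewrite ?lexx ?ler01. Qed.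

Lemma noC_in C u v c1 c2 c3 c4 : (forall c, c \in C -> [\/ c = c1, c = c2, c = c3 | c = c4]) ->
  c1 <= u \/ v <= c1 -> c2 <= u \/ v <= c2 -> c3 <= u \/ v <= c3 -> c4 <= u \/ v <= c4 -> noC C u v.
Proof.
by move=> H h1 h2 h3 h4 c /H[] -> ; rewrite negb_and -!leNgt; apply/orP.
Qed.

Lemma laps4 f C c1 c2 c3 c4 : pmt f C -> (size C <= 4)%N -> c1 \in C -> c2 \in C -> c3 \in C -> c4 \in C ->
  c1 < c2 -> c2 < c3 -> c3 < c4 ->
  [/\ inc f 0 c1, dec f c1 c2, inc f c2 c3, dec f c3 c4 & inc f c4 1] \/
  [/\ dec f 0 c1, inc f c1 c2, dec f c2 c3, inc f c3 c4 & dec f c4 1].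
Proof.
move=> P sC h1 h2 h3 h4 l12 l23 l34.
have only := only4 (uniq4 l12 l23 l34) sC h1 h2 h3 h4.
have /andP[p1 _] := fold_in P h1; have /andP[_ p4] := fold_in P h4.
have l13 := lt_trans l12 l23; have l24 := lt_trans l23 l34; have l14 := lt_trans l13 l34.
have p2 := lt_trans p1 l12; have p3 := lt_trans p2 l23; have q3 := lt_trans l34 p4; have q2 := lt_trans l23 q3.
have q1 := lt_trans l12 q2; have p4' := lt_trans p3 l34.
have s0 : smono f 0 c1.
  by apply: (seg P) => //; [exact: ltW|apply: (noC_in only); right; rewrite ?lexx ?ltW].
have s1 : smono f c1 c2.
  by apply: (seg P); rewrite ?ltW //; apply: (noC_in only); rewrite ?lexx ?(ltW l12) ?(ltW l13) ?(ltW l14) ?(ltW l23) ?(ltW l24); auto.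
have s2 : smono f c2 c3.
  by apply: (seg P); rewrite ?ltW //; apply: (noC_in only); rewrite ?lexx ?(ltW l12) ?(ltW l13) ?(ltW l34) ?(ltW l23) ?(ltW l24); auto.
have s3 : smono f c3 c4.
  by apply: (seg P); rewrite ?ltW //; apply: (noC_in only); rewrite ?lexx ?(ltW l34) ?(ltW l13) ?(ltW l14) ?(ltW l23) ?(ltW l24); auto.
have s4 : smono f c4 1.
  by apply: (seg P) => //; [exact: ltW|apply: (noC_in only); left; rewrite ?lexx ?ltW].
case: (s0) => k0; [left|right].
  have k1 := turn_incR P h1 p1 l12 k0 s1; have k2 := turn_decR P h2 l12 l23 k1 s2.
  have k3 := turn_incR P h3 l23 l34 k2 s3; have k4 := turn_decR P h4 l34 p4 k3 s4; by split.
have k1 := turn_decR P h1 p1 l12 k0 s1; have k2 := turn_incR P h2 l12 l23 k1 s2.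
have k3 := turn_decR P h3 l23 l34 k2 s3; have k4 := turn_incR P h4 l34 p4 k3 s4; by split.
Qed.

Lemma laps3 f C c1 c2 c3 : pmt f C -> (forall c, c \in C -> [\/ c = c1, c = c2 | c = c3]) ->
  c1 \in C -> c2 \in C -> c3 \in C -> c1 < c2 -> c2 < c3 ->
  [/\ inc f 0 c1, dec f c1 c2, inc f c2 c3 & dec f c3 1] \/
  [/\ dec f 0 c1, inc f c1 c2, dec f c2 c3 & inc f c3 1].
Proof.
move=> P only h1 h2 h3 l12 l23.
have only' : forall c, c \in C -> [\/ c = c1, c = c2, c = c3 | c = c3] by move=> c /only[]; constructor.
have /andP[p1 _] := fold_in P h1; have /andP[_ q3] := fold_in P h3.
have l13 := lt_trans l12 l23.
have p2 := lt_trans p1 l12; have p3 := lt_trans p2 l23; have q2 := lt_trans l23 q3.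
have q1 := lt_trans l12 q2.
have s0 : smono f 0 c1.
  by apply: (seg P) => //; [exact: ltW|apply: (noC_in only'); right; rewrite ?lexx ?ltW].
have s1 : smono f c1 c2.
  by apply: (seg P); rewrite ?ltW //; apply: (noC_in only'); rewrite ?lexx ?(ltW l12) ?(ltW l13) ?(ltW l23); auto.
have s2 : smono f c2 c3.
  by apply: (seg P); rewrite ?ltW //; apply: (noC_in only'); rewrite ?lexx ?(ltW l12) ?(ltW l13) ?(ltW l23); auto.
have s3 : smono f c3 1.
  by apply: (seg P) => //; [exact: ltW|apply: (noC_in only'); left; rewrite ?lexx ?ltW].
case: (s0) => k0; [left|right].
  have k1 := turn_incR P h1 p1 l12 k0 s1; have k2 := turn_decR P h2 l12 l23 k1 s2.
  have k3 := turn_incR P h3 l23 q3 k2 s3; by split.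
have k1 := turn_decR P h1 p1 l12 k0 s1; have k2 := turn_incR P h2 l12 l23 k1 s2.
have k3 := turn_decR P h3 l23 q3 k2 s3; by split.
Qed.

Section hard2.
Variables (f : R -> R) (C : seq R) (lam : R) (l : R -> R -> R) (x1 x2 d w : R).
Hypotheses (P : pmt f C) (G : gauge f lam l) (L : gpos l) (l2 : lam <= 2).
Hypotheses (f1 : f x1 = x2) (f2 : f x2 = x1) (d0 : 0 < d) (dx : d < x1) (xw : x1 < w) (wx : w < x2) (x21 : x2 < 1).
Hypotheses (s0 : dec f 0 d) (s1 : inc f d x1) (s2 : dec f x1 w) (s3 : inc f w x2) (s4 : dec f x2 1).

Lemma hard2_pos : [/\ 0 < x1, 0 < w, x1 < x2, x1 < 1 & d < x2 /\ w < 1].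
Proof. by do !split; ord. Qed.

Lemma hard2_val : [/\ f d < x2, f w < x1, 0 <= f d, 0 <= f w & f 1 < x1].
Proof.
have [h1 h2 h3 h4 [h5 h6]] := hard2_pos.
split.
- by rewrite -f1; apply: ne_inc.
- by rewrite -f2; apply: ne_inc.
- by case/andP: (pm_self P (x := d) lr).
- by case/andP: (pm_self P (x := w) lr).
by rewrite -f2; apply: ne_dec.
Qed.

Lemma hard2_f0 : x2 < f 0.
Proof.
have [h1 h2 h3 h4 [h5 h6]] := hard2_pos; have [k1 k2 k3 k4 k5] := hard2_val.
rewrite ltNge; apply/negP => h.
apply: (@rng_itv f C 0 x2 P); [exact: lexx|ord|exact: ltW|by right|].
apply: (rng_cat (rng_dec s0 _ _)); [ord|ord|].
apply: (rng_cat (rng_inc s1 _ _)); [ord|by rewrite f1|].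
by apply: (rng_cat (rng_dec s2 _ _) (rng_inc s3 _ _)); rewrite ?f1 ?f2; ord.
Qed.

Variable z : R.
Hypotheses (z0 : 0 <= z) (zd : z < d) (fz : f z = x2).

(** With [v] the lower of the two minima, [v,x2] is invariant; [z <= v] keeps the falling lap before
    [d] from exceeding [x2]. *)
Lemma hard2_min : z <= f d -> z <= f w -> False.
Proof.
move=> a1 a2.
have [h1 h2 h3 h4 [h5 h6]] := hard2_pos; have [k1 k2 k3 k4 k5] := hard2_val.
pose v := Num.min (f d) (f w).
have v1 : v <= f d by rewrite /v ge_min lexx.
have v2 : v <= f w by rewrite /v ge_min lexx orbT.
have zv : z <= v by rewrite le_min a1.
clearbody v.
apply: (@rng_itv f C v x2 P); [ord|ord|ord|by right|].
have [vd|dv] := leP v d.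
  apply: (rng_cat (v := d)); first by apply: (rng_dec (dec_sub s0 (le_trans z0 zv) (lexx _))) => //; rewrite -fz; move: zv; rewrite le_eqVlt => /orP[/eqP->//|zv]; apply/ltW/s0.
  apply: (rng_cat (rng_inc s1 _ _)); [ord|by rewrite f1|].
  by apply: (rng_cat (rng_dec s2 _ _) (rng_inc s3 _ _)); rewrite ?f1 ?f2; ord.
have [vx|xv] := leP v x1.
  apply: (rng_cat (rng_inc (inc_sub s1 (ltW dv) (lexx _)) _ _)); [|by rewrite f1|].
    by apply: (le_trans v1); apply/ltW/s1 => //; exact: lexx.
  by apply: (rng_cat (rng_dec s2 _ _) (rng_inc s3 _ _)); rewrite ?f1 ?f2; ord.
by move: xv; rewrite ltNge (le_trans v2 (ltW k2)).
Qed.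

Lemma hard2_len : [/\ l (f d) x2 <= lam * l d x1, 2 * l (f d) x2 <= 2 * l z x1 & 0 < l z x1].
Proof.
have [h1 h2 h3 h4 [h5 h6]] := hard2_pos; have [k1 k2 k3 k4 k5] := hard2_val.
have A0 := ga_add G z0 zd dx (ltW h4).
have L0 := L (x := z) (y := x1) z0 lr (ltW h4).
have B1 : l (f d) x2 <= lam * l z d by apply: (ga_dn_sub P G); rewrite ?fz //; ord.
have B2 : l (f d) x2 <= lam * l d x1 by apply: (ga_up_sub P G); rewrite ?f1 //; ord.
have B3 : lam * (l z d + l d x1) <= lam * l z x1 by rewrite ler_wpM2l ?(ga_lam G).
have lL : lam * l z x1 <= 2 * l z x1 by rewrite ler_wpM2r // ltW.
by split => //; rewrite mulrDr in B3; move: B1 B2 B3 lL; lra.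
Qed.

(** [z,d] and [d,x1] both cover [f d,x2], so with [lam <= 2] this interval is at most as long as
    [z,x1]; but it contains [z,x1] and [x1,x2]. *)
Lemma hard2_left : f d < z -> False.
Proof.
move=> fdz.
have [h1 h2 h3 h4 [h5 h6]] := hard2_pos; have [k1 k2 k3 k4 k5] := hard2_val; have [B2 B3 L0] := hard2_len.
have A1 := ga_add G z0 (lt_trans zd dx) h3 (ltW x21).
have A2 := ga_mono G (x := f d) (x' := z) (y' := x2) (y := x2) k3 (ltW fdz) lr (lexx _) (ltW x21).
have K0 := L (x := x1) (y := x2) (ltW h1) h3 (ltW x21).
by move: A1 A2 B3 K0; lra.
Qed.

(** The laps between [x1] and [x2] bound twice the length of [f w,x1] by that of [x1,x2]. The latter
    lies in [f d,x2], which is at most as long as [z,x1], a part of [f w,x1]. *)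
Lemma hard2_right1 : f w < z -> f d <= x1 -> False.
Proof.
move=> fwz fdx.
have [h1 h2 h3 h4 [h5 h6]] := hard2_pos; have [k1 k2 k3 k4 k5] := hard2_val; have [B2 B3 L0] := hard2_len.
have A1 := ga_mono G (x := f w) (x' := z) (y' := x1) (y := x1) k4 (ltW fwz) lr (lexx _) (ltW h4).
have A2 := ga_mono G (x := f d) (x' := x1) (y' := x2) (y := x2) k3 fdx h3 (lexx _) (ltW x21).
have A3 := ga_add G k4 k2 h3 (ltW x21).
have A4 := ga_add G (ltW h1) xw wx (ltW x21).
have K0 := L (x := x1) (y := x2) (ltW h1) h3 (ltW x21).
have B4 : l (f w) x2 <= lam * l x1 w by apply: (ga_dn_sub P G); rewrite ?f1 //; ord.
have B5 : l (f w) x1 <= lam * l w x2 by apply: (ga_up_sub P G); rewrite ?f2 //; ord.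
have B6 : lam * (l x1 w + l w x2) <= lam * l x1 x2 by rewrite ler_wpM2l ?(ga_lam G).
have lK : lam * l x1 x2 <= 2 * l x1 x2 by rewrite ler_wpM2r // ltW.
by rewrite mulrDr in B6; move: A1 A2 A3 A4 K0 B3 B4 B5 B6 lK; lra.
Qed.

(** Otherwise [0,x1] and [f d,1] would be mapped into each other. *)
Lemma hard2_visit : x1 < f d -> f d < w /\ x1 < f (f d).
Proof.
move=> fdx.
have [h1 h2 h3 h4 [h5 h6]] := hard2_pos; have [k1 k2 k3 k4 k5] := hard2_val.
have [x [fdx' x1' xf]] : exists x : R, [/\ f d <= x, x <= 1 & x1 < f x].
  apply: contrapT => no; apply: (@rng_two f C x1 (f d) P) => //; first by ord.
    have [_ /andP[f1a f1b]] := f01 P; have [/andP[f0a f0b] _] := f01 P.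
    by apply: (rng_cat (rng_dec s0 _ _) (rng_inc s1 _ _)); rewrite ?f1; ord.
  move=> x /andP[xI xI']; have /andP[-> _] := pm_self P (x := x) lr; rewrite /= leNgt; apply/negP => h.
  by apply: no; exists x.
have xx2 : x < x2.
  by rewrite ltNge; apply/negP => xx2; have /andP[_] := dec_bnd s4 (x := x) lr; rewrite f2 leNgt xf.
have xw2 : x < w.
  by rewrite ltNge; apply/negP => xw2; have /andP[_] := inc_bnd s3 (x := x) lr; rewrite f2 leNgt xf.
split; first exact: le_lt_trans xw2.
apply: (lt_le_trans xf).
by have /andP[_] := dec_bnd (dec_sub s2 (ltW fdx) (lexx _)) (x := x) lr.
Qed.

(** [f d,w] and [w,x2] both cover [f w,x1]. With [lam <= 2] the latter is at most as long as
    [f d,x2], hence as [z,x1], which it properly contains. *)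
Lemma hard2_right2 : f w < z -> x1 < f d -> False.
Proof.
move=> fwz fdx; have [ffw ffd] := hard2_visit fdx.
have [h1 h2 h3 h4 [h5 h6]] := hard2_pos; have [k1 k2 k3 k4 k5] := hard2_val; have [B2 B3 L0] := hard2_len.
have A4 := ga_add G k3 ffw wx (ltW x21).
have B4 : l (f w) x1 <= lam * l (f d) w by apply: (ga_dn_sub P G) => //; ord.
have B5 : l (f w) x1 <= lam * l w x2 by apply: (ga_up_sub P G); rewrite ?f2 //; ord.
have B6 : lam * (l (f d) w + l w x2) <= lam * l (f d) x2 by rewrite ler_wpM2l ?(ga_lam G).
have M0 := L (x := f d) (y := x2) k3 k1 (ltW x21).
have lM : lam * l (f d) x2 <= 2 * l (f d) x2 by rewrite ler_wpM2r // ltW.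
have N0 := L (x := f w) (y := z) k4 fwz lr.
have A5 := ga_add G k4 fwz (lt_trans zd dx) (ltW h4).
by rewrite mulrDr in B6; move: A4 A5 N0 M0 lM B3 B4 B5 B6; lra.
Qed.

End hard2.

Lemma no_cycle2_hard f C lam l x1 x2 d w : pmt f C -> gauge f lam l -> gpos l -> lam <= 2 ->
  f x1 = x2 -> f x2 = x1 -> 0 < d -> d < x1 -> x1 < w -> w < x2 -> x2 < 1 ->
  dec f 0 d -> inc f d x1 -> dec f x1 w -> inc f w x2 -> dec f x2 1 -> False.
Proof.
move=> P G L l2 f1 f2 d0 dx xw wx x21 s0 s1 s2 s3 s4.
have f0 := hard2_f0 P f1 f2 d0 dx xw wx x21 s0 s1 s2 s3 s4.
have [k1 k2 _ _ _] := hard2_val P f1 f2 d0 dx xw wx x21 s1 s3 s4.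
have [||z /andP[z0 zd'] fz] := ctsI_IVT (a := 0) (b := d) (v := x2) (pm_cts P) (lexx 0) (ltW d0);
  [by ord|by right; rewrite !ltW|].
have zd : z < d by rewrite lt_neqAle zd' andbT; apply/eqP => e; move: k1; rewrite -e fz ltxx.
have H1 := hard2_left P G L l2 f1 f2 d0 dx xw wx x21 s1 s3 s4 z0 zd fz.
have [h|/H1//] := leP z (f d).
have [h'|h'] := leP z (f w).
  exact: (hard2_min P f1 f2 d0 dx xw wx x21 s0 s1 s2 s3 s4 z0 fz h h').
have [e|e] := leP (f d) x1.
  exact: (hard2_right1 P G L l2 f1 f2 d0 dx xw wx x21 s1 s3 s4 z0 zd fz h' e).
exact: (hard2_right2 P G L l2 f1 f2 d0 dx xw wx x21 s0 s1 s2 s3 s4 z0 zd fz h' e).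
Qed.

Lemma no_cycle2_left f C lam l x1 x2 d w : pmt f C -> gauge f lam l -> gpos l -> lam <= 2 ->
  (size C <= 4)%N -> d \in C -> x1 \in C -> w \in C -> x2 \in C ->
  f x1 = x2 -> f x2 = x1 -> d < x1 -> x1 < w -> w < x2 -> False.
Proof.
move=> P G L l2 sC dC h1 wC h2 f1 f2 dx xw wx.
have /andP[d0 _] := fold_in P dC; have /andP[_ x21] := fold_in P h2.
have [[s0 s1 s2 s3 s4]|[s0 s1 s2 s3 s4]] := laps4 P sC dC h1 wC h2 dx xw wx; last first.
  exact: (@no_cycle2_hard f C lam l x1 x2 d w).
have [_ /andP[_ f11]] := f01 P.
have fwI := pm_self P (x := w) ltac:(ord).
have := ne_inc s2 xw; have := ne_dec s3 wx; have := ne_inc s4 x21; rewrite f1 f2 => k1 k2 k3.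
apply: (@rng_itv f C x1 1 P); try ord.
apply: (rng_cat (rng_inc s2 _ _)); [ord|ord|].
by apply: (rng_cat (rng_dec s3 _ _) (rng_inc s4 _ _)); ord.
Qed.

Lemma no_cycle2_three f C x1 e x2 : pmt f C -> (forall c, c \in C -> [\/ c = x1, c = e | c = x2]) ->
  x1 \in C -> e \in C -> x2 \in C -> f x1 = x2 -> f x2 = x1 -> x1 < e -> e < x2 -> False.
Proof.
move=> P only h1 eC h2 f1 f2 e1 e2.
have /andP[x10 _] := fold_in P h1; have /andP[_ x21] := fold_in P h2.
have [[f00 f01'] [f10 f11]] := (andP (f01 P).1, andP (f01 P).2).
have /andP[feI feI'] := pm_self P (x := e) lr.
have [[s0 s1 s2 s3]|[s0 s1 s2 s3]] := laps3 P only h1 eC h2 e1 e2.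
  have := ne_inc s0 x10; have := ne_dec s1 e1; have := ne_inc s2 e2; rewrite f1 f2 => k1 k2 k3.
  apply: (@rng_itv f C 0 x2 P); [exact: lexx|ord|exact: ltW|by right|].
  apply: (rng_cat (rng_inc s0 _ _)); [ord|by rewrite f1|].
  by apply: (rng_cat (rng_dec s1 _ _) (rng_inc s2 _ _)); rewrite ?f1 ?f2 //; ord.
have := ne_inc s1 e1; have := ne_dec s2 e2; have := ne_inc s3 x21; rewrite f1 f2 => k1 k2 k3.
apply: (@rng_itv f C x1 1 P); [exact: ltW|ord|exact: lexx|by left|].
apply: (rng_cat (rng_inc s1 _ _)); [by rewrite f1; ord|ord|].
by apply: (rng_cat (rng_dec s2 _ _) (rng_inc s3 _ _)); rewrite ?f1 ?f2 //; ord.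
Qed.

Section mid2.
Variables (f : R -> R) (C : seq R) (lam : R) (l : R -> R -> R) (x1 w1 w2 x2 : R).
Hypotheses (P : pmt f C) (G : gauge f lam l) (L : gpos l) (l2 : lam <= 2).
Hypotheses (f1 : f x1 = x2) (f2 : f x2 = x1) (x10 : 0 < x1) (a1 : x1 < w1) (a2 : w1 < w2) (a3 : w2 < x2) (x21 : x2 < 1).

(** Three laps inside [x1,x2] each cover this interval, which needs a slope of at least 3. *)
Lemma mid2_len : dec f x1 w1 -> inc f w1 w2 -> dec f w2 x2 -> f w1 <= x1 -> x2 <= f w2 -> False.
Proof.
move=> s1 s2 s3 b1 b2.
have x12 : x1 < x2 by ord.
have x20 : 0 < x2 by ord.
have w20 : 0 <= w2 by ord.
have w10 : 0 <= w1 by ord.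
have w21 : w2 <= 1 by ord.
have w11 : w1 <= 1 by ord.
have L1 : l x1 x2 <= lam * l x1 w1 by apply: (ga_dn_sub P G); rewrite ?f1 // ltW.
have L2 : l x1 x2 <= lam * l w1 w2 by apply: (ga_up_sub P G).
have L3 : l x1 x2 <= lam * l w2 x2 by apply: (ga_dn_sub P G); rewrite ?f2 // ltW.
have K0 := L (x := x1) (y := x2) (ltW x10) x12 (ltW x21).
have A1 := ga_add G (ltW x10) a1 (lt_trans a2 a3) (ltW x21).
have A2 := ga_add G w10 a2 a3 (ltW x21).
have A3 : l x1 w1 + (l w1 w2 + l w2 x2) <= l x1 x2 by apply: le_trans A1; rewrite lerD2l.
have h : lam * (l x1 w1 + (l w1 w2 + l w2 x2)) <= lam * l x1 x2 by rewrite ler_wpM2l ?(ga_lam G).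
have lK : lam * l x1 x2 <= 2 * l x1 x2 by rewrite ler_wpM2r // ltW.
by rewrite !mulrDr in h; lra.
Qed.

Lemma mid2_low : inc f 0 x1 -> dec f x1 w1 -> inc f w1 w2 -> dec f w2 x2 -> f w2 < x2 -> False.
Proof.
move=> s0 s1 s2 s3 b1.
have [[f00 f01'] _] := (andP (f01 P).1, andP (f01 P).2).
have := ne_inc s0 x10; have := ne_dec s1 a1; rewrite f1 => k1 k0.
have := ne_dec s3 a3; rewrite f2 => k3.
have /andP[w1I _] := pm_self P (x := w1) lr.
apply: (@rng_itv f C 0 x2 P); [exact: lexx|ord|exact: ltW|by right|].
apply: (rng_cat (rng_inc s0 _ _)); [by []|by rewrite f1|].
apply: (rng_cat (rng_dec s1 _ _)); [by []|by rewrite f1|].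
apply: (rng_cat (rng_inc s2 _ _) (rng_dec s3 _ _)); rewrite ?f2; [by []|exact: ltW|exact: ltW|exact: ltW].
Qed.

End mid2.

Lemma no_cycle2_mid f C lam l x1 w1 w2 x2 : pmt f C -> gauge f lam l -> gpos l -> lam <= 2 ->
  (size C <= 4)%N -> x1 \in C -> w1 \in C -> w2 \in C -> x2 \in C ->
  f x1 = x2 -> f x2 = x1 -> x1 < w1 -> w1 < w2 -> w2 < x2 -> False.
Proof.
move=> P G L l2 sC h1 w1C w2C h2 f1 f2 a1 a2 a3.
have /andP[x10 _] := fold_in P h1; have /andP[_ x21] := fold_in P h2.
have [[s0 s1 s2 s3 s4]|[s0 s1 s2 s3 s4]] := laps4 P sC h1 w1C w2C h2 a1 a2 a3; last first.
  have [[f00 f01'] [f10 f11]] := (andP (f01 P).1, andP (f01 P).2).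
  apply: (@rng_two f C x1 x2 P) => //; [ord|ord| |].
    by apply: (rng_dec s0); rewrite ?f1.
  by apply: (rng_dec s4); rewrite ?f2.
have [b1|b1] := ltP (f w2) x2; first exact: (mid2_low P f1 f2 x10 a1 a2 a3 x21 s0 s1 s2 s3 b1).
have [b2|b2] := ltP x1 (f w1); last exact: (mid2_len P G L l2 f1 f2 x10 a1 a2 a3 x21 s1 s2 s3 b2 b1).
apply: (mid2_low (mir_pmt P) (x1 := 1 - x2) (w1 := 1 - w2) (w2 := 1 - w1) (x2 := 1 - x1));
  rewrite ?subr_gt0 ?ltrD2l ?ltrN2 ?ltrBlDr ?ltrDl //; rewrite /mir ?subKr ?f1 ?f2 //.
- by have := mir_inc s4; rewrite subrr.
- exact: mir_dec.
- exact: mir_inc.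
exact: mir_dec.
Qed.

(** The exit [e] of the hull is a third turning point; the cases differ by the position of a
    possible fourth one, outside the cycle or between its points. *)
Lemma no_cycle2 f C lam l x1 x2 : pmt f C -> gauge f lam l -> gpos l -> lam <= 2 ->
  (size C <= 4)%N -> x1 \in C -> x2 \in C -> x1 < x2 -> f x1 = x2 -> f x2 = x1 -> False.
Proof.
move=> P G L l2 sC h1 h2 x12 f1 f2.
have /andP[x10 _] := fold_in P h1; have /andP[_ x21] := fold_in P h2.
have [e [eC /andP[e1 e2] fe]] := @hull_exit _ f C P x1 x2 (ltW x10) x12 (ltW x21)
  ltac:(by rewrite f1 lexx ltW) ltac:(by rewrite f2 lexx ltW) ltac:(by left; rewrite gt_eqF).
have [[t [tC t1 te t2]]|no] := pselect (exists t : R, [/\ t \in C, t != x1, t != e & t != x2]); last first.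
  apply: (@no_cycle2_three f C x1 e x2 P) => // c cC.
  by apply: contrapT => h; apply: no; exists c; split => //; apply/eqP => E; apply: h; rewrite E; constructor.
have [tx|xt|e'] := ltgtP t x1; [|  |by rewrite e' eqxx in t1].
  exact: (@no_cycle2_left f C lam l x1 x2 t e).
have [tx|xt'|e'] := ltgtP t x2; [| |by rewrite e' eqxx in t2]; last first.
  have mm c : c \in C -> 1 - c \in [seq 1 - c | c <- C] by move=> cC; apply/mapP; exists c.
  apply: (@no_cycle2_left _ _ lam (fun x y => l (1 - y) (1 - x)) (1 - x2) (1 - x1) (1 - t) (1 - e) (mir_pmt P) (mir_gauge G) (mir_gpos L) l2);
    rewrite ?size_map ?mm ?ltrD2l ?ltrN2 // /mir subKr; by rewrite ?f1 ?f2.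
move: te; rewrite neq_lt => /orP[h|h].
  exact: (@no_cycle2_mid f C lam l x1 t e x2).
exact: (@no_cycle2_mid f C lam l x1 e t x2).
Qed.

Section three.
Variables (f : R -> R) (C : seq R) (lam : R) (l : R -> R -> R) (x1 x2 x3 e : R).
Hypotheses (P : pmt f C) (G : gauge f lam l) (L : gpos l) (l1 : 1 < lam) (l2 : lam <= 2).
Hypotheses (x10 : 0 <= x1) (x12 : x1 < x2) (x23 : x2 < x3) (x31 : x3 <= 1).
Hypotheses (f1 : f x1 = x2) (f2 : f x2 = x3) (f3 : f x3 = x1).

(** The two pieces of [x1,x2] cover [x1,x2] and [x1,x3]; slope 2 leaves no length for [x2,x3]. *)
Lemma three_low : x1 < e -> e < x2 -> f e < x1 -> False.
Proof.
move=> e1 ex fe.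
have x20 := le_lt_trans x10 x12; have x21 := lt_le_trans x23 x31; have x13 := lt_trans x12 x23.
have e0 := le_lt_trans x10 e1; have e11 := lt_trans ex x21.
have A0 := ga_add G x10 e1 ex (ltW x21).
have B1 : l x1 x2 <= lam * l x1 e by apply: (ga_dn_sub P G); rewrite ?f1 // ltW.
have B2 : l x1 x3 <= lam * l e x2 by apply: (ga_up_sub P G); rewrite ?f2 // ltW.
have A1 := ga_add G x10 x12 x23 x31.
have K1 := L x10 x12 (ltW x21).
have K2 := L (ltW x20) x23 x31.
have h : lam * (l x1 e + l e x2) <= lam * l x1 x2 by rewrite ler_wpM2l ?(ga_lam G).
have lK : lam * l x1 x2 <= 2 * l x1 x2 by rewrite ler_wpM2r // ltW.
by rewrite mulrDr in h; lra.
Qed.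

(** The excursion [f e,x1] outside the hull covers [x2,x3] in turn; with this additional lap the
    covering graph grows faster than [lam <= 2] permits. *)
Lemma three_high : 0 < x1 -> x2 < e -> e < x3 -> f e < x1 -> x3 < f (f e) -> False.
Proof.
move=> x1p xe ex fe ffe.
have x20 := le_lt_trans x10 x12; have x21 := lt_le_trans x23 x31; have x13 := lt_trans x12 x23.
have e0 := lt_trans x20 xe; have e11 := lt_le_trans ex x31.
have /andP[fe0 _] : 0 <= f e <= 1 by apply: (pm_self P); rewrite !ltW.
have fe3 := lt_trans fe x13.
have x11 := lt_trans x12 x21.
have B0 : l x2 x3 <= lam * l (f e) x1 by apply: (ga_dn_sub P G); rewrite ?f1 // ltW.
have B1 : l x2 x3 <= lam * l x1 x2 by apply: (ga_up_sub P G); rewrite ?f1 ?f2 // ltW.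
have B2 : l (f e) x3 <= lam * l x2 e by apply: (ga_dn_sub P G); rewrite ?f2 // ltW.
have B3 : l (f e) x1 <= lam * l e x3 by apply: (ga_up_sub P G); rewrite ?f3 // ltW.
have A0 := ga_add G (ltW x20) xe ex x31.
have A1 := ga_add G fe0 fe x13 x31.
have A2 := ga_add G x10 x12 x23 x31.
have K2 := L (ltW x20) x23 x31.
have h : l (f e) x3 + l (f e) x1 <= lam * l x2 x3.
  apply: (@le_trans _ _ (lam * (l x2 e + l e x3))); last by rewrite ler_wpM2l ?(ga_lam G).
  by rewrite mulrDr lerD.
have h' : lam * (2 * l (f e) x1 + l x1 x2 + l x2 x3) <= lam * (lam * l x2 x3).
  by rewrite ler_wpM2l ?(ga_lam G) //; apply: le_trans h; lra.
have lK : lam * (lam * l x2 x3) <= 2 * (2 * l x2 x3).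
  apply: ler_pM => //; [exact: ga_lam G|by rewrite mulr_ge0 ?(ga_lam G) // ltW|].
  by rewrite ler_wpM2r // ltW.
have lK' : l x2 x3 < lam * l x2 x3 by rewrite -{1}[l x2 x3]mul1r ltr_pM2r.
by rewrite !mulrDr in h'; lra.
Qed.

End three.

Lemma no_cycle3 f C lam l x1 x2 x3 : pmt f C -> gauge f lam l -> gpos l -> 1 < lam -> lam <= 2 ->
  (size C <= 4)%N -> x1 \in C -> x2 \in C -> x3 \in C -> x1 < x2 -> x2 < x3 ->
  f x1 = x2 -> f x2 = x3 -> f x3 = x1 -> False.
Proof.
move=> P G L l1 l2 sC h1 h2 h3 x12 x23 f1 f2 f3.
have /andP[x10 _] := fold_in P h1; have /andP[_ x31] := fold_in P h3.
have [e [eC /andP[e1 e2] fe]] := @hull_exit _ f C P x1 x3 (ltW x10) (lt_trans x12 x23) (ltW x31)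
  ltac:(by rewrite f1 !ltW) ltac:(by rewrite f3 lexx ltW // (lt_trans x12)) ltac:(by left; rewrite gt_eqF).
have [ex|xe|e'] := ltgtP e x2; last by move: fe; rewrite e' f2 ltxx; case=> //; ord.
  have [[s0 s1 s2 s3 s4]|[s0 s1 s2 s3 s4]] := laps4 P sC h1 eC h2 h3 e1 ex x23; last first.
    by have := ne_inc s3 x23; rewrite f2 f3; ord.
  have := ne_dec s1 e1; rewrite f1 => k2.
  have fe' : f e < x1 by case: fe => // h; exfalso; move: k2; rewrite ltNge (ltW (lt_trans x23 h)).
  exact: (three_low P G L l2 (ltW x10) x12 x23 (ltW x31) f1 f2 e1 ex fe').
have [[s0 s1 s2 s3 s4]|[s0 s1 s2 s3 s4]] := laps4 P sC h1 h2 eC h3 x12 xe e2.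
  by have := ne_dec s1 x12; rewrite f1 f2; ord.
have := ne_dec s2 xe; rewrite f2 => k1.
have fe' : f e < x1 by case: fe => // h; exfalso; move: k1; rewrite ltNge (ltW h).
apply: (three_high P G L l1 l2 (ltW x10) x12 x23 (ltW x31) f1 f2 f3 x10 xe e2 fe').
(* If the second image of [e] does not pass [x3], the interval [f e,x3] is invariant. *)
rewrite ltNge; apply/negP => h; have /andP[fe0 _] := pm_self P (x := e) lr.
apply: (@rng_itv f C (f e) x3 P); [by []|ord|exact: ltW|by right|].
apply: (rng_cat (v := x1)).
  by apply: (rng_dec (dec_sub s0 fe0 (lexx _))); rewrite ?f1; ord.
apply: (rng_cat (rng_inc s1 _ _)); [by rewrite f1; ord|by rewrite f2|].
by apply: (rng_cat (rng_dec s2 _ _) (rng_inc s3 _ _)); rewrite ?f2 ?f3; ord.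
Qed.

Lemma covers f C lam l u v w (p q r : R) : pmt f C -> gauge f lam l -> 0 <= u -> u < v -> v < w -> w <= 1 ->
  p < q -> p < r ->
  f v <= p -> q <= f u -> r <= f w -> l p q + l p r <= lam * l u w.
Proof.
move=> P G u0 uv vw w1 ab ac h1 h2 h3.
have A0 := ga_add G u0 uv vw w1.
have B1 : l p q <= lam * l u v by apply: (ga_dn_sub P G) => //; ord.
have B2 : l p r <= lam * l v w by apply: (ga_up_sub P G) => //; ord.
have h : lam * (l u v + l v w) <= lam * l u w by rewrite ler_wpM2l ?(ga_lam G).
by rewrite mulrDr in h; len.
Qed.

Lemma covers_high f C lam l u v w (p q r : R) : pmt f C -> gauge f lam l -> 0 <= u -> u < v -> v < w -> w <= 1 ->
  q < p -> r < p -> p <= f v -> f u <= q -> f w <= r -> l q p + l r p <= lam * l u w.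
Proof.
move=> P G u0 uv vw w1 ab ac h1 h2 h3.
have A0 := ga_add G u0 uv vw w1.
have B1 : l q p <= lam * l u v by apply: (ga_up_sub P G) => //; ord.
have B2 : l r p <= lam * l v w by apply: (ga_dn_sub P G) => //; ord.
have h : lam * (l u v + l v w) <= lam * l u w by rewrite ler_wpM2l ?(ga_lam G).
by rewrite mulrDr in h; len.
Qed.

End short_cycles.

Local Ltac dis := repeat (apply/andP; split); first [exact isT | apply/orP; left; chains | apply/orP; right; chains].

(** * Cycles of period four and five *)

Section long_cycles.
Variable R : realType.
Implicit Types (x y z w c d e u v s t lam : R) (f a : R -> R) (C : seq R) (l : R -> R -> R).

Lemma noC_seq C xs u v : {subset C <= xs} -> all (fun c => (c <= u) || (v <= c)) xs -> noC C u v.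
Proof. by move=> sub /allP h c /sub/h; rewrite negb_and -!leNgt. Qed.

Lemma sum4 (a b c d : bool) : (3 <= a + b + c + d)%N ->
  [\/ [&& b, c & d], [&& a, c & d], [&& a, b & d] | [&& a, b & c]].
Proof.
by case: a; case: b; case: c; case: d => //= _; by [constructor 1|constructor 2|constructor 3|constructor 4].
Qed.

(** An exit below [x1] would split [x1,x2] into pieces that cover [x1,x3] and [x1,x4], too much for
    slope 2. *)
Lemma no_cycle4_low f C lam l x1 x2 x3 x4 e : pmt f C -> gauge f lam l -> gpos l -> lam <= 2 ->
  0 <= x1 -> x1 < x2 -> x2 < x3 -> x3 < x4 -> x4 <= 1 -> f x1 = x3 -> f x2 = x4 ->
  x1 < e -> e < x2 -> x1 <= f e.
Proof.
move=> P G L l2 x10 x12 x23 x34 x41 f1 f2 e1 e2; rewrite leNgt; apply/negP => fe.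
have x20 := le_lt_trans x10 x12; have x30 := lt_trans x20 x23.
have x31 := lt_le_trans x34 x41; have x21 := lt_trans x23 x31.
have feI := pm_self P (x := e) lr.
have c1 := covers P G (u := x1) (v := e) (w := x2) (p := x1) (q := x3) (r := x4) x10 e1 e2
  (ltW x21) lr lr (ltW fe) lr lr.
have a1 := ga_add G x10 x12 x23 (ltW x31).
have a2 := ga_mono G (x := x1) (x' := x1) (y' := x2) (y := x4) x10 (lexx _) x12 lr x41.
have p1 := L x2 x3 (ltW x20) x23 (ltW x31).
have p2 := L x1 x2 x10 x12 (ltW x21).
have p3 : lam * l x1 x2 <= 2 * l x1 x2 by rewrite ler_wpM2r // ltW.
by move: c1 a1 a2 p1 p2 p3; clear; lra.
Qed.

Lemma no_cycle4_high f C lam l x1 x2 x3 x4 e : pmt f C -> gauge f lam l -> gpos l -> lam <= 2 ->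
  0 <= x1 -> x1 < x2 -> x2 < x3 -> x3 < x4 -> x4 <= 1 -> f x3 = x2 -> f x4 = x1 ->
  x3 < e -> e < x4 -> f e <= x4.
Proof.
move=> P G L l2 x10 x12 x23 x34 x41 f3 f4 e1 e2; rewrite leNgt; apply/negP => fe.
have x20 := le_lt_trans x10 x12; have x30 := lt_trans x20 x23.
have x31 := lt_le_trans x34 x41; have x21 := lt_trans x23 x31.
have c1 := covers_high P G (u := x3) (v := e) (w := x4) (p := x4) (q := x2) (r := x1) (ltW x30) e1 e2
  x41 lr lr (ltW fe) lr lr.
have a1 := ga_add G (ltW x20) x23 x34 x41.
have a2 := ga_mono G (x := x1) (x' := x3) (y' := x4) (y := x4) x10 lr x34 (lexx _) x41.
have p1 := L x2 x3 (ltW x20) x23 (ltW x31).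
have p2 := L x3 x4 (ltW x30) x34 x41.
have p3 : lam * l x3 x4 <= 2 * l x3 x4 by rewrite ler_wpM2r // ltW.
by move: c1 a1 a2 p1 p2 p3; clear; lra.
Qed.

Section four.
Variables (f : R -> R) (C : seq R) (x1 x2 x3 x4 e : R).
Hypotheses (P : pmt f C) (sC : (size C <= 4)%N).
Hypotheses (x10 : 0 <= x1) (x12 : x1 < x2) (x23 : x2 < x3) (x34 : x3 < x4) (x41 : x4 <= 1).
Hypotheses (f1 : f x1 = x3) (f2 : f x2 = x4) (f3 : f x3 = x2) (f4 : f x4 = x1) (eC : e \in C).
Hypothesis cnt : (3 <= (x1 \in C) + (x2 \in C) + (x3 \in C) + (x4 \in C))%N.

(** [e] and three points of the cycle are all the turning points; in each case the alternation of
    the laps contradicts the values on the cycle. *)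
Lemma four_J1 : x1 < e -> e < x2 -> x4 < f e -> False.
Proof using All.
move=> e1 ex2 fe'.
have x20 := le_lt_trans x10 x12; have x30 := lt_trans x20 x23.
have x31 := lt_le_trans x34 x41; have x21 := lt_trans x23 x31.
case: (sum4 cnt) => /and3P[h1 h2 h3].
- have [[s0 s1 s2 s3 s4]|[s0 s1 s2 s3 s4]] := laps4 P sC eC h1 h2 h3 ex2 x23 x34.
    by have := ne_inc s2 x23; rewrite f2 f3; ord.
  by have := ne_inc s3 x34; rewrite f4 f3; ord.
- have [[s0 s1 s2 s3 s4]|[s0 s1 s2 s3 s4]] := laps4 P sC h1 eC h2 h3 e1 lr x34.
    by have := ne_dec s1 e1; rewrite f1; ord.
  by have := ne_inc s3 x34; rewrite f4 f3; ord.
- have [[s0 s1 s2 s3 s4]|[s0 s1 s2 s3 s4]] := laps4 P sC h1 eC h2 h3 e1 ex2 lr.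
    by have := ne_dec s1 e1; rewrite f1; ord.
  by have := s3 x3 x4 lr lr lr; rewrite f4 f3; ord.
- have [[s0 s1 s2 s3 s4]|[s0 s1 s2 s3 s4]] := laps4 P sC h1 eC h2 h3 e1 ex2 x23.
    by have := ne_dec s1 e1; rewrite f1; ord.
  by have := ne_inc s3 x23; rewrite f2 f3; ord.
Qed.

(** The laps alone do not exclude all cases: in the remaining ones [0,x4] is invariant, or [0,x2]
    and [x3,1] are mapped into each other. *)
Lemma four_J2 : x2 < e -> e < x3 -> False.
Proof using All.
move=> ex2 ex3; have e1 := lt_trans x12 ex2; have e4 := lt_trans ex3 x34.
have x20 := le_lt_trans x10 x12; have x30 := lt_trans x20 x23.
have x31 := lt_le_trans x34 x41; have x21 := lt_trans x23 x31.
have [/andP[f00 f01'] /andP[f10 f11]] := f01 P.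
have /andP[fe0 fe1] := pm_self P (x := e) lr.
case: (sum4 cnt) => /and3P[h1 h2 h3].
- have [[s0 s1 s2 s3 s4]|[s0 s1 s2 s3 s4]] := laps4 P sC h1 eC h2 h3 ex2 ex3 x34; last first.
    by have := s0 x1 x2 x10 x12 (lexx _); rewrite f1 f2; ord.
  have := ne_dec s1 ex2; have := ne_inc s2 ex3; rewrite f2 f3 => k1 k2.
  have [x41'|e'] := ltP x4 1; last by have /andP[_] := fold_in P h3; ord.
  apply: (@rng_itv _ f C 0 x4 P); [exact: lexx|by ord|by ord|by right|].
  apply: (rng_cat (rng_inc s0 _ _)); rewrite ?f2 ?f3; [ord|ord|].
  apply: (rng_cat (rng_dec s1 _ _)); rewrite ?f2 ?f3; [ord|ord|].
  by apply: (rng_cat (rng_inc s2 _ _) (rng_dec s3 _ _)); rewrite ?f3 ?f4 //; ord.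
- have [[s0 s1 s2 s3 s4]|[s0 s1 s2 s3 s4]] := laps4 P sC h1 eC h2 h3 e1 ex3 x34.
    by have := s1 x1 x2 lr lr lr; rewrite f1 f2; ord.
  by have := ne_inc s3 x34; rewrite f3 f4; ord.
- have [[s0 s1 s2 s3 s4]|[s0 s1 s2 s3 s4]] := laps4 P sC h1 h2 eC h3 x12 ex2 e4.
    by have := ne_dec s1 x12; rewrite f1 f2; ord.
  by have := s3 x3 x4 lr lr lr; rewrite f3 f4; ord.
- have [[s0 s1 s2 s3 s4]|[s0 s1 s2 s3 s4]] := laps4 P sC h1 h2 eC h3 x12 ex2 ex3.
    by have := ne_dec s1 x12; rewrite f1 f2; ord.
  have := ne_inc s1 x12; have := ne_dec s4 lr; rewrite f1 f2 => k1 k2.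
  apply: (@rng_two _ f C x2 x3 P x20 x23 (ltW x31)).
    by apply: (rng_cat (rng_dec s0 _ _) (rng_inc s1 _ _)); rewrite ?f1 ?f2; ord.
  by apply: (rng_dec s4); rewrite ?f3; ord.
Qed.

Lemma four_J3 : x3 < e -> e < x4 -> f e < x1 -> False.
Proof using All.
move=> ex3 e4 fe'.
have x20 := le_lt_trans x10 x12; have x30 := lt_trans x20 x23.
have x31 := lt_le_trans x34 x41; have x21 := lt_trans x23 x31.
have [/andP[f00 f01'] /andP[f10 f11]] := f01 P.
have /andP[fe0 fe1] := pm_self P (x := e) lr.
case: (sum4 cnt) => /and3P[h1 h2 h3].
- have [[s0 s1 s2 s3 s4]|[s0 s1 s2 s3 s4]] := laps4 P sC h1 h2 eC h3 x23 ex3 e4.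
    by have := ne_dec s3 e4; rewrite f4; ord.
  by have := s0 x1 x2 x10 x12 (lexx _); rewrite f1 f2; ord.
- have [[s0 s1 s2 s3 s4]|[s0 s1 s2 s3 s4]] := laps4 P sC h1 h2 eC h3 lr ex3 e4.
    by have := s1 x1 x2 lr lr lr; rewrite f1 f2; ord.
  by have := s1 x1 x3 lr lr lr; rewrite f1 f3; ord.
- have [[s0 s1 s2 s3 s4]|[s0 s1 s2 s3 s4]] := laps4 P sC h1 h2 eC h3 x12 lr e4.
    by have := ne_dec s1 x12; rewrite f1 f2; ord.
  have := ne_inc s3 e4; rewrite f4 => k3.
  have [x41'|e'] := ltP x4 1; last by have /andP[_] := fold_in P h3; ord.
  have := ne_dec s4 x41'; rewrite f4 => k4.
  apply: (@rng_two _ f C x2 x3 P x20 x23 (ltW x31)).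
    by apply: (rng_cat (rng_dec s0 _ _) (rng_inc s1 _ _)); rewrite ?f1 ?f2; ord.
  apply: (rng_cat (v := e)).
    by apply: (rng_dec (dec_sub s2 (ltW x23) (lexx _))); rewrite ?f3; ord.
  by apply: (rng_cat (rng_inc s3 _ _) (rng_dec s4 _ _)); rewrite ?f4; ord.
have [[s0 s1 s2 s3 s4]|[s0 s1 s2 s3 s4]] := laps4 P sC h1 h2 h3 eC x12 x23 ex3.
  by have := ne_dec s1 x12; rewrite f1 f2; ord.
by have := ne_inc s3 ex3; rewrite f3; ord.
Qed.

End four.

Lemma no_cycle4 f C lam l x1 x2 x3 x4 : pmt f C -> gauge f lam l -> gpos l -> lam <= 2 ->
  (size C <= 4)%N -> 0 <= x1 -> x1 < x2 -> x2 < x3 -> x3 < x4 -> x4 <= 1 ->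
  (3 <= (x1 \in C) + (x2 \in C) + (x3 \in C) + (x4 \in C))%N ->
  f x1 = x3 -> f x2 = x4 -> f x3 = x2 -> f x4 = x1 -> False.
Proof.
move=> P G L l2 sC x10 x12 x23 x34 x41 cnt f1 f2 f3 f4.
have x20 := le_lt_trans x10 x12; have x30 := lt_trans x20 x23.
have x31 := lt_le_trans x34 x41; have x21 := lt_trans x23 x31.
have x14 : x1 < x4 by ord.
have ne : x1 != 0 \/ x4 != 1.
  have h : x1 \in C \/ x4 \in C by move: cnt; do 4![case: (_ \in _)] => //= _; auto.
  by case: h => /(fold_in P)/andP[k1 k2]; [left; rewrite gt_eqF|right; rewrite lt_eqF].
have [e [eC /andP[e1 e4] fe]] := @hull_exit _ f C P x1 x4 x10 x14 x41 ltac:(by rewrite f1; ord)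
  ltac:(by rewrite f4 lexx ltW) ne.
have low := no_cycle4_low P G L l2 x10 x12 x23 x34 x41 f1 f2 (e := e) e1.
have high := no_cycle4_high P G L l2 x10 x12 x23 x34 x41 f3 f4 (e := e) ^~ e4.
have [ex2|ex2|E] := ltgtP e x2; last by move: fe; rewrite E f2 ltxx ltNge (ltW x14); case.
  have fe' : x4 < f e by case: fe => // h; have := low ex2; rewrite leNgt h.
  exact: (four_J1 P sC x10 x12 x23 x34 x41 f1 f2 f3 f4 eC cnt e1 ex2 fe').
have [ex3|ex3|E] := ltgtP e x3.
- exact: (four_J2 P sC x10 x12 x23 x34 x41 f1 f2 f3 f4 eC cnt ex2 ex3).
- have fe' : f e < x1 by case: fe => // h; have := high ex3; rewrite leNgt h.
  exact: (four_J3 P sC x10 x12 x23 x34 x41 f1 f2 f3 f4 eC cnt ex3 e4 fe').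
by move: fe; rewrite E f3 ltNge (ltW x12) ltNge (ltW (lt_trans x23 x34)); case.
Qed.

Lemma count5_interior (a b c d e : bool) : (3 <= a + b + c + d + e)%N -> ~~ a -> ~~ e -> [/\ b, c & d].
Proof. by case: a; case: b; case: c; case: d; case: e. Qed.

Lemma count5_none (a b c d e : bool) : (3 <= a + b + c + d + e)%N -> ~~ b -> ~~ c -> ~~ d -> False.
Proof. by case: a; case: b; case: c; case: d; case: e. Qed.

Lemma count5_outer (a b c d e : bool) : (3 <= a + b + c + d + e)%N -> ~~ c -> ~~ d -> [/\ a, b & e].
Proof. by case: a; case: b; case: c; case: d; case: e. Qed.

Lemma five_ord (x1 x2 x3 x4 x5 : R) : 0 <= x1 -> x1 < x2 -> x2 < x3 -> x3 < x4 -> x4 < x5 -> x5 <= 1 ->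
  [/\ [/\ 0 < x2, 0 < x3 & 0 < x4], [/\ x2 < 1, x3 < 1 & x4 < 1],
  [/\ x1 < x3, x1 < x4 & x1 < x5], x2 < x4 & x2 < x5 /\ x3 < x5].
Proof.
move=> x10 x12 x23 x34 x45 x51.
have a := le_lt_trans x10 x12; have b := lt_le_trans x45 x51.
have c := lt_trans x12 x23; have d := lt_trans x23 x34; have e := lt_trans x34 x45.
have g := lt_trans c x34; have h := lt_trans g x45; have i := lt_trans d x45.
have j := lt_trans x34 b; have k := lt_trans x23 j; have m := lt_trans a x23; have n := lt_trans m x34.
by [].
Qed.

Section five.
Variables (f : R -> R) (C : seq R) (x1 x2 x3 x4 x5 : R).
Hypotheses (P : pmt f C) (sC : (size C <= 4)%N).
Hypotheses (x10 : 0 <= x1) (x12 : x1 < x2) (x23 : x2 < x3) (x34 : x3 < x4) (x45 : x4 < x5) (x51 : x5 <= 1).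
Hypotheses (f1 : f x1 = x3) (f2 : f x2 = x5) (f3 : f x3 = x4) (f4 : f x4 = x2) (f5 : f x5 = x1).

(** The values decrease along [x2], [x3], [x4], [x5], and there is room for one more turning point
    [t]. Outside (x3,x4) it leaves two adjacent gaps decreasing, so [x3] or [x4] does not turn;
    inside, [f] increases on both sides of [t]. *)
Lemma five_interior : x2 \in C -> x3 \in C -> x4 \in C -> False.
Proof using All.
move=> h2 h3 h4.
have [[x20 x30 x40] [x21 x31 x41] [x13 x14 x15] x24 [x25 x35]] := five_ord x10 x12 x23 x34 x45 x51.
have [t [tC only]] : exists t : R, t \in C /\ forall c, c \in C -> [\/ c = x2, c = x3, c = x4 | c = t].
  have [[t [tC t2 t3 t4]]|no] := pselect (exists t : R, [/\ t \in C, t != x2, t != x3 & t != x4]); last first.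
    exists x2; split=> // c cC; apply: contrapT => h; apply: no; exists c.
    by split => //; apply/eqP => E; apply: h; rewrite E; constructor.
  have u : uniq [:: x2; x3; x4; t].
    by rewrite /= !inE !negb_or ![_ == t]eq_sym t2 t3 t4 !lt_eqF.
  by exists t; split => // c; apply: (only4 u sC).
have n23 : t <= x2 \/ x3 <= t -> dec f x2 x3.
  move=> h; apply: (seg_dec P) => //; [exact: ltW|exact: ltW| |by rewrite f2 f3].
  by apply: (noC_in only) => //; [left|right|right; exact: ltW].
have n34 : t <= x3 \/ x4 <= t -> dec f x3 x4.
  move=> h; apply: (seg_dec P) => //; [exact: ltW|exact: ltW| |by rewrite f3 f4].
  by apply: (noC_in only) => //; [left; exact: ltW|left|right].
have n45 : t <= x4 -> dec f x4 x5.
  move=> h; apply: (seg_dec P) => //; [exact: ltW| |by rewrite f4 f5].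
  by apply: (noC_in only) => //; [left; exact: ltW|left; exact: ltW|left|left].
have [tx3|x3t] := leP t x3.
  have k3 := n34 (or_introl tx3); have k4 := n45 (le_trans tx3 (ltW x34)).
  by have := not_turn P x34 x45 (or_intror (conj k3 k4)); rewrite h4.
have k2 := n23 (or_intror (ltW x3t)).
have [x4t|tx4] := leP x4 t.
  by have := not_turn P x23 x34 (or_intror (conj k2 (n34 (or_intror x4t)))); rewrite h3.
have k4 := n45 (ltW tx4).
have m1 : smono f x3 t.
  apply: (seg P); [exact: ltW|by []|by ord|].
  by apply: (noC_in only); [left; exact: ltW|left|right; exact: ltW|right].
have m2 : smono f t x4.
  apply: (seg P); [by ord|by []|exact: ltW|].
  by apply: (noC_in only); [left; ord|left; exact: ltW|right|left].
have i1 := turn_decR P h3 x23 x3t k2 m1; have i2 := turn_decL P h4 tx4 x45 k4 m2.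
by have := not_turn P x3t tx4 (or_introl (conj i1 i2)); rewrite tC.
Qed.

Variable e : R.
Hypotheses (eC : e \in C) (only : {subset C <= [:: e; x1; x2; x3; x4; x5]}).
Hypothesis cnt : (3 <= (x1 \in C) + (x2 \in C) + (x3 \in C) + (x4 \in C) + (x5 \in C))%N.

Lemma five_J1_high : x1 < e -> e < x2 -> x5 < f e -> False.
Proof using All.
move=> e1 e2 fe.
have [[x20 x30 x40] [x21 x31 x41] [x13 x14 x15] x24 [x25 x35]] := five_ord x10 x12 x23 x34 x45 x51.
have e0 := le_lt_trans x10 e1.
have k1 : dec f e x2 by apply: (seg_dec P); rewrite ?f2 ?ltW //; apply: (noC_seq only); rewrite /=; dis.
have k2 : dec f x2 x3 by apply: (seg_dec P); rewrite ?f2 ?f3 ?ltW //; apply: (noC_seq only); rewrite /=; dis.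
have k3 : dec f x3 x4 by apply: (seg_dec P); rewrite ?f3 ?f4 ?ltW //; apply: (noC_seq only); rewrite /=; dis.
have k4 : dec f x4 x5 by apply: (seg_dec P (ltW x40) x45 x51); rewrite ?f4 ?f5 //; apply: (noC_seq only); rewrite /=; dis.
by apply: (count5_none cnt); [apply: (not_turn P e2 x23)|apply: (not_turn P x23 x34)|apply: (not_turn P x34 x45)]; right.
Qed.

Lemma five_J2_high : x2 < e -> e < x3 -> x5 < f e -> False.
Proof using All.
move=> e1 e2 fe.
have [[x20 x30 x40] [x21 x31 x41] [x13 x14 x15] x24 [x25 x35]] := five_ord x10 x12 x23 x34 x45 x51.
have e0 := lt_trans x20 e1; have e11 := lt_trans e2 x31.
have k0 : inc f x1 x2 by apply: (seg_inc P x10 x12 (ltW x21)); rewrite ?f1 ?f2 //; apply: (noC_seq only); rewrite /=; dis.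
have k1 : inc f x2 e by apply: (seg_inc P); rewrite ?f2 ?ltW //; apply: (noC_seq only); rewrite /=; dis.
have k2 : dec f e x3.
  by apply: (seg_dec P); rewrite ?f3 ?(ltW e0) ?(ltW x31) ?(lt_trans x45) //; apply: (noC_seq only); rewrite /=; dis.
have k3 : dec f x3 x4 by apply: (seg_dec P); rewrite ?f3 ?f4 ?ltW //; apply: (noC_seq only); rewrite /=; dis.
have k4 : dec f x4 x5 by apply: (seg_dec P (ltW x40) x45 x51); rewrite ?f4 ?f5 //; apply: (noC_seq only); rewrite /=; dis.
apply: (count5_none cnt).
- by apply: (not_turn P x12 e1); left.
- by apply: (not_turn P e2 x34); right.
by apply: (not_turn P x34 x45); right.
Qed.

(** The turning points are [x1], [x2], [e] and [x5]; if the second image of [e] did not pass [x5],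
    the interval [f e,x5] would be invariant. *)
Lemma five_J4_low : x4 < e -> e < x5 -> f e < x1 -> x5 < f (f e).
Proof using All.
move=> e1 e2 fe.
have [[x20 x30 x40] [x21 x31 x41] [x13 x14 x15] x24 [x25 x35]] := five_ord x10 x12 x23 x34 x45 x51.
have e0 := lt_trans x40 e1; have e11 := lt_le_trans e2 x51.
have k2 : dec f x2 x3 by apply: (seg_dec P); rewrite ?f2 ?f3 ?ltW //; apply: (noC_seq only); rewrite /=; dis.
have k3 : dec f x3 x4 by apply: (seg_dec P); rewrite ?f3 ?f4 ?ltW //; apply: (noC_seq only); rewrite /=; dis.
have k4 : dec f x4 e.
  by apply: (seg_dec P); rewrite ?f4 ?(ltW x40) ?(ltW e11) ?(lt_trans fe) //; apply: (noC_seq only); rewrite /=; dis.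
have n3 : x3 \notin C by apply: (not_turn P x23 x34); right.
have n4 : x4 \notin C by apply: (not_turn P x34 e1); right.
have [h1 h2 h5] := count5_outer cnt n3 n4.
have [[s0 s1 s2 s3 s4]|[s0 s1 s2 s3 s4]] := laps4 P sC h1 h2 eC h5 x12 (lt_trans x24 e1) e2.
  by have := ne_dec s1 x12; rewrite f1 f2 ltNge (ltW x35).
rewrite ltNge; apply/negP => ffe.
have /andP[fe0 _] : 0 <= f e <= 1 by apply: (pm_self P); rewrite !ltW.
have fe5 := lt_trans fe x15.
have ne : 0 < f e \/ x5 < 1 by right; have /andP[] := fold_in P h5.
apply: (rng_itv P fe0 fe5 x51 ne).
apply: (rng_cat (v := x1)).
  by apply: (rng_dec (dec_sub s0 fe0 (lexx _))); rewrite ?f1 // ltW // (lt_trans fe).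
apply: (rng_cat (rng_inc s1 _ _)); rewrite ?f1 ?f2 ?lexx //; first by rewrite ltW // (lt_trans fe).
by apply: (rng_cat (rng_dec s2 _ _) (rng_inc s3 _ _)); rewrite ?f2 ?f5 ?lexx // ltW.
Qed.

End five.

Section five_lengths.
Variables (f : R -> R) (C : seq R) (lam : R) (l : R -> R -> R) (x1 x2 x3 x4 x5 e : R).
Hypotheses (P : pmt f C) (G : gauge f lam l) (L : gpos l) (lamlt : lam <= 8 / 5).
Hypotheses (x10 : 0 <= x1) (x12 : x1 < x2) (x23 : x2 < x3) (x34 : x3 < x4) (x45 : x4 < x5) (x51 : x5 <= 1).
Hypotheses (f1 : f x1 = x3) (f2 : f x2 = x5) (f3 : f x3 = x4) (f4 : f x4 = x2) (f5 : f x5 = x1).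

Lemma le2M y : 0 <= y -> lam * y <= 8 / 5 * y.
Proof using All. by move=> y0; rewrite ler_wpM2r. Qed.

Lemma leMM y z : 0 <= z -> y <= lam * z -> lam * y <= 64 / 25 * z.
Proof using All.
move=> z0 h; have l0 := ga_lam G.
have h1 : lam * y <= lam * (lam * z) by rewrite ler_wpM2l.
have h2 : lam * z <= 8 / 5 * z by rewrite ler_wpM2r.
have h3 : lam * (lam * z) <= 8 / 5 * (8 / 5 * z).
  by apply: ler_pM => //; rewrite mulr_ge0.
by move: h1 h3; lra.
Qed.

Lemma five_len : [/\ [/\ 0 < l x1 x2, 0 < l x2 x3, 0 < l x3 x4 & 0 < l x4 x5],
  [/\ l x1 x2 + l x2 x3 <= l x1 x3, l x1 x3 + l x3 x4 <= l x1 x4 & l x1 x4 + l x4 x5 <= l x1 x5],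
  [/\ l x2 x3 + l x3 x4 <= l x2 x4, l x2 x4 + l x4 x5 <= l x2 x5 & l x3 x4 + l x4 x5 <= l x3 x5] &
  [/\ l x3 x5 <= lam * l x1 x2, l x4 x5 <= lam * l x2 x3, l x2 x4 <= lam * l x3 x4 & l x1 x2 <= lam * l x4 x5]].
Proof using All.
have [[x20 x30 x40] [x21 x31 x41] [x13 x14 x15] x24 [x25 x35]] := five_ord x10 x12 x23 x34 x45 x51.
split.
- by split; apply: L => //; exact: ltW.
- by split; apply: (ga_add G) => //; exact: ltW.
- by split; apply: (ga_add G) => //; exact: ltW.
split.
- by apply: (ga_up_sub P G); rewrite ?f1 ?f2 // ltW.
- by apply: (ga_dn_sub P G); rewrite ?f2 ?f3 // ltW.
- by apply: (ga_dn_sub P G); rewrite ?f3 ?f4 // ltW.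
by apply: (ga_dn_sub P G); rewrite ?f4 ?f5 // ltW.
Qed.

Lemma five_J1_low : x1 < e -> e < x2 -> x1 <= f e.
Proof using All.
move=> e1 e2; rewrite leNgt; apply/negP => fe.
have [[x20 x30 x40] [x21 x31 x41] [x13 x14 x15] x24 [x25 x35]] := five_ord x10 x12 x23 x34 x45 x51.
have [[p1 p2 p3 p4] [a1 a2 a3] _ _] := five_len.
have := covers P G x10 e1 e2 (ltW x21) x13 x15 (ltW fe); rewrite f1 f2 => /(_ (lexx _) (lexx _)).
by have := le2M (ltW p1); lra.
Qed.

Lemma five_J2_low : x2 < e -> e < x3 -> x1 <= f e.
Proof using All.
move=> e1 e2; rewrite leNgt; apply/negP => fe.
have [[x20 x30 x40] [x21 x31 x41] [x13 x14 x15] x24 [x25 x35]] := five_ord x10 x12 x23 x34 x45 x51.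
have [[p1 p2 p3 p4] [a1 a2 a3] _ _] := five_len.
have := covers P G (ltW x20) e1 e2 (ltW x31) x15 x14 (ltW fe); rewrite f2 f3 => /(_ (lexx _) (lexx _)).
by have := le2M (ltW p2); lra.
Qed.

(** The covering of one step is not enough. Multiplied by [lam] and combined with the coverings of
    the cycle, it makes three copies of [x3,x4] fit into [64 / 25] of its length. *)
Lemma five_J3_low : x3 < e -> e < x4 -> x1 <= f e.
Proof using All.
move=> e1 e2; rewrite leNgt; apply/negP => fe.
have [[x20 x30 x40] [x21 x31 x41] [x13 x14 x15] x24 [x25 x35]] := five_ord x10 x12 x23 x34 x45 x51.
have [[p1 p2 p3 p4] [a1 a2 a3] [b1 b2 b3] [d1 d2 d3 d4]] := five_len.
have c1 := covers P G (ltW x30) e1 e2 (ltW x41) x14 x12 (ltW fe).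
rewrite f3 f4 in c1; move: (c1 (lexx _) (lexx _)) => {}c1.
have c2 : l x1 x2 + l x1 x2 + l x2 x3 + l x3 x4 <= lam * l x3 x4 by lra.
by have := leMM (ltW p3) c2; rewrite !mulrDr; lra.
Qed.

(** The covering is multiplied by [lam] twice; [24 / 25] is the value of [lam * lam - lam] at
    [lam = 8 / 5]. *)
Lemma five_J3_high : x3 < e -> e < x4 -> f e <= x5.
Proof using All.
move=> e1 e2; rewrite leNgt; apply/negP => fe.
have [[x20 x30 x40] [x21 x31 x41] [x13 x14 x15] x24 [x25 x35]] := five_ord x10 x12 x23 x34 x45 x51.
have [[p1 p2 p3 p4] [a1 a2 a3] [b1 b2 b3] [d1 d2 d3 d4]] := five_len.
have c1 := covers_high P G (ltW x30) e1 e2 (ltW x41) x45 x25 (ltW fe).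
rewrite f3 f4 in c1; move: (c1 (lexx _) (lexx _)) => {}c1.
have l0 := ga_lam G.
have c2 : lam * (l x4 x5 + l x4 x5 + l x2 x3 + l x3 x4) <= lam * (lam * l x3 x4).
  by rewrite ler_wpM2l //; lra.
have c3 : l x4 x5 + lam * l x3 x4 + l x1 x2 + l x1 x2 <= lam * (lam * l x3 x4).
  by move: c2; rewrite !mulrDr; lra.
have c4 : lam * (l x4 x5 + lam * l x3 x4 + l x1 x2 + l x1 x2) <= lam * (lam * (lam * l x3 x4)).
  by rewrite ler_wpM2l.
have q : lam * lam - lam <= 24 / 25 by move: l0 (lamlt); nra.
have q1 : (lam * lam - lam) * (lam * l x3 x4) <= 24 / 25 * (lam * l x3 x4).
  by rewrite ler_wpM2r // mulr_ge0 // ltW.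
have q2 : (lam * lam - lam) * (lam * l x3 x4) = lam * (lam * (lam * l x3 x4)) - lam * (lam * l x3 x4) by ring.
have q3 := le2M (ltW p3).
by rewrite !mulrDr in c4; lra.
Qed.

Lemma five_J4_high : x4 < e -> e < x5 -> f e <= x5.
Proof using All.
move=> e1 e2; rewrite leNgt; apply/negP => fe.
have [[x20 x30 x40] [x21 x31 x41] [x13 x14 x15] x24 [x25 x35]] := five_ord x10 x12 x23 x34 x45 x51.
have [[p1 p2 p3 p4] [a1 a2 a3] [b1 b2 b3] _] := five_len.
have := covers_high P G (ltW x40) e1 e2 x51 x25 x15 (ltW fe); rewrite f4 f5 => /(_ (lexx _) (lexx _)).
by have := le2M (ltW p4); lra.
Qed.

Lemma five_J4_visit : x4 < e -> e < x5 -> f e < x1 -> f (f e) <= x5.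
Proof using All.
move=> e1 e2 fe; rewrite leNgt; apply/negP => ffe.
have [[x20 x30 x40] [x21 x31 x41] [x13 x14 x15] x24 [x25 x35]] := five_ord x10 x12 x23 x34 x45 x51.
have [[p1 p2 p3 p4] [a1 a2 a3] [b1 b2 b3] [d1 d2 d3 d4]] := five_len.
have e0 := lt_trans x40 e1; have e11 := lt_le_trans e2 x51.
have /andP[fe0 _] : 0 <= f e <= 1 by apply: (pm_self P); rewrite !ltW.
have B0 : l x3 x5 <= lam * l (f e) x1.
  by apply: (ga_dn_sub P G); rewrite ?f1 // ltW // (lt_trans x14).
have c1 := covers P G (ltW x40) e1 e2 x51 (lt_trans fe x12) fe (lexx _).
rewrite f4 f5 in c1; move: (c1 (lexx _) (lexx _)) => {}c1.
have A0 := ga_add G fe0 fe x12 (ltW x21).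
have c2 : l (f e) x1 + l (f e) x1 + l x1 x2 <= lam * l x4 x5 by lra.
by have := leMM (ltW p4) c2; rewrite !mulrDr; lra.
Qed.

End five_lengths.

Lemma no_cycle5 f C lam l x1 x2 x3 x4 x5 : pmt f C -> gauge f lam l -> gpos l -> lam <= 8 / 5 ->
  (size C <= 4)%N -> 0 <= x1 -> x1 < x2 -> x2 < x3 -> x3 < x4 -> x4 < x5 -> x5 <= 1 ->
  (3 <= (x1 \in C) + (x2 \in C) + (x3 \in C) + (x4 \in C) + (x5 \in C))%N ->
  f x1 = x3 -> f x2 = x5 -> f x3 = x4 -> f x4 = x2 -> f x5 = x1 -> False.
Proof.
move=> P G L lamlt sC x10 x12 x23 x34 x45 x51 cnt f1 f2 f3 f4 f5.
have [[x20 x30 x40] [x21 x31 x41] [x13 x14 x15] x24 [x25 x35]] := five_ord x10 x12 x23 x34 x45 x51.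
have [/andP[n1 n5]|out] := boolP ((x1 \notin C) && (x5 \notin C)).
  have [h2 h3 h4] := count5_interior cnt n1 n5.
  exact: (five_interior P sC x10 x12 x23 x34 x45 x51 f1 f2 f3 f4 f5 h2 h3 h4).
have ne : x1 != 0 \/ x5 != 1.
  move: out; rewrite negb_and !negbK => /orP[] /(fold_in P)/andP[k1 k2]; first by left; rewrite gt_eqF.
  by right; rewrite lt_eqF.
have [e [eC /andP[e1 e5] fe]] := @hull_exit _ f C P x1 x5 x10 x15 x51 ltac:(by rewrite f1 !ltW)
  ltac:(by rewrite f5 lexx ltW) ne.
have exit y : x1 <= f y <= x5 -> e != y.
  by move=> /andP[y1 y2]; apply/eqP => E; move: fe; rewrite E !ltNge y1 y2; case.
have u : uniq [:: e; x1; x2; x3; x4; x5].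
  rewrite cons_uniq; apply/andP; split; last first.
    apply: (sorted_uniq (leT := <%R)); [exact: lt_trans|exact: ltxx|].
    by rewrite /= x12 x23 x34 x45.
  by rewrite !inE !negb_or !exit // ?f1 ?f2 ?f3 ?f4 ?f5 ?lexx ?ltW.
have only : {subset C <= [:: e; x1; x2; x3; x4; x5]}.
  by apply: only_turning => //; apply: (leq_trans sC); move: cnt; rewrite /= eC !addnA !addn0 -!addnA add1n ltnS !addnA.
have [E2|E2|E] := ltgtP e x2; last by move: (exit x2); rewrite f2 E eqxx (ltW x15) lexx => /(_ isT).
  case: fe => fe; last exact: (five_J1_high P sC x10 x12 x23 x34 x45 x51 f1 f2 f3 f4 f5 eC only cnt e1 E2 fe).
  by have := five_J1_low P G L lamlt x10 x12 x23 x34 x45 x51 f1 f2 f3 f4 f5 e1 E2; rewrite leNgt fe.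
have [E3|E3|E] := ltgtP e x3; last by move: (exit x3); rewrite f3 E eqxx (ltW x14) ltW // => /(_ isT).
  case: fe => fe; last exact: (five_J2_high P sC x10 x12 x23 x34 x45 x51 f1 f2 f3 f4 f5 eC only cnt E2 E3 fe).
  by have := five_J2_low P G L lamlt x10 x12 x23 x34 x45 x51 f1 f2 f3 f4 f5 E2 E3; rewrite leNgt fe.
have [E4|E4|E] := ltgtP e x4; last by move: (exit x4); rewrite f4 E eqxx !ltW // => /(_ isT).
  case: fe => fe.
    by have := five_J3_low P G L lamlt x10 x12 x23 x34 x45 x51 f1 f2 f3 f4 f5 E3 E4; rewrite leNgt fe.
  by have := five_J3_high P G L lamlt x10 x12 x23 x34 x45 x51 f1 f2 f3 f4 f5 E3 E4; rewrite leNgt fe.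
case: fe => fe; last first.
  by have := five_J4_high P G L lamlt x10 x12 x23 x34 x45 x51 f1 f2 f3 f4 f5 E4 e5; rewrite leNgt fe.
have := five_J4_visit P G L lamlt x10 x12 x23 x34 x45 x51 f1 f2 f3 f4 f5 E4 e5 fe.
by rewrite leNgt (five_J4_low P sC x10 x12 x23 x34 x45 x51 f1 f2 f3 f4 f5 eC only cnt E4 e5 fe).
Qed.

End long_cycles.

(** * Cyclic permutations *)

Section walks.
Local Open Scope nat_scope.

(** The edges of the covering graph: gap [j] between neighbours of the cycle is mapped over gap [k],
    whatever the map does between the points of the cycle. *)
Definition cov (s : seq nat) (j k : nat) :=
  let a := nth 0 s j in let b := nth 0 s j.+1 in ((a <= k) && (k < b)) || ((b <= k) && (k < a)).

(** Multiplication of a row vector by the covering matrix; iterated from a unit vector it counts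
    walks. *)
Definition wstep (s : seq nat) (m : nat) (v : seq nat) :=
  mkseq (fun k => sumn [seq (if cov s j k then nth 0 v j else 0) | j <- iota 0 m]) m.

Definition wstart (m i : nat) := mkseq (fun k => if k == i then 1 else 0) m.

Definition wcount s m n i := nth 0 (iter n (wstep s m) (wstart m i)) i.

(* Unlike [has], stops at the first success under call-by-value evaluation. *)
Fixpoint lhas (a : nat -> bool) (r : seq nat) : bool :=
  if r is x :: r' then (if a x then true else lhas a r') else false.

Lemma lhasE a r : lhas a r = has a r.
Proof. by elim: r => //= x r ->; case: (a x). Qed.

(* Some lap of the cycle carries more than [2 ^ (q * t)] closed walks of length [p * t], which is
   incompatible with [lam ^ p <= 2 ^ q]. *)
Definition overgrown (p q : nat) (s : seq nat) :=
  lhas (fun t => lhas (fun i => 2 ^ (q * t) < wcount s p.-1 (p * t) i) (iota 0 p.-1)) (iota 1 6).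

Definition cyc (p : nat) (s : seq nat) := all (fun k => iter k (nth 0 s) 0 != 0) (iota 1 p.-1).

(** When all turning points lie on the cycle, each of them is visible in the permutation as such a
    change of direction. *)
Definition bends (p : nat) (s : seq nat) :=
  count (fun i => (nth 0 s i < nth 0 s i.+1) != (nth 0 s i.+1 < nth 0 s i.+2)) (iota 0 p.-2).

(** Nested conditionals in place of boolean connectives: under call-by-value evaluation they avoid
    counting walks for permutations already discarded. *)
Definition cycles_overgrown (p q b : nat) (exc : seq (seq nat)) :=
  all (fun s => if cyc p s then if b <= bends p s then if s \in exc then true else overgrown p q s
    else true else true) (permutations (iota 0 p)).

Lemma cycles_overgrownP p q b exc s : cycles_overgrown p q b exc -> s \in permutations (iota 0 p) ->
  cyc p s -> b <= bends p s -> s \notin exc -> overgrown p q s.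
Proof. by move=> /allP h /h; case: (cyc p s) => // + _ bb; rewrite bb => + /negbTE ne; rewrite ne. Qed.

(** The exceptions in the checks for three turning points are pairs of reflected cycles. The checks
    for four turning points assume four bends, a condition that no permutation of 4 or 5 points
    satisfies. *)
Lemma check23 : cycles_overgrown 3 2 0 [::]. Proof. by vm_compute. Qed.
Lemma check34 : cycles_overgrown 4 3 0 [:: [:: 2; 3; 1; 0]; [:: 3; 2; 0; 1]]. Proof. by vm_compute. Qed.
Lemma check35 : cycles_overgrown 5 3 0 [:: [:: 2; 4; 3; 1; 0]; [:: 4; 3; 1; 0; 2]]. Proof. by vm_compute. Qed.
Lemma check44 : cycles_overgrown 4 4 4 [::]. Proof. by vm_compute. Qed.
Lemma check45 : cycles_overgrown 5 4 4 [::]. Proof. by vm_compute. Qed.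
Lemma check46 : cycles_overgrown 6 4 4 [::]. Proof. by vm_compute. Qed.
Lemma check47 : cycles_overgrown 7 4 4 [::]. Proof. by vm_compute. Qed.

Lemma three_cycles s : s \in permutations (iota 0 3) -> cyc 3 s -> s = [:: 1; 2; 0] \/ s = [:: 2; 0; 1].
Proof.
move=> h hc; have : all (fun s => cyc 3 s ==> (s \in [:: [:: 1; 2; 0]; [:: 2; 0; 1]])) (permutations (iota 0 3)).
  by vm_compute.
by move=> /allP/(_ _ h); rewrite hc !inE => /orP[]/eqP; [left|right].
Qed.

End walks.

Lemma count_sub_in (T : eqType) (a1 a2 : pred T) (r : seq T) :
  {in r, forall x, a1 x -> a2 x} -> (count a1 r <= count a2 r)%N.
Proof.
move=> h; rewrite (eq_in_count (a2 := predI a1 a2)); first by apply: sub_count => x /andP[].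
by move=> x /h /=; case: (a1 x) => //= ->.
Qed.

(** * Covering graphs of cycles *)

Section orbits.
Variable R : realType.
Implicit Types (x y z w c d e u v t lam : R) (f a : R -> R) (C : seq R) (l : R -> R -> R).

Lemma gauge_sum f lam l (X : nat -> R) n : gauge f lam l -> (forall i j, (i < j <= n)%N -> X i < X j) ->
  0 <= X 0%N -> X n <= 1 -> forall a b : nat, (a < b <= n)%N ->
  \sum_(a <= k < b) l (X k) (X k.+1) <= l (X a) (X b).
Proof.
move=> G lt X0 Xn a b; elim: b => // b IH /andP[ab bn].
have le0 i : (i <= n)%N -> 0 <= X i.
  by case: i => // i iN; apply: (le_trans X0); apply/ltW/lt; rewrite iN.
have le1 i : (i <= n)%N -> X i <= 1.
  rewrite leq_eqVlt => /orP[/eqP->//|iN]; apply: le_trans Xn; apply/ltW/lt; by rewrite iN leqnn.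
move: ab; rewrite ltnS leq_eqVlt => /orP[/eqP<-|ab]; first by rewrite big_nat1.
rewrite big_nat_recr /=; last exact: ltnW.
apply: (le_trans _ (ga_add G (le0 a _) (lt a b _) (lt b b.+1 _) (le1 b.+1 bn))).
- by rewrite lerD2r; apply: IH; rewrite ab ltnW.
- by apply: (ltnW (leq_trans ab _)); apply: ltnW.
- by rewrite ab ltnW.
by rewrite ltnSn.
Qed.

Lemma orbit_uniq (f : R -> R) c p : iter p f c = c -> (forall j, (0 < j < p)%N -> iter j f c <> c) ->
  uniq (traject f c p).
Proof.
move=> pc mn; apply/(uniqP c) => i j; rewrite !inE size_traject => ip jp.
rewrite !nth_traject //.
wlog ij : i j ip jp / (i <= j)%N => [W|] E.
  by case: (leqP i j) => h; [exact: W|apply/esym/W => //; exact: ltnW].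
move: ij; rewrite leq_eqVlt => /orP[/eqP//|ij]; exfalso.
apply: (mn (p - j + i)%N); first by lia.
by rewrite iterD E -iterD subnK // ltnW.
Qed.

Lemma orbit_cycle (f : R -> R) c p x : iter p f c = c -> (forall j, (0 < j < p)%N -> iter j f c <> c) ->
  x \in traject f c p -> forall k, (0 < k < p)%N -> iter k f x <> x.
Proof.
move=> pc mn /trajectP[i ip ->] k kp E; apply: (mn k kp).
have : iter (p - i) f (iter k f (iter i f c)) = iter (p - i) f (iter i f c) by rewrite E.
rewrite -[iter (p - i) f (iter i f c)]iterD subnK ?pc; last exact: ltnW.
move=> h; rewrite -[RHS]h; transitivity (iter (k + p) f c); first by rewrite iterD pc.
by rewrite -!iterD; congr (iter _ f c); lia.
Qed.

(** Sorting the orbit replaces its points by their ranks and [f] by a cyclic permutation, to which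
    the computed checks apply. *)
Lemma orbit_list (f : R -> R) c p : (0 < p)%N -> iter p f c = c -> (forall j, (0 < j < p)%N -> iter j f c <> c) ->
  exists (xs : seq R) (s : seq nat), [/\ perm_eq xs (traject f c p), sorted <%R xs,
    s \in permutations (iota 0 p), cyc p s &
    forall i, (i < p)%N -> f (nth 0 xs i) = nth 0 xs (nth 0%N s i)].
Proof.
move=> p0 pc mn.
set xs := sort <=%R (traject f c p).
have u := orbit_uniq pc mn.
have pe : perm_eq xs (traject f c p) by rewrite perm_sort.
have sz : size xs = p by rewrite size_sort size_traject.
have ux : uniq xs by rewrite sort_uniq.
have mem x : (x \in xs) = (x \in traject f c p) by exact: (perm_mem pe).
have fx x : x \in xs -> f x \in xs.
  rewrite !mem => /trajectP[i ip ->]; rewrite -iterS.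
  have [e|l] := eqVneq i.+1 p; first by rewrite e pc; apply/trajectP; exists 0%N.
  by apply/trajectP; exists i.+1 => //; rewrite ltn_neqAle l.
pose s := [seq index (f x) xs | x <- xs].
have ns i : (i < p)%N -> nth 0%N s i = index (f (nth 0 xs i)) xs by move=> ip; rewrite (nth_map 0) ?sz.
have val i : (i < p)%N -> f (nth 0 xs i) = nth 0 xs (nth 0%N s i).
  by move=> ip; rewrite ns // nth_index // fx // mem_nth // sz.
have sp i : (i < p)%N -> (nth 0%N s i < p)%N.
  by move=> ip; rewrite ns // -sz index_mem fx // mem_nth // sz.
have inj : {in xs &, injective f}.
  move=> x y; rewrite !mem => /trajectP[i ip ->] /trajectP[j jp ->]; rewrite -!iterS => E.
  wlog ij : i j ip jp E / (i <= j)%N => [W|].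
    by case: (leqP i j) => h; [exact: W|apply/esym/W => //; exact: ltnW].
  move: ij; rewrite leq_eqVlt => /orP[/eqP->//|ij]; exfalso.
  apply: (mn (p - j.+1 + i.+1)%N); first by lia.
  by rewrite iterD E -iterD subnK.
have us : uniq s.
  rewrite map_inj_in_uniq // => x y xx yy E.
  by apply: inj => //; rewrite -(nth_index 0 (fx _ xx)) E nth_index // fx.
have ss : size s = p by rewrite size_map.
exists xs, s; split => //; first by rewrite sort_lt_sorted.
  rewrite mem_permutations; apply: uniq_perm; [exact: us|exact: iota_uniq|].
  have sub : {subset s <= iota 0 p}.
    by move=> y /(nthP 0%N)[i]; rewrite ss mem_iota => ip <-; exact: sp.
  by have [_] := uniq_min_size us sub ltac:(by rewrite size_iota ss).
apply/allP => k; rewrite mem_iota => kp; apply/eqP => E.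
have kp' : (0 < k < p)%N by lia.
have H j : (iter j (nth 0%N s) 0%N < p)%N /\ nth 0 xs (iter j (nth 0%N s) 0%N) = iter j f (nth 0 xs 0).
  by elim: j => [//|j [h1 h2]] /=; split; [exact: sp|rewrite -val // h2].
have x0 : nth 0 xs 0 \in traject f c p by rewrite -mem mem_nth // sz.
by apply: (orbit_cycle pc mn x0 kp'); rewrite -(H k).2 E.
Qed.

Section grow.
Variables (f : R -> R) (lam : R) (l : R -> R -> R) (X : nat -> R) (m : nat) (s : seq nat).
Hypotheses (G : gauge f lam l) (Xlt : forall i j, (i < j <= m)%N -> X i < X j).
Hypotheses (X0 : 0 <= X 0%N) (Xm : X m <= 1).
Hypotheses (fX : forall i, (i <= m)%N -> f (X i) = X (nth 0%N s i)).
Hypotheses (sm : forall i, (i <= m)%N -> (nth 0%N s i <= m)%N).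
Hypotheses (sinj : forall i, (i < m)%N -> nth 0%N s i != nth 0%N s i.+1).

Local Notation L k := (l (X k) (X k.+1)).

Lemma X_ge0 i : (i <= m)%N -> 0 <= X i.
Proof using All. by case: i => // i iN; apply: (le_trans X0); apply/ltW/Xlt; rewrite iN. Qed.

Lemma X_le1 i : (i <= m)%N -> X i <= 1.
Proof using All.
rewrite leq_eqVlt => /orP[/eqP->//|iN]; apply: le_trans Xm; apply/ltW/Xlt; by rewrite iN leqnn.
Qed.

(** The covered gaps are those between the images of the two end points, and lengths are
    superadditive. *)
Lemma cov_sum j : (j < m)%N -> \sum_(0 <= k < m) (if cov s j k then L k else 0) <= lam * L j.
Proof using All.
move=> jm.
have range (a b : nat) : (a < b <= m)%N -> \sum_(0 <= k < m) (if (a <= k < b)%N then L k else 0) <= l (X a) (X b).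
  move=> /andP[ab bm]; apply: (le_trans _ (gauge_sum G Xlt X0 Xm (introT andP (conj ab bm)))).
  rewrite -big_mkcond /= (big_nat_widen a b m) //= (big_nat_widenl a 0) //=.
  by rewrite le_eqVlt; apply/orP; left; apply/eqP; apply: eq_bigl => k; rewrite andbC.
have fj := fX (ltnW jm); have fj1 := fX jm.
have X0j := X_ge0 (ltnW jm); have Xj1 := X_le1 jm; have Xjj : X j < X j.+1 by apply: Xlt; rewrite ltnSn.
have aj := sm (ltnW jm); have bj := sm jm.
have [lt|gt|e] := ltngtP (nth 0%N s j) (nth 0%N s j.+1); last by move: (sinj jm); rewrite e eqxx.
- apply: le_trans (ga_up G X0j Xjj Xj1 _); rewrite fj fj1; last by apply: Xlt; rewrite lt.
  apply: le_trans (range _ _ (introT andP (conj lt bj))).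
  apply: ler_sum => k _; rewrite /cov; case: ((_ <= k)%N && (k < nth 0%N s j.+1)%N) => //=.
  by case: ifP => // /andP[h1 h2]; move: lt; rewrite ltnNge (ltnW (leq_ltn_trans h1 h2)).
apply: le_trans (ga_dn G X0j Xjj Xj1 _); rewrite fj fj1; last by apply: Xlt; rewrite gt.
apply: le_trans (range _ _ (introT andP (conj gt aj))).
apply: ler_sum => k _; rewrite /cov orbC; case: ((_ <= k)%N && (k < nth 0%N s j)%N) => //=.
by case: ifP => // /andP[h1 h2]; move: gt; rewrite ltnNge (ltnW (leq_ltn_trans h1 h2)).
Qed.

Lemma wstep_sum (v : seq nat) :
  \sum_(0 <= k < m) (nth 0%N (wstep s m v) k)%:R * L k <= lam * \sum_(0 <= j < m) (nth 0%N v j)%:R * L j.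
Proof using All.
have -> : \sum_(0 <= k < m) (nth 0%N (wstep s m v) k)%:R * L k =
    \sum_(0 <= j < m) (nth 0%N v j)%:R * \sum_(0 <= k < m) (if cov s j k then L k else 0).
  under [RHS]eq_bigr do rewrite mulr_sumr.
  rewrite exchange_big /=; apply: eq_big_nat => k /andP[_ km].
  rewrite nth_mkseq // sumnE big_map natr_sum mulr_suml /index_iota subn0.
  by apply: eq_bigr => j _; case: ifP; rewrite ?mulr0 ?mul0r.
rewrite mulr_sumr; apply: ler_sum_nat => j /andP[_ jm]; rewrite mulrCA ler_wpM2l ?ler0n //.
exact: cov_sum.
Qed.

(** Starting with gap [i] alone, the total length weighted by walks grows by at most [lam] per step;
    the closed walks are the part of it on gap [i]. *)
Lemma wcount_le n i : (i < m)%N -> (wcount s m n i)%:R * L i <= lam ^+ n * L i.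
Proof using All.
move=> im.
have Lge k : (k < m)%N -> 0 <= L k.
  by move=> km; apply: (ga_ge0 G); [exact/X_ge0/ltnW|by apply: Xlt; rewrite ltnSn|exact: X_le1].
have H : \sum_(0 <= k < m) (nth 0%N (iter n (wstep s m) (wstart m i)) k)%:R * L k <= lam ^+ n * L i.
  elim: n => [|n IH] /=.
    rewrite expr0 mul1r (bigD1_seq i) /=; [|by rewrite mem_index_iota|exact: iota_uniq].
    rewrite nth_mkseq // eqxx mul1r big1_seq ?addr0 // => k /andP[ki]; rewrite mem_index_iota => /andP[_ km].
    by rewrite nth_mkseq // (negbTE ki) mul0r.
  by apply: (le_trans (wstep_sum _)); rewrite exprS -mulrA ler_wpM2l // (ga_lam G).
apply: le_trans H; rewrite /wcount (bigD1_seq i) /=; [|by rewrite mem_index_iota|exact: iota_uniq].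
rewrite lerDl big_seq_cond; apply: sumr_ge0 => k /andP[]; rewrite mem_index_iota => /andP[_ km] _.
by rewrite mulr_ge0 ?ler0n ?Lge.
Qed.

End grow.

Lemma not_overgrown f lam l (xs : seq R) (s : seq nat) p q : gauge f lam l -> gpos l ->
  (0 < p)%N -> size xs = p -> sorted <%R xs -> {in xs, forall x, 0 <= x <= 1} ->
  s \in permutations (iota 0 p) ->
  (forall i, (i < p)%N -> f (nth 0 xs i) = nth 0 xs (nth 0%N s i)) ->
  lam ^+ p <= 2 ^+ q -> ~~ overgrown p q s.
Proof.
case: p => // m G L _ sz so I01; rewrite mem_permutations => sp val lm.
have lt i j : (i < j <= m)%N -> nth 0 xs i < nth 0 xs j.
  move=> /andP[ij jm]; rewrite (lt_sorted_ltn_nth 0 so) // inE sz ltnS //.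
  exact: (leq_trans (ltnW ij)).
have I i : (i <= m)%N -> 0 <= nth 0 xs i <= 1 by move=> im; apply: I01; rewrite mem_nth ?sz.
have ss : size s = m.+1 by rewrite (perm_size sp) size_iota.
have sm i : (i <= m)%N -> (nth 0%N s i <= m)%N.
  move=> im; have : nth 0%N s i \in iota 0 m.+1 by rewrite -(perm_mem sp) mem_nth // ss.
  by rewrite mem_iota.
have sinj i : (i < m)%N -> nth 0%N s i != nth 0%N s i.+1.
  move=> im; rewrite nth_uniq ?ss ?ltnS //; [by rewrite ltn_eqF|exact: ltnW|].
  by rewrite (perm_uniq sp) iota_uniq.
have /andP[X0 _] := I 0%N (leq0n _); have /andP[_ Xm] := I m (leqnn _).
apply/negP; rewrite /overgrown lhasE => /hasP[t _]; rewrite lhasE => /hasP[i].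
rewrite mem_iota /= add0n => im big.
have li : 0 < l (nth 0 xs i) (nth 0 xs i.+1).
  have /andP[h1 _] := I i (ltnW im); have /andP[_ h2] := I i.+1 im.
  by apply: L => //; apply: lt; rewrite ltnSn.
have := @wcount_le f lam l (nth 0 xs) m s G lt X0 Xm val sm sinj (m.+1 * t)%N i im.
rewrite ler_pM2r // leNgt => /negP; apply.
apply: (@le_lt_trans _ _ (2 ^+ (q * t))); last by rewrite -natrX ltr_nat.
rewrite !exprM; apply: lerXn2r => //; rewrite nnegrE; first by rewrite exprn_ge0 // (ga_lam G).
by rewrite exprn_ge0.
Qed.

(** With all turning points on the cycle nothing leaves its hull, so the hull is [0,1] and its end
    points do not turn. Between neighbours [f] is monotone, so an inner point without a bend does
    not turn either. *)
Lemma bends_turning f C (xs : seq R) (s : seq nat) k : pmt f C -> size xs = k.+2 -> sorted <%R xs ->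
  s \in permutations (iota 0 k.+2) ->
  (forall i, (i < k.+2)%N -> f (nth 0 xs i) = nth 0 xs (nth 0%N s i)) ->
  {subset C <= xs} -> {in xs, forall x, 0 <= x <= 1} -> (count (mem C) xs <= bends k.+2 s)%N.
Proof.
move=> P sz so; rewrite mem_permutations => sp val sub I01.
have mono i j : (i < k.+2)%N -> (j < k.+2)%N -> (nth 0 xs i < nth 0 xs j) = (i < j)%N.
  by move=> ik jk; rewrite (lt_sorted_ltn_nth 0 so) // inE sz.
have I i : (i < k.+2)%N -> 0 <= nth 0 xs i <= 1 by move=> im; apply: I01; rewrite mem_nth ?sz.
have ss : size s = k.+2 by rewrite (perm_size sp) size_iota.
have sm i : (i < k.+2)%N -> (nth 0%N s i < k.+2)%N.
  move=> im; have : nth 0%N s i \in iota 0 k.+2 by rewrite -(perm_mem sp) mem_nth // ss.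
  by rewrite mem_iota.
have us : uniq s by rewrite (perm_uniq sp) iota_uniq.
have inC c : c \in C -> exists2 i, (i < k.+2)%N & c = nth 0 xs i.
  by move=> /sub /(nthP 0)[i ik <-]; exists i => //; rewrite -sz.
have no i : (i.+1 < k.+2)%N -> noC C (nth 0 xs i) (nth 0 xs i.+1).
  move=> ik c /inC[j jk ->]; rewrite !mono //; last exact: ltnW.
  by rewrite ltnS; case: ltnP => //; rewrite -ltnNge.
have bnd i : (i < k.+2)%N -> nth 0 xs 0 <= nth 0 xs i <= nth 0 xs k.+1.
  by move=> ik; rewrite !leNgt !mono // ltn0 /= -leqNgt -ltnS.
have [/andP[/eqP X0 /eqP X1]|ne] := boolP ((nth 0 xs 0 == 0) && (nth 0 xs k.+1 == 1)); last first.
  have /andP[x00 _] := I 0%N isT; have /andP[_ x11] := I k.+1 (ltnSn _).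
  have [||||e [eC _]] := hull_exit P x00 _ x11; first by rewrite mono.
  - by rewrite val // bnd // sm.
  - by rewrite val // bnd // sm.
  - by move: ne; rewrite negb_and => /orP[]; [left|right].
  have [i ik ->] := inC e eC; rewrite val //; have /andP[h1 h2] := bnd _ (sm i ik).
  by rewrite !ltNge h1 h2; case.
have n0 : nth 0 xs 0 \notin C by apply/negP => /(fold_in P); rewrite X0 ltxx.
have n1 : nth 0 xs k.+1 \notin C by apply/negP => /(fold_in P); rewrite X1 ltxx andbF.
have -> : xs = nth 0 xs 0 :: rcons [seq nth 0 xs i | i <- iota 1 k] (nth 0 xs k.+1).
  have io : iota 1 k.+1 = iota 1 k ++ [:: k.+1] by rewrite -{1}(addn1 k) iotaD add1n.
  by rewrite -[LHS](mkseq_nth 0) sz /mkseq -[iota 0 k.+2]/(0%N :: iota 1 k.+1) io /= -cats1 map_cat.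
rewrite /= (negbTE n0) add0n -cats1 count_cat /= (negbTE n1) !addn0 (iotaDl 1 0) -map_comp count_map.
rewrite /bends; apply: count_sub_in => i; rewrite mem_iota /= add0n => ik iC.
have i1 : (i < k.+2)%N by lia.
have i2 : (i.+1 < k.+2)%N by lia.
have i3 : (i.+2 < k.+2)%N by lia.
have l1 : nth 0 xs i < nth 0 xs i.+1 by rewrite mono.
have l2 : nth 0 xs i.+1 < nth 0 xs i.+2 by rewrite mono.
have /andP[a0 a1] := I i i1; have /andP[b0 b1] := I _ i2; have /andP[c0 c1] := I _ i3.
apply/negP => /eqP E; move: iC; apply/negP; apply: (not_turn P l1 l2).
have [up|dn] := boolP (nth 0%N s i < nth 0%N s i.+1)%N; [left|right].
  by move: E; rewrite up => /esym up'; split; apply: (seg_inc P) => //; try exact: no; rewrite !val // mono // sm.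
move: E; rewrite (negbTE dn) => /esym/negbT dn'.
have d1 : (nth 0%N s i.+1 < nth 0%N s i)%N by rewrite ltn_neqAle nth_uniq ?ss // eqn_leq ltnn /= leqNgt.
have d2 : (nth 0%N s i.+2 < nth 0%N s i.+1)%N by rewrite ltn_neqAle nth_uniq ?ss // eqn_leq ltnn /= leqNgt.
by split; apply: (seg_dec P) => //; try exact: no; rewrite !val // mono // sm.
Qed.

End orbits.

(** * No atoms for at most four turning points *)

Section no_small_atoms.
Variable R : realType.
Implicit Types (x y z w c d e u v t lam : R) (f a : R -> R) (C : seq R) (l : R -> R -> R).

Lemma hs_strict f C lam l a c p : pmt f C -> atoms f C lam l a -> gpos l -> c \in C -> 0 < a c ->
  (0 < p)%N -> iter p f c = c -> hs f -> 2 < lam ^+ 2.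
Proof.
move=> P A L cC ac p0 pc [h|h|h]; have G := at_gauge A.
- have l2 := hs1_gauge P G L h; rewrite expr2; apply: (@lt_trans _ _ (2 * 2)); last by apply: ltr_pM.
  by rewrite ltr_pMl // ltr1n.
- exact: (hs2_gauge P G L h).
rewrite lt_neqAle (at_lam A) andbT eq_sym; apply/eqP.
exact: (hs3_strict P A L cC ac p0 pc h).
Qed.

Lemma atoms_sqr f C lam l a c p : pmt f C -> atoms f C lam l a -> gpos l -> c \in C -> 0 < a c ->
  (0 < p)%N -> iter p f c = c -> 2 < lam ^+ 2.
Proof.
move=> P A L cC ac p0 pc; have [h|h] := horseshoe P; first exact: hs_strict P A L cC ac p0 pc h.
apply: (hs_strict (c := 1 - c) (mir_pmt P) (mir_atoms A) (mir_gpos L) _ _ p0 _ h).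
- exact: map_f.
- by rewrite subKr.
by rewrite mir_iter subKr pc.
Qed.

Lemma mir_mem C x : (1 - x \in [seq 1 - c | c <- C]) = (x \in C).
Proof. by rewrite (mem_map (f := fun c => 1 - c)) // => u v /(congr1 (fun t => 1 - t)); rewrite !subKr. Qed.

Lemma count_rev4 (a b c d : bool) : (a + b + c + d = 3 -> 3 <= d + c + b + a)%N.
Proof. by case: a; case: b; case: c; case: d. Qed.

Lemma count_rev5 (a b c d e : bool) : (a + b + c + d + e = 3 -> 3 <= e + d + c + b + a)%N.
Proof. by case: a; case: b; case: c; case: d; case: e. Qed.

(** From [q <= p < 2 * q] and [q <= 4] only periods up to 7 remain, and the computed checks leave
    few permutations, which are excluded one by one up to reflection. *)
Lemma no_cycle f C lam l p q (xs : seq R) (s : seq nat) :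
  pmt f C -> gauge f lam l -> gpos l -> (size C <= 4)%N -> 1 < lam -> lam <= 2 ->
  lam ^+ p <= 2 ^+ q -> (p < q.*2)%N -> (q <= p)%N -> size xs = p -> sorted <%R xs ->
  {in xs, forall x, 0 <= x <= 1} -> s \in permutations (iota 0 p) -> cyc p s ->
  (forall i, (i < p)%N -> f (nth 0 xs i) = nth 0 xs (nth 0%N s i)) ->
  count (mem C) xs = q -> False.
Proof.
move=> P G L sC l1 l2 lm pq qp sz so I01 sp cy val cnt.
have ux : uniq xs by exact: lt_sorted_uniq.
have q4 : (q <= 4)%N.
  rewrite -cnt -size_filter; apply: leq_trans sC; apply: uniq_leq_size; first exact: filter_uniq.
  by move=> x; rewrite mem_filter => /andP[].
have p0 : (0 < p)%N by case: (p) qp pq => //; rewrite leqn0 => /eqP->.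
have nov := not_overgrown G L p0 sz so I01 sp val lm.
have over b exc : cycles_overgrown p q b exc -> (b <= bends p s)%N -> s \in exc.
  move=> ch bb; apply: contraT => ne; move: nov.
  by rewrite (cycles_overgrownP ch sp cy bb ne).
(* With four turning points on the cycle there are none elsewhere, so they all appear as bends. *)
have bend4 : (1 < p)%N -> (4 <= q)%N -> (4 <= bends p s)%N.
  move=> p1 q4'; apply: (leq_trans q4'); rewrite -cnt.
  case: p p1 sz sp val {lm pq qp cy p0 nov over} => [|[|k]] // _ sz sp val.
  by apply: (bends_turning P) => //; apply: only_turning => //; rewrite cnt (leq_trans sC).
case: q cnt q4 pq qp lm nov over bend4 => [|[|[|[|[|//]]]]] cnt _ pq qp lm nov over bend4.
- by [].
- have E : p = 1%N by lia.
  rewrite E in sz; subst p; case: xs sz cnt val {so I01 ux} => [|x1 []] //= _ cnt val.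
  have x1C : x1 \in C by move: cnt; case: (x1 \in C).
  have f1 : f x1 = x1.
    have sE : s = [:: 0%N] by move: sp; rewrite mem_permutations => /perm_small_eq; apply.
    by have := val 0%N isT; rewrite sE.
  by have := no_cycle1 P G L x1C f1; rewrite ltNge l2.
- have [E|E] : p = 2%N \/ p = 3%N by lia.
    rewrite E in sz; subst p; case: xs sz cnt val so {I01 ux} => [|x1 [|x2 []]] //= _ cnt val /andP[x12 _].
    have [h1 h2] : x1 \in C /\ x2 \in C by move: cnt; case: (x1 \in C); case: (x2 \in C).
    have sE : s = [:: 1; 0]%N.
      have : all (fun s => cyc 2 s ==> (s == [:: 1; 0]%N)) (permutations (iota 0 2)) by vm_compute.
      by move=> /allP/(_ _ sp); rewrite cy => /eqP.
    have := val 0%N isT; have := val 1%N isT; rewrite sE /= => f2 f1.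
    exact: (no_cycle2 P G L l2 sC h1 h2 x12 f1 f2).
  by rewrite E in sz; subst p; have := over 0%N [::] check23 isT.
- have [E|[E|E]] : p = 3%N \/ p = 4%N \/ p = 5%N by lia.
  + rewrite E in sz; subst p; case: xs sz cnt val so {I01 ux} => [|x1 [|x2 [|x3 []]]] //= _ cnt val /and3P[x12 x23 _].
    have [h1 h2 h3] : [/\ x1 \in C, x2 \in C & x3 \in C].
      by move: cnt; case: (x1 \in C); case: (x2 \in C); case: (x3 \in C).
    have := val 0%N isT; have := val 1%N isT; have := val 2%N isT.
    have [->|->] := three_cycles sp cy => /= f3 f2 f1.
      exact: (no_cycle3 P G L l1 l2 sC h1 h2 h3 x12 x23 f1 f2 f3).
    apply: (no_cycle3 (mir_pmt P) (mir_gauge G) (mir_gpos L) l1 l2 (x1 := 1 - x3) (x2 := 1 - x2) (x3 := 1 - x1));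
      rewrite ?size_map ?mir_mem ?ltrD2l ?ltrN2 // /mir subKr ?f1 ?f2 ?f3 //.
  + rewrite E in sz; subst p; have := over 0%N _ check34 isT; rewrite !inE => sE.
    have /andP[x10 _] : 0 <= nth 0 xs 0 <= 1 by apply: I01; rewrite mem_nth ?sz.
    have /andP[_ x41] : 0 <= nth 0 xs 3 <= 1 by apply: I01; rewrite mem_nth ?sz.
    have := val 0%N isT; have := val 1%N isT; have := val 2%N isT; have := val 3%N isT.
    case: xs sz cnt so x10 x41 {I01 ux val} => [|x1 [|x2 [|x3 [|x4 []]]]] //= _.
    rewrite addn0 !addnA => cnt /and4P[x12 x23 x34 _] x10 x41.
    case/orP: sE => /eqP-> /= f4 f3 f2 f1.
      by apply: (no_cycle4 P G L l2 sC x10 x12 x23 x34 x41 _ f1 f2 f3 f4); rewrite cnt.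
    apply: (no_cycle4 (mir_pmt P) (mir_gauge G) (mir_gpos L) l2 (x1 := 1 - x4) (x2 := 1 - x3) (x3 := 1 - x2) (x4 := 1 - x1));
      rewrite ?size_map ?mir_mem ?subr_ge0 ?ltrD2l ?ltrN2 ?gerBl // /mir ?subKr ?f1 ?f2 ?f3 ?f4 //.
    exact: count_rev4 cnt.
  rewrite E in sz; subst p; have := over 0%N _ check35 isT; rewrite !inE => sE.
  have /andP[x10 _] : 0 <= nth 0 xs 0 <= 1 by apply: I01; rewrite mem_nth ?sz.
  have /andP[_ x51] : 0 <= nth 0 xs 4 <= 1 by apply: I01; rewrite mem_nth ?sz.
  (* [lam ^ 5 <= 2 ^ 3 = 8], while [(8 / 5) ^ 5 > 10]. *)
  have lam85 : lam <= 8 / 5.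
    rewrite leNgt; apply/negP => h; move: lm; rewrite leNgt => /negP; apply.
    apply: (@lt_trans _ _ ((8 / 5) ^+ 5)); first by lra.
    by rewrite ltr_pXn2r ?nnegrE ?(ltW (lt_trans _ l1)) //; lra.
  have := val 0%N isT; have := val 1%N isT; have := val 2%N isT; have := val 3%N isT; have := val 4%N isT.
  case: xs sz cnt so x10 x51 {I01 ux val} => [|x1 [|x2 [|x3 [|x4 [|x5 []]]]]] //= _.
  rewrite addn0 !addnA => cnt /and5P[x12 x23 x34 x45 _] x10 x51.
  case/orP: sE => /eqP-> /= f5 f4 f3 f2 f1.
    by apply: (no_cycle5 P G L lam85 sC x10 x12 x23 x34 x45 x51 _ f1 f2 f3 f4 f5); rewrite cnt.
  apply: (no_cycle5 (mir_pmt P) (mir_gauge G) (mir_gpos L) lam85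
      (x1 := 1 - x5) (x2 := 1 - x4) (x3 := 1 - x3) (x4 := 1 - x2) (x5 := 1 - x1));
    rewrite ?size_map ?mir_mem ?subr_ge0 ?ltrD2l ?ltrN2 ?gerBl // /mir ?subKr ?f1 ?f2 ?f3 ?f4 ?f5 //.
  exact: count_rev5 cnt.
have p1 : (1 < p)%N by lia.
have b4 := bend4 p1 isT.
have [E|[E|[E|E]]] : p = 4%N \/ p = 5%N \/ p = 6%N \/ p = 7%N by lia.
- by rewrite E in sz; subst p; have := over 4%N _ check44 b4.
- by rewrite E in sz; subst p; have := over 4%N _ check45 b4.
- by rewrite E in sz; subst p; have := over 4%N _ check46 b4.
by rewrite E in sz; subst p; have := over 4%N _ check47 b4.
Qed.

Lemma atoms_small_absurd f C lam l a c : pmt f C -> atoms f C lam l a -> (size C <= 4)%N ->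
  c \in C -> 0 < a c -> False.
Proof.
move=> P A sC cC0 ac0; have G := at_gauge A.
have L := atoms_gpos P A cC0 ac0.
have [{cC0 ac0}c [p [cC ac p0 pc mn]]] := periodic_atom P A cC0 ac0.
have s2 := atoms_sqr P A L cC ac p0 pc.
have cI : 0 <= c <= 1 by have /andP[h1 h2] := fold_in P cC; rewrite !ltW.
have [xs [s [pe so sp cy val]]] := orbit_list p0 pc mn.
have lm := lam_period P A cI ac pc.
have ce : count (mem C) xs = count (mem C) (traject f c p) by apply/permP.
move: ce; set q := count (mem C) (traject f c p) in lm * => ce.
have qp : (q <= p)%N by rewrite /q -{2}(size_traject f c p) count_size.
have l1 := at_lam1 A.
have l0 : 0 < lam by apply: lt_trans l1.
(* [2 ^ p < lam ^ (2 * p) <= 2 ^ (2 * q)]. *)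
have pq : (p < q.*2)%N.
  rewrite -(@ltr_eXn2l _ (2 : R)) ?ltr1n //; apply: (@lt_le_trans _ _ ((lam ^+ 2) ^+ p)).
    by rewrite ltr_pXn2r ?nnegrE ?exprn_ge0 // ltW.
  rewrite exprAC -mul2n mulnC exprM; apply: lerXn2r => //; rewrite nnegrE exprn_ge0 //.
  exact: ltW.
(* At most all [p] points of the cycle turn, so [lam ^ p <= 2 ^ q <= 2 ^ p]. *)
have l2 : lam <= 2.
  rewrite leNgt; apply/negP => h; move: lm; rewrite leNgt => /negP; apply.
  apply: (@le_lt_trans _ _ (2 ^+ p)); first by rewrite ler_eXn2l ?ltr1n.
  by rewrite ltr_pXn2r ?nnegrE // ltW.
apply: (no_cycle P G L sC l1 l2 lm pq qp _ so _ sp cy val ce); first by rewrite (perm_size pe) size_traject.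
by move=> x; rewrite (perm_mem pe) => /trajectP[i _ ->]; apply: (iterI P).
Qed.

End no_small_atoms.

Theorem corollary4 (R : realType) (m : nat) :
  (forall f : T_ R m,
     {for f, continuous (h_ R m)} -> {for f, continuous (Phi_ R m)}) /\
  ((m <= 4)%N -> continuous (Phi_ R m)).
Proof.
split; first exact: Phi_continuous_at_entropy.
move=> m4 f; apply: Phi_continuous_at => U UU Uf A c cC ac.
apply: (atoms_small_absurd (tmap_pmt _) (limit_atoms A) _ cC ac).
by rewrite (size_turning (set_valP f)).
Qed.
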